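(* Let $b=b(\epsilon)>0$ and $R=R(\epsilon)>0$ be functions of a parameter $\epsilon$ such that, as $\epsilon\to0$, $$b(\epsilon)\to0,\qquad R(\epsilon)\to\infty,\qquad \frac{1}{R(\epsilon)^2}\ln\frac{R(\epsilon)}{\sqrt{b(\epsilon)}}\to0.$$ Let $M_0(b,R)$ be the ground state energy defined in the context. Then $$\frac{M_0(b,R)}{R^3}=b\ln\frac{1}{\sqrt b}\,\big(1+o(1)\big)\quad\text{as }\epsilon\to0.$$
   Context: Let $\mathbf F(x_1,x_2,x_3)=(-x_2/2,x_1/2,0)$ and $Q_R=(-R/2,R/2)^3\subset\mathbb{R}^3$. For $u\in H^1(Q_R;\mathbb{C})$ let $$G_{Q_R}(u)=\int_{Q_R}\Big(b|(\nabla-i\mathbf F)u|^2+\frac12(1-|u|^2)^2\Big)dx,$$ and $M_0(b,R)=\inf\{G_{Q_R}(u):u\in H^1(Q_R;\mathbb{C})\}$. *)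

(* Defs.v *)
From HB Require Import structures.
From mathcomp Require Import all_boot all_order all_algebra.
From mathcomp Require Import all_classical all_reals all_analysis.
Set Implicit Arguments. Unset Strict Implicit. Unset Printing Implicit Defensive.
Import Order.TTheory GRing.Theory Num.Theory.
Import numFieldNormedType.Exports.
Local Open Scope classical_set_scope.
Local Open Scope ring_scope.

Section GL.
Variable R : realType.

Definition pt := ((R * R) * R)%type.

Definition leb3 := ((@lebesgue_measure R \x @lebesgue_measure R) \x @lebesgue_measure R)%E.

Definition coord (j : 'I_3) (x : pt) : R :=
  match val j with 0%N => x.1.1 | 1%N => x.1.2 | _ => x.2 end.

Definition upd (j : 'I_3) (x : pt) (t : R) : pt :=
  match val j with
  | 0%N => ((t, x.1.2), x.2)
  | 1%N => ((x.1.1, t), x.2)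
  | _ => ((x.1.1, x.1.2), t)
  end.

Definition pderiv (j : 'I_3) (f : pt -> R) (x : pt) : R :=
  derive1 (fun t => f (upd j x t)) (coord j x).

Definition iterd (js : seq 'I_3) (f : pt -> R) : pt -> R :=
  foldr (fun j g => pderiv j g) f js.

Definition smooth (f : pt -> R) : Prop :=
  forall js : seq 'I_3,
    continuous (iterd js f) /\
    forall (j : 'I_3) (x : pt), derivable (fun t => iterd js f (upd j x t)) (coord j x) 1.

Definition cube (L : R) : set pt :=
  [set x | forall j : 'I_3, - (L / 2) < coord j x < L / 2].

Definition test_fun (Q : set pt) (phi : pt -> R) : Prop :=
  smooth phi /\ exists K : set pt, [/\ compact K, K `<=` Q & forall x, ~ K x -> phi x = 0].

Definition L2 (Q : set pt) (f : pt -> R) : Prop :=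
  measurable_fun Q f /\ leb3.-integrable Q (fun x => (f x ^+ 2)%:E).

Definition weak_deriv (Q : set pt) (j : 'I_3) (f g : pt -> R) : Prop :=
  forall phi, test_fun Q phi ->
    (\int[leb3]_(x in Q) (f x * pderiv j phi x)%:E =
     - \int[leb3]_(x in Q) (g x * phi x)%:E)%E.

(* u = p + i q in H^1(Q; C), with weak gradients gp, gq *)
Definition H1_witness (Q : set pt) (p q : pt -> R) (gp gq : 'I_3 -> pt -> R) : Prop :=
  [/\ L2 Q p, L2 Q q,
      forall j, L2 Q (gp j) /\ weak_deriv Q j p (gp j)
    & forall j, L2 Q (gq j) /\ weak_deriv Q j q (gq j)].

Definition Fpot (j : 'I_3) (x : pt) : R :=
  match val j with 0%N => - (x.1.2 / 2) | 1%N => x.1.1 / 2 | _ => 0 end.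

(* integrand b|(nabla - iF)u|^2 + 1/2 (1 - |u|^2)^2, u = p + i q *)
Definition GL_density (b : R) (p q : pt -> R) (gp gq : 'I_3 -> pt -> R) (x : pt) : R :=
  b * (\sum_(j < 3) ((gp j x + Fpot j x * q x) ^+ 2 + (gq j x - Fpot j x * p x) ^+ 2))
  + 2^-1 * (1 - (p x ^+ 2 + q x ^+ 2)) ^+ 2.

Definition G_Q (b L : R) (p q : pt -> R) (gp gq : 'I_3 -> pt -> R) : \bar R :=
  (\int[leb3]_(x in cube L) (GL_density b p q gp gq x)%:E)%E.

Definition M0 (b L : R) : \bar R :=
  ereal_inf [set e | exists (p q : pt -> R) (gp gq : 'I_3 -> pt -> R),
     H1_witness (cube L) p q gp gq /\ e = G_Q b L p q gp gq].

End GL.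

(* Main.v *)
(** Put [eps = sqrt b], [Lam = - ln eps], and divide the energy by [b].

    Upper bound. For [k = sqrt (2 pi)] the lattice sum [v = sum_n e^(i n k y) chi (x - n k)] with
    [chi t = cos (k t / 4) ^ 2] on [|t| <= k] satisfies exactly
    [|v|^2 = 1 - sin (k x / 2) ^ 2 sin (k y / 2) ^ 2]: one zero per cell of area [2 pi]. The trial function
    [e^(- i x y / 2) v / sqrt (|v|^2 + b)] has energy density at most
    [(1 + tau) (pi / 2) / (|v|^2 + b)] plus terms of bounded mean, and the integral of [(|v|^2 + b)^-1] over
    the cube is [(2 / pi) Lam L^3 (1 + o(1))] by explicit antiderivatives in each variable.

    Lower bound. Mollify [u] and let [c (x, r)] be the mean tangential current on the horizontal circle of
    radius [r] about [x]. Unless the circle carries a lot of energy, the phase [M = 2 pi r c + pi r^2]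
    is a multiple of [2 pi], so [M (M - 2 pi) >= 0], a lower bound for [c^2] by an affine function of [c].
    Integrated over all centres [x] the linear term nearly cancels, and the integral of [c^2] is at least
    about [L^3 / 2] for small [r]. On the other hand a mean [W r] of the autocorrelation of the current [j]
    satisfies [0 <= W <= int |j|^2] and [W' <= - (2 / r) int c^2]; integrating from [r] of order [eps]
    to [r] of order one gives [int |j|^2 >= L^3 Lam (1 - o(1))]. *)

Require Import Defs.
From HB Require Import structures.
From mathcomp Require Import all_boot all_order all_algebra.
From mathcomp Require Import all_classical all_reals all_analysis.
From mathcomp Require Import measurable_realfun ring lra.
Import Order.TTheory GRing.Theory Num.Theory.
Import numFieldNormedType.Exports.
Local Open Scope classical_set_scope.
Local Open Scope ring_scope.
Set Implicit Arguments. Unset Strict Implicit. Unset Printing Implicit Defensive.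

(** * Translations *)

(** A competitor is only in [H^1] and has no trace on individual circles, so the lower bound works
    with a mollification at a scale that depends on the competitor; no uniformity in that scale is
    needed. [Fpot] is affine, so it commutes with mollification up to an error of order [h], but the
    quartic potential does not pass to mollifications. It is weakened to [((1 - n) / (1 + n)) ^+ 2]
    with [n = |u|^2], which is at most [(1 - n) ^+ 2], bounded, and Lipschitz in [u]. The current is
    divided by the maximum of [n] and [(1 - tau) ^+ 2]: off the vortex cores it is the
    gauge-invariant phase gradient, and its square exceeds the kinetic density by at most the factor
    [(1 - tau) ^- 2]. The term linear in [c] survives only through the slope of a cut-off of width
    [tau * L]; Young's inequality makes it small against [L^3] because [Lam] is small against [L^2],
    and this is where the third assumption enters. That step needs an a priori upper bound on the
    energy, which arguing by contradiction supplies. All relative errors are multiples of one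
    parameter, sent to zero only in the final theorem. *)

Section product_sigma_finite.
Local Open Scope ereal_scope.
Context d1 d2 (T1 : measurableType d1) (T2 : measurableType d2) (R : realType).
Variables (m1 : {sigma_finite_measure set T1 -> \bar R}) (m2 : {sigma_finite_measure set T2 -> \bar R}).
Lemma product_measure_sigma_finite : sigma_finite setT (m1 \x m2).
Proof.
have /sigma_finiteP[F [TF ndF Foo]] := sigma_finiteT m1.
have /sigma_finiteP[G [TG ndG Goo]] := sigma_finiteT m2.
exists (fun n => F n `*` G n).
  apply/seteqP; split => [[x y] _|//].
  have [n _ Fn] : (\bigcup_i F i) x by rewrite -TF.
  have [m _ Gm] : (\bigcup_i G i) y by rewrite -TG.
  exists (maxn n m) => //; split => /=.
    by move: x Fn; exact/subsetPset/ndF/leq_maxl.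
  by move: y Gm; exact/subsetPset/ndG/leq_maxr.
move=> k; have [? ?] := Foo k; have [? ?] := Goo k.
split; first exact: measurableX.
by rewrite product_measure1E// lte_mul_pinfty// ge0_fin_numE.
Qed.
(** Packing the product as a sigma-finite measure makes it usable as a factor of another product:
    for the third coordinate, for pairs of points in convolutions, and for a point together with an
    angle. *)
Definition prod_sfm : {sigma_finite_measure set (T1 * T2)%type -> \bar R} :=
  HB.pack (m1 \x m2) (Measure_isSigmaFinite.Build _ _ _ (m1 \x m2) product_measure_sigma_finite).
End product_sigma_finite.

(** Convertible to the [leb3] of the energy, so integrals against [leb3] become integrals against
    [vol] without a transfer lemma. *)
Definition vol (R : realType) : {sigma_finite_measure set (measurableTypeR R * measurableTypeR R * measurableTypeR R)%type -> \bar R} :=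
  prod_sfm (prod_sfm (@lebesgue_measure R) (@lebesgue_measure R)) (@lebesgue_measure R).

Section Foundation.
Context {R : realType}.
Notation mu1 := (@lebesgue_measure R).
Notation mu2 := (prod_sfm mu1 mu1).
Notation mu3 := (vol R).

Lemma measurable_pt1 : measurable_fun setT (fun x : pt R => x.1.1).
Proof. exact: (measurableT_comp measurable_fst measurable_fst). Qed.
Lemma measurable_pt2 : measurable_fun setT (fun x : pt R => x.1.2).
Proof. exact: (measurableT_comp measurable_snd measurable_fst). Qed.
Lemma measurable_pt3 : measurable_fun setT (fun x : pt R => x.2).
Proof. exact: measurable_snd. Qed.

Lemma measurable_pt_tuple d (T : measurableType d) (f g h : T -> R) :
  measurable_fun setT f -> measurable_fun setT g -> measurable_fun setT h ->
  measurable_fun setT (fun x => ((f x, g x), h x) : pt R).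
Proof.
move=> mf mg mh; apply: measurable_fun_pair => //.
exact: measurable_fun_pair.
Qed.

Lemma measurable_shift (h : R) : measurable_fun setT (fun x : R => x + h).
Proof. by apply: measurable_funD. Qed.

(** The pushforward by the shift gives half-open intervals their length, and this characterises
    Lebesgue measure. *)
Lemma lebesgue_measure_shift (h : R) (A : set R) : measurable A ->
  mu1 ((fun x : R => x + h) @^-1` A) = mu1 A.
Proof.
move=> mA; apply/esym.
have ms : measurable_fun [set: measurableTypeR R] (fun x : measurableTypeR R => (x + h : measurableTypeR R)).
  exact: measurable_shift.
rewrite -[RHS]/(pushforward mu1 (fun x : measurableTypeR R => (x + h : measurableTypeR R)) A).
apply: (@lebesgue_measure_unique R _ _ A mA) => X [[a b] /= _ <-].
rewrite /pushforward.
have -> : (fun x : R => x + h) @^-1` `]a, b] = `]a - h, b - h]%classic.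
  by apply/seteqP; split => x /=; rewrite !in_itv /= ltrBlDr lerBrDr.
rewrite !lebesgue_measure_itv /= !lte_fin ltrD2r.
by case: ifP => // _; rewrite -!EFinB; congr EFin; ring.
Qed.

Lemma measurable_shiftpt (h : pt R) : measurable_fun setT (fun x : pt R => x + h).
Proof.
apply: (@measurable_pt_tuple _ (pt R) (fun x => x.1.1 + h.1.1) (fun x => x.1.2 + h.1.2) (fun x => x.2 + h.2)).
- by apply: measurable_funD => //; exact: measurable_pt1.
- by apply: measurable_funD => //; exact: measurable_pt2.
- by apply: measurable_funD => //; exact: measurable_pt3.
Qed.

(** Rectangles determine a product of sigma-finite measures, and on rectangles invariance holds
    factor by factor. *)
Lemma product_measure_preserving d1 d2 (T1 : measurableType d1) (T2 : measurableType d2)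
  (m1 : {sigma_finite_measure set T1 -> \bar R})
  (m2 : {sigma_finite_measure set T2 -> \bar R}) (s1 : T1 -> T1) (s2 : T2 -> T2) :
  measurable_fun setT s1 -> measurable_fun setT s2 ->
  (forall A, measurable A -> m1 (s1 @^-1` A) = m1 A) ->
  (forall A, measurable A -> m2 (s2 @^-1` A) = m2 A) ->
  forall A, measurable A -> (m1 \x m2)%E ((fun x => (s1 x.1, s2 x.2)) @^-1` A) = (m1 \x m2)%E A.
Proof.
move=> ms1 ms2 E1 E2 A mA; apply/esym.
have ms : measurable_fun [set: T1 * T2] (fun x => (s1 x.1, s2 x.2)).
  by apply: measurable_fun_pair; apply: measurableT_comp.
rewrite -[RHS]/(pushforward (m1 \x m2)%E (fun x => (s1 x.1, s2 x.2)) A).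
apply: product_measure_unique => // B C mB mC.
rewrite /pushforward.
transitivity ((m1 \x m2)%E ((s1 @^-1` B) `*` (s2 @^-1` C))); first by [].
have mp1 : measurable (s1 @^-1` B) by rewrite -[X in measurable X]setTI; exact: ms1.
have mp2 : measurable (s2 @^-1` C) by rewrite -[X in measurable X]setTI; exact: ms2.
by rewrite product_measure1E //; congr (_ * _)%E; [exact: E1|exact: E2].
Qed.

Lemma mu3_shift (h : pt R) (A : set (pt R)) : measurable A ->
  mu3 ((fun x : pt R => x + h) @^-1` A) = mu3 A.
Proof.
move=> mA.
have S (a : R) B : measurable B -> mu1 ((fun x : R => x + a) @^-1` B) = mu1 B.
  exact: lebesgue_measure_shift.
pose T := measurableTypeR R.
have ms a : measurable_fun setT (fun x : T => x + a : T) by exact: measurable_shift.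
have P2 := @product_measure_preserving _ _ T T mu1 mu1 (fun x => x + h.1.1) (fun x => x + h.1.2) (ms _) (ms _) (S _) (S _).
have ms2 : measurable_fun setT (fun x : T * T => (x.1 + h.1.1, x.2 + h.1.2) : T * T).
  by apply: measurable_fun_pair; apply: measurable_funD.
have P3 := @product_measure_preserving _ _ _ _ mu2 mu1 (fun x => (x.1 + h.1.1, x.2 + h.1.2)) (fun x => x + h.2) ms2 (ms _) P2 (S _).
exact: (P3 A mA).
Qed.

Section preserving.
Context d (T : measurableType d) (m : {measure set T -> \bar R}) (s : T -> T).
Hypothesis ms : measurable_fun setT s.
Hypothesis sE : forall A, measurable A -> m (s @^-1` A) = m A.

Lemma ge0_integral_preserving (f : T -> \bar R) : measurable_fun setT f ->
  (forall x, 0 <= f x)%E -> (\int[m]_x f (s x) = \int[m]_x f x)%E.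
Proof.
move=> mf f0.
rewrite -[LHS]/(\int[m]_(x in s @^-1` setT) (f \o s) x)%E.
rewrite -(@ge0_integral_pushforward _ _ _ _ R s ms m setT f) //.
by apply: eq_measure_integral => A mA _; exact: sE.
Qed.

Lemma integrable_preserving (f : T -> \bar R) : m.-integrable setT f ->
  m.-integrable setT (f \o s).
Proof.
move=> /integrableP[mf foo]; apply/integrableP; split.
  exact: measurableT_comp.
by rewrite (@ge0_integral_preserving (fun x => `|f x|%E)) //; exact: measurableT_comp.
Qed.

Lemma integral_preserving (f : T -> \bar R) : m.-integrable setT f ->
  (\int[m]_x f (s x) = \int[m]_x f x)%E.
Proof.
move=> fi.
have [mf _] := integrableP _ _ _ fi.
rewrite -[LHS]/(\int[m]_(x in s @^-1` setT) (f \o s) x)%E.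
rewrite -(@integral_pushforward _ _ _ _ R s ms m setT f) //; last exact: integrable_preserving.
by apply: eq_measure_integral => A mA _; exact: sE.
Qed.

End preserving.

End Foundation.

Section Foundation2.
Context {R : realType}.
Notation mu1 := (@lebesgue_measure R).
Notation mu2 := (prod_sfm mu1 mu1).
Notation mu3 := (vol R).

Lemma ge0_integral_shift (h : pt R) (f : pt R -> \bar R) : measurable_fun setT f ->
  (forall x, 0 <= f x)%E -> (\int[mu3]_x f (x + h)%R = \int[mu3]_x f x)%E.
Proof.
apply: (@ge0_integral_preserving R _ _ mu3 (fun x : pt R => x + h)).
- exact: measurable_shiftpt.
- exact: mu3_shift.
Qed.

Lemma integrable_shift (h : pt R) (f : pt R -> \bar R) : mu3.-integrable setT f ->
  mu3.-integrable setT (fun x : pt R => f (x + h)).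
Proof.
apply: (@integrable_preserving R _ _ mu3 (fun x : pt R => x + h)).
- exact: measurable_shiftpt.
- exact: mu3_shift.
Qed.

Lemma integral_shift (h : pt R) (f : pt R -> \bar R) : mu3.-integrable setT f ->
  (\int[mu3]_x f (x + h)%R = \int[mu3]_x f x)%E.
Proof.
apply: (@integral_preserving R _ _ mu3 (fun x : pt R => x + h)).
- exact: measurable_shiftpt.
- exact: mu3_shift.
Qed.

Lemma Rintegral_shift (h : pt R) (f : pt R -> R) : mu3.-integrable setT (EFin \o f) ->
  \int[mu3]_x f (x + h)%R = \int[mu3]_x f x.
Proof. by move=> fi; rewrite /Rintegral (@integral_shift h (EFin \o f)). Qed.

(** Rounding [t] down to the grid of step [1 / n.+1] turns the preimage of a set into a countable
    union of rectangles; continuity in [t] then recovers the function as a pointwise limit. *)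
Lemma measurable_caratheodory d (T : measurableType d) (f : T -> R -> R) :
  (forall t, measurable_fun setT (f ^~ t)) -> (forall x, continuous (f x)) ->
  measurable_fun setT (fun z : T * R => f z.1 z.2).
Proof.
move=> mf cf.
pose a (n : nat) (t : R) : R := (Num.floor (t * n.+1%:R))%:~R / n.+1%:R.
apply: (@measurable_fun_cvg _ _ _ setT (fun n (z : T * R) => f z.1 (a n z.2))).
  move=> n; move=> _ Y mY; rewrite setTI.
  have -> : (fun z : T * R => f z.1 (a n z.2)) @^-1` Y =
     \bigcup_(m in [set: int]) (((fun x => f x (m%:~R / n.+1%:R)) @^-1` Y) `*`
        ((fun t : R => (t * n.+1%:R)) @^-1` `[m%:~R, (m + 1)%:~R[)).
    apply/seteqP; split => [[x t] /= Yx|[x t] [m _ [/= Yx]]].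
      exists (Num.floor (t * n.+1%:R)) => //; split => //=.
      by rewrite in_itv /=; exact: floor_itv.
    by rewrite in_itv /= /a => /floor_def ->.
  apply: countable_bigcupT_measurable => // m.
  apply: measurableX.
    by rewrite -[X in measurable X]setTI; exact: mf.
  rewrite -[X in measurable X]setTI.
  by apply: mulrr_measurable => //.
move=> [x t] _ /=.
apply: (cvg_comp (fun n => a n t) (f x)); last exact: cf.
apply/cvgrPdist_le => e e0; near=> n.
have n0 : 0 < n.+1%:R :> R by [].
have /andP[h1 h2] := floor_itv (t * n.+1%:R).
have en : n.+1%:R^-1 <= e.
  near: n; have [N _ HN] := @near_infty_natSinv_lt R (PosNum e0).
  by exists N => // k /HN /ltW.
have E : t - a n t = (t * n.+1%:R - (Num.floor (t * n.+1%:R))%:~R) / n.+1%:R.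
  by rewrite /a mulrBl mulfK // gt_eqF.
rewrite E ger0_norm; last by rewrite divr_ge0 // subr_ge0.
apply: le_trans en; rewrite ler_pdivrMr // mulVf ?gt_eqF // lerBlDr addrC.
by move: h2; rewrite intrD => /ltW.
Unshelve. all: by end_near. Qed.

(** Measurability on [pt R] refers to the product sigma-algebra, so continuity is fed into the
    Caratheodory criterion one coordinate at a time. *)
Lemma continuous_measurable_pt (f : pt R -> R) : continuous f -> measurable_fun setT f.
Proof.
move=> cf.
have c1 (y z : R) : measurable_fun setT (fun x : R => f ((x, y), z)).
  apply: continuous_measurable_fun => x.
  apply: (cvg_comp (fun x => ((x, y), z)) f); last exact: cf.
  exact: (cvg_pair (cvg_pair cvg_id (cvg_cst y)) (cvg_cst z)).
have c2 (z : R) : measurable_fun setT (fun x : R * R => f (x, z)).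
  apply: (@eq_measurable_fun _ _ _ _ _ (fun x : R * R => f ((x.1, x.2), z))); first by case.
apply: (@measurable_caratheodory _ (measurableTypeR R) (fun x y => f ((x, y), z))); first by move=> y; exact: c1.
move=> x y.
  apply: (cvg_comp (fun y => ((x, y), z)) f); last exact: cf.
  exact: (cvg_pair (cvg_pair (cvg_cst x) cvg_id) (cvg_cst z)).
apply: (@eq_measurable_fun _ _ _ _ _ (fun x : R * R * R => f (x.1, x.2))); first by case.
apply: (@measurable_caratheodory _ (R * R)%type (fun x y => f (x, y))); first by move=> y; exact: c2.
move=> x y.
apply: (cvg_comp (fun z => (x, z)) f); last exact: cf.
exact: (cvg_pair (cvg_cst x) cvg_id).
Qed.

End Foundation2.

(** * Continuity of translations in L^1 *)

Section L1_continuity.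
Context {R : realType}.
Local Open Scope ereal_scope.
Notation mu1 := (@lebesgue_measure R).
Notation mu3 := (vol R).

(** Stated for null sequences, the form that dominated convergence consumes, and for an arbitrary
    family of maps [s], so that it passes from a factor to a product. *)
Definition L1_continuous d (T : measurableType d) (m : {measure set T -> \bar R})
    (s : R -> T -> T) :=
  forall f : T -> R, m.-integrable setT (EFin \o f) ->
  forall h : R^nat, h n @[n --> \oo] --> 0%R ->
  \int[m]_x `|f (s (h n) x) - f x|%:E @[n --> \oo] --> 0.

Section prod.
Context d1 d2 (T1 : measurableType d1) (T2 : measurableType d2)
  (m1 : {sigma_finite_measure set T1 -> \bar R})
  (m2 : {sigma_finite_measure set T2 -> \bar R}).

(** By Tonelli the distance is the integral over [y] of the distances of the slices. Almost every
    slice is integrable, so its distance tends to 0, and invariance of the measure dominates it by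
    twice the norm of the slice. *)
Lemma L1_continuous_fst (s : R -> T1 -> T1) :
  (forall h, measurable_fun setT (s h)) ->
  (forall h A, measurable A -> m1 (s h @^-1` A) = m1 A) ->
  L1_continuous m1 s ->
  L1_continuous (prod_sfm m1 m2) (fun h (x : T1 * T2) => (s h x.1, x.2)).
Proof.
move=> ms sE sc f fi h h0.
have mf : measurable_fun setT f by apply/measurable_EFinP; exact: measurable_int fi.
have mg n : measurable_fun [set: T1 * T2] (fun x : T1 * T2 => `|f (s (h n) x.1, x.2) - f x|%:E).
  apply/measurable_EFinP; apply: measurableT_comp => //; apply: measurable_funB => //.
  apply: measurableT_comp => //; apply: measurable_fun_pair => //.
  exact: measurableT_comp.
pose F n y := \int[m1]_x `|f (s (h n) x, y) - f (x, y)|%:E.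
have E n : \int[prod_sfm m1 m2]_x `|f (s (h n) x.1, x.2) - f x|%:E = \int[m2]_y F n y.
  rewrite (@fubini_tonelli2 _ _ T1 T2 R m1 m2 (fun x : T1 * T2 => `|f (s (h n) x.1, x.2) - f x|%:E)) //.
under eq_fun do rewrite E.
have mF n : measurable_fun setT (F n).
  by apply: (@measurable_fun_fubini_tonelli_G _ _ T1 T2 R m1 (fun x : T1 * T2 => `|f (s (h n) x.1, x.2) - f x|%:E)).
have fi2 := @ae_integrable2 _ _ T1 T2 R m1 m2 _ fi.
have [fy fyy] := integrableP _ _ _ fi.
pose g y := 2%:E * \int[m1]_x `|f (x, y)|%:E.
have gi : m2.-integrable setT g.
  apply: integrableZl => //; apply/integrableP; split.
    by apply: (@measurable_fun_fubini_tonelli_G _ _ T1 T2 R m1 (fun x : T1 * T2 => `|f x|%:E)) => //; do 2 apply: measurableT_comp => //.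
  rewrite (@eq_integral _ _ _ m2 setT (fun y => \int[m1]_x `|f (x, y)|%:E)).
    by rewrite -(@fubini_tonelli2 _ _ T1 T2 R m1 m2 (fun x : T1 * T2 => `|f x|%:E)) //;
     do 2 apply: measurableT_comp => //.
  by move=> y _; rewrite gee0_abs // integral_ge0.
have bnd : {ae m2, forall y n, setT y -> `|F n y| <= g y}.
  move: fi2; apply: filterS => y iy n _.
  rewrite gee0_abs; last by apply: integral_ge0.
  have iys : m1.-integrable setT (fun x => (f (s (h n) x, y))%:E).
    by apply: (@integrable_preserving _ _ _ m1 (s (h n)) (ms _) (sE _) (fun x => (f (x, y))%:E)).
  have mfy : measurable_fun setT (fun x => f (x, y)) by apply/measurable_EFinP; exact: measurable_int iy.
  have mfys : measurable_fun setT (fun x => f (s (h n) x, y)) by apply/measurable_EFinP; exact: measurable_int iys.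
  apply: (@le_trans _ _ (\int[m1]_x (`|f (s (h n) x, y)|%:E + `|f (x, y)|%:E))).
    apply: ge0_le_integral => //.
    - by apply/measurable_EFinP; apply: measurableT_comp => //; apply: measurable_funB.
    - by apply: emeasurable_funD; apply/measurable_EFinP; apply: measurableT_comp.
    - by move=> x _; rewrite -EFinD lee_fin ler_normB.
  rewrite ge0_integralD //; last 2 first.
  - by apply/measurable_EFinP; apply: measurableT_comp.
  - by apply/measurable_EFinP; apply: measurableT_comp.
  rewrite (@ge0_integral_preserving _ _ _ m1 (s (h n)) (ms _) (sE _) (fun x => `|f (x, y)|%:E)) //.
    by rewrite /g mule_natl mule2n.
  by apply/measurable_EFinP; apply: measurableT_comp.
have lim : {ae m2, forall y, setT y -> F n y @[n --> \oo] --> cst 0 y}.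
  move: fi2; apply: filterS => y iy _.
  exact: (sc (fun x => f (x, y)) iy h h0).
have [_ _] := @dominated_convergence _ T2 R m2 setT measurableT F (cst 0) g mF (measurable_cst _) lim gi bnd.
by rewrite integral0.
Qed.

Lemma L1_continuous_snd (s : R -> T2 -> T2) :
  (forall h, measurable_fun setT (s h)) ->
  (forall h A, measurable A -> m2 (s h @^-1` A) = m2 A) ->
  L1_continuous m2 s ->
  L1_continuous (prod_sfm m1 m2) (fun h (x : T1 * T2) => (x.1, s h x.2)).
Proof.
move=> ms sE sc f fi h h0.
have mf : measurable_fun setT f by apply/measurable_EFinP; exact: measurable_int fi.
have mg n : measurable_fun [set: T1 * T2] (fun x : T1 * T2 => `|f (x.1, s (h n) x.2) - f x|%:E).
  apply/measurable_EFinP; apply: measurableT_comp => //; apply: measurable_funB => //.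
  apply: measurableT_comp => //; apply: measurable_fun_pair => //.
  exact: measurableT_comp.
pose F n y := \int[m2]_x `|f (y, s (h n) x) - f (y, x)|%:E.
have E n : \int[prod_sfm m1 m2]_x `|f (x.1, s (h n) x.2) - f x|%:E = \int[m1]_y F n y.
  rewrite (@fubini_tonelli1 _ _ T1 T2 R m1 m2 (fun x : T1 * T2 => `|f (x.1, s (h n) x.2) - f x|%:E)) //.
under eq_fun do rewrite E.
have mF n : measurable_fun setT (F n).
  by apply: (@measurable_fun_fubini_tonelli_F _ _ T1 T2 R m2 (fun x : T1 * T2 => `|f (x.1, s (h n) x.2) - f x|%:E)).
have fi2 := @ae_integrable1 _ _ T1 T2 R m1 m2 _ fi.
have [fy fyy] := integrableP _ _ _ fi.
pose g y := 2%:E * \int[m2]_x `|f (y, x)|%:E.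
have gi : m1.-integrable setT g.
  apply: integrableZl => //; apply/integrableP; split.
    by apply: (@measurable_fun_fubini_tonelli_F _ _ T1 T2 R m2 (fun x : T1 * T2 => `|f x|%:E)) => //; do 2 apply: measurableT_comp => //.
  rewrite (@eq_integral _ _ _ m1 setT (fun y => \int[m2]_x `|f (y, x)|%:E)).
    by rewrite -(@fubini_tonelli1 _ _ T1 T2 R m1 m2 (fun x : T1 * T2 => `|f x|%:E)) //;
     do 2 apply: measurableT_comp => //.
  by move=> y _; rewrite gee0_abs // integral_ge0.
have bnd : {ae m1, forall y n, setT y -> `|F n y| <= g y}.
  move: fi2; apply: filterS => y iy n _.
  rewrite gee0_abs; last by apply: integral_ge0.
  have iys : m2.-integrable setT (fun x => (f (y, s (h n) x))%:E).
    by apply: (@integrable_preserving _ _ _ m2 (s (h n)) (ms _) (sE _) (fun x => (f (y, x))%:E)).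
  have mfy : measurable_fun setT (fun x => f (y, x)) by apply/measurable_EFinP; exact: measurable_int iy.
  have mfys : measurable_fun setT (fun x => f (y, s (h n) x)) by apply/measurable_EFinP; exact: measurable_int iys.
  apply: (@le_trans _ _ (\int[m2]_x (`|f (y, s (h n) x)|%:E + `|f (y, x)|%:E))).
    apply: ge0_le_integral => //.
    - by apply/measurable_EFinP; apply: measurableT_comp => //; apply: measurable_funB.
    - by apply: emeasurable_funD; apply/measurable_EFinP; apply: measurableT_comp.
    - by move=> x _; rewrite -EFinD lee_fin ler_normB.
  rewrite ge0_integralD //; last 2 first.
  - by apply/measurable_EFinP; apply: measurableT_comp.
  - by apply/measurable_EFinP; apply: measurableT_comp.
  rewrite (@ge0_integral_preserving _ _ _ m2 (s (h n)) (ms _) (sE _) (fun x => `|f (y, x)|%:E)) //.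
    by rewrite /g mule_natl mule2n.
  by apply/measurable_EFinP; apply: measurableT_comp.
have lim : {ae m1, forall y, setT y -> F n y @[n --> \oo] --> cst 0 y}.
  move: fi2; apply: filterS => y iy _.
  exact: (sc (fun x => f (y, x)) iy h h0).
have [_ _] := @dominated_convergence _ T1 R m1 setT measurableT F (cst 0) g mF (measurable_cst _) lim gi bnd.
by rewrite integral0.
Qed.
End prod.

Lemma ecvg0P (u : (\bar R)^nat) : (forall n, 0 <= u n) ->
  (u n @[n --> \oo] --> 0) <->
  (forall e : R, (0 < e)%R -> exists N, forall n, (N <= n)%N -> u n <= e%:E).
Proof.
move=> u0; split=> [/fine_cvgP[[N1 _ fn] /cvgrPdist_le c] e e0|H].
  have [N2 _ H] := c e e0.
  exists (maxn N1 N2) => n; rewrite geq_max => /andP[n1 n2].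
  have := H n n2; rewrite sub0r normrN => le.
  rewrite -(fineK (fn n n1)) lee_fin; apply: le_trans le; exact: ler_norm.
have ufin n (e : R) : u n <= e%:E -> u n \is a fin_num.
  by move=> le; rewrite ge0_fin_numE // (le_lt_trans le) // ltry.
apply/fine_cvgP; split.
  have [N HN] := H 1%R ltr01; exists N => // n /= Nn.
  exact: (ufin _ 1%R (HN n Nn)).
apply/cvgrPdist_le => e e0; have [N HN] := H e e0.
exists N => // n /= Nn; have le := HN n Nn.
rewrite sub0r normrN ger0_norm ?fine_ge0 // -lee_fin fineK //.
exact: ufin le.
Qed.

Lemma integrable_tail (f : R -> R) : mu1.-integrable setT (EFin \o f) ->
  forall e : R, (0 < e)%R -> exists N : nat,
    \int[mu1]_(x in ~` `[(- N%:R)%R, N%:R%R]) `|(f x)%:E| <= e%:E.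
Proof.
move=> fi e e0.
have mf : measurable_fun setT f by apply/measurable_EFinP; exact: measurable_int fi.
pose A (n : nat) : set R := ~` `[(- n%:R)%R, n%:R%R].
pose f_ n := (fun x => `|(f x)%:E|) \_ (A n).
have mA n : measurable (A n) by apply: measurableC.
have mf_ n : measurable_fun setT (f_ n).
  apply/(measurable_restrictT _ (mA n)); apply: measurableT_comp => //.
  by apply/measurable_EFinP; exact: measurable_funTS.
have bd : {ae mu1, forall x n, setT x -> `|f_ n x| <= `|(f x)%:E|}.
  by apply: aeW => x n _; rewrite /f_ patchE; case: ifP => // _; rewrite ?abse0 ?abse_id.
have lim : {ae mu1, forall x, setT x -> f_ n x @[n --> \oo] --> cst 0 x}.
  apply: aeW => x _; apply: cvg_near_cst.
  exists (Num.truncn `|x|).+1 => // n /= nx.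
  rewrite /f_ patchE memNset //= => Anx; apply: Anx => /=.
  rewrite in_itv /= -ler_norml ltW // (lt_le_trans (truncnS_gt _)) //.
  by rewrite ler_nat.
have fia : mu1.-integrable setT (fun x => `|(f x)%:E|) by exact: integrable_abse fi.
have [_ _] := @dominated_convergence _ _ R mu1 setT measurableT f_ (cst 0) _ mf_ (measurable_cst _) lim fia bd.
rewrite integral0 => /ecvg0P c0.
have {c0}[|N HN] := c0 _ e e0.
  by move=> n; apply: integral_ge0 => x _; rewrite /f_ patchE; case: ifP.
exists N; rewrite integral_mkcond; exact: HN.
Qed.

(** Density of continuous functions [G] of bounded support: for [G] the claim is dominated
    convergence, and by invariance replacing [f] by [G] costs the same before and after the
    shift. *)
Lemma L1_continuous_lebesgue : L1_continuous mu1 (fun h (x : measurableTypeR R) => (x + h)%R : measurableTypeR R).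
Proof.
move=> f fi h h0; apply/ecvg0P; first by move=> n; exact: integral_ge0.
move=> e0 e00.
have mf : measurable_fun setT f by apply/measurable_EFinP; exact: measurable_int fi.
(* Five shares: [2 * e] for replacing [f] by [G] at the shifted point, [e] for the shift of [G], and
   [2 * e] for [G] against [f]. *)
pose e := (e0 / 5)%R; have e_gt0 : (0 < e)%R by rewrite divr_gt0.
have [N HN] := integrable_tail fi e_gt0.
pose I : set R := `[(- N.+1%:R)%R, N.+1%:R%R]%classic.
have mI : measurable I by exact: measurable_itv.
have Ifin : mu1 I < +oo by rewrite lebesgue_measure_itv /= lte_fin; case: ifP => _; rewrite ?ltry.
have fI : mu1.-integrable I (EFin \o f) by exact: integrableS fi.
have [g_ [cg gi glim]] := approximation_continuous_integrable mI Ifin fI.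
move/ecvg0P: glim => /(_ (fun n => integral_ge0 _ _)) glim.
have {glim}[|n0 Hn0] := glim _ e e_gt0; first by move=> n x _.
set g := g_ n0 in Hn0; have cgn : continuous g by exact: cg.
have {Hn0}Hg : \int[mu1]_(z in I) `|(f z - g z)%:E| <= e%:E by apply: Hn0.
(* The approximation [g] is controlled on [I] only. This plateau, 1 up to [N] and 0 from [N.+1] on,
   cuts it off where the tail of [f] is already small. *)
pose z (x : R) : R := (Num.max 0 (Num.min 1 (N.+1%:R - `|x|)))%R.
have cz : continuous z.
  move=> x.
  apply: (@continuous_max R R (cst 0%R) (fun y => Num.min 1%R (N.+1%:R - `|y|)%R) x); first exact: cvg_cst.
  apply: (@continuous_min R R (cst 1%R) (fun y => N.+1%:R - `|y|)%R x); first exact: cvg_cst.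
  by apply: cvgB; [exact: cvg_cst|exact: norm_continuous].
have z01 x : (0 <= z x <= 1)%R.
  by rewrite /z le_max lexx /= ge_max ler01 ge_min lexx.
have z1 x : (`|x| <= N%:R)%R -> z x = 1%R.
  move=> xN; rewrite /z (min_idPl _) ?(max_idPr _) //.
  by rewrite lerBrDr -addn1 natrD addrC lerD2r.
have z0 x : (N.+1%:R <= `|x|)%R -> z x = 0%R.
  move=> xN; apply/max_idPl; rewrite ge_min; apply/orP; right.
  by rewrite subr_le0.
pose G x := (g x * z x)%R.
have cG : continuous G by move=> x; apply: cvgM; [exact: cgn|exact: cz].
have mG : measurable_fun setT G by exact: continuous_measurable_fun.
have fG : \int[mu1]_x `|f x - G x|%:E <= (2 * e)%:E.
  pose A : set R := ~` `[(- N%:R)%R, N%:R%R]%classic.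
  have mA : measurable A by apply: measurableC.
  have mg : measurable_fun setT g by exact: continuous_measurable_fun.
  have m1 : measurable_fun I (fun x => `|(f x - g x)%:E|).
    apply: measurableT_comp => //; apply/measurable_EFinP; apply: measurable_funTS.
    exact: measurable_funB.
  have m2 : measurable_fun A (fun x => `|(f x)%:E|).
    by apply: measurableT_comp => //; apply/measurable_EFinP; apply: measurable_funTS.
  have m1' := (measurable_restrictT _ mI).1 m1.
  have m2' := (measurable_restrictT _ mA).1 m2.
  apply: (@le_trans _ _ (\int[mu1]_x (((fun x => `|(f x - g x)%:E|) \_ I) x + ((fun x => `|(f x)%:E|) \_ A) x))).
    apply: ge0_le_integral => //.
    - by apply/measurable_EFinP; apply: measurableT_comp => //; apply: measurable_funB.
    - exact: emeasurable_funD.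
    move=> x _; rewrite !patchE.
    have memA : x \in A = (N%:R < `|x|)%R.
      apply/idP/idP; rewrite inE /A /= in_itv /= -ler_norml => h1; first by rewrite ltNge; apply/negP.
      by apply/negP; rewrite -ltNge.
    have memI : x \in I = (`|x| <= N.+1%:R)%R.
      by apply/idP/idP; rewrite inE /I /= in_itv /= -ler_norml.
    rewrite memA memI /G.
    have [xN|xN] := leP `|x|%R N%:R.
      have -> : (`|x| <= N.+1%:R)%R by rewrite (le_trans xN) // ler_nat.
      by rewrite z1 // mulr1 adde0.
    have [xN1|xN1] := leP `|x|%R N.+1%:R; last first.
      by rewrite z0 ?mulr0 ?subr0 ?add0e // ltW.
    rewrite -EFinD lee_fin.
    have -> : (f x - g x * z x = (f x - g x) * z x + f x * (1 - z x))%R by ring.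
    have /andP[za zb] := z01 x.
    apply: (le_trans (ler_normD _ _)); rewrite !normrM (ger0_norm za) (@ger0_norm _ (1 - _)) ?subr_ge0 //.
    by apply: lerD; apply: ler_piMr => //; rewrite gerBl.
  rewrite ge0_integralD //.
  - rewrite -!integral_mkcond.
    have -> : (2 * e)%:E = (e%:E + e%:E) by rewrite -EFinD; congr EFin; ring.
    by apply: leeD.
  - by move=> x _; rewrite patchE; case: ifP.
  - by move=> x _; rewrite patchE; case: ifP.
have NN : (- N.+1%:R <= N.+1%:R :> R)%R by rewrite lerNl (le_trans _ (ler0n _ _)) // oppr_le0.
have [M [M0 HM]] : exists M : R, (0 <= M)%R /\ forall x, (`|G x| <= M)%R.
  have [|c _ Hc] := @EVT_max R (fun x => `|g x|)%R _ _ NN.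
    apply: continuous_subspaceT => x.
    by apply: (cvg_comp g (fun x => `|x|%R)); [exact: cgn|exact: norm_continuous].
  exists `|g c|%R; split => // x; rewrite /G normrM.
  have [xN1|xN1] := leP `|x|%R N.+1%:R; last first.
    by rewrite z0 ?normr0 ?mulr0 // ltW.
  have /andP[za zb] := z01 x; rewrite (ger0_norm za).
  apply: (@le_trans _ _ `|g x|%R); first by apply: ler_piMr.
  by apply: Hc; rewrite in_itv /= -ler_norml.
have [B HB] : exists B : R, forall n, (`|h n| <= B)%R.
  have [B [_ HB]] := cvg_seq_bounded (cvgP _ h0).
  by exists (B + 1)%R => n; apply: HB => //; rewrite ltrDl.
pose J : set R := `[(- (N.+1%:R + B))%R, (N.+1%:R + B)%R]%classic.
have mGn n : measurable_fun setT (fun x : R => G (x + h n)%R).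
  by apply: (measurableT_comp mG); exact: measurable_shift.
have ma (u v : R -> R) : measurable_fun setT u -> measurable_fun setT v ->
    measurable_fun [set: R] (fun x => `|u x - v x|%:E).
  by move=> mu mv; apply/measurable_EFinP; apply: measurableT_comp => //; apply: measurable_funB.
have mid : \int[mu1]_x `|G (x + h n) - G x|%:E @[n --> \oo] --> 0.
  have dJ : mu1.-integrable setT (EFin \o (fun x => 2 * M * \1_J x)%R).
    have -> : EFin \o (fun x => 2 * M * \1_J x)%R = (fun x => (2 * M)%:E * (\1_J x)%:E) by apply/funext.
    by apply: integrableZl => //; exact: integrable_indic_itv.
  have bd : {ae mu1, forall x n, setT x -> `| `|G (x + h n) - G x|%:E | <= (EFin \o (fun x => 2 * M * \1_J x)%R) x}.
    apply: aeW => x n _ /=; rewrite lee_fin normr_id indicE.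
    case: (boolP (x \in J)) => [_|].
      rewrite mulr1; apply: (le_trans (ler_normB _ _)).
      have -> : (2 * M = M + M)%R by ring.
      by apply: lerD.
    rewrite notin_setE /J /= in_itv /= -ler_norml => /negP; rewrite -ltNge => xJ.
    have B0 : (0 <= B)%R by apply: le_trans (HB 0%N).
    rewrite /G !z0 ?mulr0 ?subrr ?normr0 //.
    - by rewrite (le_trans _ (ltW xJ)) // lerDl.
    - have : (`|x| <= `|x + h n| + `|h n|)%R by rewrite -{1}(addrK (h n) x) ler_normB.
      have := HB n; lra.
  have lim : {ae mu1, forall x, setT x -> `|G (x + h n) - G x|%:E @[n --> \oo] --> cst 0 x}.
    apply: aeW => x _; apply: cvg_EFin; first by near=> n.
    suff : (fun n => `|G (x + h n) - G x|)%R n @[n --> \oo] --> `|G (x + 0) - G x|%R by rewrite addr0 subrr normr0.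
    apply: cvg_norm; apply: cvgB; last exact: cvg_cst.
    apply: (cvg_comp (fun n => x + h n)%R G); last exact: cG.
    by apply: cvgD; [exact: cvg_cst|exact: h0].
  have mm n : measurable_fun setT (fun x : measurableTypeR R => `|G (x + h n) - G x|%:E).
    by apply: ma.
  have [_ _] := @dominated_convergence _ _ R mu1 setT measurableT _ (cst 0) _ mm (measurable_cst _) lim dJ bd.
  by rewrite integral0.
move/ecvg0P: mid => /(_ (fun n => integral_ge0 _ _)) mid.
have {mid}[|N1 HN1] := mid _ e e_gt0; first by move=> n x _.
exists N1 => n /HN1 Hmid.
have mfn : measurable_fun setT (fun x : R => f (x + h n)%R).
  by apply: (measurableT_comp mf); exact: measurable_shift.
apply: (@le_trans _ _ (\int[mu1]_x (`|f (x + h n) - G (x + h n)|%:E + (`|G (x + h n) - G x|%:E + `|f x - G x|%:E)))).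
  apply: ge0_le_integral => //; first exact: ma.
    by apply: emeasurable_funD; [exact: ma|apply: emeasurable_funD; exact: ma].
  move=> x _; rewrite -!EFinD lee_fin.
  have -> : (f (x + h n) - f x = (f (x + h n) - G (x + h n)) + ((G (x + h n) - G x) - (f x - G x)))%R by ring.
  apply: (le_trans (ler_normD _ _)); rewrite lerD2l; exact: ler_normB.
rewrite ge0_integralD //; last 3 first.
- exact: ma.
- by move=> x _; rewrite adde_ge0.
- by apply: emeasurable_funD; exact: ma.
rewrite ge0_integralD //; last 2 first.
- exact: ma.
- exact: ma.
have -> : e0%:E = ((2 * e)%:E + (e%:E + (2 * e)%:E)).
  by rewrite -!EFinD; congr EFin; rewrite /e; field.
apply: leeD; last by apply: leeD.
rewrite (@ge0_integral_preserving R _ _ mu1 (fun x : measurableTypeR R => (x + h n)%R : measurableTypeR R) _ _ (fun x => `|f x - G x|%:E)) //.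
- exact: measurable_shift.
- by move=> A; exact: lebesgue_measure_shift.
- exact: ma.
Unshelve. all: by end_near. Qed.

(** Otherwise there are shifts with coordinates at most [1 / n.+1] that move [f] by more than [e].
    Splitting each into three axis shifts, and undoing the earlier ones by invariance, contradicts
    [L1_continuous] along the axes. *)
Lemma L1_continuous_vol (f : pt R -> R) : mu3.-integrable setT (EFin \o f) ->
  forall e : R, (0 < e)%R -> exists2 d : R, (0 < d)%R & forall h : pt R,
    (`|h.1.1| <= d)%R -> (`|h.1.2| <= d)%R -> (`|h.2| <= d)%R ->
    \int[mu3]_x `|f (x + h)%R - f x|%:E <= e%:E.
Proof.
move=> fi e e0; apply: contrapT => /forall2NP H.
have {}H n : exists h : pt R, [/\ (`|h.1.1| <= n.+1%:R^-1)%R, (`|h.1.2| <= n.+1%:R^-1)%R,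
    (`|h.2| <= n.+1%:R^-1)%R & e%:E < \int[mu3]_x `|f (x + h)%R - f x|%:E].
  have [|/existsNP[h]] := H n.+1%:R^-1%R; first by rewrite invr_gt0 ltr0Sn.
  move=> /not_implyP[h1] /not_implyP[h2] /not_implyP[h3] /negP; rewrite -ltNge => h4.
  by exists h.
have [h Hh] := choice H.
have to0 (u : R^nat) : (forall n, (`|u n| <= n.+1%:R^-1)%R) -> u n @[n --> \oo] --> 0%R.
  move=> Hu; apply/cvgrPdist_le => e1 e10; near=> n.
  rewrite sub0r normrN; apply: (le_trans (Hu n)); apply: ltW.
  by near: n; exact: (@near_infty_natSinv_lt R (PosNum e10)).
have mf : measurable_fun setT f by apply/measurable_EFinP; exact: measurable_int fi.
have ms (a : R) : measurable_fun setT (fun x : measurableTypeR R => x + a : measurableTypeR R)%R by exact: measurable_shift.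
have sE (a : R) A : measurable A -> mu1 ((fun x : measurableTypeR R => x + a : measurableTypeR R)%R @^-1` A) = mu1 A.
  by exact: lebesgue_measure_shift.
pose mu2 := prod_sfm mu1 mu1.
have LL := L1_continuous_lebesgue.
have L1 := L1_continuous_fst (m2 := mu1) ms sE LL.
have L2 := L1_continuous_snd (m1 := mu1) ms sE LL.
have L3 := L1_continuous_snd (m1 := mu2) ms sE LL.
have ms1 (a : R) : measurable_fun setT (fun x : measurableTypeR R * measurableTypeR R => (x.1 + a, x.2)%R : measurableTypeR R * measurableTypeR R).
  by apply: measurable_fun_pair => //; apply: measurable_funD.
have ms2 (a : R) : measurable_fun setT (fun x : measurableTypeR R * measurableTypeR R => (x.1, x.2 + a)%R : measurableTypeR R * measurableTypeR R).
  by apply: measurable_fun_pair => //; apply: measurable_funD.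
have mid : measurable_fun [set: measurableTypeR R] (@idfun (measurableTypeR R)) by exact: measurable_id.
have idE A : measurable A -> mu1 (@idfun (measurableTypeR R) @^-1` A) = mu1 A by [].
have s1E (a : R) A := @product_measure_preserving R _ _ _ _ mu1 mu1 (fun x => x + a)%R idfun (ms a) mid (sE a) idE A.
have s2E (a : R) A := @product_measure_preserving R _ _ _ _ mu1 mu1 idfun (fun x => x + a)%R mid (ms a) idE (sE a) A.
have {}L1 := L1_continuous_fst (m1 := mu2) (m2 := mu1) ms1 s1E L1.
have {}L2 := L1_continuous_fst (m1 := mu2) (m2 := mu1) ms2 s2E L2.
have p0 (v : R^nat) : (forall n, (`|v n| <= n.+1%:R^-1)%R) ->
   forall s : R -> pt R -> pt R, L1_continuous mu3 s ->
   exists N, forall n, (N <= n)%N -> \int[mu3]_x `|f (s (v n) x) - f x|%:E <= (e / 3)%:E.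
  move=> Hv s Ls.
  have nn n : 0 <= \int[mu3]_x `|f (s (v n) x) - f x|%:E by exact: integral_ge0.
  by apply: ((ecvg0P nn).1 (Ls f fi v (to0 v Hv))); rewrite divr_gt0.
have [N1 H1] := p0 (fun n => (h n).1.1) (fun n => let: And4 a _ _ _ := Hh n in a) _ L1.
have [N2 H2] := p0 (fun n => (h n).1.2) (fun n => let: And4 _ a _ _ := Hh n in a) _ L2.
have [N3 H3] := p0 (fun n => (h n).2) (fun n => let: And4 _ _ a _ := Hh n in a) _ L3.
pose n := maxn N1 (maxn N2 N3).
have {}H1 := H1 n (leq_maxl _ _).
have {}H2 := H2 n (leq_trans (leq_maxl _ _) (leq_maxr _ _)).
have {}H3 := H3 n (leq_trans (leq_maxr _ _) (leq_maxr _ _)).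
have [_ _ _] := Hh n; apply/negP; rewrite -leNgt.
pose e1 : pt R := (((h n).1.1, 0%R), 0%R).
pose e2 : pt R := ((0%R, (h n).1.2), 0%R).
pose e3 : pt R := ((0%R, 0%R), (h n).2).
have E1 x : (x + e1)%R = ((x.1.1 + (h n).1.1, x.1.2), x.2)%R :> pt R.
  by case: x => [[x1 x2] x3]; rewrite -[LHS]/(((x1 + (h n).1.1, x2 + 0), x3 + 0)%R) !addr0.
have E2 x : (x + e2)%R = ((x.1.1, x.1.2 + (h n).1.2), x.2)%R :> pt R.
  by case: x => [[x1 x2] x3]; rewrite -[LHS]/(((x1 + 0, x2 + (h n).1.2), x3 + 0)%R) !addr0.
have E3 x : (x + e3)%R = ((x.1.1, x.1.2), x.2 + (h n).2)%R :> pt R.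
  by case: x => [[x1 x2] x3]; rewrite -[LHS]/(((x1 + 0, x2 + 0), x3 + (h n).2)%R) !addr0.
have Eh x : (x + h n = x + e1 + e2 + e3 :> pt R)%R.
  by rewrite E3 E2 E1; case: (x) => [[x1 x2] x3].
have mfs (a : pt R) : measurable_fun setT (fun x : pt R => f (x + a)%R).
  by apply: (measurableT_comp mf); exact: measurable_shiftpt.
have ma (u v : pt R -> R) : measurable_fun setT u -> measurable_fun setT v ->
    measurable_fun [set: pt R] (fun x => `|u x - v x|%:E).
  by move=> mu mv; apply/measurable_EFinP; apply: measurableT_comp => //; apply: measurable_funB.
have G (a : pt R) : measurable_fun setT (fun x : pt R => `|f (x + a)%R - f x|%:E) by exact: ma.
have I3 : \int[mu3]_x `|f (x + e1 + e2 + e3)%R - f (x + e1 + e2)%R|%:E <= (e / 3)%:E.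
  under eq_integral do rewrite -(addrA _ e1 e2).
  rewrite (@ge0_integral_shift R (e1 + e2)%R (fun x => `|f (x + e3)%R - f x|%:E)) //.
  apply: le_trans H3; rewrite le_eqVlt; apply/orP; left; apply/eqP.
  by apply: eq_integral => -[[x1 x2] x3] _; rewrite E3.
have I2 : \int[mu3]_x `|f (x + e1 + e2)%R - f (x + e1)%R|%:E <= (e / 3)%:E.
  rewrite (@ge0_integral_shift R e1 (fun x => `|f (x + e2)%R - f x|%:E)) //.
  apply: le_trans H2; rewrite le_eqVlt; apply/orP; left; apply/eqP.
  by apply: eq_integral => -[[x1 x2] x3] _; rewrite E2.
have I1 : \int[mu3]_x `|f (x + e1)%R - f x|%:E <= (e / 3)%:E.
  apply: le_trans H1; rewrite le_eqVlt; apply/orP; left; apply/eqP.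
  by apply: eq_integral => -[[x1 x2] x3] _; rewrite E1.
have m12 : measurable_fun setT (fun x : pt R => f (x + e1 + e2)%R).
  by apply: (eq_measurable_fun (fun x : pt R => f (x + (e1 + e2))%R)) => // x _; rewrite addrA.
have m123 : measurable_fun setT (fun x : pt R => f (x + e1 + e2 + e3)%R).
  by apply: (eq_measurable_fun (fun x : pt R => f (x + (e1 + e2 + e3))%R)) => // x _; rewrite !addrA.
apply: (@le_trans _ _ (\int[mu3]_x (`|f (x + e1 + e2 + e3)%R - f (x + e1 + e2)%R|%:E +
   (`|f (x + e1 + e2)%R - f (x + e1)%R|%:E + `|f (x + e1)%R - f x|%:E)))).
  apply: ge0_le_integral => //; first exact: ma.
    by apply: emeasurable_funD; [exact: ma|apply: emeasurable_funD; exact: ma].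
  move=> x _; rewrite Eh -!EFinD lee_fin.
  set A := f (x + e1 + e2 + e3)%R; set B := f (x + e1 + e2)%R; set C := f (x + e1)%R.
  have -> : (A - f x = (A - B) + ((B - C) + (C - f x)))%R by ring.
  by apply: (le_trans (ler_normD _ _)); rewrite lerD2l; exact: ler_normD.
rewrite ge0_integralD //; last 3 first.
- exact: ma.
- by move=> x _; rewrite adde_ge0.
- by apply: emeasurable_funD; exact: ma.
rewrite ge0_integralD //; last 2 first.
- exact: ma.
- exact: ma.
have -> : e%:E = ((e / 3)%:E + ((e / 3)%:E + (e / 3)%:E)).
  by rewrite -!EFinD; congr EFin; field.
by apply: leeD => //; apply: leeD.
Unshelve. all: by end_near. Qed.
End L1_continuity.

(** * Differentiation rules and bump functions *)

Section Derivatives.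
Context {R : realType}.
Implicit Types (f g : R -> R) (x a b : R).

Lemma derE f x a b : is_derive x 1 f a -> a = b -> is_derive x 1 f b.
Proof. by move=> d <-. Qed.

Lemma derC x (c : R) : is_derive x 1 (fun _ : R => c) 0.
Proof. exact: is_derive_cst. Qed.

Lemma derI x : is_derive x 1 (fun t : R => t) 1.
Proof. exact: is_derive_id. Qed.

Lemma derD f g x a b : is_derive x 1 f a -> is_derive x 1 g b ->
  is_derive x 1 (fun t => f t + g t) (a + b).
Proof. by move=> df dg; exact: is_deriveD. Qed.

Lemma derN f x a : is_derive x 1 f a -> is_derive x 1 (fun t => - f t) (- a).
Proof. by move=> df; exact: is_deriveN. Qed.

Lemma derB f g x a b : is_derive x 1 f a -> is_derive x 1 g b ->
  is_derive x 1 (fun t => f t - g t) (a - b).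
Proof. by move=> df dg; exact: is_deriveB. Qed.

Lemma derM f g x a b : is_derive x 1 f a -> is_derive x 1 g b ->
  is_derive x 1 (fun t => f t * g t) (a * g x + f x * b).
Proof.
move=> df dg; apply: (derE (is_deriveM df dg)).
by rewrite /GRing.scale /= addrC (mulrC _ a).
Qed.

Lemma derZ f x a (c : R) : is_derive x 1 f a -> is_derive x 1 (fun t => c * f t) (c * a).
Proof. by move=> df; apply: (derE (derM (derC x c) df)); rewrite mul0r add0r. Qed.

Lemma der_comp f g x a b : is_derive x 1 g b -> is_derive (g x) 1 f a ->
  is_derive x 1 (fun t => f (g t)) (a * b).
Proof. by move=> dg df; exact: is_derive1_comp. Qed.

Lemma derV f x a : f x != 0 -> is_derive x 1 f a ->
  is_derive x 1 (fun t => (f t)^-1) (- a / f x ^+ 2).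
Proof.
move=> f0 df; apply: (derE (is_deriveV f0 df)).
by rewrite /GRing.scale /= !mulNr mulrC.
Qed.

Lemma derX f x a n : is_derive x 1 f a ->
  is_derive x 1 (fun t => f t ^+ n.+1) (n.+1%:R * f x ^+ n * a).
Proof.
move=> df; have := is_deriveX n.+1 df; rewrite /GRing.scale /= => H.
suff <- : f ^+ n.+1 = (fun t => f t ^+ n.+1) by [].
apply/funext => t; rewrite {H}; elim: n => [|n IH]; first by rewrite !expr1.
by rewrite exprS [in RHS]exprS -IH.
Qed.

Lemma der_near f g x a : (\near x, f x = g x) -> is_derive x 1 f a -> is_derive x 1 g a.
Proof. by move=> h; exact: near_eq_is_derive. Qed.

Lemma der_continuous f x a : is_derive x 1 f a -> {for x, continuous f}.
Proof.
move=> [df _]; apply: differentiable_continuous; exact/derivable1_diffP.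
Qed.

Lemma derivable_der f x : derivable f x 1 -> is_derive x 1 f (f^`()%classic x).
Proof. by move=> df; rewrite derive1E; exact: derivableP. Qed.

Lemma der_derive1 f x a : is_derive x 1 f a -> f^`()%classic x = a.
Proof. by move=> [_ <-]; rewrite derive1E. Qed.

(** Used for [flat] at points [s <= 0], where quadratic contact with 0 replaces the differentiation
    rules. *)
Lemma der_quadratic f x (C : R) : f x = 0 -> (forall h, `|f (x + h)| <= C * h ^+ 2) ->
  is_derive x 1 f 0.
Proof.
move=> fx H.
have C0 : 0 <= C.
  have := H 1; rewrite expr1n mulr1; exact: le_trans (normr_ge0 _).
have lim : h^-1 *: ((f \o shift x) (h *: (1 : R)) - f x) @[h --> 0^'] --> (0 : R).
  apply/cvgrPdist_le => e e0; near=> h.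
  have h0 : h != 0 by near: h; exact: nbhs_dnbhs_neq.
  rewrite sub0r normrN /= fx subr0 /GRing.scale /= mulr1 normrM normfV addrC.
  rewrite ler_pdivrMl ?normr_gt0 //; apply: (le_trans (H h)).
  rewrite -(real_normK (num_real h)) expr2 mulrA mulrC ler_wpM2l //.
  have : `|h| <= e / (C + 1).
    near: h; apply: dnbhs0_le; rewrite divr_gt0 // ltr_wpDl //.
  rewrite ler_pdivlMr ?ltr_wpDl // => le; apply: le_trans le.
  by rewrite mulrC ler_wpM2l // lerDl.
split; first by apply/cvg_ex; exists 0.
exact: cvg_lim.
Unshelve. all: by end_near. Qed.

End Derivatives.

(** * Smoothness of bump functions of one variable *)

Section SmoothFunctions.
Context {R : realType}.
Implicit Types (f g : R -> R) (n : nat).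

(** Recursive smoothness in one variable: closure under products and affine changes is a short
    induction, and tensor products transfer it to the [smooth] required of test functions. *)
Fixpoint Cn n f : Prop :=
  if n is m.+1 then (forall x, derivable f x 1) /\ Cn m f^`()%classic
  else continuous f.

Lemma CnS n f : Cn n.+1 f -> Cn n f.
Proof.
elim: n f => [|n IH] f /=; last by move=> [df H]; split => //; exact: IH.
by move=> [df _] x; exact: der_continuous (derivable_der (df x)).
Qed.

Lemma Cn_continuous n f : Cn n f -> continuous f.
Proof. by elim: n => [//|n IH] /CnS/IH. Qed.

Lemma Cn_cst n (c : R) : Cn n (fun _ => c).
Proof.
elim: n c => [|n IH] c /=; first by move=> x; exact: cvg_cst.
split => [x|]; first exact: derivable_cst.
have -> : (fun _ : R => c)^`()%classic = (fun _ => 0).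
  by apply/funext => x; exact: der_derive1 (derC x c).
exact: IH.
Qed.

Lemma CnD n f g : Cn n f -> Cn n g -> Cn n (fun t => f t + g t).
Proof.
elim: n f g => [|n IH] f g /=; first by move=> cf cg x; apply: cvgD; [exact: cf|exact: cg].
move=> [df cf] [dg cg].
have d x := derD (derivable_der (df x)) (derivable_der (dg x)).
split => [x|]; first by have [] := d x.
by rewrite (funext (fun x => der_derive1 (d x))); exact: IH.
Qed.

Lemma CnM n f g : Cn n f -> Cn n g -> Cn n (fun t => f t * g t).
Proof.
elim: n f g => [|n IH] f g; first by move=> cf cg x; apply: cvgM; [exact: cf|exact: cg].
move=> cf1 cg1; move: (cf1) (cg1) => [df cf] [dg cg].
have d x := derM (derivable_der (df x)) (derivable_der (dg x)).
split => [x|]; first by have [] := d x.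
rewrite (funext (fun x => der_derive1 (d x))); apply: CnD; apply: IH => //.
  exact: CnS.
exact: CnS.
Qed.

Lemma Cn_affine n f (a b : R) : Cn n f -> Cn n (fun t => f (a * t + b)).
Proof.
elim: n f => [|n IH] f /=.
  move=> cf x; apply: (cvg_comp (fun t => a * t + b) f); last exact: cf.
  by apply: cvgD; [apply: cvgM; [exact: cvg_cst|exact: cvg_id]|exact: cvg_cst].
move=> [df cf].
have dl (x : R) : is_derive x 1 (fun t : R => a * t + b) a.
  by apply: (derE (derD (derZ a (derI x)) (derC x b))); rewrite mulr1 addr0.
have d x := der_comp (dl x) (derivable_der (df (a * x + b))).
split => [x|]; first by have [] := d x.
rewrite (funext (fun x => der_derive1 (d x))); apply: CnM; last exact: Cn_cst.
exact: IH.
Qed.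

(** The classical [exp (- 1 / s)] with a pole [s ^- k] in front. The whole family is kept because it
    is closed under differentiation up to linear combinations, so one induction gives smoothness of
    every member. *)
Definition flat (k : nat) (s : R) : R := if 0 < s then s ^- k * expR (- s^-1) else 0.

(** The term of order [k.+2] in the exponential series of [1 / s] beats the pole of order [k] by two
    powers. *)
Lemma flat_quadratic k (s : R) : `|flat k s| <= (k.+2)`!%:R * s ^+ 2.
Proof.
rewrite /flat; case: ifPn => s0; last by rewrite normr0 mulr_ge0 // sqr_ge0.
have si : 0 < s^-1 by rewrite invr_gt0.
rewrite ger0_norm; last by rewrite mulr_ge0 ?expR_ge0 // invr_ge0 exprn_ge0 // ltW.
rewrite expRN ler_pdivrMr ?expR_gt0 //.
have H : s^-1 ^+ k.+2 / (k.+2)`!%:R <= expR s^-1.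
  by apply: le_trans (expR_ge1Dxn k.+1 (ltW si)); rewrite lerDr.
have F : (0 : R) < (k.+2)`!%:R by rewrite ltr0n fact_gt0.
rewrite -exprVn.
have -> : s^-1 ^+ k = (k.+2)`!%:R * s ^+ 2 * (s^-1 ^+ k.+2 / (k.+2)`!%:R).
  rewrite (exprS _ k.+1) (exprS _ k); field.
  by rewrite !gt_eqF.
by apply: ler_wpM2l => //; rewrite mulr_ge0 // ?sqr_ge0 // ltW.
Qed.

Lemma der_flat k (s : R) :
  is_derive s 1 (flat k) (flat k.+2 s - k%:R * flat k.+1 s).
Proof.
have [s0|s0] := ltP 0 s; last first.
  have fl m : flat m s = 0 by rewrite /flat ltNge s0.
  rewrite !fl mulr0 subr0.
  apply: (@der_quadratic _ _ _ (k.+2)`!%:R) => [|h]; first exact: fl.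
  rewrite {1}/flat; case: ifPn => sh; last by rewrite normr0 mulr_ge0 // sqr_ge0.
  have := flat_quadratic k (s + h); rewrite {1}/flat sh => /le_trans; apply.
  (* Here [s <= 0 < s + h], hence [s + h <= h]. *)
  apply: ler_wpM2l => //; rewrite lerXn2r // ?nnegrE ?(ltW sh) //; last by rewrite gerDr.
  by rewrite -(lerD2l s) addr0 (le_trans s0) // ltW.
have near0 : \forall t \near s, 0 < t by exact: lt_nbhsr.
apply: (@der_near _ (fun t => t^-1 ^+ k * expR (- t^-1))).
  by near=> t; rewrite /flat ifT ?exprVn //; near: t.
have sn : s != 0 by rewrite gt_eqF.
have dV := derV (f := fun t => t) sn (derI s).
have dE := der_comp (derN dV) (is_derive_expR (- s^-1)).
have -> : flat k.+2 s - k%:R * flat k.+1 s = s^-1 ^+ k * (expR (- s^-1) * - (- 1 / s ^+ 2)) - k%:R * s^-1 ^+ k.+1 * expR (- s^-1).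
  by rewrite /flat s0 !exprVn (exprS _ k.+1) (exprS _ k); field; rewrite expf_neq0 ?sn.
case: k => [|k].
  have -> : (fun t : R => t^-1 ^+ 0 * expR (- t^-1)) = (fun t => expR (- t^-1)).
    by apply/funext => t; rewrite expr0 mul1r.
  by apply: (derE dE); rewrite mul0r mul0r subr0 expr0 mul1r.
apply: (derE (derM (derX k dV) dE)).
rewrite !exprS; field; by rewrite ?expf_neq0 ?sn.
Unshelve. all: by end_near. Qed.

Lemma Cn_flat n k : Cn n (flat k).
Proof.
elim: n k => [|n IH] k; first by move=> s; exact: der_continuous (der_flat k s).
split => [s|]; first by have [] := der_flat k s.
rewrite (funext (fun s => der_derive1 (der_flat k s))).
apply: CnD; first exact: IH.
apply: (@eq_ind _ (fun s => (- k%:R) * flat k.+1 s) (Cn n)).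
  by apply: CnM; [exact: Cn_cst|exact: IH].
by apply/funext => s; rewrite mulNr.
Qed.

Definition bump (h t : R) : R := flat 0 (h^-1 * t + 1) * flat 0 (- h^-1 * t + 1).

Lemma Cn_bump n h : Cn n (bump h).
Proof. by apply: CnM; apply: Cn_affine; exact: Cn_flat. Qed.

Lemma bump_ge0 h t : 0 <= bump h t.
Proof.
have f0 s : 0 <= flat 0 s by rewrite /flat; case: ifP => // _; rewrite expr0 invr1 mul1r expR_ge0.
exact: mulr_ge0.
Qed.

Lemma bump_even h t : bump h (- t) = bump h t.
Proof. by rewrite /bump !mulrN !mulNr opprK mulrC. Qed.

Lemma bump_eq0 h t : 0 < h -> h <= `|t| -> bump h t = 0.
Proof.
move=> h0 ht; rewrite /bump /flat mulNr.
have : 1 <= `|h^-1 * t| by rewrite normrM gtr0_norm ?invr_gt0 // mulrC ler_pdivlMr // mul1r.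
rewrite ler_normr => /orP[H|H].
  by rewrite [X in _ * X]ifF ?mulr0 //; apply/negbTE; rewrite -leNgt addrC subr_le0.
by rewrite [X in X * _]ifF ?mul0r //; apply/negbTE; rewrite -leNgt -lerBrDr sub0r lerNr.
Qed.

Lemma bump_gt0 h t : 0 < h -> `|t| < h -> 0 < bump h t.
Proof.
move=> h0 ht; rewrite /bump /flat mulNr.
have : `|h^-1 * t| < 1 by rewrite normrM gtr0_norm ?invr_gt0 // mulrC ltr_pdivrMr // mul1r.
rewrite ltr_norml => /andP[H1 H2].
rewrite ifT; last by rewrite -ltrBlDr sub0r.
by rewrite ifT ?mulr_gt0 ?expR_gt0 ?expr0 ?invr1 // addrC subr_gt0.
Qed.

End SmoothFunctions.

(** * Tensor products and the mollifier *)

Section Tensor.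
Context {R : realType}.
Notation mu3 := (vol R).
Implicit Types (a b c : R -> R).

(** Partial derivatives keep this form and act on one factor, so smoothness in three variables, in
    the iterated sense of [smooth], reduces to one variable. *)
Definition tensor a b c (x : pt R) : R := a x.1.1 * b x.1.2 * c x.2.

Definition tensor_d (j : 'I_3) a b c : pt R -> R :=
  match val j with
  | 0%N => tensor a^`()%classic b c
  | 1%N => tensor a b^`()%classic c
  | _ => tensor a b c^`()%classic
  end.

Lemma continuous_tensor a b c : continuous a -> continuous b -> continuous c ->
  continuous (tensor a b c).
Proof.
move=> ca cb cc x; apply: cvgM; [apply: cvgM|].
- apply: (cvg_comp (fun x : pt R => x.1.1) a); last exact: ca.
  by apply: (cvg_comp fst fst); exact: cvg_fst.
- apply: (cvg_comp (fun x : pt R => x.1.2) b); last exact: cb.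
  by apply: (cvg_comp fst snd); [exact: cvg_fst|exact: cvg_snd].
- apply: (cvg_comp (fun x : pt R => x.2) c); last exact: cc.
  exact: cvg_snd.
Qed.

Definition Csm (f : R -> R) := forall n, Cn n f.

Lemma Csm_der f : Csm f -> forall x : R, is_derive x 1 f (f^`()%classic x).
Proof. by move=> cf x; have [df _] := cf 1%N; exact: derivable_der. Qed.

Lemma Csm_derive f : Csm f -> Csm f^`()%classic.
Proof. by move=> cf n; have [_] := cf n.+1. Qed.

Lemma tensor_der (j : 'I_3) a b c (x : pt R) (t : R) : Csm a -> Csm b -> Csm c ->
  is_derive t 1 (fun t => tensor a b c (upd j x t)) (tensor_d j a b c (upd j x t)).
Proof.
move=> ca cb cc; case: j => -[|[|[|//]]] i; rewrite /tensor_d /upd /tensor /=.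
- apply: (derE (derM (derM (Csm_der ca t) (derC t _)) (derC t _))).
  by rewrite !mulr0 !addr0.
- apply: (derE (derM (derM (derC t _) (Csm_der cb t)) (derC t _))).
  by rewrite mul0r add0r mulr0 addr0.
- apply: (derE (derM (derM (derC t _) (derC t _)) (Csm_der cc t))).
  by rewrite mul0r mulr0 addr0 mul0r add0r.
Qed.

Lemma pderiv_tensor (j : 'I_3) a b c : Csm a -> Csm b -> Csm c ->
  pderiv j (tensor a b c) = tensor_d j a b c.
Proof.
move=> ca cb cc; apply/funext => x; rewrite /pderiv.
rewrite (der_derive1 (tensor_der j x (Defs.coord j x) ca cb cc)).
by case: j => -[|[|[|//]]] i; case: x => [[x1 x2] x3].
Qed.

Lemma iterd_tensor (js : seq 'I_3) a b c : Csm a -> Csm b -> Csm c ->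
  exists a' b' c', [/\ Csm a', Csm b', Csm c' & iterd js (tensor a b c) = tensor a' b' c'].
Proof.
move=> ca cb cc; elim: js => [|j js [a' [b' [c' [ca' cb' cc' E]]]]]; first by exists a, b, c.
rewrite /= E pderiv_tensor //.
case: j => -[|[|[|//]]] i; rewrite /tensor_d /=.
- by exists a'^`()%classic, b', c'; split => //; exact: Csm_derive.
- by exists a', b'^`()%classic, c'; split => //; exact: Csm_derive.
- by exists a', b', c'^`()%classic; split => //; exact: Csm_derive.
Qed.

Lemma smooth_tensor a b c : Csm a -> Csm b -> Csm c -> smooth (tensor a b c).
Proof.
move=> ca cb cc js; have [a' [b' [c' [ca' cb' cc' ->]]]] := iterd_tensor js ca cb cc.
split; first by apply: continuous_tensor; exact: (Cn_continuous (n := 0)).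
by move=> j x; have [] := tensor_der j x (Defs.coord j x) ca' cb' cc'.
Qed.

Lemma prod_sfm_setX d1 d2 (T1 : measurableType d1) (T2 : measurableType d2)
  (m1 : {sigma_finite_measure set T1 -> \bar R}) (m2 : {sigma_finite_measure set T2 -> \bar R}) A B :
  measurable A -> measurable B -> prod_sfm m1 m2 (A `*` B) = (m1 A * m2 B)%E.
Proof. by move=> mA mB; exact: product_measure1E. Qed.

Definition bump_mass (h : R) : R := \int[mu3]_x tensor (bump h) (bump h) (bump h) x.

(** The normalising constant sits in the first factor only, which keeps the mollifier a tensor
    product. *)
Definition rho (h : R) : pt R -> R :=
  tensor (fun t => (bump_mass h)^-1 * bump h t) (bump h) (bump h).

Definition drho (h : R) (j : 'I_3) : pt R -> R :=
  tensor_d j (fun t => (bump_mass h)^-1 * bump h t) (bump h) (bump h).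

Definition box (h1 h2 h3 : R) : set (pt R) :=
  [set x | `|x.1.1| < h1 /\ `|x.1.2| < h2 /\ `|x.2| < h3].

Lemma measurable_box h1 h2 h3 : measurable (box h1 h2 h3).
Proof.
have -> : box h1 h2 h3 = (`]- h1, h1[ `*` `]- h2, h2[) `*` `]- h3, h3[.
  apply/seteqP; split => -[[x1 x2] x3]; rewrite /box /= !in_itv /= !ltr_norml.
    by move=> [-> [-> ->]].
  by move=> [[-> ->] ->].
by do 2 apply: measurableX => //.
Qed.

Lemma vol_box h1 h2 h3 : 0 < h1 -> 0 < h2 -> 0 < h3 ->
  mu3 (box h1 h2 h3) = (2 * h1 * (2 * h2) * (2 * h3))%:E.
Proof.
move=> p1 p2 p3.
have -> : box h1 h2 h3 = (`]- h1, h1[ `*` `]- h2, h2[) `*` `]- h3, h3[.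
  apply/seteqP; split => -[[x1 x2] x3]; rewrite /box /= !in_itv /= !ltr_norml.
    by move=> [-> [-> ->]].
  by move=> [[-> ->] ->].
have I (h : R) : 0 < h -> @lebesgue_measure R `]- h, h[%classic = (2 * h)%:E.
  move=> h0; rewrite lebesgue_measure_itv /= lte_fin gtrN // -EFinB; congr EFin; ring.
rewrite prod_sfm_setX //; last by apply: measurableX.
rewrite prod_sfm_setX //.
transitivity ((2 * h1)%:E * (2 * h2)%:E * (2 * h3)%:E)%E; last by rewrite -!EFinM.
by congr (_ * _ * _)%E; exact: I.
Qed.

Lemma box_integrable (f : pt R -> R) (h1 h2 h3 M : R) : measurable_fun setT f ->
  (forall x, `|f x| <= M) -> (forall x, ~ box h1 h2 h3 x -> f x = 0) ->
  mu3.-integrable setT (EFin \o f).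
Proof.
move=> mf fM f0.
pose k := Num.max 1 (Num.max h1 (Num.max h2 h3)).
have k0 : 0 < k by rewrite lt_max ltr01.
have fE : f = f \_ (box k k k).
  apply/funext => x; rewrite patchE; case: ifPn => //; rewrite notin_setE => nx.
  apply: f0; apply: contra_not nx => -[b1 [b2 b3]].
  by split; [|split]; rewrite !lt_max ?b1 ?b2 ?b3 !orbT.
rewrite fE -restrict_EFin.
apply/integrable_restrict => //; first exact: measurable_box.
rewrite setTI; apply: measurable_bounded_integrable.
- exact: measurable_box.
- by rewrite [ltLHS](vol_box k0 k0 k0) ltry.
- exact: measurable_funTS.
- by exists M; split; [exact: num_real|move=> y My x _ /=; rewrite (le_trans (fM x)) // ltW].
Qed.

Lemma flat0_bound (s : R) : 0 <= flat 0 s <= 1.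
Proof.
rewrite /flat expr0 invr1 mul1r; case: ifP => s0; last by rewrite lexx ler01.
by rewrite expR_ge0 /= -expR0 ler_expR oppr_le0 invr_ge0 ltW.
Qed.

Lemma bump_le1 (h t : R) : bump h t <= 1.
Proof.
rewrite /bump; have /andP[a0 a1] := flat0_bound (h^-1 * t + 1).
have /andP[b0 b1] := flat0_bound (- h^-1 * t + 1).
by rewrite mulr_ile1.
Qed.

Lemma continuous_bump (h : R) : continuous (bump h).
Proof. exact: (Cn_continuous (n := 0) (Cn_bump 0 h)). Qed.

Lemma measurable_tensor a b c : continuous a -> continuous b -> continuous c ->
  measurable_fun setT (tensor a b c).
Proof. by move=> ca cb cc; apply: continuous_measurable_pt; exact: continuous_tensor. Qed.

Lemma notin_box (h1 h2 h3 : R) (x : pt R) : ~ box h1 h2 h3 x ->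
  [\/ h1 <= `|x.1.1|, h2 <= `|x.1.2| | h3 <= `|x.2|].
Proof.
move=> nx; have [?|l1] := leP h1 `|x.1.1|; first exact: Or31.
have [?|l2] := leP h2 `|x.1.2|; first exact: Or32.
have [?|l3] := leP h3 `|x.2|; first exact: Or33.
by exfalso; apply: nx.
Qed.

Lemma tensor_bump_ge0 (h : R) x : 0 <= tensor (bump h) (bump h) (bump h) x.
Proof. by apply: mulr_ge0; [apply: mulr_ge0|]; exact: bump_ge0. Qed.

Lemma tensor_bump_integrable (h : R) : 0 < h ->
  mu3.-integrable setT (EFin \o tensor (bump h) (bump h) (bump h)).
Proof.
move=> h0; apply: (@box_integrable _ h h h 1).
- by apply: measurable_tensor; exact: continuous_bump.
- move=> x; rewrite ger0_norm ?tensor_bump_ge0 // /tensor.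
  have mle (u v : R) : 0 <= u -> u <= 1 -> 0 <= v -> v <= 1 -> u * v <= 1 by move=> *; rewrite mulr_ile1.
  by apply: (mle); rewrite ?bump_ge0 ?bump_le1 //; [apply: mulr_ge0|apply: (mle)]; rewrite ?bump_ge0 ?bump_le1.
- move=> x /notin_box; rewrite /tensor => -[] /(bump_eq0 h0) ->; by rewrite ?mul0r ?mulr0 ?mul0r.
Qed.

(** A vanishing integral would make the bump vanish almost everywhere, but it is positive on a box
    of positive volume. *)
Lemma bump_mass_gt0 (h : R) : 0 < h -> 0 < bump_mass h.
Proof.
move=> h0; rewrite lt_neqAle; apply/andP; split; last first.
  by apply: Rintegral_ge0 => x _; exact: tensor_bump_ge0.
apply/negP => /eqP Z0.
have ti := tensor_bump_integrable h0.
have I0 : (\int[mu3]_x `|(tensor (bump h) (bump h) (bump h) x)%:E| = 0)%E.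
  under eq_integral do rewrite gee0_abs ?lee_fin ?tensor_bump_ge0 //.
  rewrite -[LHS]fineK; last exact: integrable_fin_num ti.
  by congr EFin.
have mt : measurable_fun setT (EFin \o tensor (bump h) (bump h) (bump h)) by exact: measurable_int ti.
have := (@ae_eq_integral_abs _ _ _ mu3 setT measurableT _ mt).1 I0.
move=> [N [mN N0 sN]].
have : (mu3 (box h h h) <= mu3 N)%E.
  apply: le_measure; rewrite ?inE //; first exact: measurable_box.
  move=> x [b1 [b2 b3]]; apply: sN => /= H.
  have := H I => /= -[E].
  have : 0 < tensor (bump h) (bump h) (bump h) x.
    by apply: mulr_gt0; [apply: mulr_gt0|]; exact: bump_gt0.
  by rewrite E ltxx.
rewrite N0 (vol_box h0 h0 h0) lee_fin leNgt.
by rewrite !mulr_gt0.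
Qed.

Lemma tensor_lip (a b c : R -> R) (M K : R) :
  (forall t, `|a t| <= M) -> (forall t, `|b t| <= M) -> (forall t, `|c t| <= M) ->
  (forall t s, `|a t - a s| <= K * `|t - s|) -> (forall t s, `|b t - b s| <= K * `|t - s|) ->
  (forall t s, `|c t - c s| <= K * `|t - s|) ->
  forall x y, `|tensor a b c x - tensor a b c y| <=
     M ^+ 2 * K * (`|x.1.1 - y.1.1| + `|x.1.2 - y.1.2| + `|x.2 - y.2|).
Proof.
move=> Ma Mb Mc Ka Kb Kc x y; rewrite /tensor.
have -> : a x.1.1 * b x.1.2 * c x.2 - a y.1.1 * b y.1.2 * c y.2 =
  (a x.1.1 - a y.1.1) * (b x.1.2 * c x.2) + (b x.1.2 - b y.1.2) * (a y.1.1 * c x.2) +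
  (c x.2 - c y.2) * (a y.1.1 * b y.1.2) by ring.
apply: (le_trans (ler_normD _ _)); rewrite mulrDr; apply: lerD.
  apply: (le_trans (ler_normD _ _)); rewrite mulrDr; apply: lerD; rewrite !normrM.
    rewrite -mulrA mulrC; apply: ler_pM => //; rewrite ?mulr_ge0 //.
    by rewrite expr2; apply: ler_pM.
  rewrite -mulrA mulrC; apply: ler_pM => //; rewrite ?mulr_ge0 //.
  by rewrite expr2; apply: ler_pM.
rewrite !normrM -mulrA mulrC; apply: ler_pM => //; rewrite ?mulr_ge0 //.
by rewrite expr2; apply: ler_pM.
Qed.

Lemma bump_der_bound (h : R) : 0 < h -> exists2 K, 0 <= K & forall t, `|(bump h)^`()%classic t| <= K.
Proof.
move=> h0.
have cb : Csm (bump h) by move=> n; exact: Cn_bump.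
have hh : - h <= h by lra.
have cd : continuous (bump h)^`()%classic by exact: (Cn_continuous (n := 0) (Csm_derive cb 0)).
have [|c _ Hc] := @EVT_max R (fun t => `|(bump h)^`()%classic t|) _ _ hh.
  apply: continuous_subspaceT => x.
  by apply: (cvg_comp _ (fun z : R => `|z|)); [exact: cd|exact: norm_continuous].
exists `|(bump h)^`()%classic c|; first exact: normr_ge0.
move=> u.
have [hu|hu] := ltP h `|u|; last by apply: Hc; rewrite in_itv /= -ler_norml.
have nu : nbhs u [set v | h < `|v|].
  by apply: (@norm_continuous _ R u [set w | h < w]); exact: lt_nbhsr.
have nu0 : \near u, 0 = bump h u.
  by apply: filterS nu => v /= hv; rewrite bump_eq0 // ltW.
by rewrite (der_derive1 (der_near nu0 (derC u 0))) normr0.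
Qed.

Lemma bump_lip (h : R) : 0 < h -> exists2 K, 0 <= K & forall t s, `|bump h t - bump h s| <= K * `|t - s|.
Proof.
move=> h0; have [K K0 HK] := bump_der_bound h0.
have cb : Csm (bump h) by move=> n; exact: Cn_bump.
exists K => // t s.
have H u v : u <= v -> `|bump h v - bump h u| <= K * `|v - u|.
  move=> uv; have [w _ ->] := @MVT_segment R (bump h) (bump h)^`()%classic u v uv
    (fun x _ => Csm_der cb x) (continuous_subspaceT (@continuous_bump h)).
  by rewrite normrM ler_wpM2r.
have [st|ts] := leP s t; first exact: H.
by rewrite distrC (distrC t); apply: H; exact: ltW.
Qed.

Section rho_facts.
Variables (h : R) (h0 : 0 < h).
Let Z := bump_mass h.
Let Z0 : 0 < Z. Proof. exact: bump_mass_gt0. Qed.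

Lemma rhoE x : rho h x = Z^-1 * tensor (bump h) (bump h) (bump h) x.
Proof. by rewrite /rho /tensor !mulrA. Qed.

Lemma rho_ge0 x : 0 <= rho h x.
Proof. by rewrite rhoE; apply: mulr_ge0; [rewrite invr_ge0 ltW|exact: tensor_bump_ge0]. Qed.

Lemma rho_even x : rho h (- x) = rho h x.
Proof. by rewrite !rhoE /tensor /= !bump_even. Qed.

Lemma rho_supp x : ~ box h h h x -> rho h x = 0.
Proof.
rewrite rhoE => /notin_box; rewrite /tensor => -[] /(bump_eq0 h0) ->; by rewrite ?mul0r ?mulr0 ?mul0r ?mulr0.
Qed.

Lemma continuous_rho : continuous (rho h).
Proof.
apply: continuous_tensor; [|exact: continuous_bump|exact: continuous_bump].
by move=> x; apply: cvgM; [exact: cvg_cst|exact: continuous_bump].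
Qed.

Lemma measurable_rho : measurable_fun setT (rho h).
Proof. exact: continuous_measurable_pt continuous_rho. Qed.

Lemma rho_bound x : `|rho h x| <= Z^-1.
Proof.
rewrite ger0_norm ?rho_ge0 // rhoE; apply: ler_piMr; first by rewrite invr_ge0 ltW.
have mle (u v : R) : 0 <= u -> u <= 1 -> 0 <= v -> v <= 1 -> u * v <= 1 by move=> *; rewrite mulr_ile1.
by apply: (mle); rewrite ?bump_ge0 ?bump_le1 //; [apply: mulr_ge0|apply: (mle)]; rewrite ?bump_ge0 ?bump_le1.
Qed.

Lemma rho_mass : \int[mu3]_x rho h x = 1.
Proof.
under eq_Rintegral do rewrite rhoE.
by rewrite RintegralZl ?mulVf ?gt_eqF //; exact: tensor_bump_integrable.
Qed.

Lemma rho_lip : exists2 K, 0 <= K & forall x y, `|rho h x - rho h y| <=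
     K * (`|x.1.1 - y.1.1| + `|x.1.2 - y.1.2| + `|x.2 - y.2|).
Proof.
have [K K0 HK] := bump_lip h0.
have b1 t : `|bump h t| <= 1 by rewrite ger0_norm ?bump_ge0 ?bump_le1.
exists (Z^-1 * (1 ^+ 2 * K)) => [|x y].
  by rewrite mulr_ge0 ?invr_ge0 ?(ltW Z0) // mulr_ge0.
rewrite !rhoE -mulrBr normrM ger0_norm ?invr_ge0 ?(ltW Z0) // -mulrA ler_wpM2l ?invr_ge0 ?(ltW Z0) //.
exact: tensor_lip.
Qed.

Let ba := fun t => Z^-1 * bump h t.
Lemma Csm_ba : Csm ba.
Proof. by move=> n; apply: CnM; [exact: Cn_cst|exact: Cn_bump]. Qed.
Let cb : Csm (bump h). Proof. by move=> n; exact: Cn_bump. Qed.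

Lemma ba_der t : ba^`()%classic t = Z^-1 * (bump h)^`()%classic t.
Proof. exact: der_derive1 (derZ Z^-1 (Csm_der cb t)). Qed.

Lemma drho_bound : exists2 K, 0 <= K & forall j x, `|drho h j x| <= K.
Proof.
have [K K0 HK] := bump_der_bound h0.
have b1 t : `|bump h t| <= 1 by rewrite ger0_norm ?bump_ge0 ?bump_le1.
exists (Z^-1 * K) => [|j x]; first by rewrite mulr_ge0 ?invr_ge0 ?(ltW Z0).
have n (a b c M : R) : `|a| <= M -> `|b| <= 1 -> `|c| <= 1 -> `|a * b * c| <= M.
  move=> Ha Hb Hc; rewrite !normrM -mulrA; apply: le_trans Ha.
  by apply: ler_piMr => //; apply: mulr_ile1.
have Zi : `|Z^-1| = Z^-1 by rewrite gtr0_norm ?invr_gt0.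
have zz u v : `|u| <= v -> `|Z^-1 * u| <= Z^-1 * v.
  by move=> uv; rewrite normrM Zi ler_wpM2l // invr_ge0 ltW.
rewrite /drho /tensor_d /tensor.
case: j => -[|[|[|//]]] i /=.
- by apply: n; rewrite ?b1 // ba_der; exact: zz.
- have := zz _ _ (n _ _ _ _ (HK x.1.2) (b1 x.1.1) (b1 x.2)).
  congr (`|_| <= _); rewrite /Z; move: (bump h x.1.1) (bump h x.2) => u v; ring.
- have := zz _ _ (n _ _ _ _ (HK x.2) (b1 x.1.1) (b1 x.1.2)).
  congr (`|_| <= _); rewrite /Z; move: (bump h x.1.1) (bump h x.1.2) => u v; ring.
Qed.

Lemma continuous_drho j : continuous (drho h j).
Proof.
have c1 : continuous ba by exact: (Cn_continuous (n := 0) (Csm_ba 0)).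
have c2 : continuous ba^`()%classic by exact: (Cn_continuous (n := 0) (Csm_derive Csm_ba 0)).
have c3 : continuous (bump h)^`()%classic by exact: (Cn_continuous (n := 0) (Csm_derive cb 0)).
have c4 := @continuous_bump h.
by rewrite /drho /tensor_d; case: j => -[|[|[|//]]] i /=; apply: continuous_tensor.
Qed.

(** This test function identifies derivatives of a mollification with mollified weak derivatives.
    The inequalities are weak because the compact support is taken to be the closed box about
    [x]. *)
Lemma rho_test (Q : set (pt R)) (x : pt R) :
  (forall y, [/\ `|x.1.1 - y.1.1| <= h, `|x.1.2 - y.1.2| <= h & `|x.2 - y.2| <= h] -> Q y) ->
  test_fun Q (fun y => rho h (x - y)) /\
  forall j y, pderiv j (fun y => rho h (x - y)) y = - drho h j (x - y).
Proof.
move=> xQ.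
pose a t := ba (-1 * t + x.1.1); pose b t := bump h (-1 * t + x.1.2); pose c t := bump h (-1 * t + x.2).
have ca : Csm a by move=> n; apply: (@Cn_affine _ n ba); exact: Csm_ba.
have cbb : Csm b by move=> n; apply: Cn_affine; exact: cb.
have cc : Csm c by move=> n; apply: Cn_affine; exact: cb.
have E : (fun y => rho h (x - y)) = tensor a b c.
  by apply/funext => y; rewrite /rho /tensor /a /b /c /ba /= !mulN1r ![- _ + _]addrC.
rewrite E; split.
  split; first exact: smooth_tensor.
  exists ((`[x.1.1 - h, x.1.1 + h] `*` `[x.1.2 - h, x.1.2 + h]) `*` `[x.2 - h, x.2 + h]); split.
  - exact: (compact_setX (compact_setX (@segment_compact _ _ _) (@segment_compact _ _ _)) (@segment_compact _ _ _)).
  - move=> y [[/=]]; rewrite !in_itv /= -!ler_distl => h1 h2 h3; apply: xQ.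
    by rewrite distrC h1 distrC h2 distrC h3.
  - move=> y ny; rewrite -[LHS]/(tensor a b c y) -E /=; apply: rho_supp.
    apply: contra_not ny => -[h1 [h2 h3]]; split; [split|]; rewrite /= in_itv /= -ler_distl distrC ltW //.
move=> j y; rewrite pderiv_tensor //.
have da (f : R -> R) (u t : R) : Csm f -> (fun t => f (-1 * t + u))^`()%classic t = - f^`()%classic (u - t).
  move=> cf; have dl : is_derive t 1 (fun t : R => -1 * t + u) (-1).
    by apply: (derE (derD (derZ (-1) (derI t)) (derC t u))); rewrite mulr1 addr0.
  rewrite (der_derive1 (der_comp dl (Csm_der cf (-1 * t + u)))).
  by rewrite mulrN1 mulN1r addrC.
have ea t : a t = ba (x.1.1 - t) by rewrite /a mulN1r addrC.
have eb t : b t = bump h (x.1.2 - t) by rewrite /b mulN1r addrC.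
have ec t : c t = bump h (x.2 - t) by rewrite /c mulN1r addrC.
rewrite /tensor_d /drho /tensor_d; case: j => -[|[|[|//]]] i; rewrite /tensor /=.
- by rewrite (da ba _ _ Csm_ba) eb ec !mulNr.
- by rewrite (da _ _ _ cb) ea ec !(mulrN, mulNr).
- by rewrite (da _ _ _ cb) ea eb !mulrN.
Qed.

End rho_facts.

End Tensor.

(** * Mollification *)

Section RealIntegrable.
Context d (T : measurableType d) (R : realType) (mu : {measure set T -> \bar R}) (D : set T).
Hypothesis mD : measurable D.
Implicit Types f g : T -> R.

Lemma integrableZ_R (k : R) f : mu.-integrable D (EFin \o f) ->
  mu.-integrable D (EFin \o (fun y => k * f y)).
Proof.
move=> fi; have -> : EFin \o (fun y => k * f y) = (fun y => k%:E * (EFin \o f) y)%E by apply/funext.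
exact: integrableZl.
Qed.

Lemma integrableD_R f g : mu.-integrable D (EFin \o f) -> mu.-integrable D (EFin \o g) ->
  mu.-integrable D (EFin \o (fun y => f y + g y)).
Proof.
move=> fi gi; have -> : EFin \o (fun y => f y + g y) = ((EFin \o f) \+ (EFin \o g))%E by apply/funext.
exact: integrableD.
Qed.

Lemma integrableB_R f g : mu.-integrable D (EFin \o f) -> mu.-integrable D (EFin \o g) ->
  mu.-integrable D (EFin \o (fun y => f y - g y)).
Proof.
move=> fi gi; have -> : EFin \o (fun y => f y - g y) = ((EFin \o f) \- (EFin \o g))%E by apply/funext.
exact: integrableB.
Qed.

Lemma EFin_Rintegral f : mu.-integrable D (EFin \o f) ->
  (\int[mu]_(x in D) f x)%:E = (\int[mu]_(x in D) (f x)%:E)%E.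
Proof. by move=> fi; rewrite /Rintegral fineK //; exact: integrable_fin_num. Qed.

Lemma measurable_integrable_R f : mu.-integrable D (EFin \o f) -> measurable_fun D f.
Proof. by move=> fi; apply/measurable_EFinP; exact: measurable_int fi. Qed.

End RealIntegrable.

Section Mollification.
Context {R : realType}.
Notation mu3 := (vol R).

Lemma measurable_addpt : measurable_fun setT (fun z : pt R * pt R => z.1 + z.2).
Proof.
have m1 : measurable_fun setT (fun z : pt R * pt R => z.1) by exact: measurable_fst.
have m2 : measurable_fun setT (fun z : pt R * pt R => z.2) by exact: measurable_snd.
apply: (@measurable_pt_tuple _ _ (pt R * pt R)%type (fun z => z.1.1.1 + z.2.1.1) (fun z => z.1.1.2 + z.2.1.2) (fun z => z.1.2 + z.2.2)).
- by apply: measurable_funD; [exact: measurableT_comp measurable_pt1 m1|exact: measurableT_comp measurable_pt1 m2].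
- by apply: measurable_funD; [exact: measurableT_comp measurable_pt2 m1|exact: measurableT_comp measurable_pt2 m2].
- by apply: measurable_funD; [exact: measurableT_comp measurable_pt3 m1|exact: measurableT_comp measurable_pt3 m2].
Qed.

Lemma measurable_oppt : measurable_fun setT (fun z : pt R => - z).
Proof.
apply: (@measurable_pt_tuple _ _ (pt R) (fun z => - z.1.1) (fun z => - z.1.2) (fun z => - z.2)).
- exact: measurableT_comp (@oppr_measurable _ setT) measurable_pt1.
- exact: measurableT_comp (@oppr_measurable _ setT) measurable_pt2.
- exact: measurableT_comp (@oppr_measurable _ setT) measurable_pt3.
Qed.

Lemma mcomp_pt d (T : measurableType d) (f : pt R -> R) (g : T -> pt R) :
  measurable_fun setT f -> measurable_fun setT g -> measurable_fun setT (fun x => f (g x)).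
Proof. by move=> mf mg; exact: measurableT_comp. Qed.

Lemma measurable_subpt : measurable_fun setT (fun z : pt R * pt R => z.1 - z.2).
Proof.
have m1 : measurable_fun setT (fun z : pt R * pt R => z.1) by exact: measurable_fst.
have m2 : measurable_fun setT (fun z : pt R * pt R => z.2) by exact: measurable_snd.
apply: (@measurable_pt_tuple _ _ (pt R * pt R)%type (fun z => z.1.1.1 - z.2.1.1) (fun z => z.1.1.2 - z.2.1.2) (fun z => z.1.2 - z.2.2)).
- by apply: measurable_funB; [exact: measurableT_comp measurable_pt1 m1|exact: measurableT_comp measurable_pt1 m2].
- by apply: measurable_funB; [exact: measurableT_comp measurable_pt2 m1|exact: measurableT_comp measurable_pt2 m2].
- by apply: measurable_funB; [exact: measurableT_comp measurable_pt3 m1|exact: measurableT_comp measurable_pt3 m2].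
Qed.

Section fixed_h.
Variables (h : R) (h0 : 0 < h).

(** Integrated over all of space; functions on the cube are first extended by zero. *)
Definition mol (f : pt R -> R) (x : pt R) : R := \int[mu3]_y (f y * rho h (x - y)).

Lemma measurable_rhox x : measurable_fun setT (fun y : pt R => rho h (x - y)).
Proof.
apply: (measurableT_comp (measurable_rho h)).
apply: (eq_measurable_fun (fun y : pt R => - y + x)); first by move=> y _; rewrite addrC.
exact: measurableT_comp (measurable_shiftpt x) measurable_oppt.
Qed.

Lemma bounded_mul_integrable (f k : pt R -> R) (M : R) : mu3.-integrable setT (EFin \o f) ->
  measurable_fun setT k -> (forall y, `|k y| <= M) ->
  mu3.-integrable setT (EFin \o (fun y => f y * k y)).
Proof.
move=> fi mk kM.
have mf : measurable_fun setT f by apply/measurable_EFinP; exact: measurable_int fi.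
have gi : mu3.-integrable setT (EFin \o (fun y => M * f y)).
  have -> : EFin \o (fun y => M * f y) = (fun y => M%:E * (EFin \o f) y)%E by apply/funext.
  exact: integrableZl.
apply: (le_integrable measurableT _ _ gi).
  by apply/measurable_EFinP; exact: measurable_funM.
move=> y _ /=; rewrite lee_fin !normrM mulrC ler_wpM2r //.
by apply: (le_trans (kM y)); exact: ler_norm.
Qed.

Lemma mol_integrable f x : mu3.-integrable setT (EFin \o f) ->
  mu3.-integrable setT (EFin \o (fun y => f y * rho h (x - y))).
Proof.
move=> fi; apply: (@bounded_mul_integrable _ _ (bump_mass h)^-1 fi); first exact: measurable_rhox.
by move=> y; exact: rho_bound.
Qed.

Lemma rhox_integrable x : mu3.-integrable setT (EFin \o (fun y => rho h (x - y))).
Proof.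
have ri : mu3.-integrable setT (EFin \o rho h).
  apply: (@box_integrable _ _ h h h (bump_mass h)^-1); first exact: measurable_rho.
    by move=> y; exact: rho_bound.
  by move=> y; exact: rho_supp.
have := @integrable_shift _ (- x) _ ri.
congr (_.-integrable _ _); apply/funext => y /=.
by rewrite -(rho_even h (x - y)) opprB.
Qed.

Lemma rhox_mass x : \int[mu3]_y rho h (x - y) = 1.
Proof.
rewrite -(rho_mass h0).
have ri : mu3.-integrable setT (EFin \o rho h).
  by have := rhox_integrable 0; apply: eq_integrable => // y _ /=; rewrite sub0r rho_even.
rewrite -(Rintegral_shift (- x) ri).
by apply: eq_Rintegral => y _; rewrite -(rho_even h (x - y)) opprB.
Qed.

Lemma mol_ge0 f x : (forall y, 0 <= f y) -> 0 <= mol f x.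
Proof. by move=> f0; apply: Rintegral_ge0 => y _; rewrite mulr_ge0 // rho_ge0. Qed.

Lemma molD f g x : mu3.-integrable setT (EFin \o f) -> mu3.-integrable setT (EFin \o g) ->
  mol (fun y => f y + g y) x = mol f x + mol g x.
Proof.
move=> fi gi; rewrite /mol -RintegralD //; [|exact: mol_integrable|exact: mol_integrable].
by apply: eq_Rintegral => y _; rewrite mulrDl.
Qed.

Lemma mol_cst (c : R) x : \int[mu3]_y (c * rho h (x - y)) = c.
Proof. by rewrite RintegralZl ?rhox_mass ?mulr1 //; exact: rhox_integrable. Qed.

Lemma mol_jensen f x : mu3.-integrable setT (EFin \o f) ->
  mu3.-integrable setT (EFin \o (fun y => f y ^+ 2)) ->
  mol f x ^+ 2 <= mol (fun y => f y ^+ 2) x.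
Proof.
move=> fi f2i; set c := mol f x.
have i1 := mol_integrable x fi; have i2 := mol_integrable x f2i; have i3 := rhox_integrable x.
have : 0 <= \int[mu3]_y ((f y ^+ 2 * rho h (x - y) - 2 * c * (f y * rho h (x - y))) + c ^+ 2 * rho h (x - y)).
  apply: Rintegral_ge0 => y _.
  have -> : (f y ^+ 2 * rho h (x - y) - 2 * c * (f y * rho h (x - y))) + c ^+ 2 * rho h (x - y) =
    (f y - c) ^+ 2 * rho h (x - y) by ring.
  by rewrite mulr_ge0 ?sqr_ge0 // rho_ge0.
rewrite RintegralD //; last 2 first.
- by apply: integrableB_R => //; exact: integrableZ_R.
- exact: integrableZ_R.
rewrite RintegralB //; last by exact: integrableZ_R.
have -> : \int[mu3]_y (2 * c * (f y * rho h (x - y))) = 2 * c * c by rewrite RintegralZl.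
rewrite mol_cst -/(mol (fun y => f y ^+ 2) x).
by move=> H; rewrite -subr_ge0; apply: le_trans H _; rewrite le_eqVlt; apply/orP; left; apply/eqP; ring.
Qed.

Lemma continuous_mol f : mu3.-integrable setT (EFin \o f) -> continuous (mol f).
Proof.
move=> fi x; have [K K0 HK] := rho_lip h0.
have fin : mu3.-integrable setT (EFin \o (fun y => `|f y|)) by exact: integrable_norm.
pose I := \int[mu3]_y `|f y|.
have I0 : 0 <= I by apply: Rintegral_ge0.
have L z : `|mol f z - mol f x| <= K * (`|z.1.1 - x.1.1| + `|z.1.2 - x.1.2| + `|z.2 - x.2|) * I.
  rewrite /mol -RintegralB //; [|exact: mol_integrable|exact: mol_integrable].
  apply: (le_trans (le_normr_Rintegral _ _)) => //.
    by apply: integrableB_R => //; exact: mol_integrable.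
  rewrite /I -RintegralZl //; apply: le_Rintegral => //.
  - by apply: integrable_norm; apply: integrableB_R => //; exact: mol_integrable.
  - exact: integrableZ_R.
  move=> y _; rewrite -mulrBr normrM mulrC ler_wpM2r //.
  apply: (le_trans (HK _ _)) => /=.
  have e (a b c : R) : a - c - (b - c) = a - b by ring.
  by rewrite !e.
apply/cvgrPdist_le => e e0.
have d0 : 0 < e / (3 * K * I + 1) by rewrite divr_gt0 // ltr_wpDl // !mulr_ge0.
exists (ball x.1.1 (e / (3 * K * I + 1)) `*` ball x.1.2 (e / (3 * K * I + 1)), ball x.2 (e / (3 * K * I + 1))).
  split; last exact: nbhsx_ballx.
  exists (ball x.1.1 (e / (3 * K * I + 1)), ball x.1.2 (e / (3 * K * I + 1))) => //.
  by split; exact: nbhsx_ballx.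
move=> [[z1 z2] z3] [[/= b1 b2] b3] /=.
rewrite distrC; apply: (le_trans (L _)) => /=.
rewrite distrC (distrC z2) (distrC z3).
move: b1 b2 b3; rewrite /ball /= => /ltW b1 /ltW b2 /ltW b3.
apply: (@le_trans _ _ (K * (3 * (e / (3 * K * I + 1))) * I)).
  by rewrite ler_wpM2r // ler_wpM2l //; lra.
have D0 : 0 < 3 * K * I + 1 by rewrite ltr_wpDl // !mulr_ge0.
have -> : K * (3 * (e / (3 * K * I + 1))) * I = e * (3 * K * I) / (3 * K * I + 1) by ring.
by rewrite ler_pdivrMr // ler_wpM2l ?(ltW e0) // lerDl.
Qed.

Lemma measurable_rhosub : measurable_fun setT (fun z : pt R * pt R => rho h (z.1 - z.2)).
Proof. exact: (@mcomp_pt _ (pt R * pt R)%type _ _ (measurable_rho h) measurable_subpt). Qed.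

Lemma rho_integrable : mu3.-integrable setT (EFin \o rho h).
Proof.
apply: (@box_integrable _ _ h h h (bump_mass h)^-1); first exact: measurable_rho.
  by move=> y; exact: rho_bound.
by move=> y; exact: rho_supp.
Qed.

Lemma mol_tonelli F : (forall y, 0 <= F y) -> mu3.-integrable setT (EFin \o F) ->
  (\int[mu3]_x (mol F x)%:E = \int[mu3]_y (F y)%:E)%E.
Proof.
move=> F0 Fi; have mF := measurable_integrable_R Fi.
have mm : measurable_fun setT (fun z : pt R * pt R => (F z.2 * rho h (z.1 - z.2))%:E).
  apply/measurable_EFinP; apply: measurable_funM; last exact: measurable_rhosub.
  exact: (@mcomp_pt _ (pt R * pt R)%type _ _ mF measurable_snd).
have nn (z : pt R * pt R) : (0 <= (F z.2 * rho h (z.1 - z.2))%:E)%E by rewrite lee_fin mulr_ge0 // rho_ge0.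
transitivity (\int[mu3]_x \int[mu3]_y (F y * rho h (x - y))%:E)%E.
  by apply: eq_integral => x _; rewrite /mol EFin_Rintegral //; exact: mol_integrable.
rewrite (@fubini_tonelli _ _ _ _ R mu3 mu3 (fun z : pt R * pt R => (F z.2 * rho h (z.1 - z.2))%:E)) //=.
apply: eq_integral => y _.
under eq_integral do rewrite EFinM.
rewrite ge0_integralZl //; last 3 first.
- apply/measurable_EFinP; exact: measurableT_comp (measurable_rho h) (measurable_shiftpt (- y)).
- by move=> x _; rewrite lee_fin rho_ge0.
- by rewrite lee_fin.
rewrite (@ge0_integral_shift _ (- y) (EFin \o rho h)); last 2 first.
- by apply/measurable_EFinP; exact: measurable_rho.
- by move=> x; rewrite lee_fin rho_ge0.
by rewrite -(EFin_Rintegral measurableT rho_integrable) rho_mass // mule1.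
Qed.

(** The error is an average, weighted by [rho], of the differences [f (x + z) - f x] with [z] in the
    support, so Tonelli transfers a bound that is uniform in [z]. *)
Lemma mol_L1_bound f (e : R) : mu3.-integrable setT (EFin \o f) ->
  (forall z : pt R, `|z.1.1| <= h -> `|z.1.2| <= h -> `|z.2| <= h ->
     (\int[mu3]_x `|f (x + z)%R - f x|%:E <= e%:E)%E) ->
  (\int[mu3]_x `|mol f x - f x|%:E <= e%:E)%E.
Proof.
move=> fi He; have mf := measurable_integrable_R fi.
have mfx : measurable_fun setT (fun z : pt R * pt R => f (z.1 + z.2)).
  exact: (@mcomp_pt _ (pt R * pt R)%type _ _ mf measurable_addpt).
have mm : measurable_fun setT (fun z : pt R * pt R => (`|f (z.1 + z.2) - f z.1| * rho h z.2)%:E).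
  apply/measurable_EFinP; apply: measurable_funM.
    apply: measurableT_comp => //; apply: measurable_funB => //.
    exact: (@mcomp_pt _ (pt R * pt R)%type _ _ mf measurable_fst).
  exact: (@mcomp_pt _ (pt R * pt R)%type _ _ (measurable_rho h) measurable_snd).
have nn (z : pt R * pt R) : (0 <= (`|f (z.1 + z.2) - f z.1| * rho h z.2)%:E)%E by rewrite lee_fin mulr_ge0 // rho_ge0.
apply: (@le_trans _ _ (\int[mu3]_x \int[mu3]_z (`|f (x + z)%R - f x| * rho h z)%:E)%E).
  apply: ge0_le_integral => //.
  - apply/measurable_EFinP; apply: measurableT_comp => //; apply: measurable_funB => //.
    by apply: continuous_measurable_pt; exact: continuous_mol.
  - exact: (@measurable_fun_fubini_tonelli_F _ _ _ _ R mu3 (fun z : pt R * pt R => (`|f (z.1 + z.2) - f z.1| * rho h z.2)%:E)).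
  move=> x _.
  have i1 := mol_integrable x fi; have i3 := rhox_integrable x.
  have -> : mol f x - f x = \int[mu3]_y ((f y - f x) * rho h (x - y)).
    rewrite -[X in _ - X](mol_cst (f x) x) /mol -RintegralB //; last exact: integrableZ_R.
    by apply: eq_Rintegral => y _; rewrite mulrBl.
  have ii : mu3.-integrable setT (EFin \o (fun y => (f y - f x) * rho h (x - y))).
    have := integrableB_R measurableT i1 (integrableZ_R measurableT (f x) i3).
    by apply: eq_integrable => // y _ /=; rewrite mulrBl.
  apply: (@le_trans _ _ (\int[mu3]_y (`|f y - f x| * rho h (x - y))%:E)%E).
    have ni := integrable_norm ii.
    rewrite (_ : \int[mu3]_y _ = (\int[mu3]_y `|(f y - f x) * rho h (x - y)|)%:E)%E.
      by rewrite lee_fin; apply: le_normr_Rintegral.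
    rewrite EFin_Rintegral //; apply: eq_integral => y _.
    by rewrite normrM (ger0_norm (rho_ge0 h0 _)).
  rewrite -(@ge0_integral_shift _ x (fun y => (`|f y - f x| * rho h (x - y))%:E)).
  - apply: ge0_le_integral => //.
    + by move=> z _; rewrite lee_fin mulr_ge0 // rho_ge0.
    + apply/measurable_EFinP; apply: measurable_funM.
        apply: measurableT_comp => //; apply: measurable_funB => //.
        exact: measurableT_comp mf (measurable_shiftpt x).
      have := measurableT_comp (measurable_rho h) measurable_oppt.
      apply: eq_measurable_fun => z _ /=; congr (rho h _).
      by rewrite opprD addrA addrAC subrr add0r.
    + apply/measurable_EFinP; apply: measurable_funM; last exact: measurable_rho.
      apply: measurableT_comp => //; apply: measurable_funB => //.
      apply: (eq_measurable_fun (fun z : pt R => f (z + x))); first by move=> z _; rewrite addrC.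
      exact: measurableT_comp mf (measurable_shiftpt x).
    move=> z _; rewrite lee_fin (addrC z x).
    have -> : x - (x + z) = - z by rewrite opprD addrA subrr add0r.
    by rewrite rho_even.
  - apply/measurable_EFinP; apply: measurable_funM; last exact: measurable_rhox.
    by apply: measurableT_comp => //; apply: measurable_funB.
  - by move=> y; rewrite lee_fin mulr_ge0 // rho_ge0.
rewrite (@fubini_tonelli _ _ _ _ R mu3 mu3 (fun z : pt R * pt R => (`|f (z.1 + z.2) - f z.1| * rho h z.2)%:E)) //=.
apply: (@le_trans _ _ (\int[mu3]_z (e * rho h z)%:E)%E); last first.
  rewrite -(EFin_Rintegral measurableT (integrableZ_R measurableT e rho_integrable)) RintegralZl ?rho_mass ?mulr1 //.
  exact: rho_integrable.
have e0 : 0 <= e.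
  rewrite -lee_fin; apply: (le_trans _ (He 0 _ _ _)); rewrite /= ?normr0 ?(ltW h0) //.
  by apply: integral_ge0.
apply: ge0_le_integral => //.
- by move=> z _; apply: integral_ge0 => x _; rewrite lee_fin mulr_ge0 // rho_ge0.
- exact: (@measurable_fun_fubini_tonelli_G _ _ _ _ R mu3 (fun z : pt R * pt R => (`|f (z.1 + z.2) - f z.1| * rho h z.2)%:E)).
- by apply/measurable_EFinP; apply: measurable_funM => //; exact: measurable_rho.
move=> z _.
have [bz|/(rho_supp h0) ->] := pselect (box h h h z); last first.
  rewrite mulr0; under eq_integral do rewrite mulr0.
  by rewrite integral0.
under eq_integral do rewrite mulrC EFinM.
rewrite ge0_integralZl //; last 2 first.
- apply/measurable_EFinP; apply: measurableT_comp => //; apply: measurable_funB => //.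
  exact: measurableT_comp mf (measurable_shiftpt z).
- by rewrite lee_fin rho_ge0.
rewrite [leRHS](_ : _ = ((rho h z)%:E * e%:E)%E); last by rewrite -EFinM mulrC.
apply: lee_wpmul2l; first by rewrite lee_fin rho_ge0.
by case: bz => [/ltW b1 [/ltW b2 /ltW b3]]; exact: He.
Qed.

Definition circ (x : pt R) (r t : R) : pt R := ((x.1.1 + r * cos t, x.1.2 + r * sin t), x.2).

(** The derivative sits on the mollifier here; [dmol_weak] moves it onto [f] at points away from the
    boundary. *)
Definition dmol (j : 'I_3) (f : pt R -> R) (x : pt R) : R := \int[mu3]_y (f y * drho h j (x - y)).

Lemma rho_circ_der (x y : pt R) (r t : R) :
  is_derive t 1 (fun t => rho h (circ x r t - y))
    (r * (- sin t * drho h 0 (circ x r t - y) + cos t * drho h 1 (circ x r t - y))).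
Proof.
have dl (a b : R) (f f' : R -> R) : is_derive t 1 f (f' t) -> is_derive t 1 (fun t => a + r * f t - b) (r * f' t).
  by move=> df; apply: (derE (derB (derD (derC t a) (derZ r df)) (derC t b))); rewrite add0r subr0.
have d1 := der_comp (dl x.1.1 y.1.1 cos (fun t => - sin t) (is_derive_cos t)) (Csm_der (Csm_ba h) _).
have d2 := der_comp (dl x.1.2 y.1.2 sin cos (is_derive_sin t)) (Csm_der (fun n => Cn_bump n h) _).
apply: (derE (derM (derM d1 d2) (derC t (bump h (x.2 - y.2))))).
rewrite /drho /tensor_d /tensor /=; ring.
Qed.

Lemma dmol_integrable f x j : mu3.-integrable setT (EFin \o f) ->
  mu3.-integrable setT (EFin \o (fun y => f y * drho h j (x - y))).
Proof.
move=> fi; have [K K0 HK] := drho_bound h0.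
apply: (@bounded_mul_integrable _ _ K fi) => //.
apply: (@mcomp_pt _ (pt R) (drho h j) (fun y => x - y)); first exact: continuous_measurable_pt (@continuous_drho _ h j).
apply: (eq_measurable_fun (fun y : pt R => - y + x)); first by move=> y _; rewrite addrC.
exact: measurableT_comp (measurable_shiftpt x) measurable_oppt.
Qed.

(** Differentiation under the integral with the angle as the only parameter; the bound on [drho]
    gives the domination. *)
Lemma mol_circ_der f x (r t : R) : mu3.-integrable setT (EFin \o f) ->
  is_derive t 1 (fun t => mol f (circ x r t))
    (r * (- sin t * dmol 0 f (circ x r t) + cos t * dmol 1 f (circ x r t))).
Proof.
move=> fi; have [K K0 HK] := drho_bound h0.
pose F (t : R) (y : pt R) := f y * rho h (circ x r t - y).
have d (t1 : R) y : is_derive t1 1 (F ^~ y) (f y * (r * (- sin t1 * drho h 0 (circ x r t1 - y) + cos t1 * drho h 1 (circ x r t1 - y)))).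
  exact: derZ (rho_circ_der x y r t1).
have ti : (`]t - 1, t + 1[%classic : set R) t by rewrite /= in_itv /= ltrBlDr ltrDl ltr01.
pose G (y : pt R) := (`|r| * (K + K)) * `|f y|.
have Gi : mu3.-integrable setT (EFin \o G) by apply: integrableZ_R => //; exact: integrable_norm.
have G0 y : 0 <= G y by rewrite /G !mulr_ge0 // addr_ge0.
have H3 (t1 : R) y : `]t - 1, t + 1[%classic t1 -> setT y -> `|partial1of2 F t1 y| <= G y.
  move=> _ _; rewrite /partial1of2 (der_derive1 (d t1 y)) /G normrM mulrC ler_wpM2r // normrM ler_wpM2l //.
  apply: (le_trans (ler_normD _ _)); apply: lerD; rewrite normrM.
    rewrite normrN -[X in _ <= X]mul1r; apply: ler_pM => //.
    by rewrite ler_norml sin_geN1 sin_le1.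
  rewrite -[X in _ <= X]mul1r; apply: ler_pM => //.
  by rewrite ler_norml cos_geN1 cos_le1.
have H2 (t1 : R) y : `]t - 1, t + 1[%classic t1 -> setT y -> derivable (F ^~ y) t1 1.
  by move=> _ _; have [] := d t1 y.
have H1 (t1 : R) : `]t - 1, t + 1[%classic t1 -> mu3.-integrable setT (EFin \o F t1).
  by move=> _; exact: mol_integrable.
have D1 := @derivable_under_integral R _ _ mu3 F setT measurableT t (t - 1) (t + 1) ti H1 H2 G G0 Gi H3.
have D2 := @differentiation_under_integral R _ _ mu3 F setT measurableT t (t - 1) (t + 1) ti H1 H2 G G0 Gi H3.
apply: (derE (derivable_der D1)); rewrite D2.
have i0 := dmol_integrable (circ x r t) 0 fi; have i1 := dmol_integrable (circ x r t) 1 fi.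
transitivity (\int[mu3]_y (r * (- sin t) * (f y * drho h 0 (circ x r t - y)) + r * cos t * (f y * drho h 1 (circ x r t - y)))).
  apply: eq_Rintegral => y _; rewrite /partial1of2 (der_derive1 (d t y)); ring.
rewrite RintegralD //; [|exact: integrableZ_R|exact: integrableZ_R].
rewrite !RintegralZl // /dmol; ring.
Qed.

End fixed_h.
End Mollification.

(** * Integrals over compact intervals *)

Section Calculus.
Context {R : realType}.
Notation mu1 := (@lebesgue_measure R).
Implicit Types (f g F : R -> R) (a b c : R).

(** An integral over the set [[a, b]], hence 0, and not minus the reversed integral, when
    [b < a]. *)
Definition Int a b f : R := \int[mu1]_(x in `[a, b]) f x.

Lemma itv_lty a b : (mu1 `[a, b]%classic < +oo)%E.
Proof. by rewrite lebesgue_measure_itv /= lte_fin; case: ifP => _; rewrite ?ltry. Qed.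

Lemma bounded_itv_integrable a b f (M : R) : measurable_fun setT f -> (forall x, `|f x| <= M) ->
  mu1.-integrable `[a, b] (EFin \o f).
Proof.
move=> mf fM; apply: measurable_bounded_integrable => //; first exact: itv_lty.
  exact: measurable_funTS.
by exists M; split; [exact: num_real|move=> y My x _ /=; rewrite (le_trans (fM x)) // ltW].
Qed.

Lemma cont_itv_integrable a b f : continuous f -> mu1.-integrable `[a, b] (EFin \o f).
Proof.
move=> cf; apply: continuous_compact_integrable; first exact: segment_compact.
exact: continuous_subspaceT.
Qed.

Lemma Int_FTC a b f F : a <= b -> continuous f -> (forall x : R, is_derive x 1 F (f x)) ->
  Int a b f = F b - F a.
Proof.
move=> ab cf dF; have [ab'|] := ltP a b; last first.
  move=> ba; have -> : b = a by apply/eqP; rewrite eq_le ab ba.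
  by rewrite subrr /Int set_itv1 Rintegral_set1.
rewrite /Int /Rintegral (@continuous_FTC2 R f F a b ab') //.
- exact: continuous_subspaceT.
- split.
  + by move=> x _; have [] := dF x.
  + by apply: cvg_at_right_filter; exact: der_continuous (dF a).
  + by apply: cvg_at_left_filter; exact: der_continuous (dF b).
- by move=> x _; exact: der_derive1 (dF x).
Qed.

Lemma primitive f : continuous f -> exists F, F 0 = 0 /\ forall x : R, is_derive x 1 F (f x).
Proof.
move=> cf.
(* At most one of the two intervals has positive length, so this is the oriented integral from 0 on
   either side. *)
exists (fun x => Int 0 x f - Int x 0 f); split; first by rewrite subrr.
move=> x; pose D := `|x| + 1.
have D0 : 0 < D by rewrite ltr_wpDl.
have xD : - D < x < D by rewrite -ltr_norml ltrDl.
have xD1 : x < D by case/andP: xD.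
have Dx1 : - D < x by case/andP: xD.
have fi : mu1.-integrable [set` Interval (BLeft (- D)) (BRight D)] (EFin \o f) by exact: cont_itv_integrable.
have [d1 d2] := @continuous_FTC1 R f (BLeft (- D)) x D xD1 fi Dx1 (cf x).
have DF := derivable_der d1; rewrite d2 in DF.
have E : \near x, Int (- D) x f - Int (- D) 0 f = Int 0 x f - Int x 0 f.
  near=> y.
  have yD : - D < y by near: y; exact: lt_nbhsr.
  have Dy : y < D by near: y; exact: lt_nbhsl.
  have fi2 c : mu1.-integrable [set` Interval (BLeft (- D)) (BRight c)] (EFin \o f) by exact: cont_itv_integrable.
  have e0 c d : d < c -> Int c d f = 0.
    by move=> dc; rewrite /Int set_itv_ge ?Rintegral_set0 // bnd_simp -ltNge.
  have e1 c d : - D <= c -> c <= d -> Int (- D) d f - Int (- D) c f = Int c d f.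
    move=> h1 h2; rewrite /Int (@Rintegral_itvB R f (BLeft (- D)) (BRight d) c (fi2 d)) //.
    by rewrite Rintegral_itv_obnd_cbnd //; apply: integrableS (cont_itv_integrable c d cf) => //; exact: subset_itv_oc_cc.
  have [y0|y0] := leP 0 y.
    rewrite e1 // ?oppr_le0 ?(ltW D0) //.
    have [->|yn] := eqVneq y 0; last by rewrite (e0 y 0) ?subr0 // lt_neqAle eq_sym yn.
    by rewrite /Int set_itv1 Rintegral_set1 subr0.
  by rewrite (e0 0 y y0) sub0r -(e1 y 0 (ltW yD) (ltW y0)) opprB.
apply: (der_near E).
by apply: (derE (derB DF (derC x (Int (- D) 0 f)))); rewrite subr0.
Unshelve. all: by end_near. Qed.

Lemma derivative0_cst f : (forall x : R, is_derive x 1 f 0) -> forall x y, f x = f y.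
Proof.
move=> df.
have H x y : x <= y -> f x = f y.
  move=> xy; have [z _ E] := @MVT_segment R f (fun=> 0) x y xy (fun t _ => df t)
    (continuous_subspaceT (fun t => der_continuous (df t))).
  by apply/eqP; rewrite eq_sym -subr_eq0 E mul0r.
by move=> x y; have [/H|/ltW/H] := leP x y.
Qed.

(** As a function of [c], the integral over a period starting at [c] has derivative
    [f (c + T) - f c = 0]. *)
Lemma Int_periodic f (T : R) c : 0 <= T -> continuous f -> (forall x, f (x + T) = f x) ->
  Int 0 T (fun x => f (x + c)) = Int 0 T f.
Proof.
move=> T0 cf pf; have [F [F0 dF]] := primitive cf.
rewrite (Int_FTC T0 cf dF).
have sh (u v : R) : is_derive v 1 (fun x => F (x + u)) (f (v + u)).
  apply: (derE (der_comp (derD (derI v) (derC v u)) (dF (v + u)))); by rewrite addr0 mulr1.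
have cfc : continuous (fun x => f (x + c)).
  move=> x; apply: (cvg_comp (fun x => x + c) f); last exact: cf.
  by apply: cvgD; [exact: cvg_id|exact: cvg_cst].
rewrite (Int_FTC T0 cfc (sh c)).
have D (x : R) : is_derive x 1 (fun c => F (c + T) - F c) 0.
  by apply: (derE (derB (sh T x) (dF x))); rewrite pf subrr.
by have E := derivative0_cst D c 0; rewrite /= add0r in E; rewrite add0r (addrC T c) E.
Qed.

Lemma Int_double f c : 0 <= c -> continuous f -> Int 0 (2 * c) f = 2 * Int 0 c (fun x => f (2 * x)).
Proof.
move=> c0 cf; have [F [F0 dF]] := primitive cf.
have c20 : 0 <= 2 * c by rewrite mulr_ge0.
rewrite (Int_FTC c20 cf dF).
have cf2 : continuous (fun x : R => f (2 * x)).
  move=> x; apply: (cvg_comp (fun x => 2 * x) f); last exact: cf.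
  by apply: cvgM; [exact: cvg_cst|exact: cvg_id].
have d2 (x : R) : is_derive x 1 (fun x => 2^-1 * F (2 * x)) (f (2 * x)).
  apply: (derE (derZ 2^-1 (der_comp (derZ 2 (derI x)) (dF (2 * x))))); lra.
rewrite (Int_FTC c0 cf2 d2) mulr0 F0; lra.
Qed.

Lemma Int_le a b f g : continuous f -> continuous g -> (forall x, a <= x <= b -> f x <= g x) ->
  Int a b f <= Int a b g.
Proof.
move=> cf cg H; apply: le_Rintegral => //; exact: cont_itv_integrable.
Qed.

Lemma Int_cst a b c : a <= b -> Int a b (fun=> c) = c * (b - a).
Proof.
move=> ab.
have cc : continuous (fun _ : R => c) by move=> x; exact: cvg_cst.
have dc (x : R) : is_derive x 1 (fun x => c * x) c by apply: (derE (derZ c (derI x))); rewrite mulr1.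
by rewrite (Int_FTC ab cc dc) mulrBr.
Qed.

Lemma eq_Int a b f g : (forall x, a <= x <= b -> f x = g x) -> Int a b f = Int a b g.
Proof. by move=> H; apply: eq_Rintegral => x; rewrite inE /= in_itv /=; exact: H. Qed.

Lemma IntD a b f g : continuous f -> continuous g ->
  Int a b (fun x => f x + g x) = Int a b f + Int a b g.
Proof. by move=> cf cg; rewrite /Int RintegralD //; exact: cont_itv_integrable. Qed.

Lemma IntZ a b c f : continuous f -> Int a b (fun x => c * f x) = c * Int a b f.
Proof. by move=> cf; rewrite /Int RintegralZl //; exact: cont_itv_integrable. Qed.

Lemma Int_norm_le a b f (M : R) : a <= b -> continuous f -> (forall x, `|f x| <= M) ->
  `|Int a b f| <= M * (b - a).
Proof.
move=> ab cf fM.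
have cc (c : R) : continuous (fun _ : R => c) by move=> x; exact: cvg_cst.
have fM2 x : - M <= f x <= M by rewrite -ler_norml.
rewrite ler_norml -mulNr -(Int_cst M ab) -(Int_cst (- M) ab); apply/andP; split; apply: Int_le => // x _.
  by have /andP[] := fM2 x.
by have /andP[] := fM2 x.
Qed.

Lemma Rintegral_swap d1 d2 (T1 : measurableType d1) (T2 : measurableType d2)
  (m1 : {sigma_finite_measure set T1 -> \bar R}) (m2 : {sigma_finite_measure set T2 -> \bar R})
  (g : T1 * T2 -> R) : (prod_sfm m1 m2).-integrable setT (EFin \o g) ->
  (forall x, m2.-integrable setT (fun y => (g (x, y))%:E)) ->
  (forall y, m1.-integrable setT (fun x => (g (x, y))%:E)) ->
  \int[m1]_x \int[m2]_y g (x, y) = \int[m2]_y \int[m1]_x g (x, y).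
Proof.
move=> gi g1 g2.
have := @Fubini _ _ T1 T2 R m1 m2 (EFin \o g) gi.
rewrite {2 4}/Rintegral => E; congr fine.
transitivity (\int[m1]_x \int[m2]_y (g (x, y))%:E)%E.
  by apply: eq_integral => x _; rewrite (EFin_Rintegral measurableT (g1 x)).
rewrite E; apply: eq_integral => y _; by rewrite (EFin_Rintegral measurableT (g2 y)).
Qed.

(** The Caratheodory criterion turns separate continuity into joint measurability, and the bound
    gives integrability on the rectangle. *)
Lemma Int_swap a b c d (g : R -> R -> R) (M : R) :
  (forall x, continuous (g x)) -> (forall y, continuous (g ^~ y)) -> (forall x y, `|g x y| <= M) ->
  Int a b (fun x => Int c d (g x)) = Int c d (fun y => Int a b (g ^~ y)).
Proof.
move=> c1 c2 gM.
pose A : set R := `[a, b]%classic; pose B : set R := `[c, d]%classic.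
pose k (z : R * R) := g z.1 z.2 * (\1_A z.1 * \1_B z.2).
have mA : measurable A by exact: measurable_itv.
have mB : measurable B by exact: measurable_itv.
have mk : measurable_fun setT k.
  apply: measurable_funM.
    apply: (@measurable_caratheodory R _ (measurableTypeR R) g) => // y.
    exact: continuous_measurable_fun.
  apply: measurable_funM.
    exact: (measurableT_comp (measurable_indic mA) measurable_fst).
  exact: (measurableT_comp (measurable_indic mB) measurable_snd).
have M0 : 0 <= M by exact: le_trans (gM 0 0).
have i01 (D : set R) (x : R) : 0 <= (\1_D x : R) <= 1 by rewrite indicE; case: (x \in D); rewrite ?lexx ?ler01.
have kM z : `|k z| <= M.
  rewrite /k normrM; have /andP[h1 h2] := i01 A z.1; have /andP[h3 h4] := i01 B z.2.
  rewrite (ger0_norm (mulr_ge0 h1 h3)); apply: le_trans (gM z.1 z.2).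
  by apply: ler_piMr => //; exact: mulr_ile1.
have kE : k = k \_ (A `*` B).
  apply/funext => z; rewrite patchE; case: ifPn => //; rewrite notin_setE => nz.
  rewrite /k !indicE; case: (boolP (z.1 \in A)) => [zA|_]; last by rewrite mul0r mulr0.
  case: (boolP (z.2 \in B)) => [zB|_]; last by rewrite mulr0 mulr0.
  by exfalso; apply: nz; split; apply: set_mem.
have ki : (prod_sfm mu1 mu1).-integrable setT (EFin \o k).
  rewrite kE -restrict_EFin; apply/integrable_restrict => //; first exact: measurableX.
  rewrite setTI; apply: measurable_bounded_integrable.
  - exact: measurableX.
  - rewrite [ltLHS](prod_sfm_setX mu1 mu1 mA mB) lte_mul_pinfty //; last exact: itv_lty.
    by rewrite ge0_fin_numE ?itv_lty.
  - exact: measurable_funTS.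
  - by exists M; split; [exact: num_real|move=> y My x _ /=; rewrite (le_trans (kM x)) // ltW].
have Er (D : set R) (u : R -> R) (w : R) : (fun y => u y * (w * \1_D y)) = (fun y => w * u y) \_ D.
  by apply/funext => y; rewrite patchE indicE; case: ifP => _; rewrite ?mulr1 ?mulr0 // mulrC.
have Er2 (D : set R) (u : R -> R) (w : R) : (fun y => u y * (\1_D y * w)) = (fun y => w * u y) \_ D.
  by apply/funext => y; rewrite patchE indicE; case: ifP => _; rewrite ?mul1r ?mul0r ?mulr0 // mulrC.
have ci (u : R -> R) (w p q : R) : continuous u -> mu1.-integrable `[p, q] (EFin \o (fun y => w * u y)).
  by move=> cu; apply: integrableZ_R => //; exact: cont_itv_integrable.
have k1 x : mu1.-integrable setT (fun y => (k (x, y))%:E).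
  rewrite (_ : (fun y => (k (x, y))%:E) = EFin \o ((fun y => \1_A x * g x y) \_ B)); last first.
    by rewrite -Er.
  by rewrite -restrict_EFin; apply/integrable_restrict => //; rewrite setTI; exact: ci.
have k2 y : mu1.-integrable setT (fun x => (k (x, y))%:E).
  rewrite (_ : (fun x => (k (x, y))%:E) = EFin \o ((fun x => \1_B y * g x y) \_ A)); last first.
    by rewrite -Er2.
  by rewrite -restrict_EFin; apply/integrable_restrict => //; rewrite setTI; exact: ci.
have := @Rintegral_swap _ _ _ _ mu1 mu1 k ki k1 k2.
have -> : \int[mu1]_x \int[mu1]_y k (x, y) = Int a b (fun x => Int c d (g x)).
  rewrite [RHS]Rintegral_mkcond; apply: eq_Rintegral => x _; rewrite patchE.
  transitivity (\int[mu1]_(y in B) (\1_A x * g x y)).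
    rewrite [RHS]Rintegral_mkcond; apply: eq_Rintegral => z _.
    by have /= <- := congr1 (@^~ z) (Er B (g x) (\1_A x)).
  rewrite RintegralZl //; last exact: cont_itv_integrable.
  by rewrite indicE /Int; case: ifP; rewrite ?mul1r ?mul0r.
have -> // : \int[mu1]_y \int[mu1]_x k (x, y) = Int c d (fun y => Int a b (g ^~ y)).
rewrite [RHS]Rintegral_mkcond; apply: eq_Rintegral => y _; rewrite patchE.
transitivity (\int[mu1]_(x in A) (\1_B y * g x y)).
  rewrite [RHS]Rintegral_mkcond; apply: eq_Rintegral => z _.
  by have /= <- := congr1 (@^~ z) (Er2 A (g ^~ y) (\1_B y)).
rewrite RintegralZl //; last exact: cont_itv_integrable.
by rewrite indicE /Int; case: ifP; rewrite ?mul1r ?mul0r.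
Qed.

Lemma Int_continuous a b (g : R -> R -> R) (M : R) :
  (forall x, continuous (g x)) -> (forall y, continuous (g ^~ y)) -> (forall x y, `|g x y| <= M) ->
  continuous (fun x => Int a b (g x)).
Proof.
move=> c1 c2 gM x.
have xi : x \in `]x - 1, x + 1[ by rewrite in_itv /= ltrBlDr ltrDl ltr01.
apply: (@continuity_under_integral R _ _ mu1 g `[a, b] _ (x - 1) (x + 1) _ _ (fun=> M)) => //.
- by move=> t _; exact: cont_itv_integrable.
- by apply: aeW => y _ t _; exact: c2.
- by apply: cont_itv_integrable => t; exact: cvg_cst.
- by move=> t _; apply: aeW.
- by rewrite inE.
Qed.

Lemma Int_derive a b (g g' : R -> R -> R) (M : R) (t e : R) : 0 < e ->
  (forall x, continuous (g x)) ->
  (forall x y, t - e < x < t + e -> is_derive x 1 (g ^~ y) (g' x y)) ->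
  (forall x y, t - e < x < t + e -> `|g' x y| <= M) ->
  is_derive t 1 (fun x => Int a b (g x)) (Int a b (g' t)).
Proof.
move=> e0 c1 d gM.
have ti : (`]t - e, t + e[%classic : set R) t by rewrite /= in_itv /= ltrBlDr ltrDl e0.
have tt : t - e < t < t + e by rewrite ltrBlDr ltrDl e0.
have M0 : 0 <= M by apply: (le_trans _ (gM t 0 tt)).
have Gi : mu1.-integrable `[a, b] (EFin \o (fun _ : R => M)) by apply: cont_itv_integrable => y; exact: cvg_cst.
have H1 (x : R) : `]t - e, t + e[%classic x -> mu1.-integrable `[a, b] (EFin \o g x).
  by move=> _; exact: cont_itv_integrable.
have H2 (x : R) y : `]t - e, t + e[%classic x -> `[a, b]%classic y -> derivable (g ^~ y) x 1.
  by rewrite /= in_itv /= => xI _; have [] := d x y xI.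
have H3 (x : R) y : `]t - e, t + e[%classic x -> `[a, b]%classic y -> `|partial1of2 g x y| <= M.
  by rewrite /= in_itv /= => xI _; rewrite /partial1of2 (der_derive1 (d x y xI)); exact: gM.
have mI : measurable (`[a, b]%classic : set R) by exact: measurable_itv.
have D1 := @derivable_under_integral R _ _ mu1 g `[a, b] mI t (t - e) (t + e) ti H1 H2 (fun=> M) (fun=> M0) Gi H3.
have D2 := @differentiation_under_integral R _ _ mu1 g `[a, b] mI t (t - e) (t + e) ti H1 H2 (fun=> M) (fun=> M0) Gi H3.
apply: (derE (derivable_der D1)); rewrite D2.
by apply: eq_Rintegral => y _; exact: der_derive1 (d t y tt).
Qed.

End Calculus.

(** * Autocorrelations *)

Section Correlation.
Context {R : realType}.
Notation mu1 := (@lebesgue_measure R).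
Notation mu3 := (vol R).

(** The class of the truncated currents and energy densities: cut off sharply at the boundary of a
    cube, they are bounded and measurable but jump there. *)
Definition bsupp (a M : R) (f : pt R -> R) : Prop :=
  [/\ measurable_fun setT f, forall x, `|f x| <= M & forall x, ~ box a a a x -> f x = 0].

Lemma bsupp_integrable a M f : bsupp a M f -> mu3.-integrable setT (EFin \o f).
Proof. by move=> [mf fM f0]; exact: (box_integrable mf fM f0). Qed.

Lemma bsupp_mul_integrable a M f (g : pt R -> R) (N : R) : bsupp a M f -> measurable_fun setT g ->
  (forall x, `|g x| <= N) -> mu3.-integrable setT (EFin \o (fun x => f x * g x)).
Proof. by move=> bf mg gN; exact: (bounded_mul_integrable (bsupp_integrable bf) mg gN). Qed.

Lemma bsupp_shift_measurable a M f h : bsupp a M f -> measurable_fun setT (fun x : pt R => f (x + h)).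
Proof. by move=> [mf _ _]; exact: mcomp_pt mf (measurable_shiftpt h). Qed.

Definition corr (f g : pt R -> R) (h : pt R) : R := \int[mu3]_x (f (x + h) * g x).

Lemma corr_integrable a M f g h : bsupp a M f -> bsupp a M g ->
  mu3.-integrable setT (EFin \o (fun x => f (x + h) * g x)).
Proof.
move=> bf bg; have := bsupp_mul_integrable bg (bsupp_shift_measurable h bf) (fun x => let: And3 _ fM _ := bf in fM (x + h)).
by apply: eq_integrable => // x _ /=; rewrite mulrC.
Qed.

Lemma corr_opp a M f g h : bsupp a M f -> bsupp a M g -> corr f g (- h) = corr g f h.
Proof.
move=> bf bg; rewrite /corr -(Rintegral_shift h (corr_integrable (- h) bf bg)).
by apply: eq_Rintegral => x _; rewrite addrK mulrC.
Qed.

Lemma corr_diff a M f g h k : bsupp a M f -> bsupp a M g ->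
  `|corr f g h - corr f g k| <= M * \int[mu3]_x `|f (x + (h - k)) - f x|.
Proof.
move=> bf bg; have [mf fM f0] := bf; have [mg gM g0] := bg.
rewrite /corr -RintegralB //; [|exact: corr_integrable bf bg|exact: corr_integrable bf bg].
have ii := integrableB_R measurableT (corr_integrable h bf bg) (corr_integrable k bf bg).
apply: (le_trans (le_normr_Rintegral measurableT ii)).
have fi := bsupp_integrable bf.
have di u : mu3.-integrable setT (EFin \o (fun x : pt R => `|f (x + u) - f x|)).
  by apply: integrable_norm; apply: integrableB_R => //; exact: integrable_shift u _ fi.
have -> : \int[mu3]_x `|f (x + (h - k)) - f x| = \int[mu3]_x `|f (x + h) - f (x + k)|.
  rewrite -(Rintegral_shift k (di (h - k))).
  by apply: eq_Rintegral => x _; rewrite -addrA (addrCA k) subrr addr0.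
have dk : mu3.-integrable setT (EFin \o (fun x : pt R => `|f (x + h) - f (x + k)|)).
  by apply: integrable_norm; apply: integrableB_R => //; [exact: integrable_shift h _ fi|exact: integrable_shift k _ fi].
rewrite -RintegralZl //; apply: le_Rintegral => //.
- exact: integrable_norm.
- exact: integrableZ_R.
- by move=> x _; rewrite -mulrBl normrM mulrC ler_wpM2r.
Qed.

(** Translations are continuous in [L^1] and the other factor is bounded, so the jump of the
    functions at the edge of their support does no harm. *)
Lemma corr_continuous a M f g : bsupp a M f -> bsupp a M g ->
  forall e, 0 < e -> exists2 d, 0 < d & forall h k : pt R,
    `|h.1.1 - k.1.1| <= d -> `|h.1.2 - k.1.2| <= d -> `|h.2 - k.2| <= d ->
    `|corr f g h - corr f g k| <= e.
Proof.
move=> bf bg e e0; have [mf fM f0] := bf; have fi := bsupp_integrable bf.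
have M0 : 0 <= M by apply: le_trans (fM 0).
have e1 : 0 < e / (M + 1) by rewrite divr_gt0 // ltr_wpDl.
have [d d0 Hd] := L1_continuous_vol fi e1.
exists d => // h k h1 h2 h3; apply: (le_trans (corr_diff h k bf bg)).
have := Hd (h - k) h1 h2 h3.
have di : mu3.-integrable setT (EFin \o (fun x : pt R => `|f (x + (h - k)) - f x|)).
  by apply: integrable_norm; apply: integrableB_R => //; exact: integrable_shift (h - k) _ fi.
rewrite -(EFin_Rintegral measurableT di) lee_fin => H.
apply: (@le_trans _ _ (M * (e / (M + 1)))); first by rewrite ler_wpM2l.
rewrite mulrCA ler_piMr ?(ltW e0) // ler_pdivrMr ?ltr_wpDl // mul1r lerDl ler01 //.
Qed.

Lemma corr_self_le a M f h : bsupp a M f -> corr f f h <= \int[mu3]_x (f x ^+ 2).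
Proof.
move=> bf; have fi := bsupp_integrable bf; have [mf fM f0] := bf.
have f2 : mu3.-integrable setT (EFin \o (fun x => f x ^+ 2)).
  by have := bsupp_mul_integrable bf mf fM; apply: eq_integrable => // x _ /=; rewrite expr2.
have f2h : mu3.-integrable setT (EFin \o (fun x : pt R => f (x + h) ^+ 2)).
  exact: integrable_shift h _ f2.
have -> : \int[mu3]_x (f x ^+ 2) = \int[mu3]_x (2^-1 * f (x + h) ^+ 2 + 2^-1 * f x ^+ 2).
  rewrite RintegralD //; [|exact: integrableZ_R|exact: integrableZ_R].
  rewrite !RintegralZl // (@Rintegral_shift _ h (fun x => f x ^+ 2)) //; lra.
apply: le_Rintegral => //; first exact: (corr_integrable h bf bf).
  by apply: integrableD_R => //; exact: integrableZ_R.
by move=> x _; have := sqr_ge0 (f (x + h) - f x); nra.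
Qed.

Lemma corr_far a M f g (h : pt R) : bsupp a M f -> bsupp a M g ->
  2 * a <= `|h.1.1| \/ 2 * a <= `|h.1.2| -> corr f g h = 0.
Proof.
move=> [_ _ f0] [_ _ g0] hh; rewrite /corr.
transitivity (\int[mu3]_x (0 : R)); last by rewrite Rintegral_cst // mul0r.
apply: eq_Rintegral => x _.
have [bx|nx] := pselect (box a a a x); last by rewrite g0 ?mulr0.
rewrite f0 ?mul0r // => -[/= b1 [b2 b3]]; case: bx => c1 [c2 c3].
have t (u v : R) : `|v| <= `|u + v| + `|u|.
  by rewrite -{1}(addrK u v) (addrC v); exact: ler_normB.
case: hh => hh; [have := t x.1.1 h.1.1|have := t x.1.2 h.1.2].
  by move: (h.1.1) (x.1.1) hh b1 c1 => u v hh b1 c1; lra.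
by move: (h.1.2) (x.1.2) hh b2 c2 => u v hh b2 c2; lra.
Qed.

Definition vecpt (u v : R) : pt R := ((u, v), 0).

Lemma circE x r t : circ x r t = x + vecpt (r * cos t) (r * sin t).
Proof. by case: x => [[x1 x2] x3]; rewrite /circ /vecpt -[RHS]/((x1 + _, x2 + _), x3 + 0) addr0. Qed.

Lemma corr_circ a M f g r t s : bsupp a M f -> bsupp a M g ->
  \int[mu3]_x (f (circ x r t) * g (circ x r s)) =
  corr f g (vecpt (r * (cos t - cos s)) (r * (sin t - sin s))).
Proof.
move=> bf bg.
rewrite -[RHS](Rintegral_shift (vecpt (r * cos s) (r * sin s)) (corr_integrable _ bf bg)).
apply: eq_Rintegral => x _; rewrite !circE; congr (f _ * g _).
rewrite -addrA; congr (_ + _).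
by rewrite /vecpt -[RHS]/((_ + _, _ + _), 0 + 0) /= !mulrBr !(addrC _ (_ - _)) !subrK addr0.
Qed.

Lemma continuous_vecpt a M f g (u v : R -> R) : bsupp a M f -> bsupp a M g ->
  continuous u -> continuous v -> continuous (fun t => corr f g (vecpt (u t) (v t))).
Proof.
move=> bf bg cu cv t; apply/cvgrPdist_le => e e0.
have [d d0 Hd] := corr_continuous bf bg e0.
have /cvgrPdist_le /(_ d d0) n1 := cu t.
have /cvgrPdist_le /(_ d d0) n2 := cv t.
near=> s; apply: Hd; rewrite /= ?subrr ?normr0 ?(ltW d0) //; near: s; [exact: n1|exact: n2].
Unshelve. all: by end_near. Qed.

Lemma corr_bound a M f g : bsupp a M f -> bsupp a M g ->
  exists2 B, 0 <= B & forall h, `|corr f g h| <= B.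
Proof.
move=> bf bg; have gi := bsupp_integrable bg; have [mf fM f0] := bf.
have M0 : 0 <= M by apply: le_trans (fM 0).
exists (M * \int[mu3]_x `|g x|) => [|h]; first by rewrite mulr_ge0 // Rintegral_ge0.
have ii := corr_integrable h bf bg.
apply: (le_trans (le_normr_Rintegral measurableT ii)).
rewrite -RintegralZl //; last exact: integrable_norm.
apply: le_Rintegral => //; first exact: integrable_norm.
  by apply: integrableZ_R => //; exact: integrable_norm.
by move=> x _; rewrite normrM ler_wpM2r.
Qed.

Lemma swap_box (b N T : R) (g : pt R * R -> R) : 0 <= T -> measurable_fun setT g ->
  (forall z, `|g z| <= N) -> (forall z, ~ box b b b z.1 -> g z = 0) ->
  \int[mu3]_x Int 0 T (fun t => g (x, t)) = Int 0 T (fun t => \int[mu3]_x g (x, t)).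
Proof.
move=> T0 mg gN g0.
pose A : set R := `[0, T]%classic.
have mA : measurable A by exact: measurable_itv.
pose k (z : pt R * R) := g z * \1_A z.2.
have i01 (x : R) : 0 <= (\1_A x : R) <= 1 by rewrite indicE; case: (x \in A); rewrite ?lexx ?ler01.
have mk : measurable_fun setT k.
  apply: measurable_funM => //.
  exact: (measurableT_comp (measurable_indic mA) measurable_snd).
have kN z : `|k z| <= N.
  rewrite /k normrM; have /andP[h1 h2] := i01 z.2.
  by rewrite (ger0_norm h1); apply: le_trans (gN z); exact: ler_piMr.
pose c := Num.max 1 b.
have c0 : 0 < c by rewrite lt_max ltr01.
have g0c z : ~ box c c c z.1 -> g z = 0.
  by move=> nz; apply: g0; apply: contra_not nz => -[b1 [b2 b3]]; split; [|split]; rewrite lt_max ?b1 ?b2 ?b3 orbT.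
have mB : measurable (box c c c : set (pt R)) by exact: measurable_box.
have kE : k = k \_ (box c c c `*` A).
  apply/funext => z; rewrite patchE; case: ifPn => //; rewrite notin_setE => nz.
  rewrite /k indicE; case: (boolP (z.2 \in A)) => [zA|_]; last by rewrite mulr0.
  by rewrite g0c ?mul0r // => bz; apply: nz; split => //; exact: set_mem.
have ki : (prod_sfm mu3 mu1).-integrable setT (EFin \o k).
  rewrite kE -restrict_EFin; apply/integrable_restrict => //; first exact: measurableX.
  rewrite setTI; apply: measurable_bounded_integrable.
  - exact: measurableX.
  - rewrite [ltLHS](prod_sfm_setX mu3 mu1 mB mA) lte_mul_pinfty //; last exact: itv_lty.
    by rewrite [X in X \is a fin_num](vol_box c0 c0 c0).
  - exact: measurable_funTS.
  - by exists N; split; [exact: num_real|move=> y My x _ /=; rewrite (le_trans (kN x)) // ltW].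
have mg1 (x : pt R) : measurable_fun setT (fun t => g (x, t)).
  exact: (measurableT_comp mg (pair1_measurable x)).
have mg2 (t : R) : measurable_fun setT (fun x => g (x, t)).
  exact: (measurableT_comp mg (pair2_measurable t)).
have Er (u : R -> R) : (fun y => u y * \1_A y) = u \_ A.
  by apply/funext => y; rewrite patchE indicE; case: ifP => _; rewrite ?mulr1 ?mulr0.
have k1 x : mu1.-integrable setT (fun y => (k (x, y))%:E).
  rewrite (_ : (fun y => (k (x, y))%:E) = EFin \o ((fun y => g (x, y)) \_ A)); last by rewrite -Er.
  by rewrite -restrict_EFin; apply/integrable_restrict => //; rewrite setTI; exact: (bounded_itv_integrable 0 T (mg1 x) (fun y => gN (x, y))).
have gi y : mu3.-integrable setT (EFin \o (fun x => g (x, y))).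
  by apply: (@box_integrable _ _ b b b N) => // x nx; exact: g0.
have k2 y : mu3.-integrable setT (fun x => (k (x, y))%:E).
  rewrite (_ : (fun x => (k (x, y))%:E) = EFin \o (fun x => \1_A y * g (x, y))).
    exact: integrableZ_R.
  by apply/funext => x /=; rewrite mulrC.
have := @Rintegral_swap R _ _ _ _ mu3 mu1 k ki k1 k2.
have -> : \int[mu3]_x \int[mu1]_y k (x, y) = \int[mu3]_x Int 0 T (fun t => g (x, t)).
  apply: eq_Rintegral => x _; rewrite /Int [RHS]Rintegral_mkcond; apply: eq_Rintegral => y _.
  by have /= <- := congr1 (@^~ y) (Er (fun y => g (x, y))).
move=> ->; rewrite /Int [RHS]Rintegral_mkcond; apply: eq_Rintegral => y _.
rewrite patchE -/A; transitivity (\1_A y * \int[mu3]_x g (x, y)).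
  by rewrite -RintegralZl //; apply: eq_Rintegral => x _; rewrite mulrC.
by rewrite indicE; case: ifP; rewrite ?mul1r ?mul0r.
Qed.

(** The square of a circle integral is a double integral over two angles; integrating over all
    centres then produces correlations. *)
Lemma square_fubini (b N T : R) (u : R -> pt R -> R) : 0 <= T ->
  measurable_fun setT (fun z : pt R * R => u z.2 z.1) ->
  (forall t x, `|u t x| <= N) -> (forall t x, ~ box b b b x -> u t x = 0) ->
  [/\ measurable_fun setT (fun x => Int 0 T (u ^~ x)),
     forall x, `|Int 0 T (u ^~ x)| <= N * T,
     forall x, ~ box b b b x -> Int 0 T (u ^~ x) = 0 &
  \int[mu3]_x (Int 0 T (u ^~ x)) ^+ 2 = Int 0 T (fun t => Int 0 T (fun s => \int[mu3]_x (u t x * u s x)))].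
Proof.
move=> T0 mu uN u0; have N0 : 0 <= N by apply: le_trans (uN 0 0).
have mu1x x : measurable_fun setT (u ^~ x) by exact: (measurableT_comp mu (pair1_measurable x)).
have ui x : mu1.-integrable `[0, T] (EFin \o u ^~ x) by exact: bounded_itv_integrable (mu1x x) (uN ^~ x).
set A := fun x => Int 0 T (u ^~ x).
have AN x : `|A x| <= N * T.
  apply: (le_trans (le_normr_Rintegral _ (ui x))) => //.
  have <- : Int 0 T (fun=> N) = N * T by rewrite Int_cst // subr0.
  apply: le_Rintegral => //; first exact: integrable_norm.
  by apply: cont_itv_integrable => y; exact: cvg_cst.
have A0 x : ~ box b b b x -> A x = 0.
  move=> nx; rewrite /A (@eq_Int _ _ _ _ (fun=> 0)) ?Int_cst ?mul0r // => t _.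
  exact: u0.
have mA : measurable_fun setT A.
  pose I : set R := `[0, T]%classic.
  have mI : measurable I by exact: measurable_itv.
  (* Tonelli gives measurability of parameter integrals for nonnegative integrands; [s = 1] and
     [s = -1] select the positive and the negative part of [u]. *)
  pose k (s : R) (z : pt R * R) := (Num.max 0 (s * u z.2 z.1) * \1_I z.2)%:E.
  have mk s : measurable_fun setT (k s).
    apply/measurable_EFinP; apply: measurable_funM.
      by apply: measurable_maxr => //; exact: measurable_funM.
    exact: (measurableT_comp (measurable_indic mI) measurable_snd).
  have k0 s z : (0 <= k s z)%E by rewrite lee_fin mulr_ge0 ?le_max ?lexx // indicE ler0n.
  have mF s : measurable_fun setT (fun x : pt R => (\int[mu1]_t k s (x, t))%E).
    by have := @measurable_fun_fubini_tonelli_F _ _ _ _ R mu1 (k s) (mk s) (k0 s).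
  have mFr s : measurable_fun setT (fun x : pt R => Int 0 T (fun t => Num.max 0 (s * u t x))).
    have := measurableT_comp (fine_measurable measurableT) (mF s).
    apply: eq_measurable_fun => x _ /=; rewrite /Int [RHS]Rintegral_mkcond /Rintegral; congr fine.
    apply: eq_integral => t _; rewrite /k /= patchE indicE -/I.
    by case: ifP => _; rewrite ?mulr1 ?mulr0.
  apply: (eq_measurable_fun (fun x => Int 0 T (fun t => Num.max 0 (1 * u t x)) - Int 0 T (fun t => Num.max 0 (-1 * u t x)))).
    move=> x _; rewrite /A /Int -RintegralB //.
    - apply: eq_Rintegral => t _; rewrite mul1r mulN1r.
      by have [h|h] := leP 0 (u t x); rewrite /Num.max ?oppr_gt0 ?oppr_lt0 /=; case: ltP; case: ltP; lra.
    - apply: (@bounded_itv_integrable _ 0 T _ N); first by apply: measurable_maxr => //; exact: measurable_funM.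
      by move=> t; rewrite mul1r ger0_norm ?le_max ?lexx // ge_max N0 (le_trans (ler_norm _)).
    - apply: (@bounded_itv_integrable _ 0 T _ N); first by apply: measurable_maxr => //; exact: measurable_funM.
      by move=> t; rewrite mulN1r ger0_norm ?le_max ?lexx // ge_max N0 (le_trans (ler_norm _)) // normrN.
  exact: measurable_funB.
split => //.
have mA2 : measurable_fun setT (fun z : pt R * R => A z.1) by exact: (measurableT_comp mA measurable_fst).
transitivity (\int[mu3]_x Int 0 T (fun t => u t x * A x)).
  apply: eq_Rintegral => x _; rewrite /Int -/(Int 0 T (u ^~ x)) -/(A x).
  rewrite (_ : (\int[mu1]_(t in _) (u t x * A x)) = \int[mu1]_(t in `[0, T]) (A x * u t x)).
    by rewrite RintegralZl // expr2.
  by apply: eq_Rintegral => t _; rewrite mulrC.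
have N20 : 0 <= N * (N * T) by rewrite !mulr_ge0.
rewrite (@swap_box b (N * (N * T)) T (fun z => u z.2 z.1 * A z.1)) //=; last 3 first.
- exact: measurable_funM.
- by move=> z; rewrite normrM; apply: ler_pM.
- by move=> z nz; rewrite u0 ?mul0r.
apply: eq_Int => t _.
transitivity (\int[mu3]_x Int 0 T (fun s => u t x * u s x)).
  by apply: eq_Rintegral => x _; rewrite /Int RintegralZl.
have mut : measurable_fun setT (u t) by exact: (measurableT_comp mu (pair2_measurable t)).
rewrite (@swap_box b (N * N) T (fun z => u t z.1 * u z.2 z.1)) //=.
- apply: measurable_funM => //.
  exact: (measurableT_comp mut measurable_fst).
- by move=> z; rewrite normrM; apply: ler_pM.
- by move=> z nz; rewrite u0 ?mul0r.
Qed.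

End Correlation.

(** * The sharp circle inequality *)

Section ContinuityRules.
Context {R : realType}.

(** An alias of [continuous] for functions on the line, whose shape the tactic [cont] can match. *)
Definition cts (f : R -> R) : Prop := continuous f.

Lemma continuous_comp1 (f g : R -> R) : cts f -> cts g -> cts (fun t => f (g t)).
Proof. by move=> cf cg t; apply: (cvg_comp g f); [exact: cg|exact: cf]. Qed.

Lemma continuousM1 (f g : R -> R) : cts f -> cts g -> cts (fun t => f t * g t).
Proof. by move=> cf cg t; apply: cvgM; [exact: cf|exact: cg]. Qed.

Lemma continuousD1 (f g : R -> R) : cts f -> cts g -> cts (fun t => f t + g t).
Proof. by move=> cf cg t; apply: cvgD; [exact: cf|exact: cg]. Qed.

Lemma continuousN1 (f : R -> R) : cts f -> cts (fun t => - f t).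
Proof. by move=> cf t; apply: cvgN; exact: cf. Qed.

Lemma continuousX1 (f : R -> R) n : cts f -> cts (fun t => f t ^+ n).
Proof.
move=> cf; elim: n => [|n IH]; first by move=> t; exact: cvg_cst.
rewrite (_ : (fun t => _) = (fun t => f t * f t ^+ n)); first exact: continuousM1.
by apply: funext => t; rewrite exprS.
Qed.

Lemma continuousC1 (c : R) : cts (fun _ : R => c).
Proof. by move=> t; exact: cvg_cst. Qed.

Lemma continuousI1 : cts (fun t : R => t).
Proof. by move=> t; exact: cvg_id. Qed.

Lemma continuous_sin1 : cts (@sin R).
Proof. exact: continuous_sin. Qed.

Lemma continuous_cos1 : cts (@cos R).
Proof. exact: continuous_cos. Qed.

End ContinuityRules.

Ltac cts_step := match goal with
  | |- cts (fun t => t) => exact continuousI1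
  | |- cts (fun _ => ?c) => exact (@continuousC1 _ c)
  | |- cts (fun t => @GRing.add _ (@?f t) (@?g t)) => refine (@continuousD1 _ f g _ _)
  | |- cts (fun t => @GRing.opp _ (@?f t)) => refine (@continuousN1 _ f _)
  | |- cts (fun t => @GRing.mul _ (@?f t) (@?g t)) => refine (@continuousM1 _ f g _ _)
  | |- cts (fun t => @GRing.exp _ (@?f t) ?n) => refine (@continuousX1 _ f n _)
  | |- cts (fun t => sin (@?f t)) => refine (@continuous_comp1 _ _ f continuous_sin1 _)
  | |- cts (fun t => cos (@?f t)) => refine (@continuous_comp1 _ _ f continuous_cos1 _)
  | H : cts ?f |- cts ?f => exact H
  | H : continuous ?f |- cts ?f => exact H
  | H : cts ?h |- cts (fun t => ?h (@?f t)) => refine (@continuous_comp1 _ h f H _)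
  | H : continuous ?h |- cts (fun t => ?h (@?f t)) => refine (@continuous_comp1 _ h f H _)
  end.
Ltac cont := match goal with |- cts _ => idtac | |- ?P => refine (_ : cts _) end; repeat cts_step.

(** * The kernel that turns circle averages into a logarithm *)

Section LogKernel.
Context {R : realType}.

Lemma pi0 : 0 < (pi : R). Proof. exact: pi_gt0. Qed.

(* [W r] is [(pi r)^-1] times the integral over [0, pi] of [P (2 r sin t) sin t], with [P] the primitive of [Rbar]. *)
Lemma log_kernel (Rbar K : R -> R) (B J D : R) : cts Rbar -> 0 <= B -> (forall s, `|Rbar s| <= B) ->
  (forall s, Rbar s <= J) -> 0 <= D -> (forall s, D <= s -> Rbar s = 0) -> (forall r, 0 <= K r) ->
  (forall r, K r = pi^-1 * Int 0 pi (fun t => cos (2 * t) * Rbar (2 * r * sin t))) ->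
  exists W : R -> R,
  [/\ forall r : R, 0 < r -> is_derive r 1 W (- (2 / r) * K r),
      forall r, 0 < r -> W r <= J & forall r, 0 < r -> 0 <= W r].
Proof.
move=> cR B0 HB Rbar_le D0 Rbar_far K_ge0 K_formula; have [P [P0 dP]] := primitive cR.
have cP : cts P by move=> x; exact: (der_continuous (dP x)).
have cRs c : cts (fun t => Rbar (c * sin t)) by cont.
have cPs c : cts (fun t => P (c * sin t)) by cont.
pose F r := Int 0 pi (fun t => P (2 * r * sin t) * sin t).
pose I1 r := Int 0 pi (fun t => cos t ^+ 2 * Rbar (2 * r * sin t)).
pose I2 r := Int 0 pi (fun t => sin t ^+ 2 * Rbar (2 * r * sin t)).
(* Integration by parts: the boundary terms vanish because [P 0 = 0], and [F r] becomes
   [2 * r * I1 r]. *)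
have dP2 (r t : R) : is_derive t 1 (fun t => - (P (2 * r * sin t) * cos t)) (P (2 * r * sin t) * sin t - 2 * r * (cos t ^+ 2 * Rbar (2 * r * sin t))).
  have d1 : is_derive t 1 (fun t : R => 2 * r * sin t) (2 * r * cos t) by apply: derZ; exact: is_derive_sin.
  have d2 := der_comp d1 (dP (2 * r * sin t)).
  apply: (derE (derN (derM d2 (is_derive_cos t)))); ring.
have EF r : F r = 2 * r * I1 r.
  have c1 : cts (fun t => P (2 * r * sin t) * sin t) by cont.
  have c2 : cts (fun t => cos t ^+ 2 * Rbar (2 * r * sin t)) by cont.
  have c3 : cts (fun t => P (2 * r * sin t) * sin t - 2 * r * (cos t ^+ 2 * Rbar (2 * r * sin t))) by cont.
  have := Int_FTC (ltW pi0) c3 (dP2 r).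
  rewrite sin0 sinpi mulr0 P0 !mul0r subrr.
  have -> : Int 0 pi (fun t => P (2 * r * sin t) * sin t - 2 * r * (cos t ^+ 2 * Rbar (2 * r * sin t))) = F r - 2 * r * I1 r.
    rewrite /F /I1 -IntZ // -mulN1r -IntZ; last by cont.
    by rewrite -IntD //; [apply: eq_Int => t _; ring|cont].
  by move/eqP; rewrite subr_eq0 => /eqP.
have dF (r : R) : is_derive r 1 F (2 * I2 r).
  have H : is_derive r 1 F (Int 0 pi (fun t => 2 * (sin t ^+ 2 * Rbar (2 * r * sin t)))).
    apply: (@Int_derive _ 0 pi (fun r t => P (2 * r * sin t) * sin t) (fun r t => 2 * (sin t ^+ 2 * Rbar (2 * r * sin t))) (2 * B) r 1) => //.
    - by move=> x; cont.
    - move=> x t _.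
      have d1 : is_derive x 1 (fun r : R => 2 * r * sin t) (2 * sin t).
        apply: (derE (derM (derZ 2 (derI x)) (derC x (sin t)))); ring.
      have d2 := der_comp d1 (dP (2 * x * sin t)).
      apply: (derE (derM d2 (derC x (sin t)))); ring.
    - move=> x t _; rewrite normrM (ger0_norm (ler0n _ 2)) ler_wpM2l // normrM (ger0_norm (sqr_ge0 _)).
      have s1 : sin t ^+ 2 <= 1 by rewrite -(cos2Dsin2 t) lerDr sqr_ge0.
      by rewrite -[B]mul1r; exact: (ler_pM (sqr_ge0 _) (normr_ge0 _) s1).
  by move: H; rewrite IntZ //; cont.
pose W r := (pi * r)^-1 * F r.
(* As [F] has derivative [2 * I2 r], the derivative of [W] is [- 2 / (pi * r)] times [I1 r - I2 r],
   in which the weight is [cos t ^+ 2 - sin t ^+ 2 = cos (2 * t)]. *)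
have dW (r : R) : 0 < r -> is_derive r 1 W (- (2 / r) * K r).
  move=> r0; have rn : r != 0 by rewrite gt_eqF.
  have pn : (pi : R) != 0 by rewrite gt_eqF // pi0.
  have d1 : is_derive r 1 (fun r : R => (pi * r)^-1) (- pi / (pi * r) ^+ 2).
    by apply: (derE (derV (mulf_neq0 pn rn) (derZ pi (derI r)))); rewrite mulr1.
  apply: (derE (derM d1 (dF r))); rewrite EF K_formula.
  have -> : Int 0 pi (fun t => cos (2 * t) * Rbar (2 * r * sin t)) = I1 r - I2 r.
    rewrite /I1 /I2 -mulN1r -IntZ; last by cont.
    rewrite -IntD; [|by cont|by cont]; apply: eq_Int => t _.
    have -> : cos (2 * t) = cos t ^+ 2 - sin t ^+ 2 by rewrite (_ : 2 * t = t + t) ?cosD; ring.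
    ring.
  move: (I1 r) (I2 r) (pi) pn => i1 i2 p pn {d1}; field; by rewrite rn pn.
exists W; split.
- exact: dW.
- move=> r r0; rewrite /W EF.
  have I1le : I1 r <= J * (pi / 2).
    have c2 : cts (fun t => cos t ^+ 2 * Rbar (2 * r * sin t)) by cont.
    have c3 : cts (fun t : R => J * cos t ^+ 2) by cont.
    have -> : J * (pi / 2) = Int 0 pi (fun t => J * cos t ^+ 2).
      have d (t : R) : is_derive t 1 (fun t : R => J / 2 * (t + sin t * cos t)) (J * cos t ^+ 2).
        apply: (derE (derZ (J / 2) (derD (derI t) (derM (is_derive_sin t) (is_derive_cos t))))).
        have E := cos2Dsin2 t.
        have -> : sin t * - sin t = cos t ^+ 2 - 1 by rewrite mulrN -expr2 -E; ring.
        by field.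
      by rewrite (Int_FTC (ltW pi0) c3 d) sin0 sinpi !mul0r !addr0; field.
    apply: Int_le => // t _; rewrite mulrC ler_wpM2r ?sqr_ge0 //; exact: Rbar_le.
  rewrite mulrA.
  have pn : (pi : R) != 0 by rewrite gt_eqF // pi0.
  have -> : (pi * r)^-1 * (2 * r) = 2 / pi by move: (pi) pn => p pn; field; rewrite pn gt_eqF.
  apply: (le_trans (ler_wpM2l _ I1le)); first by rewrite divr_ge0 // ltW // pi0.
  have -> : 2 / pi * (J * (pi / 2)) = J by move: (pi) pn => p pn; field.
  exact: lexx.
(* [P] is constant beyond [D], so [F] is bounded and [W] tends to 0 at infinity; being
   nonincreasing, [W] cannot be negative. *)
- move=> r r0; rewrite leNgt; apply/negP => Wr.
  have [C C0 PC] : exists2 C, 0 <= C & forall s, 0 <= s -> `|P s| <= C.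
    have small s : 0 <= s -> s <= D -> `|P s| <= B * D.
      move=> s0 sa; have [z _] := @MVT_segment R P Rbar 0 s s0 (fun t _ => dP t) (continuous_subspaceT cP).
      rewrite P0 !subr0 => ->; rewrite normrM (ger0_norm s0); apply: ler_pM => //.
    exists (B * D); first exact: mulr_ge0.
    move=> s s0; have [sa|/ltW sa] := leP s D; first exact: small.
    have [z /andP[z1 _] E] := @MVT_segment R P Rbar D s sa (fun t _ => dP t) (continuous_subspaceT cP).
    have : P s = P D by apply/eqP; rewrite -subr_eq0 E Rbar_far ?mul0r.
    by move=> ->; exact: small.
  have anti x y : 0 < x -> x <= y -> W y <= W x.
    move=> x0 xy.
    have cW : {within `[x, y], continuous W}.
      apply: derivable_within_continuous => t; rewrite in_itv /= => /andP[xt _].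
      by have [] := dW t (lt_le_trans x0 xt).
    have dd t : t \in `]x, y[ -> is_derive t 1 W (- (2 / t) * K t).
      by rewrite in_itv /= => /andP[xt _]; apply: dW; exact: lt_trans xt.
    have [z zi E] := MVT_segment xy dd cW.
    have z0 : 0 < z by move: zi; rewrite in_itv /= => /andP[xz _]; exact: lt_le_trans xz.
    rewrite -subr_le0 E; apply: mulr_le0_ge0; last by rewrite subr_ge0.
    rewrite mulNr oppr_le0; apply: mulr_ge0; last exact: K_ge0.
    by rewrite divr_ge0 // ltW.
  have FC y : 0 < y -> `|F y| <= C * pi.
    move=> y0; rewrite /F -[in X in _ <= X](subr0 pi).
    have c1 : cts (fun t => P (2 * y * sin t) * sin t) by cont.
    have cC : cts (fun _ : R => C) by cont.
    have cN : cts (fun _ : R => - C) by cont.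
    have bd t : 0 <= t <= pi -> `|P (2 * y * sin t) * sin t| <= C.
      move=> /andP[t0 tp_]; have s0 : 0 <= sin t by apply: sin_ge0_pi; rewrite t0.
      rewrite normrM -[C]mulr1; apply: ler_pM => //.
        by apply: PC; rewrite !mulr_ge0 // ltW.
      by rewrite ler_norml sin_geN1 sin_le1.
    rewrite ler_norml -mulNr -(Int_cst (- C) (ltW pi0)) -(Int_cst C (ltW pi0)).
    by apply/andP; split; apply: Int_le => // t ht; have := bd t ht; rewrite ler_norml => /andP[].
  (* Far enough that [- C / y <= W y] contradicts [W y <= W r]. *)
  pose y := Num.max r ((C + 1) / - W r).
  have y0 : 0 < y by rewrite lt_max r0.
  have ry : r <= y by rewrite le_max lexx.
  have h1 := anti r y r0 ry.
  have h2 : - C / y <= W y.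
    have := FC y y0; rewrite ler_norml => /andP[h _].
    rewrite /W mulNr ler_pdivlMl ?mulr_gt0 ?pi0 //; apply: le_trans h.
    have -> : pi * y * (- (C / y)) = - (C * pi) by field; rewrite gt_eqF.
    exact: lexx.
  have h3 : (C + 1) / - W r <= y by rewrite le_max lexx orbT.
  have nW : 0 < - W r by rewrite oppr_gt0.
  rewrite ler_pdivrMr // in h3.
  have : - C / y <= W r by apply: le_trans h1.
  by rewrite ler_pdivrMr //; lra.
Qed.

End LogKernel.

(** * The square function of circle averages *)

Section SquareFunction.
Context {R : realType}.
Notation mu1 := (@lebesgue_measure R).
Notation mu3 := (vol R).
Variables (a M : R) (j1 j2 : pt R -> R).
Hypotheses (b1 : bsupp a M j1) (b2 : bsupp a M j2).

Let tp : R := 2 * pi.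
Lemma tp0 : 0 < tp. Proof. by rewrite /tp mulr_gt0 // pi0. Qed.

(** [Rs] is the trace and [S] the antisymmetric part of the correlation matrix of the current.
    Nothing else enters the sum of the squared tangential and normal circle means. *)
Let Rs h := corr j1 j1 h + corr j2 j2 h.
Let S h := corr j2 j1 h - corr j1 j2 h.

Lemma Rs_cont (u v : R -> R) : continuous u -> continuous v -> continuous (fun t => Rs (vecpt (u t) (v t))).
Proof. by move=> cu cv; apply: continuousD1; [exact: (continuous_vecpt b1 b1)|exact: (continuous_vecpt b2 b2)]. Qed.

Lemma S_cont (u v : R -> R) : continuous u -> continuous v -> continuous (fun t => S (vecpt (u t) (v t))).
Proof. by move=> cu cv; apply: continuousD1; [exact: (continuous_vecpt b2 b1)|apply: continuousN1; exact: (continuous_vecpt b1 b2)]. Qed.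

Lemma bndRS : exists2 B, 0 <= B & forall h, `|Rs h| <= B /\ `|S h| <= B.
Proof.
have [B1 p1 H1] := corr_bound b1 b1; have [B2 p2 H2] := corr_bound b2 b2.
have [B3 p3 H3] := corr_bound b2 b1; have [B4 p4 H4] := corr_bound b1 b2.
exists (B1 + B2 + B3 + B4) => [|h]; first by rewrite !addr_ge0.
have := H1 h; have := H2 h; have := H3 h; have := H4 h.
by split; [apply: (le_trans (ler_normD _ _))|apply: (le_trans (ler_normB _ _))]; lra.
Qed.

Let J := \int[mu3]_x (j1 x ^+ 2 + j2 x ^+ 2).

Lemma sq_int f : bsupp a M f -> mu3.-integrable setT (EFin \o (fun x => f x ^+ 2)).
Proof.
move=> bf; have [mf fM _] := bf.
by have := bsupp_mul_integrable bf mf fM; apply: eq_integrable => // x _ /=; rewrite expr2.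
Qed.

Lemma Rs_le h : Rs h <= J.
Proof.
rewrite /J RintegralD //; [|exact: sq_int|exact: sq_int].
by apply: lerD; [exact: corr_self_le b1|exact: corr_self_le b2].
Qed.

Definition circ_tan (x : pt R) (r : R) : R :=
  tp^-1 * Int 0 tp (fun t => - sin t * j1 (circ x r t) + cos t * j2 (circ x r t)).
(** The normal mean completes the tangential one: in the sum of squares the weights depend only on
    the difference of the two angles. Its square is discarded at the end. *)
Definition circ_nor (x : pt R) (r : R) : R :=
  tp^-1 * Int 0 tp (fun t => cos t * j1 (circ x r t) + sin t * j2 (circ x r t)).

Let T r o i := cos (i - o) * Rs (vecpt (r * (cos i - cos o)) (r * (sin i - sin o)))
  + sin (i - o) * S (vecpt (r * (cos i - cos o)) (r * (sin i - sin o))).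

Let Rbar s := tp^-1 * Int 0 tp (fun t => Rs (vecpt (s * - sin t) (s * cos t))).

Lemma measurable_circ r : measurable_fun setT (fun z : pt R * R => circ z.1 r z.2).
Proof.
have m1 : measurable_fun setT (fun z : pt R * R => z.1) by exact: measurable_fst.
have ms : measurable_fun setT (fun z : pt R * R => r * sin z.2).
  by apply: measurable_funM => //; exact: (measurableT_comp (continuous_measurable_fun continuous_sin1) measurable_snd).
have mc : measurable_fun setT (fun z : pt R * R => r * cos z.2).
  by apply: measurable_funM => //; exact: (measurableT_comp (continuous_measurable_fun continuous_cos1) measurable_snd).
apply: (@measurable_pt_tuple _ _ (pt R * R)%type (fun z => z.1.1.1 + r * cos z.2) (fun z => z.1.1.2 + r * sin z.2) (fun z => z.1.2)).
- by apply: measurable_funD => //; exact: measurableT_comp measurable_pt1 m1.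
- by apply: measurable_funD => //; exact: measurableT_comp measurable_pt2 m1.
- exact: measurableT_comp measurable_pt3 m1.
Qed.

Lemma lin_int (c1 c2 c3 c4 : R) (F1 F2 F3 F4 : pt R -> R) :
  mu3.-integrable setT (EFin \o F1) -> mu3.-integrable setT (EFin \o F2) ->
  mu3.-integrable setT (EFin \o F3) -> mu3.-integrable setT (EFin \o F4) ->
  \int[mu3]_x (c1 * F1 x + c2 * F2 x + c3 * F3 x + c4 * F4 x) =
  c1 * \int[mu3]_x F1 x + c2 * \int[mu3]_x F2 x + c3 * \int[mu3]_x F3 x + c4 * \int[mu3]_x F4 x.
Proof.
move=> i1 i2 i3 i4.
have z1 := integrableZ_R measurableT c1 i1; have z2 := integrableZ_R measurableT c2 i2.
have z3 := integrableZ_R measurableT c3 i3; have z4 := integrableZ_R measurableT c4 i4.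
have d1 := integrableD_R measurableT z1 z2; have d2 := integrableD_R measurableT d1 z3.
by rewrite !RintegralD // !RintegralZl.
Qed.

Lemma corr_circ_int f g r t s : bsupp a M f -> bsupp a M g ->
  mu3.-integrable setT (EFin \o (fun x => f (circ x r t) * g (circ x r s))).
Proof.
move=> bf bg; have [mf fM f0] := bf.
have gi : mu3.-integrable setT (EFin \o (fun x => g (circ x r s))).
  have := integrable_shift (vecpt (r * cos s) (r * sin s)) (bsupp_integrable bg).
  by apply: eq_integrable => // x _ /=; rewrite circE.
have mft : measurable_fun setT (fun x => f (circ x r t)).
  apply: (eq_measurable_fun (fun x : pt R => f (x + vecpt (r * cos t) (r * sin t)))).
    by move=> x _; rewrite circE.
  exact: bsupp_shift_measurable bf.
by have := bounded_mul_integrable gi mft (fun x => fM _); apply: eq_integrable => // x _ /=; rewrite mulrC.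
Qed.

Let K r := \int[mu3]_x (circ_tan x r ^+ 2 + circ_nor x r ^+ 2).

Lemma square_formula (p q : R -> R) r : continuous p -> continuous q -> (forall t, `|p t| <= 1) -> (forall t, `|q t| <= 1) ->
  let A x := Int 0 tp (fun t => p t * j1 (circ x r t) + q t * j2 (circ x r t)) in
  mu3.-integrable setT (EFin \o (fun x => A x ^+ 2)) /\
  \int[mu3]_x (A x ^+ 2) = Int 0 tp (fun o => Int 0 tp (fun i =>
     p o * p i * corr j1 j1 (vecpt (r * (cos i - cos o)) (r * (sin i - sin o)))
     + p o * q i * corr j2 j1 (vecpt (r * (cos i - cos o)) (r * (sin i - sin o)))
     + q o * p i * corr j1 j2 (vecpt (r * (cos i - cos o)) (r * (sin i - sin o)))
     + q o * q i * corr j2 j2 (vecpt (r * (cos i - cos o)) (r * (sin i - sin o))))).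
Proof.
move=> cp cq p1 q1 A.
pose u (t : R) (x : pt R) := p t * j1 (circ x r t) + q t * j2 (circ x r t).
have [mj1 j1M j10] := b1; have [mj2 j2M j20] := b2.
have M0 : 0 <= M by apply: le_trans (j1M 0).
have mcont (f : R -> R) : continuous f -> measurable_fun setT (fun z : pt R * R => f z.2).
  by move=> cf; exact: (measurableT_comp (continuous_measurable_fun cf) measurable_snd).
have mu : measurable_fun setT (fun z : pt R * R => u z.2 z.1).
  apply: measurable_funD; apply: measurable_funM.
  - exact: mcont.
  - exact: (measurableT_comp mj1 (measurable_circ r)).
  - exact: mcont.
  - exact: (measurableT_comp mj2 (measurable_circ r)).
have uN t x : `|u t x| <= 2 * M.
  have h1 := j1M (circ x r t); have h2 := j2M (circ x r t).
  apply: (le_trans (ler_normD _ _)); rewrite !normrM.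
  have := ler_pM (normr_ge0 _) (normr_ge0 _) (p1 t) h1; have := ler_pM (normr_ge0 _) (normr_ge0 _) (q1 t) h2.
  lra.
have u0 t x : ~ box (a + `|r|) (a + `|r|) (a + `|r|) x -> u t x = 0.
  move=> nx; have nb : ~ box a a a (circ x r t).
    apply: contra_not nx => -[/= c1 [c2 c3]].
    have cs (v w : R) : `|w| <= 1 -> `|v + r * w| < a -> `|v| < a + `|r|.
      move=> w1 H; have : `|v| <= `|v + r * w| + `|r * w| by rewrite -{1}(addrK (r * w) v) ler_normB.
      rewrite normrM => H2; apply: (le_lt_trans H2); apply: ltr_leD => //; exact: ler_piMr.
    split; [|split].
    - by apply: (cs _ (cos t)) => //; rewrite ler_norml cos_geN1 cos_le1.
    - by apply: (cs _ (sin t)) => //; rewrite ler_norml sin_geN1 sin_le1.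
    - by rewrite (lt_le_trans c3) // lerDl.
  by rewrite /u j10 // j20 // !mulr0 addr0.
have [mA AN A0 E] := square_fubini (ltW tp0) mu uN u0.
split.
  apply: (@box_integrable _ _ (a + `|r|) (a + `|r|) (a + `|r|) ((2 * M * tp) ^+ 2)).
  - exact: measurable_funX.
  - move=> x; rewrite normrX; apply: lerXn2r; rewrite ?nnegrE //; last exact: AN.
    by apply: mulr_ge0; [apply: mulr_ge0|exact: ltW tp0].
  - by move=> x nx; rewrite /A A0 // expr0n.
rewrite /A E; apply: eq_Int => o _; apply: eq_Int => i _.
rewrite -(corr_circ r i o b1 b1) -(corr_circ r i o b2 b1) -(corr_circ r i o b1 b2) -(corr_circ r i o b2 b2).
rewrite -lin_int; try exact: corr_circ_int.
by apply: eq_Rintegral => x _; rewrite /u; ring.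
Qed.

Lemma T_props r : (exists M', forall o i, `|T r o i| <= M') /\ (forall o, continuous (T r o)) /\ (forall i, continuous (fun o => T r o i)).
Proof.
have [B B0 HB] := bndRS; split; last split.
- exists (2 * B) => o i.
  have [h1 h2] := HB (vecpt (r * (cos i - cos o)) (r * (sin i - sin o))).
  have c1 : `|cos (i - o) : R| <= 1 by rewrite ler_norml cos_geN1 cos_le1.
  have s1 : `|sin (i - o) : R| <= 1 by rewrite ler_norml sin_geN1 sin_le1.
  apply: (le_trans (ler_normD _ _)); rewrite !normrM.
  have := ler_pM (normr_ge0 _) (normr_ge0 _) c1 h1; have := ler_pM (normr_ge0 _) (normr_ge0 _) s1 h2.
  lra.
- move=> o; apply: continuousD1; apply: continuousM1; [cont|by apply: Rs_cont; cont|cont|by apply: S_cont; cont].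
- move=> o; apply: continuousD1; apply: continuousM1; [cont|by apply: Rs_cont; cont|cont|by apply: S_cont; cont].
Qed.

Lemma K_double r : K r = tp^-2 * Int 0 tp (fun o => Int 0 tp (T r o)) /\
  mu3.-integrable setT (EFin \o (fun x => circ_tan x r ^+ 2)) /\
  mu3.-integrable setT (EFin \o (fun x => circ_nor x r ^+ 2)).
Proof.
have cnb t : `|- sin t : R| <= 1 by rewrite normrN ler_norml sin_geN1 sin_le1.
have csb t : `|sin t : R| <= 1 by rewrite ler_norml sin_geN1 sin_le1.
have ccb t : `|cos t : R| <= 1 by rewrite ler_norml cos_geN1 cos_le1.
have [i1 E1] := @square_formula (fun t => - sin t) cos r (continuousN1 continuous_sin1) continuous_cos1 cnb ccb.
have [i2 E2] := @square_formula cos sin r continuous_cos1 continuous_sin1 ccb csb.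
have z1 := integrableZ_R measurableT (tp^-1 ^+ 2) i1.
have z2 := integrableZ_R measurableT (tp^-1 ^+ 2) i2.
have ct : mu3.-integrable setT (EFin \o (fun x => circ_tan x r ^+ 2)).
  by move: z1; apply: eq_integrable => // x _ /=; rewrite /circ_tan exprMn.
have cn : mu3.-integrable setT (EFin \o (fun x => circ_nor x r ^+ 2)).
  by move: z2; apply: eq_integrable => // x _ /=; rewrite /circ_nor exprMn.
split; last by split.
rewrite /K RintegralD //.
have -> : \int[mu3]_x circ_tan x r ^+ 2 = tp^-1 ^+ 2 * \int[mu3]_x (Int 0 tp (fun t => - sin t * j1 (circ x r t) + cos t * j2 (circ x r t)) ^+ 2).
  by rewrite -RintegralZl //; apply: eq_Rintegral => x _; rewrite /circ_tan exprMn.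
have -> : \int[mu3]_x circ_nor x r ^+ 2 = tp^-1 ^+ 2 * \int[mu3]_x (Int 0 tp (fun t => cos t * j1 (circ x r t) + sin t * j2 (circ x r t)) ^+ 2).
  by rewrite -RintegralZl //; apply: eq_Rintegral => x _; rewrite /circ_nor exprMn.
rewrite E1 E2 exprVn -mulrDr; congr (_ * _).
pose C f g o i := corr f g (vecpt (r * (cos i - cos o)) (r * (sin i - sin o))).
pose G1 o i := - sin o * - sin i * C j1 j1 o i + - sin o * cos i * C j2 j1 o i + cos o * - sin i * C j1 j2 o i + cos o * cos i * C j2 j2 o i.
pose G2 o i := cos o * cos i * C j1 j1 o i + cos o * sin i * C j2 j1 o i + sin o * cos i * C j1 j2 o i + sin o * sin i * C j2 j2 o i.
change (Int 0 tp (fun o => Int 0 tp (G1 o)) + Int 0 tp (fun o => Int 0 tp (G2 o)) = Int 0 tp (fun o => Int 0 tp (T r o))).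
have [B1 p1 H1] := corr_bound b1 b1; have [B2 p2 H2] := corr_bound b2 b2.
have [B3 p3 H3] := corr_bound b2 b1; have [B4 p4 H4] := corr_bound b1 b2.
have tri (x y z B : R) : `|x| <= 1 -> `|y| <= 1 -> `|z| <= B -> `|x * y * z| <= B.
  move=> hx hy hz; rewrite !normrM.
  have h := ler_pM (normr_ge0 _) (normr_ge0 _) hx hy.
  have := ler_pM (mulr_ge0 (normr_ge0 _) (normr_ge0 _)) (normr_ge0 _) h hz.
  by rewrite !mul1r.
have [K1 K2] : (forall o i, `|C j1 j1 o i| <= B1) /\ (forall o i, `|C j2 j2 o i| <= B2) by split=> o i; [exact: H1|exact: H2].
have [K3 K4] : (forall o i, `|C j2 j1 o i| <= B3) /\ (forall o i, `|C j1 j2 o i| <= B4) by split=> o i; [exact: H3|exact: H4].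
have sum4 (x y z w b1' b2' b3' b4' : R) : `|x| <= b1' -> `|y| <= b2' -> `|z| <= b3' -> `|w| <= b4' -> `|x + y + z + w| <= b1' + b2' + b3' + b4'.
  by move=> h1 h2 h3 h4; do 3! (apply: (le_trans (ler_normD _ _)); apply: lerD => //).
have G1b o i : `|G1 o i| <= B1 + B3 + B4 + B2.
  by apply: sum4; apply: tri.
have G2b o i : `|G2 o i| <= B1 + B3 + B4 + B2.
  by apply: sum4; apply: tri.
have Cc f g o : bsupp a M f -> bsupp a M g -> cts (fun i => C f g o i).
  by move=> bf bg; apply: (continuous_vecpt bf bg); cont.
have Cc' f g i : bsupp a M f -> bsupp a M g -> cts (fun o => C f g o i).
  by move=> bf bg; apply: (continuous_vecpt bf bg); cont.
have C1 o := Cc j1 j1 o b1 b1; have C2 o := Cc j1 j2 o b1 b2; have C3 o := Cc j2 j1 o b2 b1; have C4 o := Cc j2 j2 o b2 b2.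
have D1 o := Cc' j1 j1 o b1 b1; have D2 o := Cc' j1 j2 o b1 b2; have D3 o := Cc' j2 j1 o b2 b1; have D4 o := Cc' j2 j2 o b2 b2.
have G1c o : continuous (G1 o) by have := C1 o; have := C2 o; have := C3 o; have := C4 o => ? ? ? ?; rewrite /G1; cont.
have G2c o : continuous (G2 o) by have := C1 o; have := C2 o; have := C3 o; have := C4 o => ? ? ? ?; rewrite /G2; cont.
have G1c' i : continuous (G1 ^~ i) by have := D1 i; have := D2 i; have := D3 i; have := D4 i => ? ? ? ?; rewrite /G1; cont.
have G2c' i : continuous (G2 ^~ i) by have := D1 i; have := D2 i; have := D3 i; have := D4 i => ? ? ? ?; rewrite /G2; cont.
rewrite -IntD; [|exact: Int_continuous G1c G1c' G1b|exact: Int_continuous G2c G2c' G2b].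
apply: eq_Int => o _; rewrite -IntD //; apply: eq_Int => i _.
by rewrite /G1 /G2 /C /T /Rs /S cosB sinB; ring.
Qed.

Lemma Rbar_cont (u : R -> R) : continuous u -> continuous (fun s => Rbar (u s)).
Proof.
move=> cu; apply: continuousM1; first cont.
have [B B0 HB] := bndRS.
apply: (@Int_continuous _ 0 tp (fun x t => Rs (vecpt (u x * - sin t) (u x * cos t))) B).
- by move=> x; apply: Rs_cont; cont.
- by move=> x; apply: Rs_cont; apply: continuousM1 => //; cont.
- by move=> x y; have [] := HB (vecpt (u x * - sin y) (u x * cos y)).
Qed.

Lemma Rbar_bound : exists2 B, 0 <= B & forall s, `|Rbar s| <= B.
Proof.
have [B B0 HB] := bndRS; exists B => // s.
rewrite /Rbar normrM gtr0_norm ?invr_gt0 ?tp0 // mulrC ler_pdivrMr ?tp0 //.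
rewrite -[X in _ <= _ * X](subr0 tp); apply: Int_norm_le; first exact: ltW tp0.
  by apply: Rs_cont; cont.
by move=> t; have [] := HB (vecpt (s * - sin t) (s * cos t)).
Qed.

Lemma Rbar_le s : Rbar s <= J.
Proof.
rewrite /Rbar mulrC ler_pdivrMr ?tp0 //.
rewrite -[X in _ <= _ * X](subr0 tp) -Int_cst ?(ltW tp0) //.
apply: Int_le; [by apply: Rs_cont; cont|by cont|].
by move=> t _; exact: Rs_le.
Qed.

(** One of [|sin t|] and [|cos t|] is at least [1 / 2], so a displacement of length [4 * a] moves
    some horizontal coordinate by [2 * a], and the supports separate. *)
Lemma Rbar_far s : 0 <= a -> 4 * a <= s -> Rbar s = 0.
Proof.
move=> a0 as_.
have E t : Rs (vecpt (s * - sin t) (s * cos t)) = 0.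
  have F : 2 * a <= `|s * - sin t| \/ 2 * a <= `|s * cos t|.
    have s0 : 0 <= s by lra.
    rewrite !normrM normrN (ger0_norm s0).
    have h := cos2Dsin2 t; have [h1|h1] := leP 2^-1 `|sin t : R|.
      by left; have := ler_wpM2l s0 h1; lra.
    right; suff h2 : 2^-1 <= `|cos t : R| by have := ler_wpM2l s0 h2; lra.
    have e1 : `|sin t : R| ^+ 2 = sin t ^+ 2 by rewrite -normrX ger0_norm // sqr_ge0.
    have e2 : `|cos t : R| ^+ 2 = cos t ^+ 2 by rewrite -normrX ger0_norm // sqr_ge0.
    have n1 := normr_ge0 (sin t : R); have n2 := normr_ge0 (cos t : R).
    rewrite leNgt; apply/negP => h2.
    have := ltr_pM n1 n1 h1 h1; have := ltr_pM n2 n2 h2 h2.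
    by rewrite -!expr2 e1 e2; lra.
  by rewrite /Rs (corr_far b1 b1) // (corr_far b2 b2) // addr0.
rewrite /Rbar (eq_Int (g := fun=> 0)) => [|t _]; last exact: E.
by rewrite Int_cst ?(ltW tp0) // mul0r mulr0.
Qed.

(** [S] is odd, and the half turn [t + pi] reverses the displacement. *)
Lemma S_mean s : Int 0 tp (fun t => S (vecpt (s * - sin t) (s * cos t))) = 0.
Proof.
set f := (fun t => _).
have cf : continuous f by apply: S_cont; cont.
have pf t : f (t + tp) = f t.
  by rewrite /f /tp mulr_natl sinD2pi cosD2pi.
have E : Int 0 tp f = - Int 0 tp f.
  rewrite -{1}(Int_periodic pi (ltW tp0) cf pf) -mulN1r -IntZ //; apply: eq_Int => t _.
  rewrite /f sinDpi cosDpi mulN1r.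
  have -> : vecpt (s * - - sin t) (s * - cos t) = - vecpt (s * - sin t) (s * cos t).
    by rewrite /vecpt; congr (_, _, _); rewrite /= ?oppr0 //; ring.
  by rewrite /S (corr_opp _ b2 b1) (corr_opp _ b1 b2) opprB.
lra.
Qed.

(** The chord from angle [o] to angle [2 * t + o] has length [2 * r * sin t] and is orthogonal to
    the direction [o + t]. Averaging over [o] at fixed [t] yields [Rbar] at the chord length, while
    the [S] part averages to zero. *)
Lemma K_formula r : K r = pi^-1 * Int 0 pi (fun t => cos (2 * t) * Rbar (2 * r * sin t)).
Proof.
have [-> _] := K_double r.
have [[MT HT] [c1 c2]] := T_props r.
have V o t : vecpt (r * (cos (2 * t + o) - cos o)) (r * (sin (2 * t + o) - sin o)) =
    vecpt (2 * r * sin t * - sin (o + t)) (2 * r * sin t * cos (o + t)).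
  have e1 : 2 * t + o = (o + t) + t by ring.
  have e2 : o = (o + t) - t by ring.
  have e3 : cos o = cos (o + t) * cos t + sin (o + t) * sin t by rewrite {1}e2 cosB.
  have e4 : sin o = sin (o + t) * cos t - cos (o + t) * sin t by rewrite {1}e2 sinB.
  by rewrite /vecpt e1 !(cosD (o + t)) !(sinD (o + t)) e3 e4; congr (_, _, _); ring.
(* Half angles: [i = 2 * t + o] with [t] in [[0, pi]] covers one period of [i]. *)
have A o : Int 0 tp (T r o) = 2 * Int 0 pi (fun t => T r o (2 * t + o)).
  have pT i : T r o (i + tp) = T r o i.
    have e : i + tp - o = (i - o) + pi *+ 2 by rewrite /tp; ring.
    by rewrite /T e /tp mulr_natl !sinD2pi !cosD2pi.
  rewrite -(Int_periodic o (ltW tp0) (c1 o) pT) /tp (@Int_double _ (fun i => T r o (i + o))) //; first exact: ltW pi0.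
  by apply: (continuous_comp1 (c1 o)); cont.
under eq_Int do rewrite A.
have Tc o : continuous (fun t : R => T r o (2 * t + o)) by have := c1 o => co; cont.
have Tc' t : continuous (fun o : R => T r o (2 * t + o)).
  rewrite /T; apply: continuousD1; apply: continuousM1; [cont|by apply: Rs_cont; cont|cont|by apply: S_cont; cont].
rewrite IntZ; last exact: (@Int_continuous _ 0 pi (fun o t => T r o (2 * t + o)) MT Tc Tc' (fun o t => HT _ _)).
rewrite (@Int_swap _ 0 tp 0 pi (fun o t => T r o (2 * t + o)) MT Tc Tc' (fun o t => HT _ _)).
have B t : Int 0 tp (fun o => T r o (2 * t + o)) = tp * (cos (2 * t) * Rbar (2 * r * sin t)).
  set s := 2 * r * sin t.
  pose f o := Rs (vecpt (s * - sin o) (s * cos o)); pose g o := S (vecpt (s * - sin o) (s * cos o)).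
  have cf : continuous f by apply: Rs_cont; cont.
  have cg : continuous g by apply: S_cont; cont.
  have pf x : f (x + tp) = f x by rewrite /f /tp mulr_natl sinD2pi cosD2pi.
  have pg x : g (x + tp) = g x by rewrite /g /tp mulr_natl sinD2pi cosD2pi.
  rewrite (eq_Int (g := fun o => cos (2 * t) * f (o + t) + sin (2 * t) * g (o + t))); last first.
    by move=> o _; rewrite /T V addrK.
  have cf' : continuous (fun o => f (o + t)) by apply: (continuous_comp1 cf); cont.
  have cg' : continuous (fun o => g (o + t)) by apply: (continuous_comp1 cg); cont.
  rewrite IntD; [|by apply: continuousM1; cont|by apply: continuousM1; cont].
  rewrite !IntZ // (Int_periodic t (ltW tp0) cf pf) (Int_periodic t (ltW tp0) cg pg) (S_mean s) mulr0 addr0.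
  rewrite /Rbar -/f; have := lt0r_neq0 tp0; move: (Int 0 tp f) => I tn; field; exact: tn.
under [X in 2 * X]eq_Int do rewrite B.
rewrite IntZ; last first.
  by apply: continuousM1; [cont|apply: Rbar_cont; cont].
move: (Int 0 pi _) => I; rewrite /tp; have := lt0r_neq0 (@pi0 R); move: (pi) => p pn; field; exact: pn.
Qed.

Lemma Rbar0_cont : cts Rbar.
Proof. by apply: (@Rbar_cont id); exact: continuousI1. Qed.

(* [W r] averages the autocorrelation of the field [(j1, j2)] over displacements of length at most [2 r];
   the factor [2 / r] is what makes the resulting lower bound sharp. *)
Lemma sharp_circle_bound : 0 <= a -> exists W : R -> R,
  [/\ forall r : R, 0 < r -> exists2 w', is_derive r 1 W w' & w' <= - (2 / r) * \int[mu3]_x (circ_tan x r ^+ 2),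
      forall r, 0 < r -> W r <= J & forall r, 0 < r -> 0 <= W r].
Proof.
move=> a0; have [B B0 HB] := Rbar_bound.
have Kge r : \int[mu3]_x (circ_tan x r ^+ 2) <= K r.
  have [_ [i1 i2]] := K_double r.
  by rewrite /K RintegralD // lerDl Rintegral_ge0 // => x _; exact: sqr_ge0.
have Tge r : 0 <= \int[mu3]_x (circ_tan x r ^+ 2) by apply: Rintegral_ge0 => x _; exact: sqr_ge0.
have [W [W1 W2 W3]] := log_kernel Rbar0_cont B0 HB Rbar_le (mulr_ge0 (ler0n _ 4) a0) (fun s => Rbar_far a0)
  (fun r => le_trans (Tge r) (Kge r)) K_formula.
exists W; split => // r r0; exists (- (2 / r) * K r); first exact: W1.
by rewrite !mulNr lerN2 ler_wpM2l ?Kge // divr_ge0 // ltW.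
Qed.

End SquareFunction.

(** * Flux quantization on a circle *)

Section CircleEstimate.
Context {R : realType}.
Implicit Types (p q f e h : R -> R).

Lemma Int_ge0 (a b : R) (g : R -> R) : a <= b -> cts g -> (forall t, a <= t <= b -> 0 <= g t) -> 0 <= Int a b g.
Proof.
move=> ab cg g0; have := @Int_le _ a b (fun=> 0) g (@continuousC1 _ 0) cg g0.
by rewrite Int_cst // mul0r.
Qed.

Lemma der_cts (g g' : R -> R) : (forall t : R, is_derive t 1 g (g' t)) -> cts g.
Proof. by move=> d t; exact: (der_continuous (d t)). Qed.

Lemma ctsV (g : R -> R) : cts g -> (forall t, g t != 0) -> cts (fun t => (g t)^-1).
Proof. by move=> cg g0 t; apply: cvgV; [exact: g0|exact: cg]. Qed.

Lemma ctsmax (g : R -> R) (c : R) : cts g -> cts (fun t => Num.max (g t) c).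
Proof. by move=> cg t; apply: continuous_max; [exact: cg|exact: cvg_cst]. Qed.

(* Rotating [p + i q] back by its accumulated phase and rescaling by [exp (- psi)] gives a constant. *)
Lemma cst_on (g : R -> R) (T : R) : 0 <= T -> cts g -> (forall t : R, 0 <= t <= T -> is_derive t 1 g 0) -> g T = g 0.
Proof.
move=> T0 cg dg.
have dg' (t : R) : t \in `]0, T[ -> is_derive t 1 g 0.
  by rewrite in_itv /= => /andP[h1 h2]; apply: dg; rewrite !ltW.
have [z _ E] := @MVT_segment R g (fun=> 0) 0 T T0 dg' (continuous_subspaceT cg).
by apply/eqP; rewrite -subr_eq0 E mul0r.
Qed.

Lemma winding p q p' q' (T m : R) : 0 <= T -> (forall t : R, is_derive t 1 p (p' t)) -> (forall t : R, is_derive t 1 q (q' t)) ->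
  cts p' -> cts q' -> p T = p 0 -> q T = q 0 -> 0 < m ->
  (forall t, 0 <= t <= T -> m <= p t ^+ 2 + q t ^+ 2) ->
  cos (Int 0 T (fun t => (p t * q' t - q t * p' t) / Num.max (p t ^+ 2 + q t ^+ 2) m)) = 1.
Proof.
move=> T0 dp dq cp' cq' pT qT m0 Nm.
have cp := der_cts dp; have cq := der_cts dq.
(* The lower bound on [N] is known on [[0, T]] only; the maximum keeps the integrands continuous on
   the whole line, where [primitive] needs them. *)
pose N t := p t ^+ 2 + q t ^+ 2; pose D t := Num.max (N t) m.
have Dn t : D t != 0 by rewrite gt_eqF // lt_max m0 orbT.
have DN t : 0 <= t <= T -> D t = N t by move=> ht; apply/max_idPl; exact: Nm.
have Nn t : 0 <= t <= T -> N t != 0 by move=> ht; rewrite -DN.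
have cN : cts N by rewrite /N; cont.
have cDV : cts (fun t => (D t)^-1) by apply: ctsV => //; exact: ctsmax.
pose w t := (p t * q' t - q t * p' t) / D t; pose v t := (p t * p' t + q t * q' t) / D t.
have cw : cts w by rewrite /w; cont.
have cv : cts v by rewrite /v; cont.
have [F [F0 dF]] := primitive cw; have [G [G0 dG]] := primitive cv.
have dE (t : R) : is_derive t 1 (fun t => expR (- G t)) (expR (- G t) * - v t).
  exact: der_comp (derN (dG t)) (is_derive_expR _).
have dc (t : R) : is_derive t 1 (fun t => cos (F t)) (- sin (F t) * w t).
  exact: der_comp (dF t) (is_derive_cos _).
have ds (t : R) : is_derive t 1 (fun t => sin (F t)) (cos (F t) * w t).
  exact: der_comp (dF t) (is_derive_sin _).
have ca (t : R) : 0 <= t <= T -> is_derive t 1 (fun t => (p t * cos (F t) + q t * sin (F t)) * expR (- G t)) 0.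
  move=> ht; apply: (derE (derM (derD (derM (dp t) (dc t)) (derM (dq t) (ds t))) (dE t))).
  have := Nn t ht; rewrite /w /v (DN t ht) /N; move: (expR _) (cos _) (sin _) (p t) (q t) (p' t) (q' t) => e c s P Q P' Q' n.
  by field.
have cb (t : R) : 0 <= t <= T -> is_derive t 1 (fun t => (q t * cos (F t) - p t * sin (F t)) * expR (- G t)) 0.
  move=> ht; apply: (derE (derM (derB (derM (dq t) (dc t)) (derM (dp t) (ds t))) (dE t))).
  have := Nn t ht; rewrite /w /v (DN t ht) /N; move: (expR _) (cos _) (sin _) (p t) (q t) (p' t) (q' t) => e c s P Q P' Q' n.
  by field.
(* A third conserved quantity: since [N] takes equal values at both ends, it forces
   [expR (- G T) = 1]. *)
have cn (t : R) : 0 <= t <= T -> is_derive t 1 (fun t => N t * (expR (- G t) * expR (- G t))) 0.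
  move=> ht; apply: (derE (derM (derD (derX 1 (dp t)) (derX 1 (dq t))) (derM (dE t) (dE t)))).
  have := Nn t ht; rewrite /w /v (DN t ht) /N; move: (expR _) (p t) (q t) (p' t) (q' t) => e P Q P' Q' n.
  by field.
have cF : cts F by exact: der_cts dF.
have cE : cts (fun t => expR (- G t)) by exact: der_cts dE.
have cc : cts (fun t => cos (F t)) by exact: der_cts dc.
have cs : cts (fun t => sin (F t)) by exact: der_cts ds.
have := cst_on T0 _ ca; have := cst_on T0 _ cb; have := cst_on T0 _ cn.
move=> /(_ ltac:(cont)) H1 /(_ ltac:(cont)) H2 /(_ ltac:(cont)) H3; move: H1 H2 H3.
have N00 : N 0 != 0 by apply: Nn; rewrite lexx.
rewrite {1 2}/N G0 F0 oppr0 expR0 cos0 sin0 pT qT !mulr0 subr0 addr0 !mulr1 -/(N 0).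
have eT := expR_gt0 (- G T); move: (expR _) eT => ex ex0 En.
have ex1 : ex = 1.
  have : N 0 * (ex * ex) = N 0 * 1 by rewrite mulr1.
  move/(mulfI N00) => H; have : (ex - 1) * (ex + 1) = 0 by rewrite -[RHS](subrr 1) -{3}H; ring.
  move/eqP; rewrite mulf_eq0 => /orP[|]; first by rewrite subr_eq0 => /eqP.
  by rewrite gt_eqF // addr_gt0.
rewrite ex1 !mulr1 => Eb Ea.
rewrite (Int_FTC T0 cw dF) F0 subr0.
have : N 0 * cos (F T) = N 0 * 1.
  rewrite mulr1 /N.
  transitivity (p 0 * (p 0 * cos (F T) + q 0 * sin (F T)) + q 0 * (q 0 * cos (F T) - p 0 * sin (F T))); first by ring.
  by rewrite Ea Eb; ring.
by move/(mulfI N00).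
Qed.

(** Only the open interval from 0 to [2 * pi] has to be excluded, and there [sin (M / 2) > 0] makes
    [cos M < 1]. The circle inequality uses quantization only in this weak form. *)
Lemma cos1_quantized (M : R) : cos M = 1 -> 0 <= M * (M - 2 * pi).
Proof.
move=> cM; rewrite leNgt; apply/negP => H.
have pi_0 := pi_gt0 R.
have [M0 M1] : 0 < M /\ M < 2 * pi.
  have [h|h] := ltP 0 M; last by move: H; rewrite ltNge mulr_le0 // subr_le0 (le_trans h) // mulr_ge0 // ltW.
  by split=> //; move: H; rewrite pmulr_rlt0 // subr_lt0.
have s0 : 0 < sin (M / 2) by apply: sin_gt0_pi; rewrite divr_gt0 //= ltr_pdivrMr // mulrC.
have := cM; rewrite (_ : M = M / 2 + M / 2); last by field.
rewrite cosD; have := cos2Dsin2 (M / 2); have := mulr_gt0 s0 s0; nra.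
Qed.

(** With [E] a primitive of [e], both [k * E + h] and [k * E - h] are nondecreasing. *)
Lemma oscillation h h' e (k T : R) : (forall t : R, is_derive t 1 h (h' t)) -> cts e -> 0 <= k ->
  (forall t, `|h' t| <= k * e t) -> forall s t, 0 <= s <= T -> 0 <= t <= T -> h t - k * Int 0 T e <= h s.
Proof.
move=> dh ce k0 he.
have [E [E0 dE]] := primitive ce.
have mono (g g' : R -> R) : (forall t : R, is_derive t 1 g (g' t)) -> (forall t, 0 <= g' t) -> forall x y, x <= y -> g x <= g y.
  move=> dg g0 x y xy; have [z _ H] := @MVT_segment R g g' x y xy (fun t _ => dg t) (continuous_subspaceT (der_cts dg)).
  by rewrite -subr_ge0 H mulr_ge0 // subr_ge0.
have m1 := mono _ _ (fun t => derD (derZ k (dE t)) (dh t)).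
have m2 := mono _ _ (fun t => derB (derZ k (dE t)) (dh t)).
have h1 t : 0 <= k * e t + h' t by have := he t; rewrite ler_norml; lra.
have h2 t : 0 <= k * e t - h' t by have := he t; rewrite ler_norml; lra.
have n1 x y (xy : x <= y) := m1 h1 x y xy; have n2 x y (xy : x <= y) := m2 h2 x y xy.
move=> s t /andP[s0 sT] /andP[t0 tT].
rewrite (Int_FTC (le_trans s0 sT) ce dE) E0 subr0.
have a1 := n1 _ _ s0; have a2 := n2 _ _ s0; have a3 := n1 _ _ sT; have a4 := n2 _ _ sT.
have b1 := n1 _ _ t0; have b2 := n2 _ _ t0; have b3 := n1 _ _ tT; have b4 := n2 _ _ tT.
rewrite /= E0 !mulr0 !add0r ?sub0r in a1 a2 a3 a4 b1 b2 b3 b4.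
have [st|/ltW ts] := leP s t.
  by have := n1 _ _ st; have := n2 _ _ st => /=; lra.
by have := n1 _ _ ts; have := n2 _ _ ts => /=; lra.
Qed.

(* If the modulus stays above [1 - tau] on the whole circle, the total phase [M = 2 pi r c + pi r^2] is a multiple
   of [2 pi], so [0 <= M (M - 2 pi)]; if not, the energy on the circle is at least of order [tau^2 / eps]. *)
Lemma circle_estimate p q p' q' f e (r eps tau : R) : 0 < eps -> eps <= r -> r <= 1 -> 0 < tau -> tau < 1 ->
  (forall t : R, is_derive t 1 p (p' t)) -> (forall t : R, is_derive t 1 q (q' t)) ->
  cts p' -> cts q' -> cts f -> cts e -> p (2 * pi) = p 0 -> q (2 * pi) = q 0 ->
  Int 0 (2 * pi) f = pi * r ^+ 2 ->
  (forall t, ((p' t + f t * q t) ^+ 2 + (q' t - f t * p t) ^+ 2) / r ^+ 2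
    + ((1 - (p t ^+ 2 + q t ^+ 2)) / (1 + (p t ^+ 2 + q t ^+ 2))) ^+ 2 / (2 * eps ^+ 2) <= e t) ->
  forall c, c = (2 * pi)^-1 * Int 0 (2 * pi) (fun t => (p t * (q' t - f t * p t) - q t * (p' t + f t * q t))
     / (r * Num.max (p t ^+ 2 + q t ^+ 2) ((1 - tau) ^+ 2))) ->
  (1 - r ^+ 2) * (c / r + 2^-1) - 3 / (4 * r ^+ 2) * (6 * r * eps / tau ^+ 2 * Int 0 (2 * pi) e) <= c ^+ 2.
Proof.
move=> e0 er r1 t0 t1 dp dq cp' cq' cf ce pT qT If He c Ec.
have cp := der_cts dp; have cq := der_cts dq.
have pp := pi_gt0 R; set T := 2 * pi in pT qT If Ec *.
have T0 : 0 < T by rewrite mulr_gt0.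
have r0 : 0 < r by exact: lt_le_trans er.
pose N t := p t ^+ 2 + q t ^+ 2.
have N0 t : 0 <= N t by rewrite addr_ge0 // sqr_ge0.
pose g t := (1 - N t) / (1 + N t).
pose d2 t := (p' t + f t * q t) ^+ 2 + (q' t - f t * p t) ^+ 2.
have d20 t : 0 <= d2 t by rewrite addr_ge0 // sqr_ge0.
have He' t : d2 t / r ^+ 2 + g t ^+ 2 / (2 * eps ^+ 2) <= e t by exact: He.
have {}He := He'.
have i1 : 0 < (r ^+ 2)^-1 by rewrite invr_gt0 exprn_gt0.
have i2 : 0 < (2 * eps ^+ 2)^-1 by rewrite invr_gt0 mulr_gt0 // exprn_gt0.
have eg0 t : 0 <= e t.
  apply: le_trans (He t); apply: addr_ge0; apply: mulr_ge0; rewrite ?(ltW i1) ?(ltW i2) ?sqr_ge0 //.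
have Ie0 : 0 <= Int 0 T e.
  by apply: Int_ge0 => //; exact: ltW.
(* Over all [c], the affine function exceeds [c ^+ 2] by at most [(1 - r ^+ 4) / (4 * r ^+ 2)],
   which the error term covers once its last factor is at least 1. *)
have trivial_bound (B : R) : 1 <= B -> (1 - r ^+ 2) * (c / r + 2^-1) - 3 / (4 * r ^+ 2) * B <= c ^+ 2.
  move=> B1; have r2 : 0 < r ^+ 2 by rewrite exprn_gt0.
  have h : 3 / (4 * r ^+ 2) <= 3 / (4 * r ^+ 2) * B by rewrite ler_peMr // divr_ge0 // mulr_ge0 // ltW.
  have sq := sqr_ge0 (c - (1 - r ^+ 2) / (2 * r)).
  have E : (c - (1 - r ^+ 2) / (2 * r)) ^+ 2 = c ^+ 2 - (1 - r ^+ 2) * (c / r) + (1 - r ^+ 2) ^+ 2 / (4 * r ^+ 2).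
    by field; rewrite gt_eqF.
  have r21 : r ^+ 2 <= 1 by rewrite exprn_ile1 // ltW.
  have E2 : (1 - r ^+ 2) ^+ 2 / (4 * r ^+ 2) + (1 - r ^+ 2) / 2 <= 3 / (4 * r ^+ 2).
    have -> : (1 - r ^+ 2) ^+ 2 / (4 * r ^+ 2) + (1 - r ^+ 2) / 2 = (1 - (r ^+ 2) ^+ 2) / (4 * r ^+ 2).
      by field; rewrite gt_eqF.
    rewrite ler_pM2r ?invr_gt0 ?mulr_gt0 //; have := sqr_ge0 (r ^+ 2); lra.
  have -> : (1 - r ^+ 2) * (c / r + 2^-1) = (1 - r ^+ 2) * (c / r) + (1 - r ^+ 2) / 2 by field; rewrite gt_eqF.
  by rewrite E in sq; lra.
(* Bad circle: the modulus drops at some angle. Either [g ^+ 2] stays above [tau ^+ 2 / 2] all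
   around and the potential term is large, or it oscillates, which costs energy as well. *)
have [[t [ht Nt]]|good] := pselect (exists t, 0 <= t <= T /\ N t < (1 - tau) ^+ 2).
  apply: trivial_bound.
  have N1 s : 1 + N s != 0 by rewrite gt_eqF // ltr_pwDl.
  have dN (s : R) : is_derive s 1 N (2 * (p s * p' s + q s * q' s)).
    by apply: (derE (derD (derX 1 (dp s)) (derX 1 (dq s)))); rewrite !expr1; ring.
  pose h' s := - 8 * g s * (p s * p' s + q s * q' s) / (1 + N s) ^+ 2.
  have dh (s : R) : is_derive s 1 (fun s => g s ^+ 2) (h' s).
    have dg := derM (derB (derC s 1) (dN s)) (@derV _ (fun s => 1 + N s) _ _ (N1 s) (derD (derC s 1) (dN s))).
    apply: (derE (derX 1 dg)); rewrite /h' /g; have := N1 s; move: (N s) (p s) (q s) (p' s) (q' s) => n P Q P' Q' nn.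
    by field.
  (* The Modica-Mortola inequality: the derivative of [g ^+ 2] is at most a product of gradient and
     potential, hence a multiple of the energy density. The square of the constant comes out as 8,
     and 3 is a convenient upper bound. *)
  have hb s : `|h' s| <= 3 * r * eps * e s.
    have A1 : (p s * p' s + q s * q' s) ^+ 2 <= N s * d2 s.
      have -> : p s * p' s + q s * q' s = p s * (p' s + f s * q s) + q s * (q' s - f s * p s) by ring.
      rewrite /N /d2; move: (p s) (q s) (p' s + f s * q s) (q' s - f s * p s) => P Q A B.
      have := sqr_ge0 (P * B - Q * A) => H; rewrite -subr_ge0.
      by suff -> : (P ^+ 2 + Q ^+ 2) * (A ^+ 2 + B ^+ 2) - (P * A + Q * B) ^+ 2 = (P * B - Q * A) ^+ 2 by []; ring.
    have A2 : h' s ^+ 2 <= 16 * (g s ^+ 2 * d2 s).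
      have -> : h' s ^+ 2 = 64 * g s ^+ 2 * ((p s * p' s + q s * q' s) ^+ 2 / (1 + N s) ^+ 4).
        by rewrite /h'; have := N1 s; move: (N s) (g s) => n G nn; field.
      have nn := N0 s; have p4 : 0 < (1 + N s) ^+ 4 by rewrite exprn_gt0 // ltr_pwDl.
      have : (p s * p' s + q s * q' s) ^+ 2 / (1 + N s) ^+ 4 <= d2 s / 4.
        rewrite ler_pdivrMr //; apply: (le_trans A1).
        have k1 : N s <= (1 + N s) ^+ 4 / 4.
          have h1 : 4 * N s <= (1 + N s) ^+ 2 by have := sqr_ge0 (1 - N s); rewrite !expr2; nra.
          have h2 : (1 + N s) ^+ 2 <= (1 + N s) ^+ 4.
            rewrite (_ : (1 + N s) ^+ 4 = (1 + N s) ^+ 2 * (1 + N s) ^+ 2); last by ring.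
            by rewrite ler_peMr ?sqr_ge0 // exprn_ege1 // lerDl.
          by lra.
        by have := ler_wpM2r (d20 s) k1; lra.
      by move=> k; have := ler_wpM2l (sqr_ge0 (g s)) k; lra.
    have A3 : g s ^+ 2 * d2 s <= (r * eps * e s) ^+ 2 / 2.
      have H := He s; have x0 : 0 <= d2 s / r ^+ 2 by rewrite mulr_ge0 // ltW.
      have y0 : 0 <= g s ^+ 2 / (2 * eps ^+ 2) by rewrite mulr_ge0 ?sqr_ge0 // ltW.
      have xy : 4 * ((d2 s / r ^+ 2) * (g s ^+ 2 / (2 * eps ^+ 2))) <= e s ^+ 2.
        have : (d2 s / r ^+ 2 + g s ^+ 2 / (2 * eps ^+ 2)) ^+ 2 <= e s ^+ 2 by rewrite lerXn2r ?nnegrE ?addr_ge0.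
        have := sqr_ge0 (d2 s / r ^+ 2 - g s ^+ 2 / (2 * eps ^+ 2)); rewrite !expr2; nra.
      have -> : g s ^+ 2 * d2 s = (r * eps) ^+ 2 / 2 * (4 * ((d2 s / r ^+ 2) * (g s ^+ 2 / (2 * eps ^+ 2)))).
        by field; rewrite !gt_eqF.
      have k0 : 0 <= (r * eps) ^+ 2 / 2 by rewrite divr_ge0 // sqr_ge0.
      by have := ler_wpM2l k0 xy; rewrite !exprMn; lra.
    have E0 : 0 <= r * eps * e s by rewrite !mulr_ge0 // ltW.
    rewrite -ler_sqr ?nnegrE ?normr_ge0 //; last by lra.
    have -> : `|h' s| ^+ 2 = h' s ^+ 2 by rewrite -normrX ger0_norm // sqr_ge0.
    by have := sqr_ge0 (r * eps * e s); nra.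
  have k0 : 0 <= 3 * r * eps by rewrite !mulr_ge0 // ltW.
  have ch : cts e by [].
  have osc := oscillation dh ch k0 hb.
  (* [N t <= (1 - tau) ^+ 2] gives [g t >= tau] because [(1 - tau) ^+ 2 * (1 + tau) <= 1 - tau]. *)
  have gt : tau ^+ 2 <= g t ^+ 2.
    have : tau <= g t.
      rewrite /g ler_pdivlMr ?ltr_pwDl //.
      have : N t * (1 + tau) <= (1 - tau) ^+ 2 * (1 + tau) by rewrite ler_wpM2r // ?ltW // addr_gt0.
      have : (1 - tau) ^+ 2 * (1 + tau) <= 1 - tau by rewrite expr2; nra.
      by lra.
    by move=> H; rewrite lerXn2r // nnegrE ?ltW // (lt_le_trans t0).
  have tt : 0 < tau ^+ 2 by rewrite exprn_gt0.
  rewrite leNgt; apply/negP => B1.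
  have B2 : 6 * r * eps * Int 0 T e < tau ^+ 2.
    by move: B1; rewrite mulrAC ltr_pdivrMr // mul1r.
  have low s : 0 <= s <= T -> tau ^+ 2 / 2 <= g s ^+ 2.
    by move=> hs; have /= := osc T s t hs ht; lra.
  have : Int 0 T (fun=> tau ^+ 2 / 2 * (2 * eps ^+ 2)^-1) <= Int 0 T e.
    apply: (@Int_le _ 0 T (fun=> _) e) => //; first exact: continuousC1.
    move=> s hs; apply: le_trans (He s).
    have := ler_wpM2r (ltW i2) (low s hs); have : 0 <= d2 s / r ^+ 2 by rewrite mulr_ge0 // ltW.
    lra.
  rewrite Int_cst ?(ltW T0) // subr0 => H.
  have k6 : 0 < 6 * r * eps by rewrite !mulr_gt0.
  have := ler_wpM2l (ltW k6) H.
  have -> : 6 * r * eps * (tau ^+ 2 / 2 * (2 * eps ^+ 2)^-1 * T) = tau ^+ 2 * (3 * pi * (r / eps)).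
    by rewrite /T; move: (pi) => P; field; rewrite gt_eqF.
  have re : 1 <= r / eps by rewrite ler_pdivlMr // mul1r.
  have p2 : 2 <= (pi : R) by exact: pi_ge2.
  have : 1 <= 3 * pi * (r / eps) by nra.
  by move=> k; have := ler_wpM2l (ltW tt) k; lra.
have goodN t : 0 <= t <= T -> (1 - tau) ^+ 2 <= N t.
  by move=> ht; rewrite leNgt; apply/negP => H; apply: good; exists t.
have m0 : 0 < (1 - tau) ^+ 2 by rewrite exprn_gt0 // subr_gt0.
have := cos1_quantized (winding (ltW T0) dp dq cp' cq' pT qT m0 goodN).
set M := Int 0 T _ => HM.
have cN : cts N by rewrite /N; cont.
have Dn t : Num.max (N t) ((1 - tau) ^+ 2) != 0 by rewrite gt_eqF // lt_max m0 orbT.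
have cDV : cts (fun t => (Num.max (N t) ((1 - tau) ^+ 2))^-1) by apply: ctsV => //; exact: ctsmax.
(* The flux of the unit field through the disc is [pi * r ^+ 2], so the gauge-invariant circulation
   is the total phase minus this area. *)
have cr : 2 * pi * r * c = M - pi * r ^+ 2.
  pose w t := (p t * q' t - q t * p' t) / Num.max (N t) ((1 - tau) ^+ 2).
  have cw : cts w by rewrite /w; cont.
  have -> : M - pi * r ^+ 2 = Int 0 T (fun t => w t + -1 * f t).
    by rewrite IntD ?IntZ //; [rewrite If mulN1r|cont].
  have E1 : Int 0 T (fun t => (p t * (q' t - f t * p t) - q t * (p' t + f t * q t)) / (r * Num.max (p t ^+ 2 + q t ^+ 2) ((1 - tau) ^+ 2)))
    = r^-1 * Int 0 T (fun t => w t + -1 * f t).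
    rewrite -IntZ; last by cont.
    apply: eq_Int => t ht; rewrite /w -/(N t) (max_idPl (goodN t ht)).
    have Nn : N t != 0 by rewrite gt_eqF // (lt_le_trans m0) // goodN.
    by move: Nn; rewrite /N => Nn; field; rewrite Nn gt_eqF.
  rewrite Ec E1.
  move: (Int _ _ _) => I; rewrite /T; move: (pi) pp => P PP.
  by field; rewrite !gt_eqF.
have key : 0 <= (r * c + r ^+ 2 / 2) * (r * c + r ^+ 2 / 2 - 1).
  have EM : M = 2 * pi * (r * c + r ^+ 2 / 2) by have := cr; lra.
  have E2 : M * (M - 2 * pi) = (2 * pi) ^+ 2 * ((r * c + r ^+ 2 / 2) * (r * c + r ^+ 2 / 2 - 1)) by rewrite EM; ring.
  by move: HM; rewrite E2 pmulr_rge0 // exprn_gt0.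
have r2 : 0 < r ^+ 2 by rewrite exprn_gt0.
(* With [y = r * c + r ^+ 2 / 2], that is [M / (2 * pi)], the difference is [y * (y - 1) / r ^+ 2]
   plus the last bracket, which equals [r ^+ 2 / 4]; the middle terms are zero. *)
have E3 : c ^+ 2 - (1 - r ^+ 2) * (c / r + 2^-1) = ((r * c + r ^+ 2 / 2) * (r * c + r ^+ 2 / 2 - 1)) / r ^+ 2 + (2 * r) ^+ 2 / 16 * 0 + r ^+ 2 / 4 * 0
   + (c / r * (1 - r ^+ 2) + (1 - r ^+ 2 / 2) / 2 - (1 - r ^+ 2) * (c / r + 2^-1)).
  by field; rewrite gt_eqF.
have k2 : 0 <= ((r * c + r ^+ 2 / 2) * (r * c + r ^+ 2 / 2 - 1)) / r ^+ 2 by rewrite divr_ge0 // ltW.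
have k3 : 0 <= 3 / (4 * r ^+ 2) * (6 * r * eps / tau ^+ 2 * Int 0 T e).
  by rewrite !mulr_ge0 ?invr_ge0 ?mulr_ge0 ?sqr_ge0 // ltW.
by lra.
Qed.

End CircleEstimate.

(** * Averages over circles *)

Section CircleAverages.
Context {R : realType}.
Notation mu1 := (@lebesgue_measure R).
Notation mu3 := (vol R).

(** Adding to [W] a primitive of the lower bound gives a nonincreasing [H] on [[r0, 1]], and
    [W 1 >= 0] is dropped. Starting at [r0] instead of [eps] reduces the error to order [k / r0]. *)
Lemma log_growth (W T : R -> R) (Y k eps r0 : R) : 0 < eps -> eps <= r0 -> r0 <= 1 -> 0 <= Y -> 0 <= k ->
  (forall r : R, 0 < r -> exists2 w', is_derive r 1 W w' & w' <= - (2 / r) * T r) ->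
  (forall r, 0 < r -> 0 <= W r) ->
  (forall r, eps <= r -> r <= 1 -> (1 - r ^+ 2) * Y - k / r <= T r) ->
  2 * Y * (- ln r0 - 2^-1) - 2 * k / r0 <= W r0.
Proof.
move=> e0 er r1 Y0 k0 dW W0 hT.
pose H r := W r + (2 * Y * (ln r - r ^+ 2 / 2) + 2 * k * r^-1).
have r00 : 0 < r0 := lt_le_trans e0 er.
have dH (r : R) : r0 <= r <= 1 -> exists2 h', is_derive r 1 H h' & h' <= 0.
  move=> /andP[ra rb]; have rp := lt_le_trans r00 ra.
  have rn : r != 0 by rewrite gt_eqF.
  have [w dw wle] := dW r rp.
  have d1 : is_derive r 1 (fun r : R => 2 * Y * (ln r - r ^+ 2 / 2) + 2 * k * r^-1) (2 * Y * (r^-1 - r) - 2 * k / r ^+ 2).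
    apply: (derE (derD (derZ (2 * Y) (derB (is_derive1_ln rp) (derM (derX 1 (derI r)) (derC r (2^-1 : R))))) (derZ (2 * k) (derV rn (derI r))))).
    by field.
  exists (w + (2 * Y * (r^-1 - r) - 2 * k / r ^+ 2)); first exact: derD.
  have h := hT r (le_trans er ra) rb.
  have h2 : 2 / r * ((1 - r ^+ 2) * Y - k / r) <= 2 / r * T r by rewrite ler_wpM2l // divr_ge0 // ltW.
  have E : 2 * Y * (r^-1 - r) - 2 * k / r ^+ 2 = 2 / r * ((1 - r ^+ 2) * Y - k / r) by field.
  by rewrite E; lra.
have cH : {within `[r0, 1], continuous H}.
  apply: derivable_within_continuous => t; rewrite in_itv /= => ht.
  by have [h' [] ] := dH t ht.
have dd (t : R) : t \in `]r0, 1[ -> is_derive t 1 H (H^`()%classic t).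
  rewrite in_itv /= => /andP[h1 h2]; have [|h' d _] := dH t; first by rewrite !ltW.
  by apply: derivable_der; case: d.
have [z zi E] := MVT_segment r1 dd cH.
have le0 : H^`()%classic z <= 0.
  have [|h' d h0] := dH z; last by rewrite (der_derive1 d).
  by move: zi; rewrite in_itv.
have : H 1 <= H r0 by rewrite -subr_le0 E mulr_le0_ge0 // subr_ge0.
rewrite /H ln1 expr1n invr1.
have w1 := W0 1 ltr01; have y2 : 0 <= Y * r0 ^+ 2 by rewrite mulr_ge0 // sqr_ge0.
by lra.
Qed.

Lemma bsupp_le (a M a' M' : R) f : bsupp a M f -> a <= a' -> M <= M' -> bsupp a' M' f.
Proof.
move=> [mf fM f0] aa MM; split=> // x; first exact: le_trans (fM x) MM.
move=> nb; apply: f0 => -[h1 [h2 h3]]; apply: nb.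
by split; [|split]; apply: lt_le_trans aa.
Qed.

Lemma measurable_circ2 r : measurable_fun setT (fun z : pt R * R => circ z.1 r z.2).
Proof. exact: measurable_circ. Qed.

Variables (a M r : R) (j1 j2 xi em : pt R -> R).
Hypotheses (b1 : bsupp a M j1) (b2 : bsupp a M j2) (bxi : bsupp a M xi) (bem : bsupp a M em).
Hypothesis r0 : 0 < r.

Lemma circ_box (x : pt R) (t : R) : box a a a (circ x r t) -> box (a + r) (a + r) (a + r) x.
Proof.
move=> [/= c1 [c2 c3]].
have cs (v w : R) : `|w| <= 1 -> `|v + r * w| < a -> `|v| < a + r.
  move=> w1 H; have : `|v| <= `|v + r * w| + `|r * w| by rewrite -{1}(addrK (r * w) v) ler_normB.
  rewrite normrM (gtr0_norm r0) => H2; apply: (le_lt_trans H2); apply: ltr_leD => //; rewrite ler_piMr // ltW //.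
split; [|split].
- by apply: (cs _ (cos t)) => //; rewrite ler_norml cos_geN1 cos_le1.
- by apply: (cs _ (sin t)) => //; rewrite ler_norml sin_geN1 sin_le1.
- by rewrite (lt_le_trans c3) // lerDl ltW.
Qed.

Lemma circ_fun_props (p q f g : R -> R) F G : cts p -> cts q -> (forall t, `|p t| <= 1) -> (forall t, `|q t| <= 1) ->
  bsupp a M F -> bsupp a M G ->
  let u (t : R) (x : pt R) := p t * F (circ x r t) + q t * G (circ x r t) in
  [/\ measurable_fun setT (fun z : pt R * R => u z.2 z.1), forall t x, `|u t x| <= 2 * M
    & forall t x, ~ box (a + r) (a + r) (a + r) x -> u t x = 0].
Proof.
move=> cp cq p1 q1 [mF FM F0] [mG GM G0] u.
have mcont (h : R -> R) : cts h -> measurable_fun setT (fun z : pt R * R => h z.2).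
  by move=> ch; exact: (measurableT_comp (continuous_measurable_fun ch) measurable_snd).
split.
- apply: measurable_funD; apply: measurable_funM.
  + exact: mcont.
  + exact: (measurableT_comp mF (measurable_circ2 r)).
  + exact: mcont.
  + exact: (measurableT_comp mG (measurable_circ2 r)).
- move=> t x; have h1 := FM (circ x r t); have h2 := GM (circ x r t).
  apply: (le_trans (ler_normD _ _)); rewrite !normrM.
  have := ler_pM (normr_ge0 _) (normr_ge0 _) (p1 t) h1; have := ler_pM (normr_ge0 _) (normr_ge0 _) (q1 t) h2.
  lra.
- move=> t x nx; have nb : ~ box a a a (circ x r t) by apply: contra_not nx; exact: circ_box.
  by rewrite /u F0 // G0 // !mulr0 addr0.
Qed.

Lemma cos1 (t : R) : `|cos t| <= 1. Proof. by rewrite ler_norml cos_geN1 cos_le1. Qed.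
Lemma sin1 (t : R) : `|sin t| <= 1. Proof. by rewrite ler_norml sin_geN1 sin_le1. Qed.

Lemma tp_gt0 : 0 < 2 * pi :> R. Proof. by rewrite mulr_gt0 // pi_gt0. Qed.

Lemma circ_tan_meas : measurable_fun setT (circ_tan j1 j2 ^~ r) /\ (forall x, `|circ_tan j1 j2 x r| <= 2 * M).
Proof.
have cns : cts (fun t : R => - sin t) by cont.
have cnb t : `|- sin t : R| <= 1 by rewrite normrN sin1.
have [m uN u0] := @circ_fun_props (fun t => - sin t) cos id id j1 j2 cns (@continuous_cos1 R) cnb cos1 b1 b2.
have [mA AN A0 _] := square_fubini (ltW tp_gt0) m uN u0.
split; first by apply: measurable_funM.
move=> x; rewrite /circ_tan normrM gtr0_norm ?invr_gt0 ?tp_gt0 // mulrC ler_pdivrMr ?tp_gt0 //.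
Qed.

Lemma em_avg_meas : measurable_fun setT (fun x => Int 0 (2 * pi) (fun t => em (circ x r t))) /\
   (forall x, `|Int 0 (2 * pi) (fun t => em (circ x r t))| <= 2 * M * (2 * pi)) /\
   mu3.-integrable setT (EFin \o (fun x => Int 0 (2 * pi) (fun t => em (circ x r t)))) /\
   \int[mu3]_x Int 0 (2 * pi) (fun t => em (circ x r t)) = 2 * pi * \int[mu3]_x em x.
Proof.
have c1 : cts (fun _ : R => 1) by cont.
have c0 : cts (fun _ : R => 0) by cont.
have h1 (t : R) : `|1 : R| <= 1 by rewrite normr1.
have h0 (t : R) : `|0 : R| <= 1 by rewrite normr0.
have [m uN u0] := @circ_fun_props (fun=> 1) (fun=> 0) id id em em c1 c0 h1 h0 bem bem.
have E t x : 1 * em (circ x r t) + 0 * em (circ x r t) = em (circ x r t) by rewrite mul1r mul0r addr0.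
have {}m : measurable_fun setT (fun z : pt R * R => em (circ z.1 r z.2)).
  by apply: (eq_measurable_fun _ _ m) => z _; rewrite E.
have {}uN t x : `|em (circ x r t)| <= 2 * M by rewrite -E.
have {}u0 t x : ~ box (a + r) (a + r) (a + r) x -> em (circ x r t) = 0 by rewrite -E; exact: u0.
have [mA AN A0 _] := @square_fubini _ (a + r) (2 * M) (2 * pi) (fun t x => em (circ x r t)) (ltW tp_gt0) m uN u0.
split=> //; split=> //.
split; first exact: (@box_integrable _ _ (a + r) (a + r) (a + r) (2 * M * (2 * pi))).
rewrite (@swap_box _ (a + r) (2 * M) (2 * pi) (fun z => em (circ z.1 r z.2)) (ltW tp_gt0) m (fun z => uN _ _) (fun z => u0 _ _)).
rewrite (eq_Int (g := fun=> \int[mu3]_x em x)) => [|t _].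
  by rewrite Int_cst ?(ltW tp_gt0) // subr0 mulrC.
rewrite -[RHS](Rintegral_shift (vecpt (r * cos t) (r * sin t)) (bsupp_integrable bem)).
by apply: eq_Rintegral => x _; rewrite circE.
Qed.

(** The left side is a circle integral of correlations of the current with [xi]. Frozen at
    displacement 0 they integrate to zero, since [- sin] and [cos] have mean zero, and freezing them
    costs the Lipschitz constant of [xi] times [r]. *)
Lemma flux_small (lip : R) : 0 <= lip -> (forall x u v, `|xi (x + vecpt u v) - xi x| <= lip * (`|u| + `|v|)) ->
  `|\int[mu3]_x (xi x * circ_tan j1 j2 x r)| <= 2 * lip * r * \int[mu3]_x (`|j1 x| + `|j2 x|).
Proof.
move=> l0 xl.
have [mj1 j1M j10] := b1; have [mj2 j2M j20] := b2; have [mx xM x0] := bxi.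
have i1 := bsupp_integrable b1; have i2 := bsupp_integrable b2.
pose v t : pt R := vecpt (r * cos t) (r * sin t).
have swap : \int[mu3]_x (xi x * circ_tan j1 j2 x r) =
   (2 * pi)^-1 * Int 0 (2 * pi) (fun t => - sin t * corr j1 xi (v t) + cos t * corr j2 xi (v t)).
  have cns : cts (fun t : R => - sin t) by cont.
  have cnb t : `|- sin t : R| <= 1 by rewrite normrN sin1.
  have [m uN u0] := @circ_fun_props (fun t => - sin t) cos id id j1 j2 cns (@continuous_cos1 R) cnb cos1 b1 b2.
  set u := (fun (t : R) x => - sin t * j1 (circ x r t) + cos t * j2 (circ x r t)) in m uN u0.
  have ti x : mu1.-integrable `[0, 2 * pi] (EFin \o (u ^~ x)).
    apply: (@bounded_itv_integrable _ _ _ _ (2 * M)) => [|t]; last exact: uN.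
    exact: (measurableT_comp m (measurable_pair1 x)).
  have [mA AN _ _] := square_fubini (ltW tp_gt0) m uN u0.
  transitivity ((2 * pi)^-1 * \int[mu3]_x Int 0 (2 * pi) (fun t => xi x * u t x)).
    have EI x : Int 0 (2 * pi) (fun t => xi x * u t x) = xi x * Int 0 (2 * pi) (u ^~ x) by rewrite /Int RintegralZl.
    under [X in _ = _ * X]eq_Rintegral do rewrite EI.
    rewrite -RintegralZl //; last exact: (bsupp_mul_integrable bxi mA AN).
    by apply: eq_Rintegral => x _; rewrite /circ_tan mulrCA.
  congr (_ * _).
  rewrite (@swap_box _ (a + r) (M * (2 * M)) (2 * pi) (fun z => xi z.1 * u z.2 z.1)).
  - apply: eq_Int => t _.
    have c1 : mu3.-integrable setT (EFin \o (fun x => j1 (x + v t) * xi x)) := corr_integrable (v t) b1 bxi.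
    have c2 : mu3.-integrable setT (EFin \o (fun x => j2 (x + v t) * xi x)) := corr_integrable (v t) b2 bxi.
    rewrite /corr -!RintegralZl // -RintegralD //; [|exact: integrableZ_R|exact: integrableZ_R].
    by apply: eq_Rintegral => x _; rewrite /u /= !circE /v; ring.
  - exact: ltW tp_gt0.
  - by apply: measurable_funM => //; exact: (measurableT_comp mx measurable_fst).
  - by move=> z; rewrite normrM; exact: (ler_pM (normr_ge0 _) (normr_ge0 _) (xM _) (uN _ _)).
  - by move=> z nz; rewrite [u _ _]u0 // mulr0.
have bound (j : pt R -> R) t : bsupp a M j -> `|corr j xi (v t) - corr j xi 0| <= lip * (2 * r) * \int[mu3]_x `|j x|.
  move=> bj; have ij := bsupp_integrable bj.
  rewrite -(corr_opp (v t) bxi bj) -(corr_opp 0 bxi bj) oppr0.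
  have c1 := corr_integrable (- v t) bxi bj; have c2 := corr_integrable 0 bxi bj.
  rewrite /corr -RintegralB //.
  apply: (le_trans (le_normr_Rintegral measurableT (integrableB_R measurableT c1 c2))).
  rewrite -RintegralZl //; last exact: (integrable_norm ij).
  apply: le_Rintegral => //.
  - exact: (integrable_norm (integrableB_R measurableT c1 c2)).
  - by apply: integrableZ_R => //; exact: (integrable_norm ij).
  move=> x _; rewrite addr0 -mulrBl normrM; apply: ler_wpM2r => //.
  have -> : - v t = vecpt (- (r * cos t)) (- (r * sin t)) by rewrite /v /vecpt; congr (_, _, _); rewrite /= oppr0.
  apply: (le_trans (xl _ _ _)); rewrite ler_wpM2l // !normrN !normrM (gtr0_norm r0).
  have h1 := ler_wpM2l (ltW r0) (cos1 t); have h2 := ler_wpM2l (ltW r0) (sin1 t); lra.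
have z0 : v 0 = v 0 by [].
rewrite swap.
have cS : cts (fun t => - sin t * corr j1 xi (v t) + cos t * corr j2 xi (v t)).
  have h1 : cts (fun t => corr j1 xi (v t)) by apply: (continuous_vecpt b1 bxi); cont.
  have h2 : cts (fun t => corr j2 xi (v t)) by apply: (continuous_vecpt b2 bxi); cont.
  by cont.
have cD : cts (fun t => - sin t * corr j1 xi 0 + cos t * corr j2 xi 0) by cont.
have I0 : Int 0 (2 * pi) (fun t => - sin t * corr j1 xi 0 + cos t * corr j2 xi 0) = 0.
  have d (t : R) : is_derive t 1 (fun t => cos t * corr j1 xi 0 + sin t * corr j2 xi 0) (- sin t * corr j1 xi 0 + cos t * corr j2 xi 0).
    apply: (derE (derD (derM (is_derive_cos t) (derC t (corr j1 xi 0))) (derM (is_derive_sin t) (derC t (corr j2 xi 0))))); ring.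
  rewrite (Int_FTC (ltW tp_gt0) cD d) -(add0r (2 * pi)) mulr_natl cosD2pi sinD2pi subrr //.
have -> : Int 0 (2 * pi) (fun t => - sin t * corr j1 xi (v t) + cos t * corr j2 xi (v t)) =
  Int 0 (2 * pi) (fun t => - sin t * (corr j1 xi (v t) - corr j1 xi 0) + cos t * (corr j2 xi (v t) - corr j2 xi 0)).
  rewrite -[LHS]subr0 -[X in _ - X]I0 -mulN1r -IntZ // -IntD //; last by cont.
  by apply: eq_Int => t _; ring.
rewrite normrM gtr0_norm ?invr_gt0 ?tp_gt0 // mulrC ler_pdivrMr ?tp_gt0 //.
rewrite -[X in _ <= _ * X](subr0 (2 * pi)); apply: Int_norm_le; first exact: ltW tp_gt0.
  have h1 : cts (fun t => corr j1 xi (v t)) by apply: (continuous_vecpt b1 bxi); cont.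
  have h2 : cts (fun t => corr j2 xi (v t)) by apply: (continuous_vecpt b2 bxi); cont.
  by cont.
move=> t; apply: (le_trans (ler_normD _ _)); rewrite !normrM normrN.
rewrite RintegralD //; [|exact: (integrable_norm i1)|exact: (integrable_norm i2)].
have k1 := ler_pM (normr_ge0 _) (normr_ge0 _) (sin1 t) (bound _ t b1).
have k2 := ler_pM (normr_ge0 _) (normr_ge0 _) (cos1 t) (bound _ t b2).
apply: (le_trans (lerD k1 k2)); move: (\int[mu3]_x `|j1 x|) (\int[mu3]_x `|j2 x|) => I1 I2.
by rewrite [leRHS](_ : _ = 1 * (lip * (2 * r) * I1) + 1 * (lip * (2 * r) * I2)); last by ring.
Qed.

(* The term linear in [circ_tan] is small: averaging over the circle moves [xi] by at most [r] in a closed loop,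
   so it only sees the Lipschitz constant of [xi]. *)
Lemma circle_mean_lower (eps lip kap : R) : 0 <= kap -> r <= 1 -> 0 <= lip ->
  (forall x, 0 <= xi x <= 1) -> (forall x, 0 <= em x) ->
  (forall x u v, `|xi (x + vecpt u v) - xi x| <= lip * (`|u| + `|v|)) ->
  (forall x, xi x != 0 -> (1 - r ^+ 2) * (circ_tan j1 j2 x r / r + 2^-1)
     - kap * Int 0 (2 * pi) (fun t => em (circ x r t)) <= circ_tan j1 j2 x r ^+ 2) ->
  (1 - r ^+ 2) * (2^-1 * \int[mu3]_x xi x - 2 * lip * \int[mu3]_x (`|j1 x| + `|j2 x|))
    - kap * (2 * pi) * \int[mu3]_x em x <= \int[mu3]_x (circ_tan j1 j2 x r ^+ 2).
Proof.
move=> k0 r1 l0 xi01 em0 xl H.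
have [mt tM] := circ_tan_meas.
have [me [eM [Ei Ee]]] := em_avg_meas.
have [_ [ti _]] := K_double b1 b2 r.
set E := (fun x => Int 0 (2 * pi) (fun t => em (circ x r t))) in me eM Ei Ee H.
have E0 x : 0 <= E x by apply: Rintegral_ge0.
have xii := bsupp_integrable bxi.
have xti := bsupp_mul_integrable bxi mt tM.
have xEi := bsupp_mul_integrable bxi me eM.
have c0 : 0 <= 1 - r ^+ 2 by rewrite subr_ge0 exprn_ile1 // ltW.
(* The circle inequality times [xi x]: trivial where [xi x = 0], and [xi x <= 1] allows the full
   square on the right. *)
have P x : (1 - r ^+ 2) / r * (xi x * circ_tan j1 j2 x r) + (1 - r ^+ 2) / 2 * xi x + - kap * (xi x * E x) <= circ_tan j1 j2 x r ^+ 2.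
  have [z|nz] := eqVneq (xi x) 0; first by rewrite z !mul0r !mulr0 !addr0 sqr_ge0.
  have /andP[x0 x1] := xi01 x; have h := ler_wpM2l x0 (H x nz).
  have h2 : xi x * circ_tan j1 j2 x r ^+ 2 <= circ_tan j1 j2 x r ^+ 2 by rewrite ler_piMl ?sqr_ge0.
  apply: le_trans h2; apply: le_trans h.
  by rewrite le_eqVlt; apply/orP; left; apply/eqP; rewrite -/(E x); field; rewrite gt_eqF.
have z1 := integrableZ_R measurableT ((1 - r ^+ 2) / r) xti.
have z2 := integrableZ_R measurableT ((1 - r ^+ 2) / 2) xii.
have z3 := integrableZ_R measurableT (- kap) xEi.
have z12 := integrableD_R measurableT z1 z2.
have := le_Rintegral measurableT (integrableD_R measurableT z12 z3) ti (fun x _ => P x).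
rewrite (RintegralD measurableT z12 z3) (RintegralD measurableT z1 z2) !RintegralZl // => Q; apply: le_trans Q.
have fl := flux_small l0 xl; rewrite ler_norml in fl; have /andP[fl1 _] := fl.
have xE : \int[mu3]_x (xi x * E x) <= 2 * pi * \int[mu3]_x em x.
  rewrite -Ee; apply: le_Rintegral => // x _; have /andP[x0 x1] := xi01 x.
  by rewrite ler_piMl.
have f1 : (1 - r ^+ 2) / r * - (2 * lip * r * \int[mu3]_x (`|j1 x| + `|j2 x|)) <= (1 - r ^+ 2) / r * \int[mu3]_x (xi x * circ_tan j1 j2 x r).
  by rewrite ler_wpM2l // divr_ge0 // ltW.
have f2 : kap * \int[mu3]_x (xi x * E x) <= kap * (2 * pi * \int[mu3]_x em x) by rewrite ler_wpM2l.
have f3 : (1 - r ^+ 2) / r * - (2 * lip * r * \int[mu3]_x (`|j1 x| + `|j2 x|)) = - ((1 - r ^+ 2) * (2 * lip * \int[mu3]_x (`|j1 x| + `|j2 x|))).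
  by field; rewrite gt_eqF.
move: f1 f2 (ler_wpM2l k0 xE); rewrite f3.
move: (\int[mu3]_x (xi x * E x)) (\int[mu3]_x em x) (\int[mu3]_x xi x) (\int[mu3]_x (xi x * circ_tan j1 j2 x r)) (\int[mu3]_x (_ + _)) (1 - r ^+ 2) pi.
by clear; move=> *; lra.
Qed.

End CircleAverages.

(** * Cut-off functions *)

Section Cutoff.
Context {R : realType}.
Notation mu3 := (vol R).

Definition clip (t : R) : R := Num.min 1 (Num.max 0 t).

Lemma clipE t : [\/ t <= 0 /\ clip t = 0, 0 <= t <= 1 /\ clip t = t | 1 <= t /\ clip t = 1].
Proof.
rewrite /clip; have [h|h] := leP 0 t; last by apply: Or31; split; [exact: ltW|rewrite min_r].
by have [h1|h1] := leP 1 t; [apply: Or33|apply: Or32; split=> //; exact: ltW].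
Qed.

Lemma clip01 t : 0 <= clip t <= 1.
Proof. by have [[_ ->]|[h ->]|[_ ->]] := clipE t; rewrite ?lexx ?ler01. Qed.

Lemma clip_lip a b : `|clip a - clip b| <= `|a - b|.
Proof.
have h := ler_norm (a - b); have h' := ler_norm (- (a - b)); rewrite normrN in h'.
by rewrite ler_norml; have [[? ->]|[/andP[? ?] ->]|[? ->]] := clipE a; have [[? ->]|[/andP[? ?] ->]|[? ->]] := clipE b; lra.
Qed.

Definition ramp (h s t : R) : R := clip ((h - `|t|) / s).

Lemma ramp01 h s t : 0 <= ramp h s t <= 1.
Proof. exact: clip01. Qed.

Lemma ramp_lip h s a b : 0 < s -> `|ramp h s a - ramp h s b| <= s^-1 * `|a - b|.
Proof.
move=> s0; apply: (le_trans (clip_lip _ _)).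
rewrite -mulrBl normrM [X in _ * X]gtr0_norm ?invr_gt0 // mulrC ler_wpM2l ?invr_ge0 ?(ltW s0) //.
have -> : h - `|a| - (h - `|b|) = `|b| - `|a| by ring.
by rewrite (distrC a b); exact: ler_dist_dist.
Qed.

Lemma ramp_out h s t : 0 < s -> h <= `|t| -> ramp h s t = 0.
Proof.
move=> s0 ht; rewrite /ramp /clip; have : (h - `|t|) / s <= 0 by rewrite pmulr_lle0 ?invr_gt0 // subr_le0.
by move=> H; rewrite (max_idPl H) min_r.
Qed.

Lemma ramp_in h s t : 0 < s -> `|t| <= h - s -> ramp h s t = 1.
Proof.
move=> s0 ht; have H : 1 <= (h - `|t|) / s by rewrite ler_pdivlMr // mul1r; lra.
by rewrite /ramp /clip (max_idPr (le_trans ler01 H)) (min_idPl H).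
Qed.

Lemma cts_ramp h s : 0 < s -> cts (ramp h s).
Proof.
move=> s0 x; apply/cvgrPdist_le => e e0.
have d0 : 0 < e * s by rewrite mulr_gt0.
have /cvgrPdist_le /(_ _ d0) := (cvg_id : x @[x --> x] --> x).
apply: filterS => y hy; apply: (le_trans (ramp_lip h x y s0)).
by rewrite ler_pdivrMl // mulrC.
Qed.

(** Lipschitz in the two horizontal variables and sharp in the third: all circles are horizontal, so
    values at different heights are never compared. *)
Definition cutoff (h s : R) (x : pt R) : R := ramp h s x.1.1 * ramp h s x.1.2 * \1_(`]- h, h[%classic : set R) x.2.

Lemma cutoff_facts h s : 0 < s -> s < h ->
  [/\ bsupp h 1 (cutoff h s), forall x, 0 <= cutoff h s x <= 1,
      forall x u v, `|cutoff h s (x + vecpt u v) - cutoff h s x| <= s^-1 * (`|u| + `|v|) &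
      (2 * (h - s)) ^+ 3 <= \int[mu3]_x cutoff h s x].
Proof.
move=> s0 sh; have h0 : 0 < h by exact: lt_trans sh.
have i01 (t : R) : 0 <= (\1_(`]- h, h[%classic : set R) t : R) <= 1.
  by rewrite indicE; case: (_ \in _); rewrite ?lexx ?ler01.
have c01 x : 0 <= cutoff h s x <= 1.
  have /andP[a0 a1] := ramp01 h s x.1.1; have /andP[b0 b1] := ramp01 h s x.1.2; have /andP[d0 d1] := i01 x.2.
  rewrite /cutoff; apply/andP; split; first by rewrite !mulr_ge0.
  by rewrite mulr_ile1 ?mulr_ge0 // mulr_ile1.
have bs : bsupp h 1 (cutoff h s).
  split.
  - apply: measurable_funM; first apply: measurable_funM.
    + exact: (measurableT_comp (continuous_measurable_fun (cts_ramp (h := h) s0)) measurable_pt1).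
    + exact: (measurableT_comp (continuous_measurable_fun (cts_ramp (h := h) s0)) measurable_pt2).
    + exact: (measurableT_comp (measurable_indic (measurable_itv _)) measurable_pt3).
  - by move=> x; have /andP[a0 a1] := c01 x; rewrite ger0_norm.
  - move=> x /notin_box[hx|hx|hx]; rewrite /cutoff.
    + by rewrite ramp_out // !mul0r.
    + by rewrite (ramp_out s0 hx) mulr0 mul0r.
    + rewrite indicE; case: (boolP (_ \in _)) => [|_]; last by rewrite mulr0.
      by rewrite inE /= in_itv /= -ltr_norml ltNge hx.
split=> //.
- move=> x u v; rewrite /cutoff /= addr0.
  have /andP[a0 a1] := ramp01 h s (x.1.1 + u); have /andP[b0 b1] := ramp01 h s x.1.2; have /andP[d0 d1] := i01 x.2.
  rewrite -mulrBl normrM (ger0_norm d0).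
  have l1 := ramp_lip h (x.1.1 + u) x.1.1 s0; have l2 := ramp_lip h (x.1.2 + v) x.1.2 s0.
  rewrite [X in s^-1 * `|X|](addrC _ (- _)) addKr in l1; rewrite [X in s^-1 * `|X|](addrC _ (- _)) addKr in l2.
  have E : `|ramp h s (x.1.1 + u) * ramp h s (x.1.2 + v) - ramp h s x.1.1 * ramp h s x.1.2| <= s^-1 * (`|u| + `|v|).
    have -> : ramp h s (x.1.1 + u) * ramp h s (x.1.2 + v) - ramp h s x.1.1 * ramp h s x.1.2 =
      ramp h s (x.1.1 + u) * (ramp h s (x.1.2 + v) - ramp h s x.1.2) + (ramp h s (x.1.1 + u) - ramp h s x.1.1) * ramp h s x.1.2 by ring.
    apply: (le_trans (ler_normD _ _)); rewrite !normrM (ger0_norm a0) (ger0_norm b0) mulrDr addrC.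
    apply: lerD; [apply: le_trans l1; rewrite ler_piMr //|apply: le_trans l2; rewrite ler_piMl //].
  by apply: le_trans E; rewrite ler_piMr.
- have hs0 : 0 < h - s by rewrite subr_gt0.
  have mb := measurable_box (h - s) (h - s) (h - s).
  have mi : measurable_fun setT (\1_(box (h - s) (h - s) (h - s)) : pt R -> R) by exact: measurable_indic.
  have bi01 x : 0 <= (\1_(box (h - s) (h - s) (h - s)) x : R) <= 1.
    by rewrite indicE; case: (_ \in _); rewrite ?lexx ?ler01.
  have -> : (2 * (h - s)) ^+ 3 = \int[mu3]_x (\1_(box (h - s) (h - s) (h - s)) x).
    rewrite /Rintegral integral_indic // setIT [X in fine X](vol_box hs0 hs0 hs0) /=; ring.
  apply: le_Rintegral => //.
  + apply: (@box_integrable _ _ (h - s) (h - s) (h - s) 1) => // x.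
      by have /andP[a0 a1] := bi01 x; rewrite ger0_norm.
    by move=> nx; rewrite indicE memNset.
  + exact: bsupp_integrable bs.
  move=> x _; rewrite indicE; case: (boolP (_ \in _)) => [|_]; last by have /andP[] := c01 x.
  rewrite inE => -[h1 [h2 h3]]; rewrite /cutoff (ramp_in s0 (ltW h1)) (ramp_in s0 (ltW h2)) !mul1r indicE.
  have -> : (x.2 \in `]- h, h[%classic) = true; last by [].
  by apply: mem_set; rewrite /= in_itv /= -ltr_norml (lt_trans h3) // gtrBl.
Qed.

End Cutoff.

(** * The lower bound for a continuous field *)

Section LowerCore.
Context {R : realType}.
Notation mu3 := (vol R).
Variables (hq M0 eps tau : R) (P Q A1 A2 B1 B2 : pt R -> R).
Let Qm : set (pt R) := box hq hq hq.
Hypotheses (cP : continuous P) (cQ : continuous Q) (cA1 : continuous A1) (cA2 : continuous A2)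
  (cB1 : continuous B1) (cB2 : continuous B2).
Hypothesis bnd : forall x, Qm x -> `|P x| <= M0 /\ `|Q x| <= M0 /\ `|A1 x| <= M0 /\ `|A2 x| <= M0 /\ `|B1 x| <= M0 /\ `|B2 x| <= M0.
Hypotheses (hq0 : 1 < hq) (eps0 : 0 < eps) (tau0 : 0 < tau) (tau1 : tau < 1).
Let F1 (x : pt R) := - (x.1.2 / 2).
Let F2 (x : pt R) := x.1.1 / 2.
(** [A1], [A2] and [B1], [B2] stand for the real and imaginary parts of the horizontal covariant
    gradient of [P + i Q]. The relation is asked only on circles inside [Qm], because near the
    boundary the derivative of a mollification is not a mollified weak derivative. *)
Hypothesis dP : forall x (r t : R), (forall t', Qm (circ x r t')) ->
  is_derive t 1 (fun t => P (circ x r t)) (r * (- sin t * (A1 (circ x r t) - F1 (circ x r t) * Q (circ x r t))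
    + cos t * (A2 (circ x r t) - F2 (circ x r t) * Q (circ x r t)))).
Hypothesis dQ : forall x (r t : R), (forall t', Qm (circ x r t')) ->
  is_derive t 1 (fun t => Q (circ x r t)) (r * (- sin t * (B1 (circ x r t) + F1 (circ x r t) * P (circ x r t))
    + cos t * (B2 (circ x r t) + F2 (circ x r t) * P (circ x r t)))).

Definition nsq (x : pt R) : R := P x ^+ 2 + Q x ^+ 2.
(** Bounded substitute for [1 - |u|^2]: its square is at most that of [1 - |u|^2] and, unlike the
    latter, is stable under mollification. *)
Definition gfun (x : pt R) : R := (1 - nsq x) / (1 + nsq x).
Definition efun (x : pt R) : R := A1 x ^+ 2 + A2 x ^+ 2 + B1 x ^+ 2 + B2 x ^+ 2 + gfun x ^+ 2 / (2 * eps ^+ 2).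
Definition em (x : pt R) : R := efun x * \1_Qm x.
(** Where the modulus is at least [1 - tau] this is the gauge-invariant phase gradient; the floor in
    the denominator keeps it bounded in the vortex cores. *)
Definition jfun (A B : pt R -> R) (x : pt R) : R := (P x * B x - Q x * A x) / Num.max (nsq x) ((1 - tau) ^+ 2) * \1_Qm x.

Lemma ptD (f g : pt R -> R) : continuous f -> continuous g -> continuous (fun x => f x + g x).
Proof. by move=> cf cg x; apply: cvgD; [exact: cf|exact: cg]. Qed.
Lemma ptM (f g : pt R -> R) : continuous f -> continuous g -> continuous (fun x => f x * g x).
Proof. by move=> cf cg x; apply: cvgM; [exact: cf|exact: cg]. Qed.
Lemma ptN (f : pt R -> R) : continuous f -> continuous (fun x => - f x).
Proof. by move=> cf x; apply: cvgN; exact: cf. Qed.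
Lemma ptC (c : R) : continuous (fun _ : pt R => c).
Proof. by move=> x; exact: cvg_cst. Qed.
Lemma ptV (f : pt R -> R) : continuous f -> (forall x, f x != 0) -> continuous (fun x => (f x)^-1).
Proof. by move=> cf f0 x; apply: cvgV; [exact: f0|exact: cf]. Qed.
Lemma ptX2 (f : pt R -> R) : continuous f -> continuous (fun x => f x ^+ 2).
Proof. by move=> cf; under eq_fun do rewrite expr2; exact: ptM. Qed.
Lemma ptmax (f : pt R -> R) (c : R) : continuous f -> continuous (fun x => Num.max (f x) c).
Proof. by move=> cf x; apply: continuous_max; [exact: cf|exact: cvg_cst]. Qed.

Lemma circ_cts (f : pt R -> R) x r : continuous f -> cts (fun t => f (circ x r t)).
Proof.
move=> cf t; apply: (cvg_comp (fun t => circ x r t) f); last exact: cf.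
have c1 : cts (fun t : R => x.1.1 + r * cos t) by cont.
have c2 : cts (fun t : R => x.1.2 + r * sin t) by cont.
exact: (cvg_pair (cvg_pair (c1 t) (c2 t)) (cvg_cst x.2)).
Qed.

Lemma nsq_ge0 x : 0 <= nsq x. Proof. by rewrite addr_ge0 // sqr_ge0. Qed.
Lemma nsq_cont : continuous nsq. Proof. by apply: ptD; exact: ptX2. Qed.
Lemma gfun_cont : continuous gfun.
Proof.
apply: ptM; first by apply: ptD; [exact: ptC|apply: ptN; exact: nsq_cont].
apply: ptV; first by apply: ptD; [exact: ptC|exact: nsq_cont].
by move=> x; rewrite gt_eqF // ltr_pwDl // nsq_ge0.
Qed.
Lemma efun_cont : continuous efun.
Proof.
apply: ptD; last by apply: ptM; [apply: ptX2; exact: gfun_cont|exact: ptC].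
by do 3! (apply: ptD; last exact: ptX2); exact: ptX2.
Qed.
Lemma efun_ge0 x : 0 <= efun x.
Proof. by rewrite /efun !addr_ge0 ?sqr_ge0 // divr_ge0 ?sqr_ge0 // mulr_ge0 // sqr_ge0. Qed.
Lemma gfun_sq_le1 x : gfun x ^+ 2 <= 1.
Proof.
have n := nsq_ge0 x; have p : 0 < 1 + nsq x by rewrite ltr_pwDl.
rewrite /gfun expr_div_n ler_pdivrMr ?exprn_gt0 // mul1r -subr_ge0.
by rewrite (_ : _ - _ = 4 * nsq x); [rewrite mulr_ge0|ring].
Qed.

Lemma i01 x : 0 <= (\1_Qm x : R) <= 1.
Proof. by rewrite indicE; case: (x \in Qm); rewrite ?lexx ?ler01. Qed.
Lemma iQ x : Qm x -> \1_Qm x = 1 :> R.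
Proof. by move=> h; rewrite indicE mem_set. Qed.
Lemma iNQ x : ~ Qm x -> \1_Qm x = 0 :> R.
Proof. by move=> h; rewrite indicE memNset. Qed.

Lemma em_ge0 x : 0 <= em x.
Proof. by rewrite mulr_ge0 ?efun_ge0 //; have /andP[] := i01 x. Qed.

Lemma mQm : measurable_fun setT (\1_Qm : pt R -> R).
Proof. by apply: measurable_indic; exact: measurable_box. Qed.

Lemma den_gt0 x : 0 < Num.max (nsq x) ((1 - tau) ^+ 2).
Proof. by rewrite lt_max [X in _ || X]exprn_gt0 ?orbT // subr_gt0. Qed.

(** Cauchy-Schwarz produces a factor [nsq x], which cancels one denominator; the other is at least
    [(1 - tau) ^+ 2]. *)
Lemma jfun_sq (A B : pt R -> R) x : jfun A B x ^+ 2 <= (A x ^+ 2 + B x ^+ 2) * \1_Qm x / (1 - tau) ^+ 2.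
Proof.
have d0 := den_gt0 x; have t2 : 0 < (1 - tau) ^+ 2 by rewrite exprn_gt0 // subr_gt0.
have [qx|nq] := pselect (Qm x); last by rewrite /jfun iNQ // !mulr0 mul0r expr0n.
rewrite /jfun iQ // !mulr1 expr_div_n ler_pdivrMr ?exprn_gt0 // mulrAC ler_pdivlMr //.
set D := Num.max _ _ in d0 *.
have D1 : nsq x <= D by rewrite le_max lexx.
have D2 : (1 - tau) ^+ 2 <= D by rewrite le_max lexx orbT.
have CS : (P x * B x - Q x * A x) ^+ 2 <= nsq x * (A x ^+ 2 + B x ^+ 2).
  rewrite /nsq -subr_ge0 (_ : _ - _ = (P x * A x + Q x * B x) ^+ 2) ?sqr_ge0 //; ring.
have s0 : 0 <= A x ^+ 2 + B x ^+ 2 by rewrite addr_ge0 // sqr_ge0.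
have CS2 : (P x * B x - Q x * A x) ^+ 2 <= D * (A x ^+ 2 + B x ^+ 2) by apply: (le_trans CS); rewrite ler_wpM2r.
apply: (le_trans (ler_pM (sqr_ge0 _) (ltW t2) CS2 D2)).
by rewrite [leRHS](_ : _ = D * (A x ^+ 2 + B x ^+ 2) * D) //; ring.
Qed.

(** One bound for currents, energy density and cut-off together; the final [+ 1] is for the
    cut-off. *)
Let Mj := 2 * M0 ^+ 2 / (1 - tau) ^+ 2 + (4 * M0 ^+ 2 + (2 * eps ^+ 2)^-1) + 1.

Lemma Mj_parts : [/\ 0 <= 2 * M0 ^+ 2 / (1 - tau) ^+ 2, 0 <= 4 * M0 ^+ 2 + (2 * eps ^+ 2)^-1 & 1 <= Mj].
Proof.
have h1 : 0 <= 2 * M0 ^+ 2 / (1 - tau) ^+ 2 by apply: divr_ge0; [apply: mulr_ge0; rewrite ?sqr_ge0|exact: sqr_ge0].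
have h2 : 0 <= 4 * M0 ^+ 2 + (2 * eps ^+ 2)^-1 by apply: addr_ge0; [apply: mulr_ge0|rewrite invr_ge0; apply: mulr_ge0]; rewrite ?sqr_ge0.
by split=> //; rewrite /Mj; lra.
Qed.

Lemma jfun_bsupp (A B : pt R -> R) : continuous A -> continuous B -> (forall x, Qm x -> `|A x| <= M0 /\ `|B x| <= M0) ->
  bsupp hq Mj (jfun A B).
Proof.
move=> cA cB bAB; have [p1 p2 p3] := Mj_parts; split.
- apply: measurable_funM; last exact: mQm.
  apply: continuous_measurable_pt; apply: ptM; first by apply: ptD; [exact: ptM|apply: ptN; exact: ptM].
  by apply: ptV; [apply: ptmax; exact: nsq_cont|move=> x; rewrite gt_eqF // den_gt0].
- move=> x; apply: (@le_trans _ _ (2 * M0 ^+ 2 / (1 - tau) ^+ 2)); last by rewrite /Mj; lra.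
  have [qx|nq] := pselect (Qm x); last by rewrite /jfun iNQ // mulr0 normr0.
  have [b1 [b2 _]] := bnd qx; have [b3 b4] := bAB x qx.
  rewrite /jfun iQ // mulr1 normrM normfV [X in _ / X](gtr0_norm (den_gt0 x)).
  apply: ler_pM => //; first by rewrite invr_ge0 ltW // den_gt0.
    apply: (le_trans (ler_normB _ _)); rewrite !normrM expr2.
    have := ler_pM (normr_ge0 _) (normr_ge0 _) b1 b4; have := ler_pM (normr_ge0 _) (normr_ge0 _) b2 b3; lra.
  by rewrite lef_pV2 ?posrE ?den_gt0 ?exprn_gt0 ?subr_gt0 // le_max lexx orbT.
- by move=> x nq; rewrite /jfun iNQ // mulr0.
Qed.

Lemma em_bsupp : bsupp hq Mj em.
Proof.
have [p1 p2 p3] := Mj_parts; split.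
- by apply: measurable_funM; [apply: continuous_measurable_pt; exact: efun_cont|exact: mQm].
- move=> x; rewrite ger0_norm ?em_ge0 //.
  apply: (@le_trans _ _ (4 * M0 ^+ 2 + (2 * eps ^+ 2)^-1)); last by rewrite /Mj; lra.
  have [qx|nq] := pselect (Qm x); last by rewrite /em iNQ // mulr0.
  have [_ [_ [b1 [b2 [b3 b4]]]]] := bnd qx.
  have sq (y : R) : `|y| <= M0 -> y ^+ 2 <= M0 ^+ 2 by move=> h; rewrite -[y ^+ 2]ger0_norm ?sqr_ge0 // normrX lerXn2r // nnegrE // (le_trans _ h).
  rewrite /em iQ // mulr1 /efun; apply: lerD.
    by have := sq _ b1; have := sq _ b2; have := sq _ b3; have := sq _ b4; lra.
  by rewrite ler_piMl ?gfun_sq_le1 // invr_ge0 mulr_ge0 // sqr_ge0.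
- by move=> x nq; rewrite /em iNQ // mulr0.
Qed.

Let j1 := jfun A1 B1.
Let j2 := jfun A2 B2.

Lemma j1_bsupp : bsupp hq Mj j1.
Proof. by apply: jfun_bsupp => // x /bnd[_ [_ [? [_ [? _]]]]]. Qed.
Lemma j2_bsupp : bsupp hq Mj j2.
Proof. by apply: jfun_bsupp => // x /bnd[_ [_ [_ [? [_ ?]]]]]. Qed.

Lemma circ_in (x : pt R) (r t : R) : 0 < r -> r <= 1 -> box (hq - 1) (hq - 1) (hq - 1) x -> Qm (circ x r t).
Proof.
move=> r0 r1 [h1 [h2 h3]].
have cs (v w : R) : `|w| <= 1 -> `|v| < hq - 1 -> `|v + r * w| < hq.
  move=> w1 hv; apply: (le_lt_trans (ler_normD _ _)); rewrite normrM (gtr0_norm r0).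
  have := ler_pM (ltW r0) (normr_ge0 w) r1 w1; lra.
split; [|split].
- by apply: cs => //; exact: cos1.
- by apply: cs => //; exact: sin1.
- by apply: lt_trans h3 _; rewrite gtrBl.
Qed.

Lemma circle_pointwise (x : pt R) (r : R) : eps <= r -> r <= 1 -> box (hq - 1) (hq - 1) (hq - 1) x ->
  (1 - r ^+ 2) * (circ_tan j1 j2 x r / r + 2^-1)
     - 9 * eps / (2 * tau ^+ 2 * r) * Int 0 (2 * pi) (fun t => em (circ x r t)) <= circ_tan j1 j2 x r ^+ 2.
Proof.
move=> er r1 bx; have r0 : 0 < r := lt_le_trans eps0 er.
have Qc t : Qm (circ x r t) by exact: circ_in.
pose p t := P (circ x r t); pose q t := Q (circ x r t).
pose f1 t := F1 (circ x r t); pose f2 t := F2 (circ x r t).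
pose a1 t := A1 (circ x r t); pose a2 t := A2 (circ x r t).
pose c1 t := B1 (circ x r t); pose c2 t := B2 (circ x r t).
have cp : cts p by exact: circ_cts.
have cq : cts q by exact: circ_cts.
have ca1 : cts a1 by exact: circ_cts.
have ca2 : cts a2 by exact: circ_cts.
have cc1 : cts c1 by exact: circ_cts.
have cc2 : cts c2 by exact: circ_cts.
have cf1 : cts f1 by rewrite /f1 /F1 /circ /=; cont.
have cf2 : cts f2 by rewrite /f2 /F2 /circ /=; cont.
pose f t := r * (- sin t * f1 t + cos t * f2 t).
have cf : cts f by rewrite /f; cont.
pose p' t := r * (- sin t * (a1 t - f1 t * q t) + cos t * (a2 t - f2 t * q t)).
pose q' t := r * (- sin t * (c1 t + f1 t * p t) + cos t * (c2 t + f2 t * p t)).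
have cp' : cts p' by rewrite /p'; cont.
have cq' : cts q' by rewrite /q'; cont.
have dp (t : R) : is_derive t 1 p (p' t) by exact: dP.
have dq (t : R) : is_derive t 1 q (q' t) by exact: dQ.
have ce : cts (fun t => efun (circ x r t)) by apply: circ_cts; exact: efun_cont.
have per : circ x r (2 * pi) = circ x r 0 by rewrite /circ -(add0r (2 * pi)) mulr_natl cosD2pi sinD2pi.
have pT : p (2 * pi) = p 0 by rewrite /p per.
have qT : q (2 * pi) = q 0 by rewrite /q per.
(* The circulation of the potential is the area of the disc, whatever the centre: the terms
   containing [x] are periodic and integrate to zero. *)
have If : Int 0 (2 * pi) f = pi * r ^+ 2.
  have d (t : R) : is_derive t 1 (fun t => r / 2 * (r * t + (x.1.1 * sin t + - x.1.2 * cos t))) (f t).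
    apply: (derE (derZ (r / 2) (derD (derZ r (derI t)) (derD (derZ x.1.1 (is_derive_sin t)) (derZ (- x.1.2) (is_derive_cos t)))))).
    have -> : f t = r / 2 * (r * (cos t ^+ 2 + sin t ^+ 2) + (x.1.1 * cos t + x.1.2 * sin t)).
      by rewrite /f /f1 /f2 /F1 /F2 /circ /=; field.
    by rewrite cos2Dsin2; field.
  rewrite (Int_FTC (ltW tp_gt0) cf d) -{2 3}(add0r (2 * pi)) mulr_natl sinD2pi cosD2pi sin0 cos0.
  by rewrite mulr2n; field.
have E1 t : p' t + f t * q t = r * (- sin t * a1 t + cos t * a2 t) by rewrite /p' /f; ring.
have E2 t : q' t - f t * p t = r * (- sin t * c1 t + cos t * c2 t) by rewrite /q' /f; ring.
have He t : ((p' t + f t * q t) ^+ 2 + (q' t - f t * p t) ^+ 2) / r ^+ 2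
    + ((1 - (p t ^+ 2 + q t ^+ 2)) / (1 + (p t ^+ 2 + q t ^+ 2))) ^+ 2 / (2 * eps ^+ 2) <= efun (circ x r t).
  rewrite E1 E2 /efun; apply: lerD; last exact: lexx.
  have CS (u v : R) : (- sin t * u + cos t * v) ^+ 2 <= u ^+ 2 + v ^+ 2.
    have E := cos2Dsin2 t; rewrite -subr_ge0.
    have -> : u ^+ 2 + v ^+ 2 - (- sin t * u + cos t * v) ^+ 2 = (cos t * u + sin t * v) ^+ 2.
      by rewrite -[u ^+ 2]mul1r -[v ^+ 2]mul1r -E; ring.
    exact: sqr_ge0.
  have -> : ((r * (- sin t * a1 t + cos t * a2 t)) ^+ 2 + (r * (- sin t * c1 t + cos t * c2 t)) ^+ 2) / r ^+ 2 =
     (- sin t * a1 t + cos t * a2 t) ^+ 2 + (- sin t * c1 t + cos t * c2 t) ^+ 2 by field; rewrite gt_eqF.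
  have h1 := CS (a1 t) (a2 t); have h2 := CS (c1 t) (c2 t).
  by apply: (le_trans (lerD h1 h2)); rewrite addrA.
have Ec : circ_tan j1 j2 x r = (2 * pi)^-1 * Int 0 (2 * pi) (fun t => (p t * (q' t - f t * p t) - q t * (p' t + f t * q t))
     / (r * Num.max (p t ^+ 2 + q t ^+ 2) ((1 - tau) ^+ 2))).
  rewrite /circ_tan; congr (_ * _); apply: eq_Int => t _.
  rewrite E1 E2 /j1 /j2 /jfun iQ // !mulr1 -/(p t) -/(q t) -/(a1 t) -/(a2 t) -/(c1 t) -/(c2 t).
  have := den_gt0 (circ x r t); rewrite /nsq -/(p t) -/(q t); move: (Num.max _ _) => D D0.
  by field; rewrite !gt_eqF.
have := circle_estimate eps0 er r1 tau0 tau1 dp dq cp' cq' cf ce pT qT If He Ec.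
have -> : Int 0 (2 * pi) (fun t => efun (circ x r t)) = Int 0 (2 * pi) (fun t => em (circ x r t)).
  by apply: eq_Int => t _; rewrite /em iQ // mulr1.
move: (Int _ _ _) (circ_tan _ _ _ _) => I c.
have -> // : 3 / (4 * r ^+ 2) * (6 * r * eps / tau ^+ 2 * I) = 9 * eps / (2 * tau ^+ 2 * r) * I.
by field; rewrite !gt_eqF.
Qed.

(** [Y] is half the mass of the cut-off minus the flux term, in which
    [|y| <= sig + y ^+ 2 / (4 * sig)] trades the integral of [|j|] for volume and energy.
    Integrating the radius from [K * eps] on makes the loss on bad circles a multiple of [E / K]. *)
Lemma lower_core (s sig K : R) : 0 < s -> s + 1 < hq -> 0 < sig -> 1 <= K -> K * eps <= 1 ->
  let E := \int[mu3]_x em x in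
  let Y := 2^-1 * (2 * (hq - 1 - s)) ^+ 3 - 2 / s * (2 * sig * (2 * hq) ^+ 3 + E / ((1 - tau) ^+ 2 * (4 * sig))) in
  0 <= Y ->
  2 * Y * (- ln (K * eps) - 2^-1) - 18 * pi * E / (tau ^+ 2 * K) <= E / (1 - tau) ^+ 2.
Proof.
move=> s0 sh sig0 K1 Ke E Y Y0.
have h0 : s < hq - 1 by rewrite ltrBrDr.
have [bxi xi01 xl xm] := cutoff_facts s0 h0.
have hq00 : 0 <= hq by rewrite ltW // (lt_trans ltr01).
have [p1 p2 M1] := Mj_parts.
have [_ _ xi0] := bxi.
have {}bxi : bsupp hq Mj (cutoff (hq - 1) s) by apply: bsupp_le bxi _ M1; rewrite gerBl.
have b1 := j1_bsupp; have b2 := j2_bsupp; have be := em_bsupp.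
have [W [W1 W2 W3]] := sharp_circle_bound b1 b2 hq00.
have ei := bsupp_integrable be.
have E0 : 0 <= E by apply: Rintegral_ge0 => x _; exact: em_ge0.
have t2 : 0 < (1 - tau) ^+ 2 by rewrite exprn_gt0 // subr_gt0.
have i1 := bsupp_integrable b1; have i2 := bsupp_integrable b2.
have sqi f : bsupp hq Mj f -> mu3.-integrable setT (EFin \o (fun x => f x ^+ 2)).
  by move=> bf; have [mf fM _] := bf; have := bsupp_mul_integrable bf mf fM; apply: eq_integrable => // x _ /=; rewrite expr2.
have i12 := integrableD_R measurableT (sqi _ b1) (sqi _ b2).
have JE : \int[mu3]_x (j1 x ^+ 2 + j2 x ^+ 2) <= E / (1 - tau) ^+ 2.
  rewrite mulrC -RintegralZl //; apply: le_Rintegral => //; first exact: integrableZ_R.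
  move=> x _; apply: (le_trans (lerD (jfun_sq A1 B1 x) (jfun_sq A2 B2 x))).
  rewrite -mulrDl -mulrDl mulrC ler_wpM2l ?invr_ge0 ?(ltW t2) //.
  rewrite /em; apply: ler_wpM2r; first by have /andP[] := i01 x.
  rewrite /efun; have : 0 <= gfun x ^+ 2 / (2 * eps ^+ 2) by rewrite divr_ge0 ?sqr_ge0 // mulr_ge0 // sqr_ge0.
  lra.
have hq1 : 0 < hq by apply: lt_trans hq0.
have ind_int : mu3.-integrable setT (EFin \o (\1_Qm : pt R -> R)).
  apply: (@box_integrable _ _ hq hq hq 1) => [|x|x]; [exact: mQm| |exact: iNQ].
  by have /andP[a0 a1] := i01 x; rewrite ger0_norm.
have ind_vol : \int[mu3]_x (\1_Qm x) = (2 * hq) ^+ 3.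
  rewrite /Rintegral integral_indic //; last exact: measurable_box.
  by rewrite setIT [X in fine X](vol_box hq1 hq1 hq1) /=; ring.
have JL : \int[mu3]_x (`|j1 x| + `|j2 x|) <= 2 * sig * (2 * hq) ^+ 3 + E / ((1 - tau) ^+ 2 * (4 * sig)).
  apply: (@le_trans _ _ (2 * sig * (2 * hq) ^+ 3 + (4 * sig)^-1 * \int[mu3]_x (j1 x ^+ 2 + j2 x ^+ 2))); last first.
    rewrite lerD2l [leRHS](_ : _ = (4 * sig)^-1 * (E / (1 - tau) ^+ 2)); last by rewrite invfM mulrA mulrC.
    by apply: ler_wpM2l => //; rewrite invr_ge0 mulr_ge0 // ltW.
  rewrite -ind_vol -RintegralZl // -RintegralZl // -RintegralD //; [|exact: integrableZ_R|exact: integrableZ_R].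
  apply: le_Rintegral => //.
  - by apply: integrableD_R => //; [exact: (integrable_norm i1)|exact: (integrable_norm i2)].
  - by apply: integrableD_R => //; exact: integrableZ_R.
  move=> x _; have [qx|nq] := pselect (Qm x); last first.
    by rewrite /j1 /j2 /jfun iNQ // !mulr0 normr0 !expr0n /= !addr0 mulr0.
  rewrite iQ // mulr1.
  have am (y : R) : `|y| <= sig + (4 * sig)^-1 * y ^+ 2.
    have -> : y ^+ 2 = `|y| ^+ 2 by rewrite -normrX ger0_norm // sqr_ge0.
    rewrite -subr_ge0 (_ : _ - _ = (4 * sig)^-1 * (2 * sig - `|y|) ^+ 2); last by field; rewrite gt_eqF.
    by rewrite mulr_ge0 ?sqr_ge0 // invr_ge0 mulr_ge0 // ltW.
  by have := am (j1 x); have := am (j2 x); lra.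
have r0p : 0 < K * eps by rewrite mulr_gt0 // (lt_le_trans ltr01).
have Ker : eps <= K * eps by rewrite ler_peMl // ltW.
(* The coefficient [9 * eps / (2 * tau ^+ 2 * r)] of [circle_pointwise], times [2 * pi * E], is
   [k / r]. *)
pose k := 9 * pi * eps / tau ^+ 2 * E.
have k0 : 0 <= k by rewrite /k !mulr_ge0 ?invr_ge0 ?sqr_ge0 // ?pi_ge0 // ltW.
have hT r : eps <= r -> r <= 1 -> (1 - r ^+ 2) * Y - k / r <= \int[mu3]_x (circ_tan j1 j2 x r ^+ 2).
  move=> er r1; have r0 : 0 < r := lt_le_trans eps0 er.
  have kp : 0 <= 9 * eps / (2 * tau ^+ 2 * r) by rewrite divr_ge0 ?mulr_ge0 ?sqr_ge0 // ltW.
  have H := @circle_mean_lower _ hq Mj r j1 j2 (cutoff (hq - 1) s) em b1 b2 bxi be r0 eps s^-1 _ kp r1 _ xi01 em_ge0 xl _.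
  apply: le_trans (H _ _); last first.
  - move=> x xn; apply: circle_pointwise => //.
    by apply: contrapT => nb; move/eqP: xn; apply; exact: xi0.
  - by rewrite invr_ge0 ltW.
  apply: lerB; last first.
    rewrite -/E /k le_eqVlt; apply/orP; left; apply/eqP; move: (pi) => pp; field; rewrite !gt_eqF //.
  apply: ler_wpM2l; first by rewrite subr_ge0 exprn_ile1 // ltW.
  rewrite /Y; apply: lerB; first by rewrite ler_wpM2l // invr_ge0.
  rewrite -(mulrA 2) -[in leRHS](mulrA 2) ler_wpM2l // ler_wpM2l ?invr_ge0 ?(ltW s0) //.
have := log_growth eps0 Ker Ke Y0 k0 W1 W3 hT.
have -> : 2 * k / (K * eps) = 18 * pi * E / (tau ^+ 2 * K).
  by rewrite /k; move: (pi) => pp; field; rewrite !gt_eqF // (lt_le_trans ltr01).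
move=> H; apply: le_trans JE; apply: le_trans H _; exact: W2.
Qed.

End LowerCore.

(** * Mollification of an H1 function *)

Section Extension.
Context {R : realType}.
Notation mu3 := (vol R).
Implicit Types (f g F : pt R -> R) (x : pt R).

Definition ext (Q : set (pt R)) f : pt R -> R := f \_ Q.

Lemma ext_in Q f x : Q x -> ext Q f x = f x.
Proof. by move=> qx; rewrite /ext patchE mem_set. Qed.

Lemma ext_out Q f x : ~ Q x -> ext Q f x = 0.
Proof. by move=> qx; rewrite /ext patchE memNset. Qed.

Lemma ext_sqr Q f : (fun x => ext Q f x ^+ 2) = ext Q (fun x => f x ^+ 2).
Proof.
by apply: funext => x; have [qx|qx] := pselect (Q x); [rewrite !ext_in|rewrite !ext_out // expr0n].
Qed.

Lemma ext_integral Q f : (\int[mu3]_(x in Q) (f x)%:E = \int[mu3]_x (ext Q f x)%:E)%E.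
Proof. by rewrite integral_mkcond; apply: eq_integral => x _; rewrite [LHS](congr1 (@^~ x) (restrict_EFin f Q)). Qed.

Lemma ext_integrable Q f : measurable Q -> mu3.-integrable Q (EFin \o f) -> mu3.-integrable setT (EFin \o ext Q f).
Proof. by move=> mQ /(integrable_mkcond _ mQ); rewrite restrict_EFin. Qed.

Definition L12 f := mu3.-integrable setT (EFin \o f) /\ mu3.-integrable setT (EFin \o (fun x => f x ^+ 2)).

Lemma integrable_le f g : measurable_fun setT f -> mu3.-integrable setT (EFin \o g) ->
  (forall x, `|f x| <= g x) -> mu3.-integrable setT (EFin \o f).
Proof.
move=> mf gi H; apply: (le_integrable measurableT _ _ gi).
  exact/measurable_EFinP.
by move=> x _ /=; rewrite lee_fin; apply: (le_trans (H x)); exact: ler_norm.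
Qed.

Lemma L12D f g : L12 f -> L12 g -> L12 (fun x => f x + g x).
Proof.
move=> [f1 f2] [g1 g2]; have i := integrableD_R measurableT f1 g1; split=> //.
have j := integrableZ_R measurableT 2 (integrableD_R measurableT f2 g2).
apply: (integrable_le _ j); first by apply: measurable_funX; exact: measurable_integrable_R i.
move=> x; rewrite ger0_norm ?sqr_ge0 //.
by rewrite -subr_ge0 (_ : _ - _ = (f x - g x) ^+ 2) ?sqr_ge0 //; ring.
Qed.

Lemma L12M f (k : pt R -> R) (B : R) : L12 f -> measurable_fun setT k -> (forall x, `|k x| <= B) -> L12 (fun x => k x * f x).
Proof.
move=> [f1 f2] mk kB; split.
  by have := bounded_mul_integrable f1 mk kB; apply: eq_integrable => // x _ /=; rewrite mulrC.
have B0 : 0 <= B by exact: le_trans (kB 0).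
have k2 x : `|k x ^+ 2| <= B ^+ 2 by rewrite normrX lerXn2r // nnegrE.
have := bounded_mul_integrable f2 (measurable_funX 2 mk) k2.
by apply: eq_integrable => // x _ /=; rewrite exprMn mulrC.
Qed.

Lemma L2_ext Q f : measurable Q -> (mu3 Q < +oo)%E -> L2 Q f -> L12 (ext Q f).
Proof.
move=> mQ Qf [mf f2].
have i2 : mu3.-integrable setT (EFin \o (fun x => ext Q f x ^+ 2)).
  by rewrite ext_sqr; exact: ext_integrable.
have me : measurable_fun setT (ext Q f) by apply/(measurable_restrictT _ mQ).
have i1 : mu3.-integrable setT (EFin \o (\1_Q : pt R -> R)).
  apply/integrableP; split; first by apply/measurable_EFinP; exact: measurable_indic.
  have -> : (\int[mu3]_x `|(EFin \o \1_Q) x| = \int[mu3]_x (\1_Q x)%:E)%E.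
    by apply: eq_integral => x _; rewrite /= ger0_norm // indicE.
  by rewrite integral_indic // setIT.
split=> //; apply: (integrable_le me (integrableD_R measurableT i1 i2)) => x.
have [qx|qx] := pselect (Q x); last by rewrite ext_out // normr0 addr_ge0 ?sqr_ge0 // indicE; case: (_ \in _).
rewrite indicE mem_set //= -[ext Q f x ^+ 2]ger0_norm ?sqr_ge0 // normrX.
by have := sqr_ge0 (`|ext Q f x| - 1); have := normr_ge0 (ext Q f x); nra.
Qed.

Lemma cubeE (L : R) : cube L = box (L / 2) (L / 2) (L / 2).
Proof.
apply/seteqP; split => x; rewrite /cube /box /= => H.
  have h0 := H (@Ordinal 3 0 isT); have h1 := H (@Ordinal 3 1 isT); have h2 := H (@Ordinal 3 2 isT).
  by rewrite !ltr_norml.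
by move: H => [h0 [h1 h2]] [[|[|[|//]]] hi]; rewrite /Defs.coord /= -ltr_norml.
Qed.

End Extension.

(** * Commutators and the bounded potential *)

Section MollifiedEnergy.
Context {R : realType}.
Notation mu3 := (vol R).
Implicit Types (f g F : pt R -> R) (x : pt R).
Variables (h : R) (h0 : 0 < h).

Lemma mol_Rintegral F : (forall y, 0 <= F y) -> mu3.-integrable setT (EFin \o F) ->
  mu3.-integrable setT (EFin \o mol h F) /\ \int[mu3]_x mol h F x = \int[mu3]_x F x.
Proof.
move=> F0 Fi; have E := mol_tonelli h0 F0 Fi.
split; last by rewrite /Rintegral E.
apply/integrableP; split.
  by apply/measurable_EFinP; apply: continuous_measurable_pt; exact: continuous_mol.
have /integrableP[_] := Fi; apply: le_lt_trans.
have -> : (\int[mu3]_x `|(EFin \o mol h F) x| = \int[mu3]_x (mol h F x)%:E)%E.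
  by apply: eq_integral => x _; rewrite /= ger0_norm // mol_ge0.
rewrite E; have -> : (\int[mu3]_x `|(EFin \o F) x| = \int[mu3]_x (F x)%:E)%E; last exact: lexx.
by apply: eq_integral => x _; rewrite /= ger0_norm.
Qed.

(** Multiplication by [F] and mollification differ only by the oscillation of [F] over the support
    of the mollifier, at most [h / 2] for half a coordinate. *)
Lemma mol_commutator f F x : mu3.-integrable setT (EFin \o f) -> mu3.-integrable setT (EFin \o (fun y => F y * f y)) ->
  (forall y, box h h h (x - y) -> `|F x - F y| <= h / 2) ->
  `|F x * mol h f x - mol h (fun y => F y * f y) x| <= h / 2 * mol h (fun y => `|f y|) x.
Proof.
move=> fi Ffi HF.
have i1 := mol_integrable h0 x fi; have i2 := mol_integrable h0 x Ffi.
have i3 := mol_integrable h0 x (integrable_norm fi).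
have z1 := integrableZ_R measurableT (F x) i1.
have z3 := integrableZ_R measurableT (h / 2) i3.
have d := integrableB_R measurableT z1 i2.
rewrite /mol -!RintegralZl // -RintegralB //.
apply: (le_trans (le_normr_Rintegral measurableT d)).
apply: le_Rintegral => //; first exact: (integrable_norm d).
move=> y _; have r0 := rho_ge0 h0 (x - y).
have [b|nb] := pselect (box h h h (x - y)); last by rewrite rho_supp // !mulr0 subrr normr0.
have -> : F x * (f y * rho h (x - y)) - F y * f y * rho h (x - y) = (F x - F y) * (f y * rho h (x - y)) by ring.
rewrite (normrM (F x - F y)); apply: ler_pM => //; first exact: HF.
by rewrite (normrM (f y)) (ger0_norm r0).
Qed.

Lemma commutator_sq f g F x (tau : R) : 0 < tau -> L12 f -> L12 g -> L12 (fun y => F y * f y) ->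
  (forall y, box h h h (x - y) -> `|F x - F y| <= h / 2) ->
  (mol h g x + F x * mol h f x) ^+ 2 <= (1 + tau) * mol h (fun y => (g y + F y * f y) ^+ 2) x
    + (1 + tau^-1) * (h ^+ 2 / 4) * mol h (fun y => f y ^+ 2) x.
Proof.
move=> t0 [f1 f2] Lg LF HF; have [a1 a2] := L12D Lg LF; have [g1 g2] := Lg; have [F1 F2] := LF.
have c := mol_commutator f1 F1 HF.
have E : mol h g x + F x * mol h f x = mol h (fun y => g y + F y * f y) x + (F x * mol h f x - mol h (fun y => F y * f y) x).
  by rewrite molD //; ring.
have J1 := mol_jensen h0 x a1 a2.
have n1 : mu3.-integrable setT (EFin \o (fun y => `|f y|)) by exact: integrable_norm.
have n2 : mu3.-integrable setT (EFin \o (fun y => `|f y| ^+ 2)).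
  by move: f2; apply: eq_integrable => // y _ /=; rewrite -normrX ger0_norm // sqr_ge0.
have J2 := mol_jensen h0 x n1 n2.
have J2' : mol h (fun y => `|f y|) x ^+ 2 <= mol h (fun y => f y ^+ 2) x.
  apply: (le_trans J2); rewrite le_eqVlt; apply/orP; left; apply/eqP.
  by congr (mol h _ x); apply: funext => y; rewrite -normrX ger0_norm // sqr_ge0.
rewrite E; move: c J1 J2'; set u := mol h (fun y => g y + F y * f y) x; set v := F x * _ - _.
set w := mol h (fun y => `|f y|) x; set A := mol h (fun y => (g y + F y * f y) ^+ 2) x; set B := mol h (fun y => f y ^+ 2) x.
move=> c J1 J3.
have w0 : 0 <= w by apply: mol_ge0.
have v2 : v ^+ 2 <= h ^+ 2 / 4 * B.
  have : `|v| ^+ 2 <= (h / 2 * w) ^+ 2 by rewrite lerXn2r ?nnegrE // mulr_ge0 // divr_ge0 // ltW.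
  rewrite -normrX ger0_norm ?sqr_ge0 // => H; apply: (le_trans H); rewrite exprMn expr_div_n.
  by rewrite (_ : 2 ^+ 2 = 4 :> R); [rewrite ler_wpM2l // divr_ge0 ?sqr_ge0|ring].
have ti : 0 < tau^-1 by rewrite invr_gt0.
have young : (u + v) ^+ 2 <= (1 + tau) * u ^+ 2 + (1 + tau^-1) * v ^+ 2.
  rewrite -subr_ge0 (_ : _ - _ = tau^-1 * (tau * u - v) ^+ 2); last by field; rewrite gt_eqF.
  by rewrite mulr_ge0 ?sqr_ge0 // ltW.
apply: (le_trans young); rewrite -mulrA; apply: lerD; apply: ler_wpM2l => //; [move: t0|move: ti]; clear; lra.
Qed.

Definition gam (p q : R) : R := (1 - (p ^+ 2 + q ^+ 2)) / (1 + (p ^+ 2 + q ^+ 2)).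

(** Since [|a| / (1 + a ^+ 2) <= 1 / 2], [gam] is globally Lipschitz; being also bounded by 1, its
    square is Lipschitz. Hence an [L^1] bound on the mollification error controls the potential
    term. *)
Lemma gam_lip p q p' q' : gam p q ^+ 2 <= gam p' q' ^+ 2 + 4 * (`|p - p'| + `|q - q'|).
Proof.
set n := p ^+ 2 + q ^+ 2; set n' := p' ^+ 2 + q' ^+ 2.
have pos : 0 < 1 + n by rewrite ltr_pwDl // addr_ge0 // sqr_ge0.
have pos' : 0 < 1 + n' by rewrite ltr_pwDl // addr_ge0 // sqr_ge0.
have b1 (a c : R) : `|gam a c| <= 1.
  have ac : 0 <= a ^+ 2 + c ^+ 2 by rewrite addr_ge0 // sqr_ge0.
  have k : 0 < 1 + (a ^+ 2 + c ^+ 2) by rewrite ltr_pwDl.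
  rewrite /gam ler_norml; apply/andP; split; [rewrite ler_pdivlMr //|rewrite ler_pdivrMr //]; lra.
have half (a c : R) : `|a| / (1 + (a ^+ 2 + c ^+ 2)) <= 2^-1.
  have k : 0 < 1 + (a ^+ 2 + c ^+ 2) by rewrite ltr_pwDl // addr_ge0 // sqr_ge0.
  rewrite ler_pdivrMr //; have : a ^+ 2 = `|a| ^+ 2 by rewrite -normrX ger0_norm // sqr_ge0.
  by move=> ->; have := sqr_ge0 (`|a| - 1); have := sqr_ge0 c; nra.
have half' (a c : R) : `|c| / (1 + (a ^+ 2 + c ^+ 2)) <= 2^-1 by rewrite (addrC (a ^+ 2)); exact: half.
have key (a a' : R) : `|a| / (1 + n) <= 2^-1 -> `|a'| / (1 + n') <= 2^-1 -> `|(a' - a) * (a' + a)| / ((1 + n) * (1 + n')) <= `|a - a'|.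
  move=> h1 h2; rewrite normrM distrC -mulrA ler_piMr //.
  have n1 : 1 <= 1 + n by rewrite lerDl addr_ge0 // sqr_ge0.
  have n2 : 1 <= 1 + n' by rewrite lerDl addr_ge0 // sqr_ge0.
  rewrite ler_pdivrMr ?mulr_gt0 // mul1r; apply: (le_trans (ler_normD _ _)).
  rewrite ler_pdivrMr // in h1; rewrite ler_pdivrMr // in h2; nra.
have D : `|gam p q - gam p' q'| <= 2 * (`|p - p'| + `|q - q'|).
  have -> : gam p q - gam p' q' = 2 * ((p' - p) * (p' + p) / ((1 + n) * (1 + n')) + (q' - q) * (q' + q) / ((1 + n) * (1 + n'))).
    by rewrite /gam -/n -/n'; rewrite /n /n' in pos pos' *; field; rewrite !gt_eqF.
  rewrite normrM ger0_norm // ler_wpM2l //; apply: (le_trans (ler_normD _ _)).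
  have mp : 0 < (1 + n) * (1 + n') by rewrite mulr_gt0.
  by rewrite !normrM !normfV !(gtr0_norm mp) -!normrM; apply: lerD; apply: key; rewrite ?half ?half'.
have := b1 p q; have := b1 p' q'; move: D; move: (gam p q) (gam p' q') => a b D h1 h2.
have : (a - b) * (a + b) <= 4 * (`|p - p'| + `|q - q'|).
  apply: (le_trans (ler_norm _)); rewrite normrM.
  have : `|a + b| <= 2 by apply: (le_trans (ler_normD _ _)); lra.
  by move=> h3; have := ler_pM (normr_ge0 _) (normr_ge0 _) D h3; lra.
by rewrite !expr2; lra.
Qed.

End MollifiedEnergy.

Section SignedMollification.
Context {R : realType}.
Notation mu3 := (vol R).

Lemma RintZ (c : R) (f : pt R -> R) : mu3.-integrable setT (EFin \o f) ->
  \int[mu3]_x (c * f x) = c * \int[mu3]_x f x.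
Proof. by move=> fi; rewrite RintegralZl. Qed.

Lemma mol_abs_integrable (h : R) (f : pt R -> R) : 0 < h -> mu3.-integrable setT (EFin \o f) ->
  mu3.-integrable setT (EFin \o (fun x => `|mol h f x - f x|)).
Proof.
move=> h0 fi; have ni := integrable_norm fi.
have [ai _] := mol_Rintegral h0 (fun x => normr_ge0 (f x)) ni.
have mi : mu3.-integrable setT (EFin \o mol h f).
  apply: (integrable_le _ ai); first by apply: continuous_measurable_pt; exact: continuous_mol.
  move=> x; have i := mol_integrable h0 x fi.
  apply: (le_trans (le_normr_Rintegral measurableT i)); apply: le_Rintegral => //.
  - exact: (integrable_norm i).
  - exact: mol_integrable.
  - by move=> y _; rewrite (normrM (f y)) (ger0_norm (rho_ge0 h0 _)).
by have := integrable_norm (integrableB_R measurableT mi fi).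
Qed.

Lemma linear_sum4 (t c X Y A1 A2 A3 A4 m1 m2 m3 m4 : R) :
  A1 <= (1 + t) * m1 + c * X -> A2 <= (1 + t) * m2 + c * X -> A3 <= (1 + t) * m3 + c * Y -> A4 <= (1 + t) * m4 + c * Y ->
  A1 + A2 + A3 + A4 <= (1 + t) * (m1 + m2 + (m3 + m4)) + c * (2 * (Y + X)).
Proof. lra. Qed.

End SignedMollification.

(** * The mollified competitor *)

Section Witness.
Context {R : realType}.
Notation mu3 := (vol R).
Variables (L eps : R) (p q : pt R -> R) (gp gq : 'I_3 -> pt R -> R).
Hypotheses (L0 : 0 < L) (eps0 : 0 < eps) (W : H1_witness (cube L) p q gp gq).
Let Q : set (pt R) := cube L.
Let k0 : 'I_3 := 0.
Let k1 : 'I_3 := 1.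
Let p' := ext Q p.
Let q' := ext Q q.

Lemma mQ : measurable Q.
Proof. by rewrite /Q cubeE; exact: measurable_box. Qed.

Lemma half_gt0 : 0 < L / 2. Proof. by rewrite divr_gt0. Qed.

Lemma volQ : mu3 Q = (L ^+ 3)%:E.
Proof.
rewrite /Q cubeE [LHS](vol_box half_gt0 half_gt0 half_gt0); congr (_%:E); by field.
Qed.

Lemma finQ : (mu3 Q < +oo)%E. Proof. by rewrite volQ ltry. Qed.

Lemma Lp : L12 p'. Proof. by case: W => h _ _ _; exact: L2_ext mQ finQ h. Qed.
Lemma Lq : L12 q'. Proof. by case: W => _ h _ _; exact: L2_ext mQ finQ h. Qed.
Lemma Lgp j : L12 (ext Q (gp j)). Proof. by case: W => _ _ h _; have [H _] := h j; exact: L2_ext mQ finQ H. Qed.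
Lemma Lgq j : L12 (ext Q (gq j)). Proof. by case: W => _ _ _ h; have [H _] := h j; exact: L2_ext mQ finQ H. Qed.

(** At these points the reflected mollifier is a legitimate test function, and the two minus signs,
    from the reflection and from the weak derivative, cancel. *)
Lemma dmol_weak (h : R) (j : 'I_3) (f g : pt R -> R) (x : pt R) : 0 < h ->
  L12 (ext Q f) -> L12 (ext Q g) -> weak_deriv Q j f g ->
  box (L / 2 - h) (L / 2 - h) (L / 2 - h) x -> dmol h j (ext Q f) x = mol h (ext Q g) x.
Proof.
move=> h0 [f1 _] [g1 _] wd [b1 [b2 b3]].
have xQ (y : pt R) : [/\ `|x.1.1 - y.1.1| <= h, `|x.1.2 - y.1.2| <= h & `|x.2 - y.2| <= h] -> Q y.
  move=> [c1 c2 c3]; rewrite /Q cubeE.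
  have tri (u v : R) : `|u| < L / 2 - h -> `|u - v| <= h -> `|v| < L / 2.
    move=> hu huv; have : `|v| <= `|u| + `|u - v|.
      by rewrite -{1}(subKr u v); exact: ler_normB.
    by lra.
  by split; [|split]; [exact: tri b1 c1|exact: tri b2 c2|exact: tri b3 c3].
have [tf pd] := rho_test h0 xQ.
have := wd _ tf.
have -> : (\int[leb3 (R:=R)]_(x0 in Q) (f x0 * pderiv j (fun y => rho h (x - y)) x0)%:E =
   (- dmol h j (ext Q f) x)%:E)%E.
  rewrite [LHS](ext_integral Q (fun y => f y * pderiv j (fun y => rho h (x - y)) y)).
  have di := dmol_integrable h0 x j f1.
  rewrite /dmol -mulN1r -RintegralZl // EFin_Rintegral //; last exact: integrableZ_R.
  apply: eq_integral => y _; congr (_%:E).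
  by have [qy|qy] := pselect (Q y); [rewrite !ext_in // pd mulN1r mulrN|rewrite !ext_out // mul0r mulr0].
have -> : (\int[leb3 (R:=R)]_(x0 in Q) (g x0 * rho h (x - x0))%:E = (mol h (ext Q g) x)%:E)%E.
  rewrite [LHS](ext_integral Q (fun y => g y * rho h (x - y))).
  rewrite /mol EFin_Rintegral //; last exact: mol_integrable.
  apply: eq_integral => y _; congr (_%:E).
  by have [qy|qy] := pselect (Q y); [rewrite !ext_in|rewrite !ext_out // mul0r].
by move=> E; move: E; rewrite -EFinN => -[] /oppr_inj.
Qed.

Let F1 (x : pt R) := - (x.1.2 / 2).
Let F2 (x : pt R) := x.1.1 / 2.

(** The potential is unbounded on the whole space, but after extension by zero only its values on
    the cube count. *)
Lemma L12_field (F f : pt R -> R) : measurable_fun setT F -> (forall x, Q x -> `|F x| <= L) ->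
  L12 (ext Q f) -> L12 (fun x => F x * ext Q f x).
Proof.
move=> mF bF Lf.
have -> : (fun x => F x * ext Q f x) = (fun x => (F x * \1_Q x) * ext Q f x).
  apply: funext => x; have [qx|qx] := pselect (Q x); last by rewrite !ext_out // !mulr0.
  by rewrite indicE mem_set // mulr1.
apply: (@L12M _ _ _ L) => //.
  by apply: measurable_funM => //; apply: measurable_indic; exact: mQ.
move=> x; have [qx|qx] := pselect (Q x); last by rewrite indicE memNset // mulr0 normr0 ltW.
by rewrite indicE mem_set // mulr1; exact: bF.
Qed.

Lemma F_facts : [/\ measurable_fun setT F1, measurable_fun setT F2, forall x, Q x -> `|F1 x| <= L & forall x, Q x -> `|F2 x| <= L].
Proof.
split.
- by apply: measurable_funN; apply: measurable_funM => //; exact: measurable_pt2.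
- by apply: measurable_funM => //; exact: measurable_pt1.
- move=> x; rewrite /Q cubeE => -[_ [h _]]; rewrite /F1 normrN normrM.
  by rewrite [X in _ * X]ger0_norm ?invr_ge0 //; have := L0; lra.
- move=> x; rewrite /Q cubeE => -[h _]; rewrite /F2 normrM.
  by rewrite [X in _ * X]ger0_norm ?invr_ge0 //; have := L0; lra.
Qed.

Lemma F_osc (h : R) (x y : pt R) : box h h h (x - y) -> [/\ `|F1 x - F1 y| <= h / 2, `|F2 x - F2 y| <= h / 2,
   `|- F1 x - - F1 y| <= h / 2 & `|- F2 x - - F2 y| <= h / 2].
Proof.
move=> [/= c1 [c2 _]].
have e1 : F1 x - F1 y = - ((x.1.2 - y.1.2) / 2) by rewrite /F1; field.
have e2 : F2 x - F2 y = (x.1.1 - y.1.1) / 2 by rewrite /F2; field.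
have n2 (z : R) : `|z / 2| = `|z| / 2 by rewrite normrM [X in _ * X]ger0_norm // invr_ge0.
have e3 : - F1 x - - F1 y = (x.1.2 - y.1.2) / 2 by rewrite /F1; field.
have e4 : - F2 x - - F2 y = - ((x.1.1 - y.1.1) / 2) by rewrite /F2; field.
by split; rewrite ?e1 ?e2 ?e3 ?e4 ?normrN n2 ler_pM2r ?invr_gt0 // ltW.
Qed.

Let a1 x := ext Q (gp k0) x + F1 x * q' x.
Let a2 x := ext Q (gp k1) x + F2 x * q' x.
Let c1 x := ext Q (gq k0) x + - F1 x * p' x.
Let c2 x := ext Q (gq k1) x + - F2 x * p' x.
Let pot x := ext Q (fun x => (1 - (p x ^+ 2 + q x ^+ 2)) ^+ 2) x.

Lemma field_L12 : [/\ L12 (fun x => F1 x * q' x), L12 (fun x => F2 x * q' x),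
   L12 (fun x => - F1 x * p' x) & L12 (fun x => - F2 x * p' x)].
Proof.
have [m1 m2 b1 b2] := F_facts.
split; apply: L12_field => //; try exact: Lp; try exact: Lq; try exact: measurable_funN.
- by move=> x qx; rewrite normrN b1.
- by move=> x qx; rewrite normrN b2.
Qed.

Hypothesis potI : mu3.-integrable setT (EFin \o pot).

Definition molP h := mol h p'.
Definition molQ h := mol h q'.
(** The potential stays outside [mol]: this is the covariant derivative of the mollification, as the
    phase argument requires, and not the mollified covariant derivative. Their difference is the
    commutator. *)
Definition molA (k : 'I_3) (F : pt R -> R) h (x : pt R) := mol h (ext Q (gp k)) x + F x * molQ h x.
Definition molB (k : 'I_3) (F : pt R -> R) h (x : pt R) := mol h (ext Q (gq k)) x + - F x * molP h x.
Let E h := em (L / 2 - h) eps (molP h) (molQ h) (molA k0 F1 h) (molA k1 F2 h) (molB k0 F1 h) (molB k1 F2 h).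

Lemma F_cont : continuous F1 /\ continuous F2.
Proof.
have d1 : continuous (fun x : pt R => x.1.2).
  by move=> x; apply: (cvg_comp fst snd); [exact: cvg_fst|exact: cvg_snd].
have d2 : continuous (fun x : pt R => x.1.1).
  by move=> x; apply: (cvg_comp fst fst); [exact: cvg_fst|exact: cvg_fst].
by split; [apply: ptN|]; apply: ptM => //; exact: ptC.
Qed.

Lemma mol_conts h : 0 < h -> [/\ continuous (molP h), continuous (molQ h),
   forall k, continuous (molA k F1 h) /\ continuous (molA k F2 h) & forall k, continuous (molB k F1 h) /\ continuous (molB k F2 h)].
Proof.
move=> h0; have [cF1 cF2] := F_cont.
have cp : continuous (molP h) by apply: continuous_mol => //; have [] := Lp.
have cq : continuous (molQ h) by apply: continuous_mol => //; have [] := Lq.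
have cm f : L12 f -> continuous (mol h f) by move=> [fi _]; exact: continuous_mol.
have n1 := ptN cF1; have n2 := ptN cF2.
split=> // k; [have c := cm _ (Lgp k)|have c := cm _ (Lgq k)].
  by split; apply: (ptD c); exact: ptM.
by split; apply: (ptD c); exact: ptM.
Qed.

Definition D0 := \int[mu3]_x (a1 x ^+ 2 + a2 x ^+ 2 + (c1 x ^+ 2 + c2 x ^+ 2)).

Lemma cov_L12 : [/\ L12 a1, L12 a2, L12 c1 & L12 c2].
Proof.
have [l1 l2 l3 l4] := field_L12.
by split; apply: L12D => //; [exact: Lgp|exact: Lgp|exact: Lgq|exact: Lgq].
Qed.

(** Inside the smaller cube the covariant derivatives are treated by [commutator_sq] and the
    potential by [gam_lip]; outside it the density on the left is zero. Mollification preserves the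
    integrals of the nonnegative densities. *)
Lemma energy_mol (h tau e : R) : 0 < h -> 0 < tau ->
  \int[mu3]_x `|molP h x - p' x| <= e -> \int[mu3]_x `|molQ h x - q' x| <= e ->
  mu3.-integrable setT (EFin \o E h) /\
  \int[mu3]_x E h x <= (1 + tau) * D0
    + (1 + tau^-1) * (h ^+ 2 / 4) * (2 * (\int[mu3]_x (p' x ^+ 2) + \int[mu3]_x (q' x ^+ 2)))
    + (2 * eps ^+ 2)^-1 * (\int[mu3]_x pot x + 4 * (e + e)).
Proof.
move=> h0 t0 eP eQ.
have [[p1 p2] [q1 q2]] := (Lp, Lq).
have [La1 La2 Lc1 Lc2] := cov_L12; have [l1 l2 l3 l4] := field_L12.
have [cP cQ cA cB] := mol_conts h0.
have sq0 (f : pt R -> R) x : 0 <= f x ^+ 2 by exact: sqr_ge0.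
have [ia1 ea1] := mol_Rintegral h0 (sq0 a1) La1.2.
have [ia2 ea2] := mol_Rintegral h0 (sq0 a2) La2.2.
have [ic1 ec1] := mol_Rintegral h0 (sq0 c1) Lc1.2.
have [ic2 ec2] := mol_Rintegral h0 (sq0 c2) Lc2.2.
have [ip ep] := mol_Rintegral h0 (sq0 p') p2.
have [iq eq_] := mol_Rintegral h0 (sq0 q') q2.
have pos_t : 0 <= 1 + tau by rewrite addr_ge0 // ltW.
have pos_ti : 0 <= (1 + tau^-1) * (h ^+ 2 / 4) by rewrite mulr_ge0 ?divr_ge0 ?sqr_ge0 // addr_ge0 // invr_ge0 ltW.
have pos_e : 0 <= (2 * eps ^+ 2)^-1 by rewrite invr_ge0 mulr_ge0 // sqr_ge0.
have mint f : L12 f -> mu3.-integrable setT (EFin \o (fun x => `|mol h f x - f x|)).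
  by move=> [fi _]; exact: mol_abs_integrable.
have ipP := mint _ Lp; have iqQ := mint _ Lq.
have D12 := integrableD_R measurableT ia1 ia2; have D34 := integrableD_R measurableT ic1 ic2.
have DD := integrableD_R measurableT D12 D34.
have T1 := integrableZ_R measurableT (1 + tau) DD.
have PQ := integrableZ_R measurableT 2 (integrableD_R measurableT ip iq).
have T2 := integrableZ_R measurableT ((1 + tau^-1) * (h ^+ 2 / 4)) PQ.
have S4 := integrableZ_R measurableT 4 (integrableD_R measurableT ipP iqQ).
have S5 := integrableD_R measurableT potI S4.
have T3 := integrableZ_R measurableT (2 * eps ^+ 2)^-1 S5.
have T12 := integrableD_R measurableT T1 T2.
have T := integrableD_R measurableT T12 T3.
have E0 x : 0 <= E h x by exact: em_ge0.
have pot0 x : 0 <= pot x.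
  by rewrite /pot; have [qx|qx] := pselect (Q x); [rewrite ext_in // sqr_ge0|rewrite ext_out].
have m0 f x : 0 <= mol h (fun x => f x ^+ 2) x by apply: mol_ge0 => // y; exact: sqr_ge0.
have mE : measurable_fun setT (E h).
  apply: measurable_funM; last by apply: measurable_indic; exact: measurable_box.
  by apply: continuous_measurable_pt; apply: efun_cont => //; [exact: (cA k0).1|exact: (cA k1).2|exact: (cB k0).1|exact: (cB k1).2].
have key x : E h x <= (1 + tau) * (mol h (fun x => a1 x ^+ 2) x + mol h (fun x => a2 x ^+ 2) x
       + (mol h (fun x => c1 x ^+ 2) x + mol h (fun x => c2 x ^+ 2) x))
     + (1 + tau^-1) * (h ^+ 2 / 4) * (2 * (mol h (fun x => p' x ^+ 2) x + mol h (fun x => q' x ^+ 2) x))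
     + (2 * eps ^+ 2)^-1 * (pot x + 4 * (`|molP h x - p' x| + `|molQ h x - q' x|)).
  have [qm|nqm] := pselect (box (L / 2 - h) (L / 2 - h) (L / 2 - h) x); last first.
    by rewrite /E /em indicE memNset // mulr0 !addr_ge0 // mulr_ge0 // ?addr_ge0 ?mulr_ge0 ?addr_ge0.
  have qx : Q x.
    move: qm => [b1 [b2 b3]]; rewrite /Q cubeE; have hh : L / 2 - h < L / 2 by rewrite gtrBl.
    by split; [|split]; apply: lt_trans hh.
  rewrite /E /em indicE mem_set // mulr1 /efun.
  have O y b := F_osc b : [/\ `|F1 x - F1 y| <= h / 2, `|F2 x - F2 y| <= h / 2,
     `|- F1 x - - F1 y| <= h / 2 & `|- F2 x - - F2 y| <= h / 2].
  have k1' := commutator_sq h0 t0 Lq (Lgp k0) l1 (fun y b => let: And4 H _ _ _ := O y b in H).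
  have k2' := commutator_sq h0 t0 Lq (Lgp k1) l2 (fun y b => let: And4 _ H _ _ := O y b in H).
  have k3' := commutator_sq h0 t0 Lp (Lgq k0) l3 (fun y b => let: And4 _ _ H _ := O y b in H).
  have k4' := commutator_sq h0 t0 Lp (Lgq k1) l4 (fun y b => let: And4 _ _ _ H := O y b in H).
  have g1 := gam_lip (molP h x) (molQ h x) (p' x) (q' x).
  have g2 : gam (p' x) (q' x) ^+ 2 <= pot x.
    rewrite /pot ext_in // /p' /q' !ext_in // /gam expr_div_n.
    have n0 : 0 <= p x ^+ 2 + q x ^+ 2 by rewrite addr_ge0 // sqr_ge0.
    by rewrite ler_pdivrMr ?exprn_gt0 ?ltr_pwDl // ler_peMr ?sqr_ge0 // exprn_ege1 // lerDl.
  have g3 : gfun (molP h) (molQ h) x ^+ 2 / (2 * eps ^+ 2) <= (2 * eps ^+ 2)^-1 * (pot x + 4 * (`|molP h x - p' x| + `|molQ h x - q' x|)).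
    rewrite mulrC ler_wpM2l //; apply: (le_trans g1); rewrite lerD2r; exact: g2.
  apply: lerD; last exact: g3.
  rewrite -/(molA k0 F1 h x) in k1'; rewrite -/(molA k1 F2 h x) in k2'.
  rewrite -/(molB k0 F1 h x) in k3'; rewrite -/(molB k1 F2 h x) in k4'.
  move: k1' k2' k3' k4'; rewrite -/a1 -/a2 -/c1 -/c2.
  exact: linear_sum4.
have EI : mu3.-integrable setT (EFin \o E h).
  by apply: (integrable_le mE T) => x; rewrite ger0_norm.
split=> //.
have := le_Rintegral measurableT EI T (fun x _ => key x).
move/le_trans; apply.
rewrite (RintegralD measurableT T12 T3) (RintegralD measurableT T1 T2).
rewrite (RintZ _ DD) (RintZ _ PQ) (RintZ _ S5).
rewrite (RintegralD measurableT D12 D34) (RintegralD measurableT ia1 ia2) (RintegralD measurableT ic1 ic2).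
rewrite (RintZ _ (integrableD_R measurableT ip iq)) (RintegralD measurableT ip iq).
rewrite (RintegralD measurableT potI S4) (RintZ _ (integrableD_R measurableT ipP iqQ)) (RintegralD measurableT ipP iqQ).
rewrite ea1 ea2 ec1 ec2 ep eq_.
have -> : D0 = \int[mu3]_x (a1 x ^+ 2) + \int[mu3]_x (a2 x ^+ 2) + (\int[mu3]_x (c1 x ^+ 2) + \int[mu3]_x (c2 x ^+ 2)).
  have [[_ s1] [_ s2] [_ s3] [_ s4]] := cov_L12.
  rewrite /D0 (RintegralD measurableT (integrableD_R measurableT s1 s2) (integrableD_R measurableT s3 s4)).
  by rewrite (RintegralD measurableT s1 s2) (RintegralD measurableT s3 s4).
rewrite lerD2l; apply: ler_wpM2l => //; rewrite lerD2l; apply: ler_wpM2l => //; exact: lerD.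
Qed.

End Witness.

Lemma six_sum_le (R : realFieldType) (L C1 C2 C3 C4 C5 C6 : R) : 0 <= C1 -> 0 <= C2 -> 0 <= C3 -> 0 <= C4 -> 0 <= C5 -> 0 <= C6 ->
  0 <= L * C1 -> 0 <= L * C2 -> forall u, [\/ u = C1, u = C2, u = C3 + L * C2 \/ u = C4 + L * C2 | u = C5 + L * C1 \/ u = C6 + L * C1] ->
  u <= C1 + C2 + C3 + C4 + C5 + C6 + L * C1 + L * C2.
Proof. by move=> ? ? ? ? ? ? ? ? u [->|->|[->|->]|[->|->]]; lra. Qed.

(** * The lower bound for one competitor *)

Section WitnessLower.
Context {R : realType}.
Notation mu3 := (vol R).
Variables (L eps G : R) (p q : pt R -> R) (gp gq : 'I_3 -> pt R -> R).
Hypotheses (L0 : 0 < L) (eps0 : 0 < eps) (W : H1_witness (cube L) p q gp gq).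
(** The energy is finite and written with [eps ^+ 2] factored out, so that [G] is the energy divided
    by [b]. *)
Hypothesis EG : G_Q (eps ^+ 2) L p q gp gq = (eps ^+ 2 * G)%:E.
Let Q : set (pt R) := cube L.
Let k0 : 'I_3 := 0.
Let k1 : 'I_3 := 1.
Let k2 : 'I_3 := ord_max.
Let p' := ext Q p.
Let q' := ext Q q.
Let F1 (x : pt R) := - (x.1.2 / 2).
Let F2 (x : pt R) := x.1.1 / 2.
Let a1 x := ext Q (gp k0) x + F1 x * q' x.
Let a2 x := ext Q (gp k1) x + F2 x * q' x.
Let c1 x := ext Q (gq k0) x + - F1 x * p' x.
Let c2 x := ext Q (gq k1) x + - F2 x * p' x.
Let pot x := ext Q (fun x => (1 - (p x ^+ 2 + q x ^+ 2)) ^+ 2) x.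
Let dens x := eps ^+ 2 * (a1 x ^+ 2 + a2 x ^+ 2 + (c1 x ^+ 2 + c2 x ^+ 2)
   + (ext Q (gp k2) x ^+ 2 + ext Q (gq k2) x ^+ 2)) + 2^-1 * pot x.

Lemma dens_ext x : ext Q (GL_density (eps ^+ 2) p q gp gq) x = dens x.
Proof.
rewrite /dens /a1 /a2 /c1 /c2 /pot /p' /q'.
have [qx|qx] := pselect (Q x); last first.
  by rewrite !ext_out // !mulr0 !addr0 !expr0n /= !addr0 mulr0.
rewrite !ext_in // /GL_density !big_ord_recl big_ord0 /Fpot /=.
rewrite (_ : lift ord0 ord0 = k1); last exact: val_inj.
rewrite (_ : lift ord0 (lift ord0 ord0) = k2); last exact: val_inj.
rewrite (_ : ord0 = k0); last exact: val_inj.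
by rewrite /F1 /F2; ring.
Qed.

Lemma pot_ge0 x : 0 <= pot x.
Proof. by rewrite /pot; have [qx|qx] := pselect (Q x); [rewrite ext_in // sqr_ge0|rewrite ext_out]. Qed.

Lemma dens_ge0 x : 0 <= dens x.
Proof.
rewrite /dens addr_ge0 //; first by rewrite mulr_ge0 ?sqr_ge0 // !addr_ge0 ?sqr_ge0.
by rewrite mulr_ge0 ?invr_ge0 // pot_ge0.
Qed.

Lemma dens_integral : mu3.-integrable setT (EFin \o dens) /\ \int[mu3]_x dens x = eps ^+ 2 * G.
Proof.
have [[m1 _] [m2 _] [m3 _] [m4 _]] := cov_L12 L0 W.
have mp := measurable_integrable_R (Lp L0 W).1; have mq := measurable_integrable_R (Lq L0 W).1.
have mg := measurable_integrable_R (Lgp L0 W k2).1; have mg' := measurable_integrable_R (Lgq L0 W k2).1.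
have mpot : measurable_fun setT pot.
  have E : pot = fun x => (1 - (p' x ^+ 2 + q' x ^+ 2)) ^+ 2 * \1_Q x.
    apply: funext => x; rewrite /pot /p' /q'; have [qx|qx] := pselect (Q x).
      by rewrite !ext_in // indicE mem_set // mulr1.
    by rewrite ext_out // indicE memNset // mulr0.
  rewrite E; apply: measurable_funM; last by apply: measurable_indic; exact: mQ.
  by apply: measurable_funX; apply: measurable_funB => //; apply: measurable_funD; exact: measurable_funX.
have md : measurable_fun setT dens.
  apply: measurable_funD; last exact: measurable_funM.
  apply: measurable_funM => //; apply: measurable_funD; last by apply: measurable_funD; exact: measurable_funX.
  apply: measurable_funD; apply: measurable_funD; apply: measurable_funX.
  - exact: (measurable_integrable_R m1).
  - exact: (measurable_integrable_R m2).
  - exact: (measurable_integrable_R m3).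
  - exact: (measurable_integrable_R m4).
have I : (\int[mu3]_x (dens x)%:E = (eps ^+ 2 * G)%:E)%E.
  rewrite -EG /G_Q [RHS](ext_integral Q (GL_density (eps ^+ 2) p q gp gq)).
  by apply: eq_integral => x _; rewrite dens_ext.
split; last by rewrite /Rintegral I.
apply/integrableP; split; first exact/measurable_EFinP.
have -> : (\int[mu3]_x `|(EFin \o dens) x| = \int[mu3]_x (dens x)%:E)%E.
  by apply: eq_integral => x _; rewrite /= ger0_norm // dens_ge0.
by rewrite I ltry.
Qed.

Lemma potI : mu3.-integrable setT (EFin \o pot).
Proof.
have [di _] := dens_integral.
have mpot : measurable_fun setT pot.
  have mp := measurable_integrable_R (Lp L0 W).1; have mq := measurable_integrable_R (Lq L0 W).1.
  have E : pot = fun x => (1 - (p' x ^+ 2 + q' x ^+ 2)) ^+ 2 * \1_Q x.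
    apply: funext => x; rewrite /pot /p' /q'; have [qx|qx] := pselect (Q x).
      by rewrite !ext_in // indicE mem_set // mulr1.
    by rewrite ext_out // indicE memNset // mulr0.
  rewrite E; apply: measurable_funM; last by apply: measurable_indic; exact: mQ.
  by apply: measurable_funX; apply: measurable_funB => //; apply: measurable_funD; exact: measurable_funX.
apply: (integrable_le mpot (integrableZ_R measurableT 2 di)) => x.
rewrite ger0_norm ?pot_ge0 // /dens.
set S := _ + (_ + _ : R); have S0 : 0 <= S by rewrite /S !addr_ge0 ?sqr_ge0.
have -> : 2 * (eps ^+ 2 * S + 2^-1 * pot x) = 2 * (eps ^+ 2 * S) + pot x by field.
by rewrite lerDr mulr_ge0 // mulr_ge0 // sqr_ge0.
Qed.

(** The vertical derivatives are dropped: the estimate of the current is purely horizontal. *)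
Lemma energy_split : D0 L p q gp gq + (2 * eps ^+ 2)^-1 * \int[mu3]_x pot x <= G.
Proof.
have [di Ed] := dens_integral; have pI := potI.
have [[_ s1] [_ s2] [_ s3] [_ s4]] := cov_L12 L0 W.
have e2 : 0 < eps ^+ 2 by rewrite exprn_gt0.
have i4 := integrableD_R measurableT (integrableD_R measurableT s1 s2) (integrableD_R measurableT s3 s4).
have zp := integrableZ_R measurableT (2 * eps ^+ 2)^-1 pI.
have -> : G = \int[mu3]_x (eps ^- 2 * dens x) by rewrite RintZ // Ed mulrA mulVf ?mul1r // gt_eqF.
rewrite -RintZ // /D0 -(RintegralD measurableT i4 zp).
apply: (le_Rintegral measurableT (integrableD_R measurableT i4 zp) (integrableZ_R measurableT _ di)) => x _.
rewrite -/(a1 x) -/(a2 x) -/(c1 x) -/(c2 x) /dens.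
have -> : eps ^- 2 * (eps ^+ 2 * (a1 x ^+ 2 + a2 x ^+ 2 + (c1 x ^+ 2 + c2 x ^+ 2)
   + (ext Q (gp k2) x ^+ 2 + ext Q (gq k2) x ^+ 2)) + 2^-1 * pot x) =
  (a1 x ^+ 2 + a2 x ^+ 2 + (c1 x ^+ 2 + c2 x ^+ 2) + (2 * eps ^+ 2)^-1 * pot x)
   + (ext Q (gp k2) x ^+ 2 + ext Q (gq k2) x ^+ 2) by field; rewrite gt_eqF.
by rewrite lerDl addr_ge0 // sqr_ge0.
Qed.

Let E h := em (L / 2 - h) eps (molP L p h) (molQ L q h) (molA L q gp k0 F1 h) (molA L q gp k1 F2 h) (molB L p gq k0 F1 h) (molB L p gq k1 F2 h).

Lemma mol_error (f : pt R -> R) (e : R) : 0 < e -> mu3.-integrable setT (EFin \o f) ->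
  exists2 d, 0 < d & forall h, 0 < h -> h <= d -> \int[mu3]_x `|mol h f x - f x| <= e.
Proof.
move=> e0 fi; have [d d0 Hd] := L1_continuous_vol fi e0.
exists d => // h h0 hd; rewrite -lee_fin EFin_Rintegral //; last exact: mol_abs_integrable.
apply: mol_L1_bound => // z z1 z2 z3; apply: Hd; exact: le_trans hd.
Qed.

Lemma mol_bounded (h : R) (f : pt R -> R) : 0 < h -> mu3.-integrable setT (EFin \o f) ->
  exists2 C, 0 <= C & forall x, `|mol h f x| <= C.
Proof.
move=> h0 fi; have ni := integrable_norm fi.
exists ((bump_mass h)^-1 * \int[mu3]_x `|f x|).
  by rewrite mulr_ge0 ?invr_ge0 ?(ltW (bump_mass_gt0 h0)) //; apply: Rintegral_ge0.
move=> x; have i := mol_integrable h0 x fi.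
apply: (le_trans (le_normr_Rintegral measurableT i)); rewrite -RintZ //.
apply: le_Rintegral => //; [exact: (integrable_norm i)|exact: integrableZ_R|].
by move=> y _; rewrite (normrM (f y)) mulrC ler_wpM2r // rho_bound.
Qed.

Lemma mollified_energy (tau del : R) : 0 < tau -> 0 < del ->
  exists2 h, 0 < h <= 1 & \int[mu3]_x E h x <= (1 + tau) * G + del.
Proof.
move=> t0 del0; have e2 : 0 < eps ^+ 2 by rewrite exprn_gt0.
(* Two mollification errors of this size, times [4 / (2 * eps ^+ 2)], make [del / 2]. *)
have e0 : 0 < del * eps ^+ 2 / 8 by rewrite divr_gt0 // mulr_gt0.
have [d1 d10 H1] := mol_error e0 (Lp L0 W).1.
have [d2 d20 H2] := mol_error e0 (Lq L0 W).1.
pose S := \int[mu3]_x (ext Q p x ^+ 2) + \int[mu3]_x (ext Q q x ^+ 2).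
have S0 : 0 <= S by apply: addr_ge0; apply: Rintegral_ge0 => x _; exact: sqr_ge0.
pose c := (1 + tau^-1) * 2^-1 * S.
have c0 : 0 <= c by rewrite !mulr_ge0 ?invr_ge0 // addr_ge0 // invr_ge0 ltW.
(* The last entry makes the commutator term, at most [c * h * h <= c * h], no larger than
   [del / 2]. *)
pose h := Num.min (Num.min d1 d2) (Num.min 1 (del / (2 * (c + 1)))).
have cp : 0 < 2 * (c + 1) by rewrite mulr_gt0 // ltr_wpDl.
have h0 : 0 < h by rewrite !lt_min d10 d20 ltr01 divr_gt0.
have h1 : h <= 1 by rewrite !ge_min lexx !orbT.
exists h; first by rewrite h0.
have hd1 : h <= d1 by rewrite !ge_min lexx.
have hd2 : h <= d2 by rewrite !ge_min lexx orbT.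
have hd3 : h <= del / (2 * (c + 1)) by rewrite !ge_min lexx !orbT.
have [_ B] := energy_mol eps L0 W potI h0 t0 (H1 h h0 hd1) (H2 h h0 hd2).
apply: (le_trans B).
have es := energy_split; rewrite -/(pot _) in es.
set D := D0 _ _ _ _ _ in es *; set V := \int[mu3]_x _ in es *.
have b1 : (1 + tau^-1) * (h ^+ 2 / 4) * (2 * S) <= del / 2.
  have -> : (1 + tau^-1) * (h ^+ 2 / 4) * (2 * S) = c * h * h by rewrite /c; field; rewrite gt_eqF.
  have hh : c * h * h <= c * h by rewrite ler_piMr // mulr_ge0 // ltW.
  have : h * (2 * (c + 1)) <= del by rewrite -ler_pdivlMr.
  have := mulr_ge0 c0 (ltW h0); nra.
have b2 : (2 * eps ^+ 2)^-1 * (V + 4 * (del * eps ^+ 2 / 8 + del * eps ^+ 2 / 8)) = (2 * eps ^+ 2)^-1 * V + del / 2.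
  by field; rewrite gt_eqF.
have V0 : 0 <= (2 * eps ^+ 2)^-1 * V.
  apply: mulr_ge0; first by rewrite invr_ge0 mulr_ge0 // sqr_ge0.
  by apply: Rintegral_ge0 => x _; exact: pot_ge0.
rewrite -/S b2.
have : (1 + tau) * (D + (2 * eps ^+ 2)^-1 * V) <= (1 + tau) * G by rewrite ler_wpM2l // addr_ge0 // ltW.
have := mulr_ge0 (ltW t0) V0; move: ((2 * eps ^+ 2)^-1 * V) b1 => v.
move: (_ * (2 * S)) => w; rewrite !mulrDl !mulrDr; lra.
Qed.

(** Here the mollification meets the hypotheses of [lower_core]: it is continuous, bounded on the
    shrunken cube, and its derivatives along circles are mollified weak derivatives. *)
Lemma witness_core (h tau s sig K : R) : 0 < h <= 1 -> 0 < tau -> tau < 1 -> 0 < s -> s + 2 < L / 2 -> 0 < sig -> 1 <= K -> K * eps <= 1 ->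
  let I := \int[mu3]_x E h x in
  0 <= I /\
  let Y := 2^-1 * (2 * (L / 2 - h - 1 - s)) ^+ 3 - 2 / s * (2 * sig * (2 * (L / 2 - h)) ^+ 3 + I / ((1 - tau) ^+ 2 * (4 * sig))) in
  (0 <= Y -> 2 * Y * (- ln (K * eps) - 2^-1) - 18 * pi * I / (tau ^+ 2 * K) <= I / (1 - tau) ^+ 2).
Proof.
move=> /andP[h0 h1] t0 t1 s0 sL sig0 K1 Ke I; split.
  by apply: Rintegral_ge0 => x _; exact: em_ge0.
have [cP cQ cA cB] := mol_conts L0 W h0.
have [mb bnd] : exists M0, forall x, box (L / 2 - h) (L / 2 - h) (L / 2 - h) x -> `|molP L p h x| <= M0 /\ `|molQ L q h x| <= M0 /\
   `|molA L q gp k0 F1 h x| <= M0 /\ `|molA L q gp k1 F2 h x| <= M0 /\ `|molB L p gq k0 F1 h x| <= M0 /\ `|molB L p gq k1 F2 h x| <= M0.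
  have [C1 C10 B1] := mol_bounded h0 (Lp L0 W).1; have [C2 C20 B2] := mol_bounded h0 (Lq L0 W).1.
  have [C3 C30 B3] := mol_bounded h0 (Lgp L0 W k0).1; have [C4 C40 B4] := mol_bounded h0 (Lgp L0 W k1).1.
  have [C5 C50 B5] := mol_bounded h0 (Lgq L0 W k0).1; have [C6 C60 B6] := mol_bounded h0 (Lgq L0 W k1).1.
  have [_ _ f1 f2] := F_facts L0.
  exists (C1 + C2 + C3 + C4 + C5 + C6 + L * C1 + L * C2) => x bx.
  have qx : Q x.
    move: bx => [b1 [b2 b3]]; rewrite /Q cubeE; have hh : L / 2 - h < L / 2 by rewrite gtrBl.
    by split; [|split]; apply: lt_trans hh.
  have l1 : 0 <= L * C1 by rewrite mulr_ge0 // ltW.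
  have l2 : 0 <= L * C2 by rewrite mulr_ge0 // ltW.
  have e1 := B1 x; have e2 := B2 x; have e3 := B3 x; have e4 := B4 x; have e5 := B5 x; have e6 := B6 x.
  have tri (u v w C D : R) : `|u| <= C -> `|v| <= L -> `|w| <= D -> `|u + v * w| <= C + L * D.
    move=> hu hv hw; apply: (le_trans (ler_normD _ _)); apply: lerD => //; rewrite normrM.
    exact: ler_pM.
  have g1 := tri _ _ _ _ _ e3 (f1 x qx) e2; have g2 := tri _ _ _ _ _ e4 (f2 x qx) e2.
  have f1' : `|- F1 x| <= L by rewrite normrN; exact: f1.
  have f2' : `|- F2 x| <= L by rewrite normrN; exact: f2.
  have g3 := tri _ _ _ _ _ e5 f1' e1; have g4 := tri _ _ _ _ _ e6 f2' e1.
  have sum_le := six_sum_le C10 C20 C30 C40 C50 C60 l1 l2.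
  split; first by apply: (le_trans e1); apply: sum_le; constructor 1.
  split; first by apply: (le_trans e2); apply: sum_le; constructor 2.
  split; first by apply: (le_trans g1); apply: sum_le; constructor 3; left.
  split; first by apply: (le_trans g2); apply: sum_le; constructor 3; right.
  by split; [apply: (le_trans g3)|apply: (le_trans g4)]; apply: sum_le; constructor 4; [left|right].
have inner x (r : R) : (forall t', box (L / 2 - h) (L / 2 - h) (L / 2 - h) (circ x r t')) -> forall t (j : 'I_3),
    (dmol h j (ext Q p) (circ x r t) = mol h (ext Q (gp j)) (circ x r t)) /\
    (dmol h j (ext Q q) (circ x r t) = mol h (ext Q (gq j)) (circ x r t)).
  move=> Hc t j; case: (W) => Wp Wq Wgp Wgq.
  split; apply: (dmol_weak h0) => //.
  - exact: (Lp L0 W).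
  - exact: (Lgp L0 W j).
  - by have [] := Wgp j.
  - exact: (Lq L0 W).
  - exact: (Lgq L0 W j).
  - by have [] := Wgq j.
have dP x (r t : R) : (forall t', box (L / 2 - h) (L / 2 - h) (L / 2 - h) (circ x r t')) ->
  is_derive t 1 (fun t => molP L p h (circ x r t)) (r * (- sin t * (molA L q gp k0 F1 h (circ x r t) - F1 (circ x r t) * molQ L q h (circ x r t))
    + cos t * (molA L q gp k1 F2 h (circ x r t) - F2 (circ x r t) * molQ L q h (circ x r t)))).
  move=> Hc; apply: (derE (mol_circ_der h0 x r t (Lp L0 W).1)).
  have [-> _] := inner x r Hc t k0; have [-> _] := inner x r Hc t k1.
  by rewrite /molA; ring.
have dQ x (r t : R) : (forall t', box (L / 2 - h) (L / 2 - h) (L / 2 - h) (circ x r t')) ->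
  is_derive t 1 (fun t => molQ L q h (circ x r t)) (r * (- sin t * (molB L p gq k0 F1 h (circ x r t) + F1 (circ x r t) * molP L p h (circ x r t))
    + cos t * (molB L p gq k1 F2 h (circ x r t) + F2 (circ x r t) * molP L p h (circ x r t)))).
  move=> Hc; apply: (derE (mol_circ_der h0 x r t (Lq L0 W).1)).
  have [_ ->] := inner x r Hc t k0; have [_ ->] := inner x r Hc t k1.
  by rewrite /molB; ring.
have hq : 1 < L / 2 - h by lra.
have sh : s + 1 < L / 2 - h by lra.
exact: (lower_core cP cQ (cA k0).1 (cA k1).2 (cB k0).1 (cB k1).2 bnd hq eps0 t0 t1 dP dQ s0 sh sig0 K1 Ke).
Qed.

End WitnessLower.

(** * The lower bound *)

Section LowerBound.
Context {R : realType}.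

(** Fixes the cut-off width [tau * L] and the Young parameter [tau ^+ 2 * L / 4]. The volume loses a
    fraction [9 * tau], and the two parts of the flux term cost [tau * L ^+ 3] each, the second
    because [Lam] is small against [L ^+ 2]; with half the volume that makes [13 * tau / 2]. *)
Lemma flux_budget (tau L h I Lam : R) : 0 < tau -> tau <= 20^-1 -> 4 <= tau * L -> 0 <= h <= 1 ->
  0 <= I -> I <= L ^+ 3 * Lam -> Lam <= L ^+ 2 * (tau ^+ 4 / 4) ->
  L ^+ 3 * (1 - 13 * tau) / 2 <= 2^-1 * (2 * (L / 2 - h - 1 - tau * L)) ^+ 3
    - 2 / (tau * L) * (2 * (tau ^+ 2 * L / 4) * (2 * (L / 2 - h)) ^+ 3 + I / ((1 - tau) ^+ 2 * (4 * (tau ^+ 2 * L / 4)))).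
Proof.
move=> t0 t1 tL /andP[h0 h1] I0 IX LL.
have L0 : 0 < L by rewrite -(pmulr_rgt0 _ t0); lra.
have L3 : 0 < L ^+ 3 by rewrite exprn_gt0.
have s0 : 0 < tau * L by rewrite mulr_gt0.
have A : L ^+ 3 * (1 - 9 * tau) <= (2 * (L / 2 - h - 1 - tau * L)) ^+ 3.
  have a1 : L * (1 - 3 * tau) <= 2 * (L / 2 - h - 1 - tau * L) by lra.
  have a0 : 0 <= L * (1 - 3 * tau) by rewrite mulr_ge0 ?(ltW L0) //; lra.
  have : (L * (1 - 3 * tau)) ^+ 3 <= (2 * (L / 2 - h - 1 - tau * L)) ^+ 3 by rewrite lerXn2r // nnegrE // (le_trans a0).
  apply: le_trans; rewrite exprMn ler_wpM2l ?(ltW L3) //.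
  have -> : (1 - 3 * tau) ^+ 3 = 1 - 9 * tau + 27 * tau ^+ 2 * (1 - tau) by ring.
  by rewrite lerDl !mulr_ge0 ?sqr_ge0 //; lra.
have B : (2 * (L / 2 - h)) ^+ 3 <= L ^+ 3.
  have tL' : tau * L <= 20^-1 * L by rewrite ler_wpM2r // ltW.
  rewrite lerXn2r // ?nnegrE; lra.
have B' : 2 / (tau * L) * (2 * (tau ^+ 2 * L / 4) * (2 * (L / 2 - h)) ^+ 3) <= tau * L ^+ 3.
  have -> : 2 / (tau * L) * (2 * (tau ^+ 2 * L / 4) * (2 * (L / 2 - h)) ^+ 3) = tau * (2 * (L / 2 - h)) ^+ 3.
    by field; rewrite !gt_eqF.
  by rewrite ler_wpM2l // ltW.
have tt : 2^-1 <= (1 - tau) ^+ 2.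
  have -> : (1 - tau) ^+ 2 = 1 - 2 * tau + tau ^+ 2 by ring.
  have := sqr_ge0 tau; lra.
have t2 : 0 < (1 - tau) ^+ 2 by lra.
have C : 2 / (tau * L) * (I / ((1 - tau) ^+ 2 * (4 * (tau ^+ 2 * L / 4)))) <= tau * L ^+ 3.
  have -> : 2 / (tau * L) * (I / ((1 - tau) ^+ 2 * (4 * (tau ^+ 2 * L / 4)))) = 2 * I / (tau ^+ 3 * L ^+ 2) / (1 - tau) ^+ 2.
    by field; rewrite (gt_eqF L0) (gt_eqF t0) gt_eqF //; lra.
  rewrite ler_pdivrMr // ler_pdivrMr ?mulr_gt0 ?exprn_gt0 //.
  have k1 : 2 * I <= 2 * (L ^+ 3 * (L ^+ 2 * (tau ^+ 4 / 4))).
    by rewrite ler_wpM2l //; apply: (le_trans IX); rewrite ler_wpM2l // ltW.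
  apply: (le_trans k1).
  have -> : tau * L ^+ 3 * (1 - tau) ^+ 2 * (tau ^+ 3 * L ^+ 2) = L ^+ 3 * L ^+ 2 * tau ^+ 4 * (1 - tau) ^+ 2 by ring.
  have -> : 2 * (L ^+ 3 * (L ^+ 2 * (tau ^+ 4 / 4))) = L ^+ 3 * L ^+ 2 * tau ^+ 4 * 2^-1 by field.
  by rewrite ler_wpM2l // !mulr_ge0 // ?exprn_ge0 // ltW.
rewrite (mulrDr (2 / (tau * L))); lra.
Qed.

(** With [K = 72 / tau ^+ 3] the loss on bad circles is [pi / 4 * tau * I], at most [tau * I]. With
    [(1 - tau) ^- 2 <= 1 + 3 * tau] the coefficient of [I] becomes [1 + 4 * tau], while
    [(1 - 13 * tau) * (1 - tau)] exceeds [(1 + 4 * tau) * (1 - 18 * tau)]. *)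
Lemma lower_endgame (tau L Lam I Y a : R) : 0 < tau -> tau <= 20^-1 -> 0 < L -> 0 < Lam -> 0 <= I ->
  L ^+ 3 * (1 - 13 * tau) / 2 <= Y -> a + 2^-1 <= tau * Lam ->
  (0 <= Y -> 2 * Y * (- (a - Lam) - 2^-1) - 18 * pi * I / (tau ^+ 2 * (72 / tau ^+ 3)) <= I / (1 - tau) ^+ 2) ->
  (1 - 18 * tau) * (L ^+ 3 * Lam) <= I.
Proof.
move=> t0 t1 L0 Lam0 I0 Yb lK core; set X := L ^+ 3 * Lam.
have X0 : 0 < X by rewrite mulr_gt0 // exprn_gt0.
have L3 : 0 < L ^+ 3 by rewrite exprn_gt0.
have Y0 : 0 <= Y by apply: le_trans Yb; rewrite divr_ge0 // mulr_ge0 ?(ltW L3) //; lra.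
have {}core := core Y0; rewrite leNgt; apply/negP => ItX.
have p4 : 18 * pi * I / (tau ^+ 2 * (72 / tau ^+ 3)) <= tau * I.
  have -> : 18 * pi * I / (tau ^+ 2 * (72 / tau ^+ 3)) = pi / 4 * (tau * I).
    by move: (pi) => P; field; rewrite gt_eqF.
  rewrite ler_piMl ?mulr_ge0 ?(ltW t0) // ler_pdivrMr // mul1r.
  have [/andP[_ h2] _] := pihalf_02_cos_pihalf R; lra.
have t2 : 0 < (1 - tau) ^+ 2 by rewrite exprn_gt0 // subr_gt0; lra.
have q4 : I / (1 - tau) ^+ 2 <= (1 + 3 * tau) * I.
  rewrite ler_pdivrMr // mulrAC ler_peMl //.
  have -> : (1 + 3 * tau) * (1 - tau) ^+ 2 = 1 + tau * (1 - 5 * tau + 3 * tau ^+ 2) by ring.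
  by rewrite lerDl mulr_ge0 ?(ltW t0) //; have := sqr_ge0 tau; lra.
have big : L ^+ 3 * (1 - 13 * tau) * ((1 - tau) * Lam) <= 2 * Y * (- (a - Lam) - 2^-1).
  apply: ler_pM.
  - by rewrite mulr_ge0 ?(ltW L3) //; lra.
  - by rewrite mulr_ge0 ?(ltW Lam0) //; lra.
  - by move: Yb; clear; lra.
  - by move: lK; clear; lra.
have : L ^+ 3 * (1 - 13 * tau) * ((1 - tau) * Lam) <= (1 + 4 * tau) * I.
  by apply: (le_trans big); lra.
have -> : L ^+ 3 * (1 - 13 * tau) * ((1 - tau) * Lam) = (1 - 14 * tau + 13 * tau ^+ 2) * X by rewrite /X; ring.
have : (1 + 4 * tau) * I < (1 + 4 * tau) * ((1 - 18 * tau) * X) by rewrite ltr_pM2l //; lra.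
have := mulr_ge0 (sqr_ge0 tau) (ltW X0); nra.
Qed.

Lemma lower_bound (tau L eps G : R) (p q : pt R -> R) (gp gq : 'I_3 -> pt R -> R) :
  0 < tau -> tau <= 20^-1 -> 0 < eps -> 4 <= tau * L -> 0 < - ln eps ->
  - ln eps <= L ^+ 2 * (tau ^+ 4 / 4) -> 72 / tau ^+ 3 * eps <= 1 -> ln (72 / tau ^+ 3) + 2^-1 <= tau * - ln eps ->
  H1_witness (cube L) p q gp gq -> G_Q (eps ^+ 2) L p q gp gq = (eps ^+ 2 * G)%:E ->
  (1 - 20 * tau) * (L ^+ 3 * - ln eps) <= G.
Proof.
move=> t0 t1 e0 tL; set Lam := - ln eps => Lam0 LL Ke lK W EG.
have L0 : 0 < L by rewrite -(pmulr_rgt0 _ t0); lra.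
set X := L ^+ 3 * Lam; have X0 : 0 < X by rewrite mulr_gt0 // exprn_gt0.
(* The negation supplies the upper bound on the mollified energy that [flux_budget] requires. *)
rewrite leNgt; apply/negP => GX.
(* With [del = tau * X] the mollified energy is below [(1 + tau) * (1 - 20 * tau) * X + tau * X],
   hence below [(1 - 18 * tau) * X]. *)
have [h /andP[h0 h1] hI] := mollified_energy L0 e0 W EG t0 (mulr_gt0 t0 X0).
have tlt1 : tau < 1 by lra.
have s0 : 0 < tau * L by rewrite mulr_gt0.
have sL : tau * L + 2 < L / 2.
  have : tau * L <= 20^-1 * L by rewrite ler_wpM2r // ltW.
  lra.
have sg : 0 < tau ^+ 2 * L / 4 by rewrite divr_gt0 // mulr_gt0 // exprn_gt0.
have K1 : 1 <= 72 / tau ^+ 3.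
  rewrite ler_pdivlMr ?exprn_gt0 // mul1r.
  have : tau ^+ 3 <= 1 by rewrite exprn_ile1 // ltW.
  lra.
have hh : 0 < h <= 1 by rewrite h0.
have [I0 core] := witness_core L0 e0 W hh t0 tlt1 s0 sL sg K1 Ke.
move: hI I0 core; set I := \int[_]_x _ => hI I0 core.
have ItX : I < (1 - 18 * tau) * X.
  apply: (le_lt_trans hI).
  have : (1 + tau) * G < (1 + tau) * ((1 - 20 * tau) * X) by rewrite ltr_pM2l // addr_gt0.
  have := mulr_ge0 (sqr_ge0 tau) (ltW X0); nra.
have IX : I <= X by apply: (le_trans (ltW ItX)); rewrite ler_piMl ?(ltW X0) //; lra.
have h01 : 0 <= h <= 1 by rewrite (ltW h0).
have Yb := flux_budget t0 t1 tL h01 I0 IX LL.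
move: core Yb; set Y := _ - _ => core Yb.
have K0 : 0 < 72 / tau ^+ 3 by rewrite divr_gt0 // exprn_gt0.
rewrite lnM ?posrE // -[ln eps]opprK -/Lam in core.
by move: ItX; rewrite ltNge (lower_endgame t0 t1 L0 Lam0 I0 Yb lK core).
Qed.

End LowerBound.

(** * Weak derivatives of differentiable functions *)

Section ClassicalWeak.
Context {R : realType}.
Notation mu3 := (vol R).

Lemma upd_coord (j : 'I_3) (x : pt R) (t : R) : Defs.coord j (upd j x t) = t.
Proof. by case: j => [[|[|[|//]]] hj]. Qed.

Lemma upd_upd (j : 'I_3) (x : pt R) (t s : R) : upd j (upd j x t) s = upd j x s.
Proof. by case: j => [[|[|[|//]]] hj]. Qed.

Lemma upd_id (j : 'I_3) (x : pt R) : upd j x (Defs.coord j x) = x.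
Proof. by case: j => [[|[|[|//]]] hj]; case: x => [[x1 x2] x3]. Qed.

Definition axis (j : 'I_3) (t : R) : pt R := upd j 0 t.

Lemma add_axis (j : 'I_3) (x : pt R) (t : R) : x + axis j t = upd j x (Defs.coord j x + t).
Proof.
by case: j => [[|[|[|//]]] hj]; case: x => [[x1 x2] x3]; rewrite /axis /upd /=; congr (_, _, _); rewrite /= addr0.
Qed.

Lemma upd_cvg (j : 'I_3) (x : pt R) (s : R) : upd j x t @[t --> s] --> upd j x s.
Proof.
case: j => [[|[|[|//]]] hj]; rewrite /upd /=.
- exact: (cvg_pair (cvg_pair cvg_id (cvg_cst x.1.2)) (cvg_cst x.2)).
- exact: (cvg_pair (cvg_pair (cvg_cst x.1.1) cvg_id) (cvg_cst x.2)).
- exact: (cvg_pair (cvg_pair (cvg_cst x.1.1) (cvg_cst x.1.2)) cvg_id).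
Qed.

Lemma compact_supp_bounded (K : set (pt R)) (f : pt R -> R) : compact K -> continuous f ->
  (forall x, ~ K x -> f x = 0) -> exists2 C, 0 <= C & forall x, `|f x| <= C.
Proof.
move=> cK cf f0; have [[x0 Kx0]|nK] := pselect (K !=set0); last first.
  by exists 0 => // x; rewrite f0 ?normr0 // => Kx; apply: nK; exists x.
have cn : {within K, continuous (fun x => `|f x|)}.
  by apply: continuous_subspaceT => x; apply: cvg_norm; exact: cf.
have [c Kc Hc] := compact_EVT_max (ex_intro _ x0 Kx0) cK cn.
exists `|f c| => // x; have [Kx|nKx] := pselect (K x); last by rewrite f0 // normr0.
by apply: Hc; exact: mem_set.
Qed.

(** The integral of the translates of [F] along an axis is constant, and its derivative at 0, taken
    under the integral, is the integral of [h]. For shifts shorter than 1 the domination lives on a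
    box one unit wider. *)
Lemma integral_pderiv0 (ell : R) (K : set (pt R)) (j : 'I_3) (F h : pt R -> R) :
  compact K -> K `<=` box ell ell ell -> continuous F -> continuous h ->
  (forall x, ~ K x -> F x = 0) -> (forall x, ~ K x -> h x = 0) ->
  (forall x, is_derive (Defs.coord j x : R) 1 (fun t => F (upd j x t)) (h x)) ->
  mu3.-integrable setT (EFin \o h) /\ \int[mu3]_x h x = 0.
Proof.
move=> cK KB cF ch F0 h0 dF.
have [CF CF0 bF] := compact_supp_bounded cK cF F0.
have [C C0 bh] := compact_supp_bounded cK ch h0.
have mF := continuous_measurable_pt cF; have mh := continuous_measurable_pt ch.
have Fi : mu3.-integrable setT (EFin \o F).
  by apply: (@box_integrable _ _ ell ell ell CF) => // x nb; apply: F0 => /KB.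
have hi : mu3.-integrable setT (EFin \o h).
  by apply: (@box_integrable _ _ ell ell ell C) => // x nb; apply: h0 => /KB.
split=> //.
pose Ft (t : R) (y : pt R) := F (y + axis j t).
have d (t : R) y : is_derive t 1 (Ft ^~ y) (h (y + axis j t)).
  have := dF (y + axis j t); rewrite add_axis upd_coord => D.
  have d1 : is_derive t 1 (fun s : R => Defs.coord j y + s) 1.
    by apply: (derE (derD (derC t (Defs.coord j y)) (derI t))); rewrite add0r.
  have D' : is_derive (Defs.coord j y + t) 1 (fun s : R => F (upd j y s)) (h (upd j y (Defs.coord j y + t))).
    by move: D; under eq_fun do rewrite upd_upd.
  have E : (Ft ^~ y) = (fun s => F (upd j y (Defs.coord j y + s))).
    by apply: funext => s; rewrite /Ft add_axis.
  by rewrite E; apply: (derE (der_comp d1 D')); rewrite mulr1.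
pose G (y : pt R) := C * \1_(box (ell + 1) (ell + 1) (ell + 1)) y.
have Gi : mu3.-integrable setT (EFin \o G).
  apply: (@box_integrable _ _ (ell + 1) (ell + 1) (ell + 1) C).
  - by apply: measurable_funM => //; apply: measurable_indic; exact: measurable_box.
  - by move=> x; rewrite normrM (ger0_norm C0) ler_piMr // indicE; case: (_ \in _); rewrite ?normr1 ?normr0.
  - by move=> x nb; rewrite /G indicE memNset // mulr0.
have G0 y : 0 <= G y by rewrite mulr_ge0 // indicE; case: (_ \in _).
have t0 : (`](-1 : R), 1[%classic : set R) 0 by rewrite /= in_itv /= ltrN10 ltr01.
have H1 (t : R) : `](-1 : R), 1[%classic t -> mu3.-integrable setT (EFin \o Ft t).
  by move=> _; exact: (integrable_shift (axis j t) Fi).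
have H2 (t : R) y : `](-1 : R), 1[%classic t -> setT y -> derivable (Ft ^~ y) t 1.
  by move=> _ _; have [] := d t y.
have H3 (t : R) y : `](-1 : R), 1[%classic t -> setT y -> `|partial1of2 Ft t y| <= G y.
  rewrite /= in_itv /= => /andP[ta tb] _; rewrite /partial1of2 (der_derive1 (d t y)) /G.
  have [kb|nk] := pselect (K (y + axis j t)); last by rewrite h0 // normr0 mulr_ge0 // indicE; case: (_ \in _).
  rewrite indicE mem_set ?mulr1 //.
  have := KB _ kb; rewrite add_axis.
  have tri (v : R) : `|v + t| < ell -> `|v| < ell + 1.
    by rewrite !ltr_norml => /andP[h1 h2]; apply/andP; split; lra.
  have e1 (v : R) : `|v| < ell -> `|v| < ell + 1 by move/lt_trans; apply; rewrite ltrDl.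
  by case: (j) => [[|[|[|//]]] hj] [/= b1 [b2 b3]]; split; [|split| |split| |split]; first [exact: tri|exact: e1].
have D1 := @derivable_under_integral R _ _ mu3 Ft setT measurableT 0 (-1) 1 t0 H1 H2 G G0 Gi H3.
have D2 := @differentiation_under_integral R _ _ mu3 Ft setT measurableT 0 (-1) 1 t0 H1 H2 G G0 Gi H3.
have cst t : \int[mu3]_y Ft t y = \int[mu3]_y F y by exact: Rintegral_shift.
have : (fun t => \int[mu3]_y Ft t y)^`()%classic 0 = 0.
  by under eq_fun do rewrite cst; exact: (der_derive1 (derC 0 _)).
rewrite D2 => <-; apply: eq_Rintegral => y _.
rewrite /partial1of2 (der_derive1 (d 0 y)); congr h.
by rewrite add_axis addr0 upd_id.
Qed.

(** Integration by parts, as [integral_pderiv0] applied to [f * phi]. *)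
Lemma weak_deriv_classical (L : R) (j : 'I_3) (f g : pt R -> R) : continuous f -> continuous g ->
  (forall x, is_derive (Defs.coord j x : R) 1 (fun t => f (upd j x t)) (g x)) -> weak_deriv (cube L) j f g.
Proof.
move=> cf cg df phi [sm [K [cK KQ phi0]]].
have [cphi dphi] := sm [::]; have [cdphi _] := sm [:: j]; rewrite /= in cphi dphi cdphi.
have dp x : is_derive (Defs.coord j x : R) 1 (fun t => phi (upd j x t)) (pderiv j phi x).
  exact: derivable_der (dphi j x).
(* [K] is closed, so [phi] vanishes in a neighbourhood of every point outside it. *)
have dphi0 x : ~ K x -> pderiv j phi x = 0.
  move=> nK; have hK : closed K by apply: compact_closed cK; exact: norm_hausdorff.
  have oK : nbhs x (~` K) by apply: open_nbhs_nbhs; split; [exact: closed_openC|].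
  apply: der_derive1; apply: (@der_near R (fun=> 0) _ (Defs.coord j x) 0 _ (derC _ 0)).
  have hn : nbhs (upd j x (Defs.coord j x)) (~` K) by rewrite upd_id.
  have H : \forall t \near (Defs.coord j x : R), ~ K (upd j x t) := @upd_cvg j x (Defs.coord j x) _ hn.
  by apply: filterS H => t nt; rewrite phi0.
pose F x := f x * phi x; pose h x := g x * phi x + f x * pderiv j phi x.
have cF : continuous F by exact: ptM.
have ch : continuous h by apply: ptD; exact: ptM.
have dF x : is_derive (Defs.coord j x : R) 1 (fun t => F (upd j x t)) (h x).
  by apply: (derE (derM (df x) (dp x))); rewrite !upd_id.
have F0 x : ~ K x -> F x = 0 by move=> nK; rewrite /F phi0 // mulr0.
have h0 x : ~ K x -> h x = 0 by move=> nK; rewrite /h phi0 // dphi0 // !mulr0 addr0.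
have KB : K `<=` box (L / 2) (L / 2) (L / 2) by rewrite -cubeE.
have [hi hz] := integral_pderiv0 cK KB cF ch F0 h0 dF.
have gi : mu3.-integrable setT (EFin \o (fun x => g x * phi x)).
  have c : continuous (fun x => g x * phi x) by exact: ptM.
  have z x : ~ K x -> g x * phi x = 0 by move=> nK; rewrite phi0 // mulr0.
  have [C _ bC] := compact_supp_bounded cK c z.
  apply: (@box_integrable _ _ (L / 2) (L / 2) (L / 2) C) => //; first exact: continuous_measurable_pt.
  by move=> x nb; apply: z => /KB.
have fi : mu3.-integrable setT (EFin \o (fun x => f x * pderiv j phi x)).
  by have := integrableB_R measurableT hi gi; apply: eq_integrable => // x _ /=; rewrite /h; congr (_%:E); ring.
have ext0 (k : pt R -> R) : (forall x, ~ K x -> k x = 0) -> mu3.-integrable setT (EFin \o k) ->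
    (\int[leb3 (R:=R)]_(x in cube L) (k x)%:E = (\int[mu3]_x k x)%:E)%E.
  move=> k0 ki; rewrite [LHS](ext_integral (cube L) k) EFin_Rintegral //.
  apply: eq_integral => x _; congr (_%:E).
  have [qx|nq] := pselect (cube L x); first by rewrite ext_in.
  by rewrite ext_out // k0 // => /KQ.
rewrite ext0 //; last by move=> x nK; rewrite dphi0 // mulr0.
rewrite ext0 //; last by move=> x nK; rewrite phi0 // mulr0.
rewrite -EFinN; congr (_%:E); apply/eqP; rewrite -addr_eq0 addrC -RintegralD //; apply/eqP.
exact: hz.
Qed.

End ClassicalWeak.

(** * The vortex lattice *)

Section Profile.
Context {R : realType}.

Lemma cst_between (g : R -> R) (a b : R) : a <= b -> cts g -> (forall t : R, a < t < b -> is_derive t 1 g 0) -> g a = g b.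
Proof.
move=> ab cg dg.
have dg' (t : R) : t \in `]a, b[ -> is_derive t 1 g 0 by rewrite in_itv /=; exact: dg.
have [z _ E] := @MVT_segment R g (fun=> 0) a b ab dg' (continuous_subspaceT cg).
by apply/eqP; rewrite eq_sym -subr_eq0 E mul0r.
Qed.

(** Side of the square cells: the field has density 1, so a vortex of phase [2 * pi] needs a cell of
    area [2 * pi]. *)
Definition kk : R := Num.sqrt (2 * pi).

Lemma kk_gt0 : 0 < kk.
Proof. by rewrite sqrtr_gt0 mulr_gt0 // pi_gt0. Qed.

Lemma kk_sq : kk ^+ 2 = 2 * pi.
Proof. by rewrite sqr_sqrtr // mulr_ge0 // pi_ge0. Qed.

(** Projection to [[- pi, pi]]. Since the sine vanishes at both ends, composing with it gives the
    derivative of the profile by a single continuous formula. *)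
Definition clamp (t : R) : R := 2 * pi * clip ((t + pi) / (2 * pi)) - pi.

Lemma clamp_id t : - pi <= t <= pi -> clamp t = t.
Proof.
move=> /andP[h1 h2]; have p0 := pi_gt0 R; have tp : 0 < 2 * pi :> R by rewrite mulr_gt0.
have h3 : 0 <= (t + pi) / (2 * pi) by rewrite divr_ge0 ?(ltW tp) //; lra.
have h4 : (t + pi) / (2 * pi) <= 1 by rewrite ler_pdivrMr // mul1r; lra.
rewrite /clamp; have [[h ->]|[_ ->]|[h ->]] := clipE ((t + pi) / (2 * pi)).
- by move: h; rewrite pmulr_lle0 ?invr_gt0 // => h; lra.
- by move: (pi) p0 => P P0; field; rewrite gt_eqF.
- by move: h; rewrite ler_pdivlMr // mul1r => h; lra.
Qed.

Lemma clamp_out t : pi <= `|t| -> sin (clamp t) = 0.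
Proof.
move=> h; have p0 := pi_gt0 R; have tp : 0 < 2 * pi :> R by rewrite mulr_gt0.
have [t0|t0] := leP 0 t.
  rewrite ger0_norm // in h.
  have h4 : 1 <= (t + pi) / (2 * pi) by rewrite ler_pdivlMr // mul1r; lra.
  rewrite /clamp; have [[h5 _]|[/andP[_ h5] ->]|[_ ->]] := clipE ((t + pi) / (2 * pi)).
  - lra.
  - have -> : (t + pi) / (2 * pi) = 1 by apply/eqP; rewrite eq_le h4 h5.
    by rewrite mulr1 (_ : 2 * pi - pi = pi) ?sinpi //; ring.
  - by rewrite mulr1 (_ : 2 * pi - pi = pi) ?sinpi //; ring.
rewrite ltr0_norm // in h.
have h4 : (t + pi) / (2 * pi) <= 0 by rewrite pmulr_lle0 ?invr_gt0 //; lra.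
rewrite /clamp; have [[_ ->]|[/andP[h5 _] ->]|[h5 _]] := clipE ((t + pi) / (2 * pi)).
- by rewrite mulr0 sub0r sinN sinpi oppr0.
- have -> : (t + pi) / (2 * pi) = 0 by apply/eqP; rewrite eq_le h4 h5.
  by rewrite mulr0 sub0r sinN sinpi oppr0.
- lra.
Qed.

Lemma cts_clip : cts (@clip R).
Proof.
move=> x; apply/cvgrPdist_le => e e0.
have /cvgrPdist_le /(_ _ e0) := (cvg_id : t @[t --> x] --> x).
by apply: filterS => y hy; apply: le_trans hy; exact: clip_lip.
Qed.

Lemma cts_clamp : cts clamp.
Proof.
have c := cts_clip; rewrite /clamp; cont.
Qed.

(* Derivative of the profile that equals [cos (kk t / 4) ^+ 2] for [|t| <= kk] and vanishes elsewhere. *)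
Definition dprof (t : R) : R := - (kk / 4) * sin (clamp (kk * t / 2)).

Lemma cts_dprof : cts dprof.
Proof. by have c := cts_clamp; rewrite /dprof; cont. Qed.

(** Taking 1 plus a primitive of [dprof] makes the profile differentiable everywhere by
    construction; the two formulas follow by comparing derivatives on the two regions, without
    gluing at [|t| = kk]. *)
Lemma prof_ex : exists chi : R -> R, [/\ forall t : R, is_derive t 1 chi (dprof t),
   forall t, `|t| <= kk -> chi t = (1 + cos (kk * t / 2)) / 2 & forall t, kk <= `|t| -> chi t = 0].
Proof.
have [F [F0 dF]] := primitive cts_dprof.
have k0 := kk_gt0; have k2 := kk_sq; have p0 := pi_gt0 R.
have cF : cts F by exact: der_cts dF.
have inr t : `|t| <= kk -> - pi <= kk * t / 2 <= pi.
  rewrite ler_norml => /andP[h1 h2].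
  have := ler_wpM2l (ltW k0) h1; have := ler_wpM2l (ltW k0) h2; rewrite mulrN -!expr2 k2 => *.
  by apply/andP; split; lra.
have small t : `|t| <= kk -> F t = (1 + cos (kk * t / 2)) / 2 - 1.
  move=> ht; pose g s := F s - cos (kk * s / 2) / 2.
  have cg : cts g by rewrite /g; cont.
  have dg (s : R) : `|s| <= kk -> is_derive s 1 g 0.
    move=> hs; have d1 : is_derive s 1 (fun s : R => kk * s / 2) (kk / 2).
      by apply: (derE (derM (derZ kk (derI s)) (derC s (2^-1 : R)))); field.
    apply: (derE (derB (dF s) (derM (der_comp d1 (is_derive_cos _)) (derC s (2^-1 : R))))).
    by rewrite /dprof clamp_id ?inr //; field.
  have E : g t = g 0.
    have [t0|/ltW t0] := leP 0 t.
      apply/esym; apply: cst_between => // s /andP[s0 st]; apply: dg.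
      by rewrite ger0_norm ?(ltW s0) // (le_trans (ltW st)) // (le_trans (ler_norm _)).
    apply: cst_between => // s /andP[st s0]; apply: dg.
    by rewrite ltr0_norm //; move: ht; rewrite ler_norml; lra.
  by move: E; rewrite /g F0 mulr0 mul0r cos0; lra.
have kk1 : kk * kk / 2 = pi by rewrite -expr2 k2; field.
have big t : kk <= `|t| -> F t = -1.
  have dz (s : R) : kk <= `|s| -> is_derive s 1 F 0.
    move=> hs; apply: (derE (dF s)); rewrite /dprof clamp_out ?mulr0 //.
    rewrite !normrM (gtr0_norm k0) [X in _ * X]ger0_norm ?invr_ge0 // -kk1.
    by rewrite ler_pM2r ?invr_gt0 // ler_pM2l.
  have [t0|/ltW t0] := leP 0 t.
    rewrite ger0_norm // => ht.
    have <- : F kk = F t.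
      apply: cst_between => // s /andP[ks _]; apply: dz.
      by rewrite ger0_norm ?(ltW ks) // ltW // (lt_trans k0).
    by rewrite small ?ger0_norm ?(ltW k0) // kk1 cospi; lra.
  rewrite ler0_norm // => ht.
  have -> : F t = F (- kk).
    apply: cst_between => //; first by lra.
    move=> s /andP[_ ks]; apply: dz; rewrite ler0_norm; lra.
  rewrite small ?normrN ?ger0_norm ?(ltW k0) //.
  by rewrite mulrN mulNr kk1 cosN cospi; lra.
exists (fun t => 1 + F t); split.
- by move=> t; apply: (derE (derD (derC t 1) (dF t))); rewrite add0r.
- by move=> t ht; rewrite small //; lra.
- by move=> t ht; rewrite big //; lra.
Qed.

Lemma dprof_in t : `|t| <= kk -> dprof t = - (kk / 4) * sin (kk * t / 2).
Proof.
move=> ht; rewrite /dprof clamp_id //.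
have k0 := kk_gt0; have k2 := kk_sq; move: ht; rewrite ler_norml => /andP[h1 h2].
have := ler_wpM2l (ltW k0) h1; have := ler_wpM2l (ltW k0) h2; rewrite mulrN -!expr2 k2 => *.
by apply/andP; split; lra.
Qed.

Lemma dprof_out t : kk <= `|t| -> dprof t = 0.
Proof.
move=> hs; have k0 := kk_gt0; rewrite /dprof clamp_out ?mulr0 //.
rewrite !normrM (gtr0_norm k0) [X in _ * X]ger0_norm ?invr_ge0 //.
have -> : pi = kk * kk / 2 by rewrite -expr2 kk_sq; field.
by rewrite ler_pM2r ?invr_gt0 // ler_pM2l.
Qed.

End Profile.

(** * The lattice sum and its modulus *)

Section Lattice.
Context {R : realType}.
Notation k := (@kk R).

Definition chi : R -> R := sval (cid (@prof_ex R)).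

Lemma chi_der (t : R) : is_derive t 1 chi (dprof t).
Proof. by rewrite /chi; case: (cid _) => c [] H _ _ /=; exact: H. Qed.
Lemma chi_in t : `|t| <= k -> chi t = (1 + cos (k * t / 2)) / 2.
Proof. by rewrite /chi; case: (cid _) => c [] _ H _ /=; exact: H. Qed.
Lemma chi_out t : k <= `|t| -> chi t = 0.
Proof. by rewrite /chi; case: (cid _) => c [] _ _ H /=; exact: H. Qed.
Lemma cts_chi : cts chi. Proof. exact: der_cts chi_der. Qed.

Lemma der_sum n (f : 'I_n -> R -> R) (g : 'I_n -> R) (x : R) : (forall i, is_derive x 1 (f i) (g i)) ->
  is_derive x 1 (fun t => \sum_(i < n) f i t) (\sum_(i < n) g i).
Proof.
elim: n f g => [|n IH] f g H.
  by rewrite big_ord0; under eq_fun do rewrite big_ord0; exact: derC.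
rewrite big_ord_recr /=; under eq_fun do rewrite big_ord_recr /=.
by apply: derD => //; apply: IH.
Qed.

Lemma pt_sum n (f : 'I_n -> pt R -> R) : (forall i, continuous (f i)) -> continuous (fun x => \sum_(i < n) f i x).
Proof.
elim: n f => [|n IH] f H.
  by under eq_fun do rewrite big_ord0; exact: ptC.
by under eq_fun do rewrite big_ord_recr /=; apply: ptD => //; apply: IH.
Qed.

Lemma sum_two n (f : 'I_n -> R) (i j : 'I_n) : i != j -> (forall l, l != i -> l != j -> f l = 0) ->
  \sum_(l < n) f l = f i + f j.
Proof.
move=> ij H; rewrite (bigD1 i) //= (bigD1 j) 1?eq_sym //= big1 ?addr0 //.
by move=> l /andP[li lj]; exact: H.
Qed.

Variable M : nat.
Let n := (2 * M).+1.

(** Lattice lines at the multiples of [k] from [- M] to [M]: a finite sum covers any cube of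
    half-width at most [M * k]. *)
Definition shift (i : 'I_n) : R := (i%:R - M%:R) * k.
Definition VR (x y : R) := \sum_(i < n) cos (shift i * y) * chi (x - shift i).
Definition VI (x y : R) := \sum_(i < n) sin (shift i * y) * chi (x - shift i).
Definition XR (x y : R) := \sum_(i < n) cos (shift i * y) * dprof (x - shift i).
Definition XI (x y : R) := \sum_(i < n) sin (shift i * y) * dprof (x - shift i).
(* [YR], [YI] are the [y]-derivatives that are covariant for the potential [(0, x)]. *)
Definition YR (x y : R) := \sum_(i < n) (x - shift i) * (sin (shift i * y) * chi (x - shift i)).
Definition YI (x y : R) := \sum_(i < n) (x - shift i) * - (cos (shift i * y) * chi (x - shift i)).

Lemma der_shift (g g' : R -> R) (x c : R) : is_derive (x - c) 1 g (g' (x - c)) -> is_derive x 1 (fun t => g (t - c)) (g' (x - c)).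
Proof.
move=> d; have d1 : is_derive x 1 (fun t : R => t - c) 1 by apply: (derE (derB (derI x) (derC x c))); rewrite subr0.
by apply: (derE (der_comp d1 d)); rewrite mulr1.
Qed.

Lemma VR_dx (x y : R) : is_derive x 1 (VR ^~ y) (XR x y).
Proof. by apply: der_sum => i; apply: derZ; apply: der_shift; exact: chi_der. Qed.
Lemma VI_dx (x y : R) : is_derive x 1 (VI ^~ y) (XI x y).
Proof. by apply: der_sum => i; apply: derZ; apply: der_shift; exact: chi_der. Qed.

Lemma VR_dy (x y : R) : is_derive y 1 (VR x) (YR x y - x * VI x y).
Proof.
have -> : YR x y - x * VI x y = \sum_(i < n) - sin (shift i * y) * shift i * chi (x - shift i).
  rewrite /YR /VI mulr_sumr -sumrB; apply: eq_bigr => i _; ring.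
apply: der_sum => i.
have d1 : is_derive y 1 (fun y : R => shift i * y) (shift i) by apply: (derE (derZ (shift i) (derI y))); rewrite mulr1.
by apply: (derE (derM (der_comp d1 (is_derive_cos _)) (derC y (chi (x - shift i))))); ring.
Qed.

Lemma VI_dy (x y : R) : is_derive y 1 (VI x) (YI x y + x * VR x y).
Proof.
have -> : YI x y + x * VR x y = \sum_(i < n) cos (shift i * y) * shift i * chi (x - shift i).
  rewrite /YI /VR mulr_sumr -big_split; apply: eq_bigr => i _ /=; ring.
apply: der_sum => i.
have d1 : is_derive y 1 (fun y : R => shift i * y) (shift i) by apply: (derE (derZ (shift i) (derI y))); rewrite mulr1.
by apply: (derE (derM (der_comp d1 (is_derive_sin _)) (derC y (chi (x - shift i))))); ring.
Qed.

Lemma pt_comp1 (f : R -> R) (g : pt R -> R) : cts f -> continuous g -> continuous (fun x => f (g x)).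
Proof. by move=> cf cg x; apply: (cvg_comp g f); [exact: cg|exact: cf]. Qed.

Lemma pt_c1 : continuous (fun x : pt R => x.1.1).
Proof. by move=> x; apply: (cvg_comp fst fst); [exact: cvg_fst|exact: cvg_fst]. Qed.
Lemma pt_c2 : continuous (fun x : pt R => x.1.2).
Proof. by move=> x; apply: (cvg_comp fst snd); [exact: cvg_fst|exact: cvg_snd]. Qed.

Lemma V_cont : [/\ continuous (fun z : pt R => VR z.1.1 z.1.2), continuous (fun z : pt R => VI z.1.1 z.1.2),
   continuous (fun z : pt R => XR z.1.1 z.1.2), continuous (fun z : pt R => XI z.1.1 z.1.2) &
   continuous (fun z : pt R => YR z.1.1 z.1.2) /\ continuous (fun z : pt R => YI z.1.1 z.1.2)].
Proof.
have cc i : continuous (fun z : pt R => cos (shift i * z.1.2)).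
  by apply: (pt_comp1 (@continuous_cos1 R)); apply: ptM; [exact: ptC|exact: pt_c2].
have cs i : continuous (fun z : pt R => sin (shift i * z.1.2)).
  by apply: (pt_comp1 (@continuous_sin1 R)); apply: ptM; [exact: ptC|exact: pt_c2].
have ct i : continuous (fun z : pt R => z.1.1 - shift i) by apply: ptD; [exact: pt_c1|exact: ptC].
have ch i : continuous (fun z : pt R => chi (z.1.1 - shift i)) by apply: (pt_comp1 cts_chi).
have cd i : continuous (fun z : pt R => dprof (z.1.1 - shift i)) by apply: (pt_comp1 (@cts_dprof R)).
split; [| | | |split]; apply: pt_sum => i; apply: ptM => //; try exact: ptM.
by apply: ptN; exact: ptM.
Qed.

Lemma sin_sq_shift (z : R) m : sin (z + m%:R * pi) ^+ 2 = sin z ^+ 2.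
Proof.
elim: m => [|m IH]; first by rewrite mul0r addr0.
have -> : z + m.+1%:R * pi = z + m%:R * pi + pi by rewrite -natr1; ring.
by rewrite sinDpi sqrrN.
Qed.

(** A crude constant suffices, because the squared gradient enters the density of the trial function
    multiplied by [b ^+ 2]. *)
Lemma strip_gradient (K t al be C g2 : R) : 0 <= t <= K -> 0 <= al <= 1 -> 0 <= be <= 1 -> -1 <= C <= 1 -> 0 <= g2 <= K ^+ 2 ->
  g2 * (2 - 2 * C) + ((t * al) ^+ 2 + 2 * (t * al) * ((t - K) * be) * C + ((t - K) * be) ^+ 2) <= 10 * K ^+ 2.
Proof.
move=> /andP[t0 tk] /andP[a0 a1] /andP[b0 b1] /andP[C0 C1] /andP[g0 g1].
have h1 : 0 <= g2 * (1 + C) by rewrite mulr_ge0 //; lra.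
have h2 : 0 <= (t * al) * ((K - t) * be) * (1 + C) by apply: mulr_ge0; [apply: mulr_ge0; apply: mulr_ge0; lra|lra].
have w1 : t * al <= K by apply: le_trans tk; rewrite ler_piMr.
have v1 : (t * al) ^+ 2 <= K ^+ 2 by rewrite lerXn2r ?nnegrE ?mulr_ge0 // (le_trans t0).
have v2 : ((K - t) * be) ^+ 2 <= K ^+ 2.
  have kt : 0 <= K - t by lra.
  have kt2 : K - t <= K by lra.
  by rewrite lerXn2r ?nnegrE ?mulr_ge0 ?(le_trans kt kt2) // (le_trans _ kt2) // ler_piMr.
have v3 : 2 * ((t * al) * ((K - t) * be)) <= (t * al) ^+ 2 + ((K - t) * be) ^+ 2.
  by rewrite -subr_ge0 (_ : _ - _ = (t * al - (K - t) * be) ^+ 2) ?sqr_ge0 //; ring.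
rewrite (_ : ((t - K) * be) ^+ 2 = ((K - t) * be) ^+ 2); last by ring.
rewrite (_ : 2 * (t * al) * ((t - K) * be) * C = 2 * ((t * al) * ((K - t) * be)) - 2 * ((t * al) * ((K - t) * be) * (1 + C))); last by ring.
have k2 := sqr_ge0 K; move: h1 h2 v1 v2 v3 g1 k2; clear; lra.
Qed.

(** The coefficient of [N] must stay near 1, since this term produces the logarithm. Young's
    inequality moves the cross term into [N ^+ 2], which contributes only a bounded density. *)
Lemma strip_current (N rho c tau S : R) : 0 <= N -> c ^+ 2 <= N -> -1 <= rho <= 1 -> 0 < tau -> S + c ^+ 2 <= N ->
  S + (rho * N - c) ^+ 2 <= (1 + tau) * N + (1 + tau^-1) * N ^+ 2.
Proof.
move=> N0 cN /andP[r0 r1] tau0 h1.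
have rr : 0 <= (1 - rho) * (1 + rho) by apply: mulr_ge0; lra.
have h2 : (rho * N) ^+ 2 <= N ^+ 2 by rewrite exprMn ler_piMl ?sqr_ge0 // expr2; lra.
have y1 : - 2 * rho * c <= tau + tau^-1 * c ^+ 2.
  rewrite -subr_ge0.
  have -> : tau + tau^-1 * c ^+ 2 - - 2 * rho * c = tau^-1 * (c + rho * tau) ^+ 2 + tau * ((1 - rho) * (1 + rho)).
    by field; rewrite gt_eqF.
  by apply: addr_ge0; apply: mulr_ge0; rewrite ?sqr_ge0 ?invr_ge0 ?(ltW tau0).
have y2 := ler_wpM2r N0 y1; rewrite mulrDl in y2.
have y3 : tau^-1 * c ^+ 2 * N <= tau^-1 * N ^+ 2.
  by rewrite -mulrA ler_wpM2l ?invr_ge0 ?(ltW tau0) // (expr2 N) ler_wpM2r.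
have -> : (rho * N - c) ^+ 2 = (rho * N) ^+ 2 + - 2 * rho * c * N + c ^+ 2 by ring.
rewrite !mulrDl !mul1r; move: h1 h2 y2 y3; clear; lra.
Qed.

(* On the strip between two lattice lines only two neighbouring summands survive; their common phase [(c, s)]
   drops out by rotation invariance. *)
Lemma strip_algebra (c s cX sX cY sY t tau : R) : c ^+ 2 + s ^+ 2 = 1 -> cX ^+ 2 + sX ^+ 2 = 1 -> cY ^+ 2 + sY ^+ 2 = 1 ->
  0 <= t <= k ->
  let C := 1 - 2 * sY ^+ 2 in let S := 2 * sY * cY in
  let al := (1 + cX) / 2 in let be := (1 - cX) / 2 in let g := k / 4 * sX in
  let c' := c * C - s * S in let s' := s * C + c * S in
  let vr := c * al + c' * be in let vi := s * al + s' * be in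
  let xr := c * - g + c' * g in let xi := s * - g + s' * g in
  let yr := t * (s * al) + (t - k) * (s' * be) in let yi := t * - (c * al) + (t - k) * - (c' * be) in
  let N := 1 - sX ^+ 2 * sY ^+ 2 in
  [/\ vr ^+ 2 + vi ^+ 2 = N, xr ^+ 2 + xi ^+ 2 + yr ^+ 2 + yi ^+ 2 <= 10 * k ^+ 2 &
     0 < tau -> (vr * xi - vi * xr) ^+ 2 + (vr * yi - vi * yr) ^+ 2 <= k ^+ 2 / 4 * ((1 + tau) * N + (1 + tau^-1) * N ^+ 2)].
Proof.
move=> Ec EX EY /andP[t0 tk] C S al be g c' s' vr vi xr xi yr yi N.
have k0 := @kk_gt0 R.
have sX2 : sX ^+ 2 = 1 - cX ^+ 2 by rewrite -EX; ring.
have cY2 : cY ^+ 2 = 1 - sY ^+ 2 by rewrite -EY; ring.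
pose a0 := al + be * C; pose b0 := be * S.
pose p0 := (t - k) * (be * S); pose q0 := - (t * al + (t - k) * (be * C)).
have Evr : vr = c * a0 - s * b0 by rewrite /vr /c' /a0 /b0; ring.
have Evi : vi = s * a0 + c * b0 by rewrite /vi /s' /a0 /b0; ring.
have Exr : xr = c * (g * (C - 1)) - s * (g * S) by rewrite /xr /c'; ring.
have Exi : xi = s * (g * (C - 1)) + c * (g * S) by rewrite /xi /s'; ring.
have Eyr : yr = c * p0 - s * q0 by rewrite /yr /s' /p0 /q0; ring.
have Eyi : yi = s * p0 + c * q0 by rewrite /yi /c' /p0 /q0; ring.
have rot (u v : R) : (c * u - s * v) ^+ 2 + (s * u + c * v) ^+ 2 = u ^+ 2 + v ^+ 2.
  by rewrite -[RHS]mul1r -Ec; ring.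
have rotx (u v u' v' : R) : (c * u - s * v) * (s * u' + c * v') - (s * u + c * v) * (c * u' - s * v') = u * v' - v * u'.
  by rewrite -[RHS]mul1r -Ec; ring.
have S2 : S ^+ 2 = 4 * sY ^+ 2 * (1 - sY ^+ 2) by rewrite /S !exprMn cY2; ring.
have EN : vr ^+ 2 + vi ^+ 2 = N.
  by rewrite Evr Evi rot /a0 /b0 exprMn S2 /al /be /C /N sX2; field.
have Ej1 : (vr * xi - vi * xr) = g * S.
  by rewrite Evr Evi Exr Exi rotx /a0 /b0 /al /be; field.
pose rho := 1 - 2 * t / k.
(* The [y]-current is affine in [N]; [rho] is the position across the strip, running from 1 to
   -1. *)
have Ej2 : (vr * yi - vi * yr) = k / 2 * (rho * N - cX).
  rewrite Evr Evi Eyr Eyi rotx /a0 /b0 /p0 /q0.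
  have -> : (al + be * C) * - (t * al + (t - k) * (be * C)) - be * S * ((t - k) * (be * S)) =
    - (t * al ^+ 2 + (2 * t - k) * al * be * C + (t - k) * be ^+ 2 * (C ^+ 2 + S ^+ 2)) by ring.
  have -> : C ^+ 2 + S ^+ 2 = 1 by rewrite S2 /C; ring.
  by rewrite /al /be /C /N /rho sX2; field; rewrite gt_eqF.
have cX1 : -1 <= cX <= 1.
  by rewrite -ler_norml -(@ler_pXn2r _ 2) ?nnegrE // expr1n -normrX ger0_norm ?sqr_ge0 //; have := sqr_ge0 sX; lra.
have sY1 : 0 <= sY ^+ 2 <= 1 by rewrite sqr_ge0; have := sqr_ge0 cY; lra.
have sX1 : 0 <= sX ^+ 2 <= 1 by rewrite sqr_ge0; have := sqr_ge0 cX; lra.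
have rho1 : -1 <= rho <= 1.
  have h1 : 0 <= t / k by rewrite divr_ge0 // ltW.
  have h2 : t / k <= 1 by rewrite ler_pdivrMr // mul1r.
  by rewrite /rho -mulrA; apply/andP; split; lra.
split; first exact: EN.
  rewrite -addrA Exr Exi rot Eyr Eyi rot.
  have k2 : 0 <= k ^+ 2 by rewrite sqr_ge0.
  have al1 : 0 <= al <= 1 by rewrite /al; move: cX1; clear; lra.
  have be1 : 0 <= be <= 1 by rewrite /be; move: cX1; clear; lra.
  have C1 : -1 <= C <= 1 by rewrite /C; move: sY1; clear; lra.
  have CS : C ^+ 2 + S ^+ 2 = 1 by rewrite S2 /C; ring.
  have E1 : (g * (C - 1)) ^+ 2 + (g * S) ^+ 2 = g ^+ 2 * (2 - 2 * C).
    by rewrite -[X in X - 2 * C]/(1 + 1) -{2}CS; ring.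
  have E2 : p0 ^+ 2 + q0 ^+ 2 = (t * al) ^+ 2 + 2 * (t * al) * ((t - k) * be) * C + ((t - k) * be) ^+ 2.
    transitivity ((t * al) ^+ 2 + 2 * (t * al) * ((t - k) * be) * C + ((t - k) * be) ^+ 2 * (C ^+ 2 + S ^+ 2)).
      by rewrite /p0 /q0; move: (k) => K; ring.
    by rewrite CS mulr1.
  rewrite E1 E2.
  have g2 : g ^+ 2 <= k ^+ 2.
    have -> : g ^+ 2 = k ^+ 2 * (sX ^+ 2 / 16) by rewrite /g; move: (k) => K; field.
    by rewrite ler_piMr //; move: sX1; clear; lra.
  by apply: strip_gradient => //; rewrite ?sqr_ge0 ?g2 // t0.
move=> tau0; rewrite Ej1 Ej2.
  have N0 : cX ^+ 2 <= N.
    rewrite -subr_ge0 (_ : N - cX ^+ 2 = sX ^+ 2 * (1 - sY ^+ 2)).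
      by apply: mulr_ge0; [exact: sqr_ge0|move: sY1; clear; lra].
    by rewrite /N sX2; ring.
  have N00 : 0 <= N by apply: le_trans N0; exact: sqr_ge0.
  have -> : (g * S) ^+ 2 + (k / 2 * (rho * N - cX)) ^+ 2 =
     k ^+ 2 / 4 * (sX ^+ 2 * sY ^+ 2 * (1 - sY ^+ 2) + (rho * N - cX) ^+ 2).
    by rewrite exprMn S2 /g; field.
  rewrite ler_wpM2l ?divr_ge0 ?sqr_ge0 //.
  have h1 : sX ^+ 2 * sY ^+ 2 * (1 - sY ^+ 2) + cX ^+ 2 <= N.
    rewrite -subr_ge0 (_ : N - _ = sX ^+ 2 * (1 - sY ^+ 2) ^+ 2); first by apply: mulr_ge0; exact: sqr_ge0.
    by rewrite /N sX2; ring.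
  exact: strip_current.
Qed.

Lemma strip_find (x : R) : `|x| < M%:R * k -> exists i : nat, (i.+1 < n)%N /\ 0 <= x - (i%:R - M%:R) * k <= k.
Proof.
move=> hx; have k0 := @kk_gt0 R; move: hx; rewrite ltr_norml => /andP[h1 h2].
have y0 : 0 <= (x + M%:R * k) / k by rewrite divr_ge0 ?(ltW k0) //; lra.
exists (Num.truncn ((x + M%:R * k) / k)).
have /andP[t1 t2] := truncn_itv y0.
rewrite ler_pdivlMr // in t1; rewrite ltr_pdivrMr // in t2.
split; last by rewrite -natr1 in t2; apply/andP; split; lra.
rewrite /n ltnS; suff : ((Num.truncn ((x + M%:R * k) / k))%:R : R) < (2 * M)%:R by rewrite ltr_nat.
rewrite -(ltr_pM2r k0) (le_lt_trans t1) // natrM; lra.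
Qed.

(** Reduction to one strip: at most two summands are nonzero at [x], and moving by a lattice line
    changes [k * x / 2] by [pi], which the squared sine does not see. *)
Lemma strip_bounds (x y tau : R) : `|x| < M%:R * k ->
  let N := 1 - sin (k * x / 2) ^+ 2 * sin (k * y / 2) ^+ 2 in
  [/\ VR x y ^+ 2 + VI x y ^+ 2 = N, XR x y ^+ 2 + XI x y ^+ 2 + YR x y ^+ 2 + YI x y ^+ 2 <= 10 * k ^+ 2 &
     0 < tau -> (VR x y * XI x y - VI x y * XR x y) ^+ 2 + (VR x y * YI x y - VI x y * YR x y) ^+ 2
        <= k ^+ 2 / 4 * ((1 + tau) * N + (1 + tau^-1) * N ^+ 2)].
Proof.
move=> hx N; have k0 := @kk_gt0 R; have k2 := @kk_sq R.
have [i [hi ht]] := strip_find hx; set t := x - (i%:R - M%:R) * k in ht.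
pose i1 : 'I_n := Ordinal (ltn_trans (ltnSn i) hi); pose i2 : 'I_n := Ordinal hi.
have i12 : i1 != i2 by rewrite -val_eqE /= ltn_eqF.
have s1 : shift i1 = x - t by rewrite /shift /= /t; ring.
have s2 : shift i2 = x - t + k by rewrite /shift /= /t -natr1; ring.
have far l : l != i1 -> l != i2 -> k <= `|x - shift l|.
  rewrite -!val_eqE /= => l1 l2; have /andP[ta tb] := ht.
  have E : x - shift l = t + (i%:R - l%:R) * k by rewrite /shift /t; ring.
  have [li|li] := ltnP l i.
    have h : (1 : R) <= i%:R - l%:R.
      have : ((l + 1)%N%:R : R) <= i%:R by rewrite ler_nat addn1.
      by rewrite natrD; lra.
    have := ler_wpM2r (ltW k0) h; rewrite mul1r E => H; apply: le_trans (ler_norm _); lra.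
  have li2 : (i.+2 <= l)%N by rewrite ltn_neqAle eq_sym l2 ltn_neqAle eq_sym l1.
  have h : i%:R - l%:R <= (- 2 : R).
    have : ((i + 2)%N%:R : R) <= l%:R by rewrite ler_nat addn2.
    by rewrite natrD; lra.
  have := ler_wpM2r (ltW k0) h; rewrite E => H; rewrite -normrN; apply: le_trans (ler_norm _); lra.
have t1 : `|t| <= k by rewrite ger0_norm; lra.
have t2 : `|t - k| <= k by rewrite ler0_norm; lra.
have xs1 : x - shift i1 = t by rewrite s1; ring.
have xs2 : x - shift i2 = t - k by rewrite s2; ring.
have kk2 : k * k / 2 = pi by rewrite -expr2 k2; field.
have hk : k * (t - k) / 2 = k * t / 2 - pi by rewrite -kk2; field.
have cpi (z : R) : cos (z - pi) = - cos z by rewrite cosB cospi sinpi; ring.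
have spi (z : R) : sin (z - pi) = - sin z by rewrite sinB cospi sinpi; ring.
have ch1 : chi (x - shift i1) = (1 + cos (k * t / 2)) / 2 by rewrite xs1 chi_in.
have ch2 : chi (x - shift i2) = (1 - cos (k * t / 2)) / 2 by rewrite xs2 chi_in // hk cpi.
have dh1 : dprof (x - shift i1) = - (k / 4 * sin (k * t / 2)) by rewrite xs1 dprof_in // mulNr.
have dh2 : dprof (x - shift i2) = k / 4 * sin (k * t / 2) by rewrite xs2 dprof_in // hk spi; ring.
have z1 l : l != i1 -> l != i2 -> chi (x - shift l) = 0 by move=> a b; rewrite chi_out // far.
have z2 l : l != i1 -> l != i2 -> dprof (x - shift l) = 0 by move=> a b; rewrite dprof_out // far.
have th2 : shift i2 * y = shift i1 * y + (k * y / 2 + k * y / 2) by rewrite s1 s2; field.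
set c := cos (shift i1 * y); set s := sin (shift i1 * y).
set cY := cos (k * y / 2); set sY := sin (k * y / 2) in N *.
have EY : cY ^+ 2 + sY ^+ 2 = 1 by exact: cos2Dsin2.
have C2 : cos (k * y / 2 + k * y / 2) = 1 - 2 * sY ^+ 2.
  by rewrite cosD -/cY -/sY -{1}EY; ring.
have S2 : sin (k * y / 2 + k * y / 2) = 2 * sY * cY by rewrite sinD -/cY -/sY; ring.
have c' : cos (shift i2 * y) = c * (1 - 2 * sY ^+ 2) - s * (2 * sY * cY) by rewrite th2 cosD C2 S2.
have s' : sin (shift i2 * y) = s * (1 - 2 * sY ^+ 2) + c * (2 * sY * cY) by rewrite th2 sinD C2 S2 -/c -/s; ring.
have EN : sin (k * x / 2) ^+ 2 = sin (k * t / 2) ^+ 2.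
  rewrite -(sin_sq_shift (k * x / 2) M) -(sin_sq_shift (k * t / 2) i); congr (sin _ ^+ 2).
  by rewrite -kk2 /t; field.
have := @strip_algebra c s (cos (k * t / 2)) (sin (k * t / 2)) cY sY t tau (cos2Dsin2 _) (cos2Dsin2 _) EY ht.
rewrite /N EN.
have -> : VR x y = c * ((1 + cos (k * t / 2)) / 2) + cos (shift i2 * y) * ((1 - cos (k * t / 2)) / 2).
  by rewrite /VR (sum_two i12) ?ch1 ?ch2 // => l a b; rewrite z1 // mulr0.
have -> : VI x y = s * ((1 + cos (k * t / 2)) / 2) + sin (shift i2 * y) * ((1 - cos (k * t / 2)) / 2).
  by rewrite /VI (sum_two i12) ?ch1 ?ch2 // => l a b; rewrite z1 // mulr0.
have -> : XR x y = c * - (k / 4 * sin (k * t / 2)) + cos (shift i2 * y) * (k / 4 * sin (k * t / 2)).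
  by rewrite /XR (sum_two i12) ?dh1 ?dh2 // => l a b; rewrite z2 // mulr0.
have -> : XI x y = s * - (k / 4 * sin (k * t / 2)) + sin (shift i2 * y) * (k / 4 * sin (k * t / 2)).
  by rewrite /XI (sum_two i12) ?dh1 ?dh2 // => l a b; rewrite z2 // mulr0.
have -> : YR x y = t * (s * ((1 + cos (k * t / 2)) / 2)) + (t - k) * (sin (shift i2 * y) * ((1 - cos (k * t / 2)) / 2)).
  by rewrite /YR (sum_two i12) ?ch1 ?ch2 ?xs1 ?xs2 // => l a b; rewrite z1 // !mulr0.
have -> : YI x y = t * - (c * ((1 + cos (k * t / 2)) / 2)) + (t - k) * - (cos (shift i2 * y) * ((1 - cos (k * t / 2)) / 2)).
  by rewrite /YI (sum_two i12) ?ch1 ?ch2 ?xs1 ?xs2 // => l a b; rewrite z1 // mulr0 oppr0 mulr0.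
by rewrite c' s'.
Qed.

End Lattice.

(** * The trial function *)

Section Polar.
Context {R : realType}.
Implicit Types (b v w dv dw : R).

(** Regularised normalisation: well above [b] the squared modulus becomes nearly 1, while at the
    zeros the quotient stays differentiable. The vortex cores get a size of order [Num.sqrt b]. *)
Definition amp b v w : R := (Num.sqrt (v ^+ 2 + w ^+ 2 + b))^-1.
Definition damp b v w dv dw : R := - (v * dv + w * dw) / (v ^+ 2 + w ^+ 2 + b) * amp b v w.

(* The real and imaginary parts of [amp * (v + i w) * exp(i f)] and of its derivative without the [f'] term. *)
Definition polR b v w f : R := amp b v w * (v * cos f - w * sin f).
Definition polI b v w f : R := amp b v w * (v * sin f + w * cos f).
Definition dpolR b v w dv dw f : R := damp b v w dv dw * (v * cos f - w * sin f) + amp b v w * (dv * cos f - dw * sin f).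
Definition dpolI b v w dv dw f : R := damp b v w dv dw * (v * sin f + w * cos f) + amp b v w * (dv * sin f + dw * cos f).

Lemma amp_den_gt0 b v w : 0 < b -> 0 < v ^+ 2 + w ^+ 2 + b.
Proof. by move=> b0; rewrite ltr_wpDl // addr_ge0 // sqr_ge0. Qed.

Lemma amp_sq b v w : 0 < b -> amp b v w ^+ 2 = (v ^+ 2 + w ^+ 2 + b)^-1.
Proof. by move=> b0; rewrite /amp exprVn sqr_sqrtr // ltW // amp_den_gt0. Qed.

Lemma amp_der b (v w : R -> R) dv dw (x : R) : 0 < b -> is_derive x 1 v dv -> is_derive x 1 w dw ->
  is_derive x 1 (fun t => amp b (v t) (w t)) (damp b (v x) (w x) dv dw).
Proof.
move=> b0 hv hw; pose N (t : R) := v t ^+ 2 + w t ^+ 2 + b.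
have N0 : 0 < N x by exact: amp_den_gt0.
have dN : is_derive x 1 N (2 * (v x * dv + w x * dw)).
  by apply: (derE (derD (derD (derX 1 hv) (derX 1 hw)) (derC x b))); ring.
have s0 : 0 < Num.sqrt (N x) by rewrite sqrtr_gt0.
have dS := der_comp dN (is_derive1_sqrt N0).
apply: (derE (derV (f := fun t => Num.sqrt (N t)) (lt0r_neq0 s0) dS)).
rewrite /damp /amp -/(N x) sqr_sqrtr ?(ltW N0) //.
by move: s0 N0; move: (Num.sqrt (N x)) => S; move: (N x) => n S0 n0; field; rewrite !gt_eqF.
Qed.

Lemma pol_der b (v w f : R -> R) dv dw df (x : R) : 0 < b -> is_derive x 1 v dv -> is_derive x 1 w dw -> is_derive x 1 f df ->
  is_derive x 1 (fun t => polR b (v t) (w t) (f t)) (dpolR b (v x) (w x) dv dw (f x) - df * polI b (v x) (w x) (f x)) /\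
  is_derive x 1 (fun t => polI b (v t) (w t) (f t)) (dpolI b (v x) (w x) dv dw (f x) + df * polR b (v x) (w x) (f x)).
Proof.
move=> b0 hv hw hf.
have dc := der_comp hf (is_derive_cos _); have ds := der_comp hf (is_derive_sin _).
have da := amp_der b0 hv hw.
split.
  apply: (derE (derM da (derB (derM hv dc) (derM hw ds)))).
  by rewrite /dpolR /polI; ring.
apply: (derE (derM da (derD (derM hv ds) (derM hw dc)))).
by rewrite /dpolI /polR; ring.
Qed.

(** The added vector [c * (- w, v)] is orthogonal to [(v, w)], so it does not affect the amplitude:
    a change of potential passes through the normalisation. *)
Lemma pol_shift b v w dv dw f c : 0 < b ->
  dpolR b v w (dv - c * w) (dw + c * v) f = dpolR b v w dv dw f - c * polI b v w f /\
  dpolI b v w (dv - c * w) (dw + c * v) f = dpolI b v w dv dw f + c * polR b v w f.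
Proof.
move=> b0; have h : v * (dv - c * w) + w * (dw + c * v) = v * dv + w * dw by ring.
by rewrite /dpolR /dpolI /damp /polI /polR h; split; ring.
Qed.

Lemma pol_norm b v w f : 0 < b -> polR b v w f ^+ 2 + polI b v w f ^+ 2 = (v ^+ 2 + w ^+ 2) / (v ^+ 2 + w ^+ 2 + b).
Proof.
move=> b0; rewrite -(amp_sq v w b0) /polR /polI.
transitivity (amp b v w ^+ 2 * (v ^+ 2 + w ^+ 2) * (cos f ^+ 2 + sin f ^+ 2)); first by ring.
by rewrite cos2Dsin2; ring.
Qed.

(** Lagrange's identity splits the gradient into a radial part and the current [v * dw - w * dv].
    The regularised normalisation damps the radial part, which is why the full gradient appears only
    with [b ^+ 2]. *)
Lemma dpol_norm b v w dv dw f : 0 < b -> let N := v ^+ 2 + w ^+ 2 in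
  dpolR b v w dv dw f ^+ 2 + dpolI b v w dv dw f ^+ 2 =
  ((dv ^+ 2 + dw ^+ 2) * b ^+ 2 + (v * dw - w * dv) ^+ 2 * (N + 2 * b)) / (N + b) ^+ 3.
Proof.
move=> b0 N; have N0 := amp_den_gt0 v w b0; rewrite -/N in N0.
have A2 := amp_sq v w b0; rewrite -/N in A2.
rewrite /dpolR /dpolI /damp -/N.
move: (amp b v w) A2 (cos f) (sin f) (cos2Dsin2 f) => A A2 c s cs.
pose m := - (v * dv + w * dw) / (N + b).
transitivity (A ^+ 2 * ((m * v + dv) ^+ 2 + (m * w + dw) ^+ 2) * (c ^+ 2 + s ^+ 2)); first by rewrite /m; ring.
by rewrite cs A2 /m /N; field; rewrite gt_eqF.
Qed.

(* Each term of [(T b^2 + J (N + 2b)) / (N + b)^3] is compared separately, using [N (N + 2b) <= (N + b)^2]. *)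
Lemma density_bound (b N T J k tau : R) : 0 < b -> 0 <= N -> 0 < tau -> T <= 10 * k ^+ 2 ->
  J <= k ^+ 2 / 4 * ((1 + tau) * N + (1 + tau^-1) * N ^+ 2) ->
  b * ((T * b ^+ 2 + J * (N + 2 * b)) / (N + b) ^+ 3) + 2^-1 * (1 - N / (N + b)) ^+ 2 <=
  b * (k ^+ 2 / 4 * (1 + tau) * (N + b)^-1 + (10 * k ^+ 2 + 1) * (b / (N + b) ^+ 2) + k ^+ 2 / 4 * (1 + tau^-1)).
Proof.
move=> b0 N0 t0 hT hJ; have Nb : 0 < N + b by lra.
have k2 : 0 <= k ^+ 2 / 4 by rewrite divr_ge0 ?sqr_ge0.
have D3 : 0 < (N + b) ^+ 3 by rewrite exprn_gt0.
have ti : 0 < 1 + tau^-1 by rewrite addr_gt0 ?invr_gt0.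
have s1 : (T * b ^+ 2 + J * (N + 2 * b)) / (N + b) ^+ 3 <= (10 * k ^+ 2 * b ^+ 2 +
    k ^+ 2 / 4 * ((1 + tau) * N + (1 + tau^-1) * N ^+ 2) * (N + 2 * b)) / (N + b) ^+ 3.
  rewrite ler_pM2r ?invr_gt0 // lerD //; first by rewrite ler_wpM2r ?sqr_ge0.
  by rewrite ler_wpM2r //; lra.
have s2 : b ^+ 2 / (N + b) ^+ 3 <= b / (N + b) ^+ 2.
  rewrite ler_pdivrMr // (_ : b / (N + b) ^+ 2 * (N + b) ^+ 3 = b * (N + b)); last by field; rewrite gt_eqF.
  by rewrite expr2 ler_pM2l //; lra.
have s3 : N * (N + 2 * b) / (N + b) ^+ 3 <= (N + b)^-1.
  rewrite ler_pdivrMr // (_ : (N + b)^-1 * (N + b) ^+ 3 = (N + b) ^+ 2); last by field; rewrite gt_eqF.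
  by rewrite -subr_ge0 (_ : _ - _ = b ^+ 2) ?sqr_ge0 //; ring.
have s4 : N ^+ 2 * (N + 2 * b) / (N + b) ^+ 3 <= 1.
  rewrite ler_pdivrMr // mul1r -subr_ge0 (_ : _ - _ = N * (N * b) + b * (3 * N * b + b ^+ 2)); last by ring.
  by rewrite addr_ge0 ?mulr_ge0 ?addr_ge0 ?sqr_ge0 ?(ltW b0) // ?mulr_ge0 ?(ltW b0).
have s5 : 2^-1 * (1 - N / (N + b)) ^+ 2 <= b * (b / (N + b) ^+ 2).
  rewrite (_ : 1 - N / (N + b) = b / (N + b)); last by field; rewrite gt_eqF.
  have -> : b * (b / (N + b) ^+ 2) = (b / (N + b)) ^+ 2 by field; rewrite gt_eqF.
  by rewrite ler_piMl ?sqr_ge0 //; lra.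
have s1' := ler_wpM2l (ltW b0) s1.
apply: (le_trans (lerD s1' s5)); rewrite -mulrDr ler_pM2l //.
have u2 : 10 * k ^+ 2 * (b ^+ 2 / (N + b) ^+ 3) <= 10 * k ^+ 2 * (b / (N + b) ^+ 2).
  by rewrite ler_wpM2l // mulr_ge0 // sqr_ge0.
have u3 : k ^+ 2 / 4 * (1 + tau) * (N * (N + 2 * b) / (N + b) ^+ 3) <= k ^+ 2 / 4 * (1 + tau) * (N + b)^-1.
  by rewrite ler_wpM2l // mulr_ge0 //; lra.
have u4 : k ^+ 2 / 4 * (1 + tau^-1) * (N ^+ 2 * (N + 2 * b) / (N + b) ^+ 3) <= k ^+ 2 / 4 * (1 + tau^-1).
  by rewrite -[leRHS]mulr1 ler_wpM2l // mulr_ge0 // ltW.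
rewrite (_ : (_ + _) / (N + b) ^+ 3 = 10 * k ^+ 2 * (b ^+ 2 / (N + b) ^+ 3) + k ^+ 2 / 4 * (1 + tau) * (N * (N + 2 * b) / (N + b) ^+ 3)
   + k ^+ 2 / 4 * (1 + tau^-1) * (N ^+ 2 * (N + 2 * b) / (N + b) ^+ 3)); last by ring.
move: u2 u3 u4; clear; lra.
Qed.

End Polar.

(** * Integrals of the lattice energy *)

Section PeriodIntegrals.
Context {R : realType}.
Notation k := (@kk R).
Implicit Types (A B d l r t x y : R).

(* [t + atan w] is the branch of [atan (r tan t)] that is smooth on all of R. *)
Lemma atan_tan_der r t : 0 < r ->
  is_derive t 1 (fun t : R => t + atan ((r - 1) * (sin t * cos t) / (cos t ^+ 2 + r * sin t ^+ 2)))
    (r / (cos t ^+ 2 + r ^+ 2 * sin t ^+ 2)).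
Proof.
move=> r0; have E : sin t ^+ 2 = 1 - cos t ^+ 2 by exact: sin2cos2.
have pos (a : R) : 0 < a -> 0 < cos t ^+ 2 + a * sin t ^+ 2.
  move=> a0; have c0 := sqr_ge0 (cos t); have s0 := sqr_ge0 (sin t).
  have [z|z] := eqVneq (cos t ^+ 2) 0; first by rewrite E z; lra.
  by rewrite ltr_pwDl ?lt_def ?z // mulr_ge0 // ltW.
have d1 := pos _ r0; have d2 := pos _ (exprn_gt0 2 r0).
have ds := is_derive_sin t; have dc := is_derive_cos t.
have dD : is_derive t 1 (fun t : R => cos t ^+ 2 + r * sin t ^+ 2) (2 * (r - 1) * (sin t * cos t)).
  by apply: (derE (derD (derX 1 dc) (derZ r (derX 1 ds)))); ring.
have dn : is_derive t 1 (fun t : R => (r - 1) * (sin t * cos t)) ((r - 1) * (cos t ^+ 2 - sin t ^+ 2)).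
  by apply: (derE (derZ (r - 1) (derM ds dc))); ring.
pose D (u : R) := cos u ^+ 2 + r * sin u ^+ 2.
have dw := derM dn (derV (f := D) (lt0r_neq0 d1) dD).
apply: (derE (derD (derI t) (der_comp dw (is_derive1_atan _)))).
rewrite /D; move: (E) d1 d2; move: (cos t) (sin t) => c s {}E d1 d2 /=.
have W : 1 + ((r - 1) * (s * c) / (c ^+ 2 + r * s ^+ 2)) ^+ 2 = (c ^+ 2 + r ^+ 2 * s ^+ 2) / (c ^+ 2 + r * s ^+ 2) ^+ 2.
  transitivity ((c ^+ 2 + r ^+ 2 * s ^+ 2) * (c ^+ 2 + s ^+ 2) / (c ^+ 2 + r * s ^+ 2) ^+ 2); first by field; rewrite gt_eqF.
  by rewrite E (_ : c ^+ 2 + (1 - c ^+ 2) = 1) ?mulr1 //; ring.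
have W2 : (r - 1) * (c ^+ 2 - s ^+ 2) * (c ^+ 2 + r * s ^+ 2)^-1 +
   (r - 1) * (s * c) * (- (2 * (r - 1) * (s * c)) / (c ^+ 2 + r * s ^+ 2) ^+ 2) = (r - 1) * (c ^+ 2 - r * s ^+ 2) / (c ^+ 2 + r * s ^+ 2) ^+ 2.
  transitivity ((r - 1) * (c ^+ 2 - r * s ^+ 2) * (c ^+ 2 + s ^+ 2) / (c ^+ 2 + r * s ^+ 2) ^+ 2); first by field; rewrite gt_eqF.
  by rewrite E (_ : c ^+ 2 + (1 - c ^+ 2) = 1) ?mulr1 //; ring.
rewrite W W2 invf_div; move: d1; move: (c ^+ 2 + r * s ^+ 2) => Q Q0.
transitivity (r * (c ^+ 2 + s ^+ 2) / (c ^+ 2 + r ^+ 2 * s ^+ 2)).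
  by field; rewrite exprMn !gt_eqF.
by rewrite E (_ : c ^+ 2 + (1 - c ^+ 2) = 1) ?mulr1 //; ring.
Qed.

Lemma cts_half : cts (fun y : R => k * y / 2).
Proof. by cont. Qed.

(** The antiderivative is linear plus an arctangent. The linear part gives [2 * l / c] for
    [c = Num.sqrt (A * (A + B))], and the arctangent changes by at most [pi], which contributes at
    most [k / c] because [k ^+ 2 = 2 * pi]. *)
Lemma Int_inv_cos2 A B l : 0 < A -> 0 <= B -> 0 <= l ->
  Int (- l) l (fun y => (A + B * cos (k * y / 2) ^+ 2)^-1) <= (2 * l + k) / Num.sqrt (A * (A + B)).
Proof.
move=> A0 B0 l0; have k0 := @kk_gt0 R; have AB : 0 < A + B by lra.
pose c := Num.sqrt (A * (A + B)); have c0 : 0 < c by rewrite sqrtr_gt0 mulr_gt0.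
have c2 : c ^+ 2 = A * (A + B) by rewrite sqr_sqrtr // mulr_ge0 // ltW.
pose r := A / c; have r0 : 0 < r by rewrite divr_gt0.
pose w t := (r - 1) * (sin t * cos t) / (cos t ^+ 2 + r * sin t ^+ 2).
pose F y := 2 / (k * c) * (k * y / 2 + atan (w (k * y / 2))).
have pos y : 0 < A + B * cos (k * y / 2) ^+ 2 by rewrite ltr_wpDr // mulr_ge0 // sqr_ge0.
have dF y : is_derive y 1 F (A + B * cos (k * y / 2) ^+ 2)^-1.
  have dk : is_derive y 1 (fun y : R => k * y / 2) (k / 2).
    by apply: (derE (derM (derZ k (derI y)) (derC y 2^-1))); ring.
  apply: (derE (derZ (2 / (k * c)) (der_comp dk (atan_tan_der (k * y / 2) r0)))).
  have E : sin (k * y / 2) ^+ 2 = 1 - cos (k * y / 2) ^+ 2 by exact: sin2cos2.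
  have := pos y; rewrite E; move: (cos (k * y / 2) ^+ 2) => C pC.
  have -> : C + r ^+ 2 * (1 - C) = (A + B * C) / (A + B).
    by rewrite /r expr_div_n c2; field; rewrite !gt_eqF.
  by rewrite /r; move: (k) k0 => K K0; transitivity (A * (A + B) / c ^+ 2 * (A + B * C)^-1);
    [field; rewrite !gt_eqF|rewrite c2 divff ?mul1r // gt_eqF // mulr_gt0].
rewrite (Int_FTC _ _ dF); first last.
- have chh := cts_half; apply: (@ctsV _ (fun y => A + B * cos (k * y / 2) ^+ 2)); first by cont.
  by move=> y; rewrite gt_eqF.
- lra.
have ub t : 2 / (k * c) * atan t <= pi / (k * c).
  rewrite [leRHS](_ : _ = 2 / (k * c) * (pi / 2)); last by move: (pi) (k) k0 => P K K0; field; rewrite !gt_eqF.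
  by rewrite ler_wpM2l ?divr_ge0 ?mulr_ge0 ?(ltW k0) ?(ltW c0) // ltW // atan_ltpi2.
have lb t : - (pi / (k * c)) <= 2 / (k * c) * atan t.
  rewrite [leLHS](_ : _ = 2 / (k * c) * (- (pi / 2))); last by move: (pi) (k) k0 => P K K0; field; rewrite !gt_eqF.
  by rewrite ler_wpM2l ?divr_ge0 ?mulr_ge0 ?(ltW k0) ?(ltW c0) // ltW // atan_gtNpi2.
have E : (2 * l + k) / c = 2 / (k * c) * (k * l / 2) - 2 / (k * c) * (k * - l / 2) + 2 * (pi / (k * c)).
  have -> : pi = k ^+ 2 / 2 :> R by rewrite kk_sq; field.
  by move: (k) k0 => K K0; field; rewrite !gt_eqF.
rewrite -/c E /F !mulrDr; have := ub (w (k * l / 2)); have := lb (w (k * - l / 2)).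
by move: (_ * atan _) (_ * atan _) => u v; lra.
Qed.

(** The interval is covered by at most [2 * l / T + 1] whole periods, and [f] is nonnegative. *)
Lemma Int_periodic_le (f : R -> R) (T c l : R) : 0 < T -> 0 <= l -> cts f -> (forall x, 0 <= f x) ->
  (forall x, f (x + T) = f x) -> Int 0 T f <= c -> Int (- l) l f <= (2 * l + T) / T * c.
Proof.
move=> T0 l0 cf f0 fT fc.
have [F [F0 dF]] := primitive cf.
have cst x : F (x + T) - F x = F T.
  have d0 (z : R) : is_derive z 1 (fun x : R => F (x + T) - F x) 0.
    have dx : is_derive z 1 (fun x : R => x + T) 1 by apply: (derE (derD (derI z) (derC z T))); rewrite addr0.
    by apply: (derE (derB (der_comp dx (dF (z + T))) (dF z))); rewrite fT mulr1 subrr.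
  by rewrite (derivative0_cst d0 x 0) add0r F0 subr0.
have FT : F T = Int 0 T f by rewrite (Int_FTC _ cf dF) ?F0 ?subr0 // ltW.
have FT0 : 0 <= F T by rewrite FT; apply: Int_ge0 => //; exact: ltW.
have step x m : F (x + m%:R * T) = F x + m%:R * F T.
  elim: m => [|m IH]; first by rewrite !mul0r !addr0.
  have -> : x + m.+1%:R * T = (x + m%:R * T) + T by rewrite -natr1; ring.
  by have := cst (x + m%:R * T); rewrite IH -natr1 => h; lra.
pose m := (Num.truncn (2 * l / T)).+1.
have h0 : 0 <= 2 * l / T by rewrite divr_ge0 ?(ltW T0) //; lra.
have /andP[m1 m2] := truncn_itv h0.
have mono x y : x <= y -> F x <= F y.
  by move=> xy; rewrite -subr_ge0 -(Int_FTC xy cf dF); exact: Int_ge0.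
rewrite (Int_FTC _ cf dF); last lra.
have h1 : F l <= F (- l) + m%:R * F T.
  by rewrite -step; apply: mono; move: m2; rewrite ltr_pdivrMr // -/m => h; lra.
apply: (@le_trans _ _ (m%:R * F T)); first lra.
apply: ler_pM => //; last by rewrite FT.
by rewrite mulrDl divff ?gt_eqF // /m -natr1; lra.
Qed.

(** Source of the logarithm. The numerator 1 is split into [sin] and [1 - sin]: the first part has
    an explicit antiderivative, an inverse hyperbolic sine of [cos / d], and the second quotient is
    at most 1 since [1 - sin <= cos ^+ 2 <= |cos|] on the half period. *)
Lemma Int_inv_sqrt d l : 0 < d -> d <= 1 -> 0 <= l ->
  Int (- l) l (fun x => (Num.sqrt (cos (k * x / 2) ^+ 2 + d ^+ 2))^-1) <=
    (2 * l + k) * (2 / pi * (- ln d + 2) + 1).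
Proof.
move=> d0 d1 l0; have k0 := @kk_gt0 R; have p0 := pi_gt0 R.
pose N x := cos (k * x / 2) ^+ 2 + d ^+ 2.
have N0 x : 0 < N x by rewrite ltr_wpDl ?sqr_ge0 // exprn_gt0.
have chh := cts_half.
have cN : cts N by rewrite /N; cont.
have cs : cts (fun x => Num.sqrt (N x)).
  by move=> x; apply: (@continuous_comp _ _ _ N (@Num.sqrt R)); [exact: cN|exact: sqrt_continuous].
have cf : cts (fun x => (Num.sqrt (N x))^-1) by apply: ctsV => // x; rewrite gt_eqF // sqrtr_gt0.
have -> : (2 * l + k) * (2 / pi * (- ln d + 2) + 1) = (2 * l + k) / k * (4 / k * (- ln d + 2) + k).
  have -> : pi = k ^+ 2 / 2 :> R by rewrite kk_sq; field.
  by move: (k) k0 => K K0; field; rewrite !gt_eqF.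
have kk2 : k * k / 2 = pi by rewrite -expr2 kk_sq; field.
apply: Int_periodic_le => //.
- move=> x; have -> : k * (x + k) / 2 = k * x / 2 + pi by rewrite -kk2; field.
  by rewrite cosDpi sqrrN.
pose f x := sin (k * x / 2) * (Num.sqrt (N x))^-1.
have cff : cts f by rewrite /f; cont.
pose H (u : R) := ln (u + Num.sqrt (u ^+ 2 + d ^+ 2)).
have sq_gt (u : R) : `|u| < Num.sqrt (u ^+ 2 + d ^+ 2).
  by rewrite -sqrtr_sqr ltr_sqrt ?ltrDl ?exprn_gt0 // ltr_wpDl ?sqr_ge0 // exprn_gt0.
have Hpos (u : R) : 0 < u + Num.sqrt (u ^+ 2 + d ^+ 2).
  by have := sq_gt u; rewrite ltr_norml => /andP[h _]; lra.
have dH (u : R) : is_derive u 1 H (Num.sqrt (u ^+ 2 + d ^+ 2))^-1.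
  have q0 : 0 < u ^+ 2 + d ^+ 2 by rewrite ltr_wpDl ?sqr_ge0 // exprn_gt0.
  have s0 : 0 < Num.sqrt (u ^+ 2 + d ^+ 2) by rewrite sqrtr_gt0.
  have d2 := derD (derX 1 (derI u)) (derC u (d ^+ 2)).
  apply: (derE (der_comp (derD (derI u) (der_comp d2 (is_derive1_sqrt q0))) (is_derive1_ln (Hpos u)))).
  have := Hpos u; move: s0; move: (Num.sqrt _) => S S0 h.
  by field; rewrite !gt_eqF.
have dG (x : R) : is_derive x 1 (fun x : R => - (2 / k) * H (cos (k * x / 2))) (f x).
  have dk : is_derive x 1 (fun y : R => k * y / 2) (k / 2).
    by apply: (derE (derM (derZ k (derI x)) (derC x 2^-1))); ring.
  apply: (derE (derZ _ (der_comp (der_comp dk (is_derive_cos _)) (dH _)))).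
  by rewrite /f /N; move: ((Num.sqrt _)^-1) => S; move: (k) k0 (sin _) => K K0 s; field; rewrite gt_eqF.
apply: (@le_trans _ _ (Int 0 k (fun x => f x + 1))).
  apply: Int_le => //; first by cont.
  move=> x /andP[x0 x1]; have := N0 x; rewrite /f; set S := Num.sqrt (N x) => Nx.
  have S0 : 0 < S by rewrite sqrtr_gt0.
  have sx : 0 <= sin (k * x / 2) by rewrite sin_ge0_pi // -kk2 divr_ge0 ?mulr_ge0 ?(ltW k0) //= ler_pM2r ?invr_gt0 // ler_pM2l.
  have s1 := sin_le1 (k * x / 2).
  have sc : cos (k * x / 2) ^+ 2 = 1 - sin (k * x / 2) ^+ 2 by exact: cos2sin2.
  have cS : `|cos (k * x / 2)| <= S by rewrite ltW // /S /N sq_gt.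
  have c1 : `|cos (k * x / 2)| <= 1 by rewrite ler_norml cos_geN1 cos_le1.
  have h : 1 - sin (k * x / 2) <= S.
    apply: le_trans cS; apply: (@le_trans _ _ (cos (k * x / 2) ^+ 2)).
      rewrite sc -subr_ge0 (_ : _ - _ = sin (k * x / 2) * (1 - sin (k * x / 2))); last by ring.
      by rewrite mulr_ge0 // subr_ge0.
    by rewrite -real_normK ?num_real // expr2 ler_piMl.
  rewrite -lerBlDl -[X in X - _]mul1r -mulrBl ler_pdivrMr // mul1r.
  exact: h.
rewrite IntD //; last by cont.
rewrite Int_cst ?(ltW k0) // mul1r subr0 lerD2r (Int_FTC (ltW k0) cff dG).
rewrite mulr0 mul0r cos0 kk2 cospi /H sqrrN expr1n.
set S := Num.sqrt (1 + d ^+ 2).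
have q0 : 0 < 1 + d ^+ 2 by rewrite ltr_wpDr ?sqr_ge0.
have S2 : S ^+ 2 = 1 + d ^+ 2 by rewrite sqr_sqrtr // ltW.
have S1 : 1 < S by have := sq_gt 1; rewrite normr1 expr1n.
have Sle : S <= 2.
  rewrite -(@ler_pXn2r _ 2) ?nnegrE ?(ltW (lt_trans ltr01 S1)) // S2.
  have : d ^+ 2 <= 1 by rewrite expr_le1 // ltW.
  lra.
(* Rewriting the near-cancellation at [cos = -1] as [d ^+ 2 / (1 + S)] exhibits the term
   [2 * ln d]. *)
have E : -1 + S = d ^+ 2 / (1 + S).
  have -> : d ^+ 2 = S ^+ 2 - 1 by rewrite S2; ring.
  by field; rewrite gt_eqF //; lra.
have l1 : ln (1 + S) <= 2.
  have S10 : -1 < S by lra.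
  by apply: (le_trans (le_ln1Dx S10)).
have L1 : ln (-1 + S) = 2 * ln d - ln (1 + S).
  rewrite E ln_div ?posrE ?exprn_gt0 //; last lra.
  by rewrite lnXn // mulr_natl.
rewrite L1.
rewrite [leRHS](_ : _ = 2 / k * (2 * (- ln d + 2))); last by ring.
rewrite [leLHS](_ : _ = 2 / k * (2 * (- ln d + ln (1 + S)))); last by ring.
by rewrite ler_wpM2l ?divr_ge0 ?(ltW k0) //; lra.
Qed.

End PeriodIntegrals.

(** * Iterated integration over the cube *)

Section CubeIntegral.
Context {R : realType}.
Notation mu1 := (@lebesgue_measure R).
Notation mu2 := (prod_sfm mu1 mu1).
Notation mu3 := (vol R).

Lemma integral_Int (a b : R) (f : R -> R) : cts f ->
  (\int[mu1]_x (f x * \1_(`[a, b]%classic : set R) x)%:E = (Int a b f)%:E)%E.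
Proof.
move=> cf; have fi := cont_itv_integrable a b cf.
rewrite /Int EFin_Rintegral // [RHS]integral_mkcond; apply: eq_integral => x _ /=.
by rewrite patchE indicE; case: ifP => _; rewrite ?mulr1 ?mulr0.
Qed.

(** The open cube is enlarged to a product of closed intervals. The third coordinate contributes the
    factor [L], then the integral is bounded in [y] for fixed [x], and finally in [x]. *)
Lemma cube_integral_le (L c : R) (h : R -> R -> R) (g : R -> R) : 0 < L ->
  continuous (fun z : pt R => h z.1.1 z.1.2) -> (forall x y, 0 <= h x y) -> (forall x, cts (h x)) ->
  cts g -> (forall x, Int (- (L / 2)) (L / 2) (h x) <= g x) -> Int (- (L / 2)) (L / 2) g <= c ->
  (\int[mu3]_(z in cube L) (h z.1.1 z.1.2)%:E <= (L * c)%:E)%E.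
Proof.
move=> L0 ch h0 chx cg hg gc.
pose I : set R := `[- (L / 2), L / 2]%classic; pose i (x : R) : R := \1_I x.
have mI : measurable I by exact: measurable_itv.
have i0 x : 0 <= i x by rewrite /i indicE.
have mi : measurable_fun setT i by exact: measurable_indic.
have mQ : measurable (cube L : set (pt R)) by rewrite cubeE; exact: measurable_box.
have mh := continuous_measurable_pt ch.
pose H (p : R * R) := h p.1 p.2 * i p.2 * i p.1.
have mH : measurable_fun setT H.
  have mh2 : measurable_fun setT (fun p : R * R => h p.1 p.2) by exact: (measurableT_comp mh (pair2_measurable (0 : R))).
  apply: measurable_funM; last exact: (measurableT_comp mi measurable_fst).
  by apply: measurable_funM => //; exact: (measurableT_comp mi measurable_snd).
have H0 p : 0 <= H p by rewrite /H !mulr_ge0.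
have mHz : measurable_fun setT (fun z : pt R => H z.1 * i z.2).
  by apply: measurable_funM; [exact: (measurableT_comp mH measurable_fst)|exact: (measurableT_comp mi measurable_snd)].
have muI : (mu1 I = L%:E)%E.
  by rewrite /I lebesgue_measure_itv /= lte_fin ifT; [rewrite -EFinB; congr (_%:E)|]; lra.
apply: (@le_trans _ _ (\int[mu3]_z (H z.1 * i z.2)%:E)%E).
  rewrite integral_mkcond; apply: ge0_le_integral => //.
  - by move=> z _; rewrite patchE; case: ifP => _; rewrite lee_fin.
  - by apply/measurable_restrict => //; rewrite setTI; apply/measurable_EFinP; exact: measurable_funTS.
  - exact/measurable_EFinP.
  move=> z _; rewrite patchE; case: ifPn => zQ; last by rewrite lee_fin mulr_ge0.
  have inI (j : 'I_3) : i (Defs.coord j z) = 1.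
    rewrite /i indicE mem_set //; move: zQ; rewrite inE => /(_ j) /andP[h1 h2].
    by rewrite /I /= in_itv /= !ltW.
  have := inI (inord 0); have := inI (inord 1); have := inI (inord 2).
  by rewrite /Defs.coord /= !inordK // /H => -> -> ->; rewrite !mulr1.
rewrite (@fubini_tonelli1 _ _ _ _ R mu2 mu1 (fun z : pt R => (H z.1 * i z.2)%:E)) //=; first last.
- by move=> z; rewrite lee_fin mulr_ge0.
- exact/measurable_EFinP.
have Ei : (\int[mu1]_x (i x)%:E = L%:E)%E by rewrite integral_indic // setIT.
have E1 p : fubini_F mu1 (fun z : pt R => (H z.1 * i z.2)%:E) p = (L%:E * (H p)%:E)%E.
  rewrite /fubini_F /=; under eq_integral do rewrite EFinM.
  rewrite ge0_integralZl ?lee_fin //; first last.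
  - by move=> x _; rewrite lee_fin.
  - exact/measurable_EFinP.
  by rewrite muleC; congr (_ * _)%E; exact: Ei.
rewrite (_ : (\int[_]_x fubini_F _ _ x = \int[mu2]_p (L%:E * (H p)%:E))%E); last by apply: eq_integral => p _; exact: E1.
rewrite ge0_integralZl ?lee_fin ?(ltW L0) //; first last.
- by move=> p _; rewrite lee_fin.
- exact/measurable_EFinP.
rewrite EFinM lee_wpmul2l ?lee_fin ?(ltW L0) //.
rewrite (@fubini_tonelli1 _ _ _ _ R mu1 mu1 (fun p : R * R => (H p)%:E)) //=; first last.
- exact/measurable_EFinP.
have E2 x : fubini_F mu1 (fun p : R * R => (H p)%:E) x = (Int (- (L / 2)) (L / 2) (h x) * i x)%:E.
  rewrite /fubini_F /H /=; under eq_integral do rewrite EFinM muleC.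
  rewrite ge0_integralZl ?lee_fin //; first last.
  - by move=> y _; rewrite lee_fin mulr_ge0.
  - apply/measurable_EFinP; apply: measurable_funM => //; exact: continuous_measurable_fun (chx x).
  by rewrite integral_Int // muleC EFinM.
apply: (@le_trans _ _ (\int[mu1]_x (g x * i x)%:E)%E); last by rewrite integral_Int // lee_fin.
have mF := @measurable_fun_fubini_tonelli_F _ _ _ _ R mu1 (fun p : R * R => (H p)%:E).
apply: ge0_le_integral => //.
- by move=> x _; apply: integral_ge0 => y _; rewrite lee_fin.
- by apply: mF => //; exact/measurable_EFinP.
- by apply/measurable_EFinP; apply: measurable_funM => //; exact: continuous_measurable_fun.
move=> x _; apply: (@le_trans _ _ (Int (- (L / 2)) (L / 2) (h x) * i x)%:E); last by rewrite lee_fin ler_wpM2r.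
by rewrite le_eqVlt; apply/orP; left; apply/eqP; exact: E2.
Qed.

End CubeIntegral.

(** * The explicit majorant of the energy density *)

Section Majorant.
Context {R : realType}.
Notation k := (@kk R).
Notation mu3 := (vol R).

Definition latN (x y : R) : R := 1 - sin (k * x / 2) ^+ 2 * sin (k * y / 2) ^+ 2.

Lemma latN_ge0 x y : 0 <= latN x y.
Proof.
have a1 : sin (k * x / 2) ^+ 2 <= 1 by rewrite sin2cos2; have := sqr_ge0 (cos (k * x / 2)); lra.
have a2 : sin (k * y / 2) ^+ 2 <= 1 by rewrite sin2cos2; have := sqr_ge0 (cos (k * y / 2)); lra.
have b1 := sqr_ge0 (sin (k * x / 2)); have b2 := sqr_ge0 (sin (k * y / 2)).
by have := ler_pM b1 b2 a1 a2; rewrite mulr1 /latN subr_ge0.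
Qed.

(** The [c1] term carries the logarithm, the [c2] term the vortex cores, and the [c3] term is
    bounded. *)
Definition majorant (b c1 c2 c3 x y : R) : R :=
  b * (c1 * (latN x y + b)^-1 + c2 * (b / (latN x y + b) ^+ 2) + c3).

Lemma majorant_cts b c1 c2 c3 x : 0 < b -> cts (majorant b c1 c2 c3 x).
Proof.
move=> b0; have chh := @cts_half R; pose D y := latN x y + b.
have cD : cts D by rewrite /D /latN; cont.
have cV : cts (fun y => (D y)^-1) by apply: ctsV => // y; rewrite gt_eqF // ltr_wpDl // latN_ge0.
rewrite (_ : majorant _ _ _ _ _ = fun y => b * (c1 * (D y)^-1 + c2 * (b * (D y)^-1 ^+ 2) + c3)); first by cont.
by apply/funext => y; rewrite /majorant exprVn.
Qed.

(** The minimum over [y] of [latN x y + d ^+ 2], attained where [cos (k * y / 2) = 0]. *)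
Definition latA (d x : R) : R := cos (k * x / 2) ^+ 2 + d ^+ 2.

Lemma latA_gt0 d x : 0 < d -> 0 < latA d x.
Proof. by move=> d0; rewrite ltr_wpDl ?sqr_ge0 // exprn_gt0. Qed.

Lemma cts_latA d : cts (latA d).
Proof. by have chh := @cts_half R; rewrite /latA; cont. Qed.

Lemma cts_latA_inv d : 0 < d -> cts (fun x => (latA d x)^-1) /\ cts (fun x => (Num.sqrt (latA d x))^-1).
Proof.
move=> d0; have cA := @cts_latA d; split; apply: ctsV => //.
- by move=> x; rewrite gt_eqF // latA_gt0.
- by move=> x; apply: (@continuous_comp _ _ _ (latA d) (@Num.sqrt R)); [exact: cA|exact: sqrt_continuous].
- by move=> x; rewrite gt_eqF // sqrtr_gt0 latA_gt0.
Qed.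

Definition inner_bound (d c1 c2 c3 l x : R) : R :=
  d ^+ 2 * (c1 * ((2 * l + k) * (Num.sqrt (latA d x))^-1) + c2 * ((2 * l + k) * (d * (latA d x)^-1)) + c3 * (2 * l)).

Lemma cts_inner_bound d c1 c2 c3 l : 0 < d -> cts (inner_bound d c1 c2 c3 l).
Proof. by move=> /cts_latA_inv [h1 h2]; rewrite /inner_bound; cont. Qed.

(** In [y] the denominator is [A + B * cos (k * y / 2) ^+ 2] with [A + B = 1 + d ^+ 2], so
    [Int_inv_cos2] applies. In the core term one of the two denominators is first replaced by its
    minimum [A]. *)
Lemma majorant_inner (d c1 c2 c3 l x : R) : 0 < d -> 0 <= c1 -> 0 <= c2 -> 0 <= l ->
  Int (- l) l (majorant (d ^+ 2) c1 c2 c3 x) <= inner_bound d c1 c2 c3 l x.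
Proof.
move=> d0 c10 c20 l0; rewrite /inner_bound; set A := latA d x; have k0 := @kk_gt0 R; have b0 : 0 < d ^+ 2 by rewrite exprn_gt0.
have chh := @cts_half R.
have A0 : 0 < A by exact: latA_gt0.
pose B := sin (k * x / 2) ^+ 2; have B0 : 0 <= B by exact: sqr_ge0.
have AB : A + B = 1 + d ^+ 2 by have := cos2Dsin2 (k * x / 2); rewrite /A /latA /B; lra.
pose f y := (A + B * cos (k * y / 2) ^+ 2)^-1.
have D0 y : 0 < A + B * cos (k * y / 2) ^+ 2 by rewrite ltr_wpDr // mulr_ge0 // sqr_ge0.
have cf : cts f by apply: ctsV; [cont|move=> y; rewrite gt_eqF].
have EN y : latN x y + d ^+ 2 = A + B * cos (k * y / 2) ^+ 2.
  by rewrite /latN /A /latA /B (cos2sin2 (k * x / 2)) (cos2sin2 (k * y / 2)); ring.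
have I1 := Int_inv_cos2 A0 B0 l0; rewrite -/(Int (- l) l f) in I1.
have kl : 0 <= 2 * l + k by lra.
have sA : 0 < Num.sqrt A by rewrite sqrtr_gt0.
have s1 : (2 * l + k) / Num.sqrt (A * (A + B)) <= (2 * l + k) * (Num.sqrt A)^-1.
  rewrite ler_wpM2l // lef_pV2 ?posrE ?sqrtr_gt0 //; last by rewrite mulr_gt0 // AB; lra.
  by rewrite ler_sqrt ?mulr_ge0 ?(ltW A0) // ?AB; [rewrite ler_peMr ?(ltW A0) //; lra|lra].
have s2 : d ^+ 2 / A * ((2 * l + k) / Num.sqrt (A * (A + B))) <= (2 * l + k) * (d / A).
  have dS : d <= Num.sqrt (A * (A + B)).
    rewrite -[leLHS](gtr0_norm d0) -sqrtr_sqr ler_sqrt ?mulr_ge0 ?(ltW A0) // ?AB; last lra.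
    have : 0 <= A * d ^+ 2 by rewrite mulr_ge0 ?(ltW A0) // ltW.
    by have : d ^+ 2 <= A; [rewrite /A /latA lerDr sqr_ge0|rewrite mulrDr mulr1; lra].
  have S0 : 0 < Num.sqrt (A * (A + B)) by exact: lt_le_trans dS.
  rewrite (_ : d ^+ 2 / A * _ = (2 * l + k) * (d / A) * (d / Num.sqrt (A * (A + B)))).
    apply: ler_piMr; first by rewrite mulr_ge0 ?divr_ge0 ?(ltW A0) ?(ltW d0).
    by rewrite ler_pdivrMr // mul1r.
  by move: (Num.sqrt _) S0 => S S0; field; rewrite !gt_eqF.
apply: (@le_trans _ _ (Int (- l) l (fun y => d ^+ 2 * (c1 + c2 * (d ^+ 2 / A)) * f y + d ^+ 2 * c3))).
  apply: Int_le; [exact: majorant_cts|by cont|move=> y _].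
  rewrite [leRHS](_ : _ = d ^+ 2 * ((c1 + c2 * (d ^+ 2 / A)) * f y + c3)); last by ring.
  rewrite /majorant EN -/(f y) ler_pM2l // mulrDl lerD2r lerD2l -[leRHS]mulrA ler_wpM2l //.
  rewrite expr2 invfM -/(f y) mulrA ler_wpM2r ?invr_ge0 ?(ltW (D0 y)) // ler_pM2l // lef_pV2 ?posrE //.
  by rewrite lerDl mulr_ge0 // sqr_ge0.
rewrite IntD //; [|by cont|by cont].
rewrite IntZ // Int_cst; last lra.
have h1 : (c1 + c2 * (d ^+ 2 / A)) * Int (- l) l f <= c1 * ((2 * l + k) * (Num.sqrt A)^-1) + c2 * ((2 * l + k) * (d / A)).
  have q0 : 0 <= d ^+ 2 / A by rewrite divr_ge0 // ltW.
  rewrite mulrDl lerD //.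
    by rewrite ler_wpM2l // (le_trans I1).
  rewrite -mulrA ler_wpM2l //; apply: le_trans s2; exact: ler_wpM2l.
have := ler_wpM2l (ltW b0) h1; move: (Int _ _ _) => I; rewrite opprK; clear; lra.
Qed.

(** The first term is the logarithmic integral; in the core term the spare factor [d] compensates
    the [1 / d] coming from [Int_inv_cos2]. *)
Lemma majorant_outer (d c1 c2 c3 l : R) : 0 < d -> d <= 1 -> 0 <= c1 -> 0 <= c2 -> 0 <= l ->
  Int (- l) l (inner_bound d c1 c2 c3 l) <=
  d ^+ 2 * (c1 * ((2 * l + k) ^+ 2 * (2 / pi * (- ln d + 2) + 1)) + c2 * (2 * l + k) ^+ 2 + c3 * (2 * l) ^+ 2).
Proof.
move=> d0 d1 c10 c20 l0; have k0 := @kk_gt0 R; have b0 : 0 < d ^+ 2 by rewrite exprn_gt0.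
pose f x := (Num.sqrt (latA d x))^-1.
pose g x := (d ^+ 2 + 1 * cos (k * x / 2) ^+ 2)^-1.
have Eg : g = fun x => (latA d x)^-1 by apply/funext => x; rewrite /g /latA mul1r addrC.
have [cg cf] := cts_latA_inv d0; rewrite -Eg -/f in cg cf.
have kl : 0 <= 2 * l + k by lra.
rewrite (_ : inner_bound _ _ _ _ _ = fun x => d ^+ 2 * (c1 * (2 * l + k)) * f x + (d ^+ 2 * (c2 * (2 * l + k) * d) * g x + d ^+ 2 * (c3 * (2 * l)))); last first.
  by apply/funext => x; rewrite Eg /inner_bound /f; ring.
rewrite IntD //; [|by cont|by cont].
rewrite IntD //; [|by cont|by cont].
rewrite (IntZ _ _ _ cf) (IntZ _ _ _ cg) Int_cst; last lra.
have I1 := Int_inv_sqrt d0 d1 l0; rewrite -/(Int (- l) l f) in I1.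
have I2 := @Int_inv_cos2 R (d ^+ 2) 1 l b0 ler01 l0; rewrite -/(Int (- l) l g) in I2.
have h1 : d ^+ 2 * (c1 * (2 * l + k)) * Int (- l) l f <= d ^+ 2 * (c1 * ((2 * l + k) ^+ 2 * (2 / pi * (- ln d + 2) + 1))).
  rewrite [leRHS](_ : _ = d ^+ 2 * (c1 * (2 * l + k)) * ((2 * l + k) * (2 / pi * (- ln d + 2) + 1))); last by ring.
  by rewrite ler_wpM2l // mulr_ge0 ?(ltW b0) // mulr_ge0.
have h2 : d ^+ 2 * (c2 * (2 * l + k) * d) * Int (- l) l g <= d ^+ 2 * (c2 * (2 * l + k) ^+ 2).
  rewrite [leRHS](_ : _ = d ^+ 2 * (c2 * (2 * l + k) * d) * ((2 * l + k) / d)); last by field; rewrite gt_eqF.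
  rewrite ler_wpM2l ?mulr_ge0 ?(ltW b0) ?(ltW d0) //.
  apply: (le_trans I2); rewrite ler_wpM2l // lef_pV2 ?posrE ?sqrtr_gt0 //; last first.
    by rewrite mulr_gt0 //; lra.
  rewrite -[leLHS](gtr0_norm d0) -sqrtr_sqr ler_sqrt; first by rewrite ler_peMr ?(ltW b0) //; lra.
  by rewrite mulr_ge0 ?(ltW b0) //; lra.
move: h1 h2; move: (Int _ _ f) (Int _ _ g) => I J; rewrite opprK; clear; lra.
Qed.

Lemma majorant_cont b c1 c2 c3 : 0 < b -> continuous (fun z : pt R => majorant b c1 c2 c3 z.1.1 z.1.2).
Proof.
move=> b0; have chh := @cts_half R.
pose D (z : pt R) := latN z.1.1 z.1.2 + b.
have D0 z : 0 < D z by rewrite ltr_wpDl // latN_ge0.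
have cs : cts (fun t => sin (k * t / 2)) by cont.
have cD : continuous D.
  apply: ptD; [apply: ptD; [exact: ptC|apply: ptN; apply: ptM; apply: ptX2]|exact: ptC].
    by apply: (pt_comp1 cs); exact: pt_c1.
  by apply: (pt_comp1 cs); exact: pt_c2.
have cV : continuous (fun z => (D z)^-1) by apply: ptV => // z; rewrite gt_eqF.
rewrite (_ : (fun z : pt R => _) = fun z => b * (c1 * (D z)^-1 + c2 * (b * (D z)^-1 ^+ 2) + c3)).
  apply: ptM; [exact: ptC|apply: ptD; [apply: ptD|exact: ptC]]; apply: ptM; try exact: ptC; first by [].
  by apply: ptM; [exact: ptC|exact: ptX2].
by apply/funext => z; rewrite /majorant exprVn.
Qed.

Lemma majorant_integral (d c1 c2 c3 L : R) : 0 < d -> d <= 1 -> 0 <= c1 -> 0 <= c2 -> 0 <= c3 -> 0 < L ->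
  (\int[mu3]_(z in cube L) (majorant (d ^+ 2) c1 c2 c3 z.1.1 z.1.2)%:E <=
   (L * (d ^+ 2 * (c1 * ((L + k) ^+ 2 * (2 / pi * (- ln d + 2) + 1)) + c2 * (L + k) ^+ 2 + c3 * L ^+ 2)))%:E)%E.
Proof.
move=> d0 d1 c10 c20 c30 L0; have b0 : 0 < d ^+ 2 by rewrite exprn_gt0.
have chh := @cts_half R; have l0 : 0 <= L / 2 by lra.
have L2 : 2 * (L / 2) = L by field.
apply: (@cube_integral_le R L _ (majorant (d ^+ 2) c1 c2 c3) (inner_bound d c1 c2 c3 (L / 2))) => //.
- exact: majorant_cont.
- move=> x y; have := latN_ge0 x y => n0; have D0 : 0 < latN x y + d ^+ 2 by lra.
  by rewrite mulr_ge0 ?(ltW b0) // !addr_ge0 // mulr_ge0 ?invr_ge0 ?divr_ge0 ?(ltW b0) ?(ltW D0) // exprn_ge0 // ltW.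
- by move=> x; exact: majorant_cts.
- exact: cts_inner_bound.
- by move=> x; exact: majorant_inner.
by have := majorant_outer c3 d0 d1 c10 c20 l0; rewrite L2.
Qed.

End Majorant.

(** * The upper bound *)

Section CtsPolar.
Context {R : realType}.
Notation mu3 := (vol R).

Lemma pt_amp b (v w : pt R -> R) : 0 < b -> continuous v -> continuous w -> continuous (fun z => amp b (v z) (w z)).
Proof.
move=> b0 cv cw; apply: ptV; last by move=> z; rewrite gt_eqF // sqrtr_gt0 amp_den_gt0.
apply: (@pt_comp1 R (@Num.sqrt R)); first by move=> x; exact: sqrt_continuous.
by apply: ptD; [apply: ptD; exact: ptX2|exact: ptC].
Qed.

Lemma pt_pol b (v w f : pt R -> R) : 0 < b -> continuous v -> continuous w -> continuous f ->
  continuous (fun z => polR b (v z) (w z) (f z)) /\ continuous (fun z => polI b (v z) (w z) (f z)).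
Proof.
move=> b0 cv cw cf; have ca := pt_amp b0 cv cw.
have cc := pt_comp1 (@continuous_cos1 R) cf; have cs := pt_comp1 (@continuous_sin1 R) cf.
by split; apply: ptM => //; apply: ptD; try apply: ptN; exact: ptM.
Qed.

Lemma pt_dpol b (v w dv dw f : pt R -> R) : 0 < b -> continuous v -> continuous w -> continuous dv -> continuous dw -> continuous f ->
  continuous (fun z => dpolR b (v z) (w z) (dv z) (dw z) (f z)) /\ continuous (fun z => dpolI b (v z) (w z) (dv z) (dw z) (f z)).
Proof.
move=> b0 cv cw cdv cdw cf; have ca := pt_amp b0 cv cw.
have cc := pt_comp1 (@continuous_cos1 R) cf; have cs := pt_comp1 (@continuous_sin1 R) cf.
have cd : continuous (fun z => damp b (v z) (w z) (dv z) (dw z)).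
  apply: ptM => //; apply: ptM; first by apply: ptN; apply: ptD; exact: ptM.
  apply: ptV; last by move=> z; rewrite gt_eqF // amp_den_gt0.
  by apply: ptD; [apply: ptD; exact: ptX2|exact: ptC].
by split; apply: ptD; apply: ptM => //; apply: ptD; try apply: ptN; exact: ptM.
Qed.

Lemma L2_cube_continuous (L : R) (f : pt R -> R) : 0 < L -> continuous f -> L2 (cube L) f.
Proof.
move=> L0 cf; have mf := continuous_measurable_pt cf.
have mQ : measurable (cube L : set (pt R)) by rewrite cubeE; exact: measurable_box.
split; first exact: measurable_funTS.
have cf2 : continuous (fun x => f x ^+ 2) by exact: ptX2.
pose I : set R := `[- (L / 2), L / 2]%classic.
have cI : compact I by exact: segment_compact.
have cK := compact_setX (compact_setX cI cI) cI.
have K0 : ((I `*` I) `*` I) ((0, 0), 0) by repeat split; rewrite /I /= in_itv /=; apply/andP; split; lra.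
have cn : {within (I `*` I) `*` I, continuous (fun x : pt R => f x ^+ 2)} by exact: continuous_subspaceT.
have [c _ Hc] := compact_EVT_max (ex_intro _ _ K0) cK cn.
apply: measurable_bounded_integrable => //.
- have fin : (mu3 (cube L) < +oo)%E by rewrite cubeE vol_box ?ltry //; lra.
  exact: fin.
- by apply: measurable_funTS; exact: continuous_measurable_pt.
exists (f c ^+ 2); split; first exact: num_real.
move=> y hy x xQ /=; rewrite ger0_norm ?sqr_ge0 //; apply: le_trans (ltW hy); apply: Hc; apply: mem_set.
have h (j : 'I_3) : I (Defs.coord j x) by have /andP[h1 h2] := xQ j; rewrite /I /= in_itv /= !ltW.
have h0 := h (inord 0); have h1 := h (inord 1); have h2 := h (inord 2).
by rewrite /Defs.coord /= !inordK in h0 h1 h2.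
Qed.

End CtsPolar.

(** * The trial function as a competitor *)

Section Trial.
Context {R : realType}.
Notation k := (@kk R).
Notation mu3 := (vol R).
Variables (M : nat) (b : R).
Hypothesis b0 : 0 < b.

Let vr (z : pt R) := VR M z.1.1 z.1.2.
Let vi (z : pt R) := VI M z.1.1 z.1.2.
(** Its gradient turns the potential [(0, x)], natural for the lattice sum, into the symmetric
    [(- y / 2, x / 2)]. *)
Definition gauge (z : pt R) : R := - 2^-1 * (z.1.1 * z.1.2).
Definition trialR (z : pt R) := polR b (vr z) (vi z) (gauge z).
Definition trialI (z : pt R) := polI b (vr z) (vi z) (gauge z).
(** Covariant derivatives come first and the gradients below add the potential back, so the energy
    density sees only these. The trial function is constant in the third variable. *)
Definition covR (j : 'I_3) (z : pt R) : R :=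
  match val j with
  | 0%N => dpolR b (vr z) (vi z) (XR M z.1.1 z.1.2) (XI M z.1.1 z.1.2) (gauge z)
  | 1%N => dpolR b (vr z) (vi z) (YR M z.1.1 z.1.2) (YI M z.1.1 z.1.2) (gauge z)
  | _ => 0 end.
Definition covI (j : 'I_3) (z : pt R) : R :=
  match val j with
  | 0%N => dpolI b (vr z) (vi z) (XR M z.1.1 z.1.2) (XI M z.1.1 z.1.2) (gauge z)
  | 1%N => dpolI b (vr z) (vi z) (YR M z.1.1 z.1.2) (YI M z.1.1 z.1.2) (gauge z)
  | _ => 0 end.
Definition gradR (j : 'I_3) (z : pt R) := covR j z - Fpot j z * trialI z.
Definition gradI (j : 'I_3) (z : pt R) := covI j z + Fpot j z * trialR z.

Lemma gauge_cont : continuous gauge.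
Proof. by apply: ptM; [exact: ptC|apply: ptM; [exact: pt_c1|exact: pt_c2]]. Qed.

Lemma trial_cont : [/\ continuous trialR, continuous trialI & forall j, continuous (covR j) /\ continuous (covI j)].
Proof.
have [c1 c2 c3 c4 [c5 c6]] := @V_cont R M; have cg := gauge_cont.
have [h1 h2] := pt_pol b0 c1 c2 cg.
split=> // -[[|[|j]] hj].
- exact: pt_dpol.
- exact: pt_dpol.
- by split; exact: ptC.
Qed.

Lemma Fpot_cont (j : 'I_3) : continuous (@Fpot R j).
Proof.
case: j => [[|[|j]] hj]; rewrite /Fpot /=.
- by apply: ptN; apply: ptM; [exact: pt_c2|exact: ptC].
- by apply: ptM; [exact: pt_c1|exact: ptC].
- exact: ptC.
Qed.

Lemma trial_der (j : 'I_3) (z : pt R) :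
  is_derive (Defs.coord j z : R) 1 (fun t => trialR (upd j z t)) (gradR j z) /\
  is_derive (Defs.coord j z : R) 1 (fun t => trialI (upd j z t)) (gradI j z).
Proof.
case: z => -[x y] w; case: j => [[|[|j]] hj]; rewrite /gradR /gradI /covR /covI /trialR /trialI /Defs.coord /upd /Fpot /vr /vi /gauge /=.
- have dg : is_derive x 1 (fun t : R => - 2^-1 * (t * y)) (- (y / 2)).
    by apply: (derE (derZ _ (derM (derI x) (derC x y)))); field.
  exact: (pol_der b0 (VR_dx M x y) (VI_dx M x y) dg).
- have dg : is_derive y 1 (fun t : R => - 2^-1 * (x * t)) (- (x / 2)).
    by apply: (derE (derZ _ (derM (derC y x) (derI y)))); field.
  have [h1 h2] := pol_der b0 (VR_dy M x y) (VI_dy M x y) dg.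
  have [e1 e2] := pol_shift (VR M x y) (VI M x y) (YR M x y) (YI M x y) (- 2^-1 * (x * y)) x b0.
  split.
    by apply: (derE h1); rewrite e1; field.
  by apply: (derE h2); rewrite e2; field.
- by split; [apply: (derE (derC _ _)); ring|apply: (derE (derC _ _)); ring].
Qed.

Lemma trial_witness (L : R) : 0 < L -> H1_witness (cube L) trialR trialI gradR gradI.
Proof.
move=> L0; have [cR cI cc] := trial_cont.
have cgR j : continuous (gradR j).
  by apply: ptD; [exact: (proj1 (cc j))|apply: ptN; apply: ptM => //; exact: Fpot_cont].
have cgI j : continuous (gradI j).
  by apply: ptD; [exact: (proj2 (cc j))|apply: ptM => //; exact: Fpot_cont].
split; try exact: L2_cube_continuous.
- move=> j; split; first exact: L2_cube_continuous.
  by apply: weak_deriv_classical => // z; have [] := trial_der j z.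
- move=> j; split; first exact: L2_cube_continuous.
  by apply: weak_deriv_classical => // z; have [] := trial_der j z.
Qed.

Lemma trial_density (tau : R) (z : pt R) : 0 < tau -> `|z.1.1| < M%:R * k ->
  GL_density b trialR trialI gradR gradI z <=
  majorant b (k ^+ 2 / 4 * (1 + tau)) (10 * k ^+ 2 + 1) (k ^+ 2 / 4 * (1 + tau^-1)) z.1.1 z.1.2.
Proof.
move=> t0 hx; have [EN HT /(_ t0) HJ] := strip_bounds z.1.2 tau hx.
have n0 := latN_ge0 z.1.1 z.1.2.
have := density_bound b0 n0 t0 HT HJ; rewrite -/(latN z.1.1 z.1.2) in EN *.
rewrite /majorant; apply: le_trans.
rewrite /GL_density (pol_norm _ _ _ b0) -/(vr z) -/(vi z) EN lerD2r ler_pM2l //.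
rewrite le_eqVlt; apply/orP; left; apply/eqP.
have E j : (gradR j z + Fpot j z * trialI z) ^+ 2 + (gradI j z - Fpot j z * trialR z) ^+ 2 = covR j z ^+ 2 + covI j z ^+ 2.
  by rewrite /gradR /gradI subrK addrK.
under eq_bigr do rewrite E.
rewrite !big_ord_recr big_ord0 /= add0r /covR /covI /= expr0n /= !addr0 !dpol_norm // /vr /vi EN.
by rewrite -mulrDl; congr (_ / _); ring.
Qed.

Lemma trial_energy (d L tau : R) : b = d ^+ 2 -> 0 < d -> d <= 1 -> 0 < tau -> 0 < L -> L / 2 <= M%:R * k ->
  (G_Q b L trialR trialI gradR gradI <=
   (L * (d ^+ 2 * (k ^+ 2 / 4 * (1 + tau) * ((L + k) ^+ 2 * (2 / pi * (- ln d + 2) + 1)) + (10 * k ^+ 2 + 1) * (L + k) ^+ 2 + k ^+ 2 / 4 * (1 + tau^-1) * L ^+ 2)))%:E)%E.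
Proof.
move=> bd d0 d1 t0 L0 LM.
have k2 : 0 <= k ^+ 2 / 4 by rewrite divr_ge0 ?sqr_ge0.
have ti : 0 < tau^-1 by rewrite invr_gt0.
apply: (@le_trans _ _ (\int[mu3]_(z in cube L) (majorant (d ^+ 2) (k ^+ 2 / 4 * (1 + tau)) (10 * k ^+ 2 + 1) (k ^+ 2 / 4 * (1 + tau^-1)) z.1.1 z.1.2)%:E)%E).
  have mQ : measurable (cube L : set (pt R)) by rewrite cubeE; exact: measurable_box.
  have [cR cI cc] := trial_cont.
  rewrite /G_Q; apply: ge0_le_integral => //.
  - move=> z _; rewrite lee_fin; apply: addr_ge0; apply: mulr_ge0; rewrite ?invr_ge0 ?sqr_ge0 ?(ltW b0) //.
    by apply: sumr_ge0 => j _; rewrite addr_ge0 // sqr_ge0.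
  - apply/measurable_EFinP; apply: measurable_funTS; apply: continuous_measurable_pt.
    apply: ptD; apply: ptM; try exact: ptC.
      apply: pt_sum => j; have [c1 c2] := cc j.
      rewrite (_ : (fun z => _) = fun z => covR j z ^+ 2 + covI j z ^+ 2); first by apply: ptD; exact: ptX2.
      by apply/funext => z; rewrite /gradR /gradI subrK addrK.
    apply: (@ptX2 R (fun x => 1 - (trialR x ^+ 2 + trialI x ^+ 2))).
    by apply: ptD; [exact: ptC|apply: ptN; apply: ptD; exact: ptX2].
  - by apply/measurable_EFinP; apply: measurable_funTS; apply: continuous_measurable_pt; apply: majorant_cont; rewrite exprn_gt0.
  - move=> z zQ; rewrite lee_fin -bd; apply: trial_density => //; apply: lt_le_trans LM.
    have := zQ (inord 0); rewrite /Defs.coord /= inordK // => /andP[h1 h2].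
    by rewrite ltr_norml h1.
apply: majorant_integral => //; last by rewrite mulr_ge0 // addr_ge0 // ltW.
- by rewrite mulr_ge0 // addr_ge0 // ltW.
- by rewrite addr_ge0 // mulr_ge0 // sqr_ge0.
Qed.

End Trial.

(** * Assembly of the two bounds *)

Section Asymptotics.
Context {R : realType}.
Notation k := (@kk R).

Lemma pi_le4 : pi <= 4 :> R.
Proof. by have := pihalf_lt2 R; lra. Qed.

(** As [k ^+ 2 = 2 * pi], the leading coefficient [k ^+ 2 / 4 * (2 / pi)] is 1. The terms without
    [La] add up to at most [32 + 324 + 4 / t <= 360 / t], which is at most [t * La]; with
    [(1 + t) ^+ 3 <= 1 + 7 * t] this makes [8 * t]. *)
Lemma upper_arith (t L La : R) : 0 < t -> t <= 1 -> 3 <= t * L -> 360 <= t ^+ 2 * La ->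
  k ^+ 2 / 4 * (1 + t) * ((L + k) ^+ 2 * (2 / pi * (La + 2) + 1)) + (10 * k ^+ 2 + 1) * (L + k) ^+ 2 + k ^+ 2 / 4 * (1 + t^-1) * L ^+ 2
    <= L ^+ 2 * (La * (1 + 8 * t)).
Proof.
move=> t0 t1 tL hLa; have k0 := @kk_gt0 R; have p0 := pi_gt0 R; have p4 := pi_le4.
have k2 : k ^+ 2 = 2 * pi := @kk_sq R.
have L0 : 0 < L by rewrite -(pmulr_rgt0 _ t0); lra.
have La0 : 0 <= La by rewrite -(pmulr_rge0 _ (exprn_gt0 2 t0)); lra.
have k3 : k <= 3.
  by rewrite -(@ler_pXn2r _ 2) ?nnegrE ?(ltW k0) // k2; lra.
have W : (L + k) ^+ 2 <= (1 + t) ^+ 2 * L ^+ 2 by rewrite -exprMn lerXn2r ?nnegrE; lra.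
have W0 : 0 <= (L + k) ^+ 2 by exact: sqr_ge0.
have L2 : 0 <= L ^+ 2 by exact: sqr_ge0.
have t2 : (1 + t) ^+ 2 <= 4.
  by rewrite (_ : 4 = 2 ^+ 2) ?lerXn2r ?nnegrE //; [lra|lra|ring].
have t3 : (1 + t) ^+ 3 <= 1 + 7 * t.
  rewrite -subr_ge0 (_ : _ - _ = t * ((1 - t) * (4 + t))); last by ring.
  by rewrite mulr_ge0 ?(ltW t0) // mulr_ge0; lra.
have ti : 1 <= t^-1 by rewrite invf_ge1.
have E1 : k ^+ 2 / 4 * (1 + t) * ((L + k) ^+ 2 * (2 / pi * (La + 2) + 1)) = (1 + t) * (L + k) ^+ 2 * (La + 2 + pi / 2).
  by rewrite k2; move: (pi) p0 => P P0; field; rewrite gt_eqF.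
have b1 : (1 + t) * (L + k) ^+ 2 * (La + 2 + pi / 2) <= L ^+ 2 * ((1 + 7 * t) * La + 32).
  apply: (@le_trans _ _ ((1 + t) * ((1 + t) ^+ 2 * L ^+ 2) * (La + 4))).
    apply: ler_pM; [rewrite mulr_ge0 //; lra|lra|rewrite ler_wpM2l //; lra|lra].
  rewrite (_ : (1 + t) * _ * _ = L ^+ 2 * ((1 + t) ^+ 3 * La + (1 + t) ^+ 3 * 4)); last by ring.
  rewrite ler_wpM2l // lerD //; first by rewrite ler_wpM2r.
  by move: t3 t1; clear; lra.
have b2 : (10 * k ^+ 2 + 1) * (L + k) ^+ 2 <= L ^+ 2 * 324.
  apply: (@le_trans _ _ (81 * (4 * L ^+ 2))); last by rewrite le_eqVlt; apply/orP; left; apply/eqP; ring.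
  apply: ler_pM => //; [rewrite k2; lra|rewrite k2; lra|].
  by apply: (le_trans W); rewrite ler_wpM2r.
have b3 : k ^+ 2 / 4 * (1 + t^-1) * L ^+ 2 <= L ^+ 2 * (4 * t^-1).
  rewrite mulrC ler_wpM2l // k2.
  apply: (@le_trans _ _ (2 * (2 * t^-1))); last by rewrite mulrA -natrM.
  by apply: ler_pM; lra.
rewrite E1; apply: (le_trans (lerD (lerD b1 b2) b3)); rewrite -!mulrDr ler_wpM2l //.
have : 360 * t^-1 <= t * La.
  by rewrite ler_pdivrMr // mulrC mulrA -expr2.
by move: ti; clear; lra.
Qed.

Lemma upper_bound (t L d : R) : 0 < t -> t <= 1 -> 3 <= t * L -> 0 < d -> d <= 1 -> 360 <= t ^+ 2 * - ln d ->
  (M0 (d ^+ 2) L <= (L ^+ 3 * (d ^+ 2 * - ln d) * (1 + 8 * t))%:E)%E.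
Proof.
move=> t0 t1 tL d0 d1 hd; have k0 := @kk_gt0 R.
have L0 : 0 < L by rewrite -(pmulr_rgt0 _ t0); lra.
have b0 : 0 < d ^+ 2 by rewrite exprn_gt0.
(* Enough lattice lines for [strip_bounds] to hold on the whole cube. *)
pose M := (Num.truncn (L / 2 / k)).+1.
have LM : L / 2 <= M%:R * k.
  have h0 : 0 <= L / 2 / k by rewrite !divr_ge0 // ltW.
  by have /andP[_ /ltW] := truncn_itv h0; rewrite ler_pdivrMr.
apply: ge_ereal_inf; exists (G_Q (d ^+ 2) L (trialR M (d ^+ 2)) (trialI M (d ^+ 2)) (gradR M (d ^+ 2)) (gradI M (d ^+ 2))).
  exists (trialR M (d ^+ 2)), (trialI M (d ^+ 2)), (gradR M (d ^+ 2)), (gradI M (d ^+ 2)).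
  by split => //; exact: trial_witness.
apply: (le_trans (trial_energy b0 erefl d0 d1 t0 L0 LM)); rewrite lee_fin.
rewrite (_ : L ^+ 3 * _ * _ = L * (d ^+ 2 * (L ^+ 2 * (- ln d * (1 + 8 * t))))); last by ring.
by rewrite ler_pM2l // ler_pM2l //; exact: upper_arith.
Qed.

Lemma G_Q_ge0 (b L : R) p q gp gq : 0 <= b -> (0 <= G_Q b L p q gp gq)%E.
Proof.
move=> b0; apply: integral_ge0 => z _; rewrite lee_fin; apply: addr_ge0; apply: mulr_ge0; rewrite ?invr_ge0 ?sqr_ge0 //.
by apply: sumr_ge0 => j _; rewrite addr_ge0 // sqr_ge0.
Qed.

(** Competitors of infinite energy satisfy the bound trivially; for the others the energy is divided
    by [d ^+ 2] and [lower_bound] applies. *)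
Lemma M0_lower (t L d : R) : 0 < t -> t <= 20^-1 -> 0 < d -> 4 <= t * L -> 0 < - ln d ->
  - ln d <= L ^+ 2 * (t ^+ 4 / 4) -> 72 / t ^+ 3 * d <= 1 -> ln (72 / t ^+ 3) + 2^-1 <= t * - ln d ->
  ((L ^+ 3 * (d ^+ 2 * - ln d) * (1 - 20 * t))%:E <= M0 (d ^+ 2) L)%E.
Proof.
move=> t0 t1 d0 tL l0 lL td ld; have b0 : 0 < d ^+ 2 by rewrite exprn_gt0.
apply: le_ereal_inf_tmp => e [p [q [gp [gq [W ->]]]]].
have := G_Q_ge0 L p q gp gq (ltW b0).
case E : (G_Q _ _ _ _ _ _) => [r| |] // r0; last by rewrite leey.
rewrite lee_fin.
have EG : G_Q (d ^+ 2) L p q gp gq = (d ^+ 2 * (r / d ^+ 2))%:E by rewrite E mulrC divfK // gt_eqF.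
have := lower_bound t0 t1 d0 tL l0 lL td ld W EG; rewrite ler_pdivlMr //.
by apply: le_trans; rewrite le_eqVlt; apply/orP; left; apply/eqP; ring.
Qed.

Lemma M0_asymptotics (t L d : R) : 0 < t -> t <= 20^-1 -> 0 < d -> d <= 1 -> 4 <= t * L ->
  ln (L / d) <= L ^+ 2 * (t ^+ 4 / 4) -> 72 / t ^+ 3 * d <= 1 -> ln (72 / t ^+ 3) + 2^-1 <= t * - ln d ->
  360 <= t ^+ 2 * - ln d ->
  exists2 h, M0 (d ^+ 2) L = (L ^+ 3 * (d ^+ 2 * - ln d * (1 + h)))%:E & `|h| <= 20 * t.
Proof.
move=> t0 t1 d0 d1 tL lL td ld l360.
have L1 : 1 <= L.
  rewrite leNgt; apply/negP => L1; have : t * L < t * 1 by rewrite ltr_pM2l.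
  by rewrite mulr1; lra.
have La0 : 0 < - ln d by rewrite -(pmulr_rgt0 _ (exprn_gt0 2 t0)); lra.
have b0 : 0 < d ^+ 2 by rewrite exprn_gt0.
have L0 : 0 < L by lra.
(* [L >= 1], so the bound on [ln (L / d)] contains the one on [- ln d]. *)
have lL' : - ln d <= L ^+ 2 * (t ^+ 4 / 4).
  by apply: le_trans lL; rewrite ln_div ?posrE // lerDr ln_ge0.
have t2 : t <= 1 by lra.
have tL3 : 3 <= t * L by lra.
have up := upper_bound t0 t2 tL3 d0 d1 l360.
have lo := M0_lower t0 t1 d0 tL La0 lL' td ld.
pose X := L ^+ 3 * (d ^+ 2 * - ln d); have X0 : 0 < X by rewrite !mulr_gt0 // exprn_gt0.
rewrite -/X in up lo.
case: (M0 (d ^+ 2) L) up lo => [m| |] //; rewrite !lee_fin => up lo.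
exists (m / X - 1).
  congr (_%:E); rewrite mulrA -/X; field; rewrite gt_eqF //.
have h1 : 1 - 20 * t <= m / X by rewrite ler_pdivlMr // mulrC.
have h2 : m / X <= 1 + 8 * t by rewrite ler_pdivrMr // mulrC.
by rewrite ler_norml; apply/andP; split; lra.
Qed.

End Asymptotics.

Unset Implicit Arguments.

Theorem theorem2p6 (R : realType) (b L : R -> R)
  (hb : forall eps, 0 < b eps) (hL : forall eps, 0 < L eps)
  (hb0 : b x @[x --> 0^'] --> 0)
  (hLoo : L x @[x --> 0^'] --> +oo)
  (hlog : (ln (L x / Num.sqrt (b x)) / L x ^+ 2) @[x --> 0^'] --> 0) :
  exists h : R -> R, h x @[x --> 0^'] --> 0 /\
    \forall eps \near 0^',
      M0 (b eps) (L eps) =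
      (L eps ^+ 3 * (b eps * ln (1 / Num.sqrt (b eps)) * (1 + h eps)))%:E.
Proof.
(* For fixed [t] the assumptions of [M0_asymptotics] hold near 0, which bounds the relative error by
   [20 * t]; afterwards [t] is arbitrary. *)
have key t : 0 < t -> t <= 20^-1 -> \forall x \near 0^', 0 < ln (1 / Num.sqrt (b x)) /\
    exists2 h, M0 (b x) (L x) = (L x ^+ 3 * (b x * ln (1 / Num.sqrt (b x)) * (1 + h)))%:E & `|h| <= 20 * t.
  move=> t0 t1.
  have t3 : 0 < 72 / t ^+ 3 by rewrite divr_gt0 // exprn_gt0.
  have t4 : 0 < t ^+ 4 / 4 by rewrite divr_gt0 // exprn_gt0.
  (* The two summands encode the two lower bounds required of [- ln d]; [d0] also enforces
     [72 / t ^+ 3 * d <= 1]. *)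
  pose K := `|ln (72 / t ^+ 3) + 2^-1| / t + 360 / t ^+ 2.
  pose d0 := Num.min (expR (- K)) (t ^+ 3 / 72).
  have d00 : 0 < d0 by rewrite lt_min expR_gt0 divr_gt0 // exprn_gt0.
  have n1 : \forall x \near 0^', b x < d0 ^+ 2 by apply: (cvgr_lt _ hb0); rewrite exprn_gt0.
  have n2 : \forall x \near 0^', 4 / t <= L x by move/cvgryPge: hLoo; apply.
  move/cvgr0Pnorm_le: hlog => /(_ _ t4) n3.
  near=> x.
  have bx : b x < d0 ^+ 2 by near: x.
  have Lx : 4 / t <= L x by near: x.
  have lx : `|ln (L x / Num.sqrt (b x)) / L x ^+ 2| <= t ^+ 4 / 4 by near: x.
  set d := Num.sqrt (b x) in lx *.
  have dp : 0 < d by rewrite sqrtr_gt0.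
  have Eb : b x = d ^+ 2 by rewrite sqr_sqrtr // ltW.
  have dd : d < d0 by rewrite -(@ltr_pXn2r _ 2) ?nnegrE ?(ltW dp) ?(ltW d00) // -Eb.
  have q0 : 0 < 360 / t ^+ 2 by apply: divr_gt0; [rewrite ltr0n|rewrite exprn_gt0].
  have K0 : 0 <= K by apply: addr_ge0; [rewrite divr_ge0 // ltW|exact: ltW].
  have lnd : K <= - ln d.
    rewrite lerNr -[leRHS]expRK ler_ln ?posrE ?expR_gt0 //.
    by apply: (le_trans (ltW dd)); rewrite ge_min lexx.
  have d3 : d <= t ^+ 3 / 72 by apply: (le_trans (ltW dd)); rewrite ge_min lexx orbT.
  have k1 : `|ln (72 / t ^+ 3) + 2^-1| / t <= - ln d.
    by apply: le_trans lnd; rewrite /K lerDl ltW.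
  have k2 : 360 / t ^+ 2 <= - ln d.
    by apply: le_trans lnd; rewrite /K lerDr divr_ge0 // ltW.
  have l0 : 0 < - ln d by exact: lt_le_trans k2.
  have El : ln (1 / d) = - ln d by rewrite div1r lnV.
  rewrite El; split => //; rewrite Eb.
  apply: M0_asymptotics => //.
  - by rewrite leNgt; apply/negP => /ltW /ln_ge0; rewrite leNgt -oppr_gt0 l0.
  - by move: Lx; rewrite ler_pdivrMr // mulrC.
  - have L2 : 0 < L x ^+ 2 by rewrite exprn_gt0.
    by have := le_trans (ler_norm _) lx; rewrite ler_pdivrMr // [leRHS]mulrC.
  - by rewrite -ler_pdivlMl // invf_div mulr1.
  - by move: k1; rewrite ler_pdivrMr // [leRHS]mulrC => k1; exact: le_trans (ler_norm _) k1.
  - by move: k2; rewrite ler_pdivrMr ?exprn_gt0 // mulrC.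
(* The relative error is read off the energy itself, so it does not depend on [t]; the default value
   of [fine] at infinity does not occur near 0. *)
pose h x := fine (M0 (b x) (L x)) / (L x ^+ 3 * (b x * ln (1 / Num.sqrt (b x)))) - 1.
have hE x h' : 0 < ln (1 / Num.sqrt (b x)) -> M0 (b x) (L x) = (L x ^+ 3 * (b x * ln (1 / Num.sqrt (b x)) * (1 + h')))%:E -> h x = h'.
  move=> l0 E; rewrite /h E /=; move: (ln _) (hb x) (hL x) l0 => l b0 L0 l0.
  by field; rewrite !gt_eqF.
exists h; split.
  apply/cvgr0Pnorm_le => e e0.
  pose t := Num.min 20^-1 (e / 20).
  have t0 : 0 < t by rewrite lt_min invr_gt0 ltr0n divr_gt0.
  have t1 : t <= 20^-1 by rewrite ge_min lexx.
  have t2 : 20 * t <= e by rewrite -ler_pdivlMl // mulrC ge_min lexx orbT.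
  apply: filterS (key t t0 t1) => x [l0 [h' E hh]].
  by rewrite (hE x h' l0 E) (le_trans hh).
have t0 : 0 < 20^-1 :> R by rewrite invr_gt0.
apply: filterS (key _ t0 (lexx _)) => x [l0 [h' E _]].
by rewrite (hE x h' l0 E).
Unshelve. all: by end_near.
Qed.
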